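(* Let $d\ge1$, $0<\beta\le1$, $1<p\le\frac{d(m-1)}{2\beta}$ and $m\ge p$. Let $f:\mathbb{R}\to\mathbb{R}$ satisfy $f(0)=0$ and, for some constants $C_0>0$, $\lambda>0$, $$|f(u)-f(v)|\le C_0|u-v|\left(|u|^{m-1}e^{\lambda|u|^p}+|v|^{m-1}e^{\lambda|v|^p}\right)\qquad\text{for all }u,v\in\mathbb{R}.$$ Then there exists $\epsilon>0$ such that for every $u_0\in\exp L^p(\mathbb{R}^d)$ with $\|u_0\|_{\exp L^p}\le\epsilon$ there exists a global weak-mild solution $u\in L^\infty((0,\infty),\exp L^p(\mathbb{R}^d))$ of $$\partial_tu+(-\Delta+|x|^2)^\beta u=f(u),\qquad u(x,0)=u_0(x),$$ satisfying $$\lim_{t\to0}\|u(t)-e^{-tH^\beta}u_0\|_{\exp L^p}=0.$$ Moreover, $$\|u(t)\|_{L^a}\le C\,t^{-\left(\frac1{m-1}-\frac d{2\beta a}\right)},\qquad t>0,$$ for $a$ satisfying: (1) if $\frac d{2\beta}>\frac p{p-1}$, then $\frac d{2\beta}(m-1)<a<\frac d{2\beta}(m-1)\frac1{(2-m)_+}$; (2) if $\frac d{2\beta}=\frac p{p-1}$, then $\frac d{2\beta}(m-1)<a<\frac d{2\beta}(m-1)\frac1{(2-m)_+}$; (3) if $\frac d{2\beta}<\frac p{p-1}$ and $(2-m)_+<\frac{d(p-1)}{2\beta p}$, then $\frac p{p-1}(m-1)<a<\frac d{2\beta}(m-1)\frac1{(2-m)_+}$. Here $C>0$ is a constant independent of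 $t$.
   Context: $(z)_+=\max(z,0)$, and $\frac1{(2-m)_+}=+\infty$ when $m\ge2$. $H=-\Delta+|x|^2$ is the Hermite operator on $\mathbb{R}^d$, with spectral decomposition $H=\sum_{k\ge0}(2k+d)P_k$, where $P_k$ is the orthogonal projection of $L^2(\mathbb{R}^d)$ onto the eigenspace of eigenvalue $2k+d$, i.e. $P_kg=\sum_{|\alpha|=k}\langle g,\Phi_\alpha\rangle\Phi_\alpha$ with $\Phi_\alpha$, $\alpha\in\mathbb{N}^d$, the normalized Hermite functions ($H\Phi_\alpha=(2|\alpha|+d)\Phi_\alpha$). The heat propagator of $H^\beta$ is $e^{-tH^\beta}g=\sum_{k\ge0}e^{-t(2k+d)^\beta}P_kg$. For $1\le p<\infty$, $\exp L^p(\mathbb{R}^d)$ is the space of $u\in L^1_{loc}(\mathbb{R}^d)$ with $\int_{\mathbb{R}^d}(e^{|u(x)|^p/\mu^p}-1)\,dx<\infty$ for some $\mu>0$, with the Luxemburg norm $\|u\|_{\exp L^p}=\inf\{\mu>0:\int_{\mathbb{R}^d}(e^{|u(x)|^p/\mu^p}-1)\,dx\le1\}$. For $p>1$ the weak$^\star$ topology on $\exp L^p(\mathbb{R}^d)$ is the one coming from its predual, the Orlicz space $L^{\psi^*}(\mathbb{R}^d)$ where $\psi(s)=e^{s^p}-1$ and $\psi^*(r)=\sup_{s\ge0}(rs-\psi(s))$: $u(t)\to u_0$ weak$^\star$ means $\int u(t)\varphi\,dx\to\int u_0\varphi\,dx$ for every $\varphi\in L^{\psi^*}(\mathbb{R}^d)$.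 A weak-mild solution on $(0,T)$, $0<T\le\infty$, with initial data $u_0\in\exp L^p(\mathbb{R}^d)$ is a function $u\in L^\infty((0,T),\exp L^p(\mathbb{R}^d))$ satisfying $u(t)=e^{-tH^\beta}u_0+\int_0^te^{-(t-s)H^\beta}f(u(s))\,ds$ in $\exp L^p(\mathbb{R}^d)$ for almost all $t\in(0,T)$, with $u(t)\to u_0$ in the weak$^\star$ topology as $t\to0$. It is global if $T=\infty$. *)

(* Defs.v *)
From HB Require Import structures.
From mathcomp Require Import all_boot all_order all_algebra.
From mathcomp Require Import all_classical all_reals all_analysis.

Set Implicit Arguments.
Unset Strict Implicit.
Unset Printing Implicit Defensive.

Import Order.TTheory GRing.Theory Num.Theory.
Import numFieldNormedType.Exports.

Local Open Scope classical_set_scope.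
Local Open Scope ring_scope.

(* R^n as n-tuples, with the product (i.e. Borel) sigma-algebra. *)
Notation Rn R n := (n.-tuple (measurableTypeR R)).

Section lebesgue_Rn.
Context {R : realType}.

Definition cons_Rn n (xt : measurableTypeR R * Rn R n) : Rn R n.+1 :=
  [the n.+1.-tuple (measurableTypeR R) of xt.1 :: xt.2].

Lemma measurable_cons_Rn n : measurable_fun setT (@cons_Rn n).
Proof. by apply: measurable_cons; [exact: measurable_fst|exact: measurable_snd]. Qed.

Definition uncons_Rn n (x : Rn R n.+1) : measurableTypeR R * Rn R n :=
  (thead x, [tuple of behead x]).

Lemma measurable_uncons_Rn n : measurable_fun setT (@uncons_Rn n).
Proof.
apply/measurable_fun_pair; first exact: measurable_tnth.
exact: measurable_behead.
Qed.

Lemma cons_RnK n : cancel (@cons_Rn n) (@uncons_Rn n).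
Proof. by case=> x t; rewrite /uncons_Rn theadE; congr pair; exact/val_inj. Qed.

Section step.
Variables (m : {sigma_finite_measure set (measurableTypeR R) -> \bar R}).
Variables (n : nat) (nu : {sigma_finite_measure set (Rn R n) -> \bar R}).

Definition measure_cons : set (Rn R n.+1) -> \bar R :=
  pushforward (m \x nu)%E (@cons_Rn n).

Let pm (A : set (Rn R n.+1)) (mA : measurable A) :
  measurable (@cons_Rn n @^-1` A).
Proof. by rewrite -[X in measurable X]setTI; exact: measurable_cons_Rn. Qed.

Let measure_cons0 : measure_cons set0 = 0%E.
Proof. by rewrite /measure_cons /pushforward preimage_set0 measure0. Qed.

Let measure_cons_ge0 A : (0 <= measure_cons A)%E.
Proof. by rewrite /measure_cons /pushforward; exact: measure_ge0. Qed.

Let measure_cons_sigma_additive : semi_sigma_additive measure_cons.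
Proof.
move=> F mF tF mUF; rewrite /measure_cons /pushforward preimage_bigcup.
apply: measure_semi_sigma_additive.
- by move=> k; exact: pm.
- apply/trivIsetP => /= i j _ _ ij; rewrite -preimage_setI.
  by move/trivIsetP : tF => /(_ _ _ _ _ ij) ->//; rewrite preimage_set0.
- by rewrite -preimage_bigcup; exact: pm.
Qed.

HB.instance Definition _ := isMeasure.Build _ _ _ measure_cons
  measure_cons0 measure_cons_ge0 measure_cons_sigma_additive.

Let measure_cons_sigma_finite : sigma_finite setT measure_cons.
Proof.
have /sigma_finiteP[F [TF ndF Foo]] := sigma_finiteT m.
have /sigma_finiteP[G [TG ndG Goo]] := sigma_finiteT nu.
exists (fun i => @uncons_Rn n @^-1` (F i `*` G i)).
  rewrite -preimage_bigcup; apply/esym/seteqP; split => // x _.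
  have [i _ Fi] : (\bigcup_i F i) (uncons_Rn x).1 by rewrite -TF.
  have [j _ Gj] : (\bigcup_i G i) (uncons_Rn x).2 by rewrite -TG.
  exists (maxn i j) => //; split.
    by move: Fi; exact/subsetPset/ndF/leq_maxl.
  by move: Gj; exact/subsetPset/ndG/leq_maxr.
move=> i; have [mF Fi] := Foo i; have [mG Gi] := Goo i.
split.
  rewrite -[X in measurable X]setTI; apply: measurable_uncons_Rn => //.
  exact: measurableX.
rewrite /measure_cons /pushforward -comp_preimage.
rewrite (_ : _ \o _ = id); last by apply/funext => x; exact: cons_RnK.
by rewrite preimage_id product_measure1E// lte_mul_pinfty// ge0_fin_numE.
Qed.

HB.instance Definition _ := Measure_isSigmaFinite.Build _ _ _ measure_cons
  measure_cons_sigma_finite.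
End step.

Fixpoint lebesgue_Rn n : {sigma_finite_measure set (Rn R n) -> \bar R} :=
  match n with
  | 0 => \d_([tuple] : Rn R 0)
  | n'.+1 => measure_cons (@lebesgue_measure R) (lebesgue_Rn n')
  end.

Lemma lebesgue_Rn_box n (A : 'I_n -> set (measurableTypeR R)) :
  (forall j, measurable (A j)) ->
  lebesgue_Rn n [set x | forall j, A j (tnth x j)] =
  (\prod_(j < n) @lebesgue_measure R (A j))%E.
Proof.
elim: n A => [|n IH] A mA.
  by rewrite big_ord0 /= diracE mem_set// => -[].
rewrite big_ord_recl -IH; last by move=> j; exact: mA.
rewrite /= /measure_cons /pushforward.
rewrite -product_measure1E//; last first.
  have -> : [set x : Rn R n | forall j, A (lift ord0 j) (tnth x j)] =
      \big[setI/setT]_(j < n) ((fun x : Rn R n => tnth x j) @^-1` A (lift ord0 j)).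
    apply/seteqP; split=> x.
      by move=> h; elim/big_rec: _ => // j B _ Bx; split => //; exact: h.
    by move=> h j; move: h; rewrite (bigD1 j)//= => -[].
  apply: bigsetI_measurable => j _; rewrite -[X in measurable X]setTI.
  exact: measurable_tnth.
congr product_measure1; apply/seteqP; split=> -[x t] /=.
  by move=> h; split=> [|j]; [have := h ord0|have := h (lift ord0 j); rewrite tnthS].
move=> [h0 h] j; case: (unliftP ord0 j) => [k|] ->; last by [].
by rewrite tnthS.
Qed.

End lebesgue_Rn.

Definition pos_part {R : realType} (z : R) : R := Num.max z 0.

Section hermite.
Context {R : realType}.

(* physicists' Hermite polynomials: e^{-x^2} H_k(x) = (-1)^k (d/dx)^k e^{-x^2} *)
Fixpoint hermite_poly (k : nat) : {poly R} :=
  if k is k'.+1 then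
    2%:R *: ('X * hermite_poly k') - (hermite_poly k')^`()
  else 1.

(* normalized in L^2(R); (- d^2/dx^2 + x^2) h_k = (2k + 1) h_k *)
Definition hermite_fun (k : nat) (x : R) : R :=
  (hermite_poly k).[x] * expR (- (x ^+ 2 / 2)) /
  Num.sqrt (2 ^+ k * (k`!)%:R * Num.sqrt pi).

Context {d : nat}.
Local Notation mu := (@lebesgue_Rn R d).

Definition hermite_Phi (alpha : 'I_d -> nat) (x : Rn R d) : R :=
  \prod_(j < d) hermite_fun (alpha j) (tnth x j).

Definition hermite_coef (alpha : 'I_d -> nat) (g : Rn R d -> R) : R :=
  \int[mu]_x (g x * hermite_Phi alpha x).

(* P_k; a multi-index with |alpha| = k has all its entries in {0, ..., k} *)
Definition hermite_proj (k : nat) (g : Rn R d -> R) (x : Rn R d) : R :=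
  \sum_(alpha : {ffun 'I_d -> 'I_k.+1} | (\sum_(j < d) alpha j)%N == k)
    hermite_coef (fun j => alpha j) g * hermite_Phi (fun j => alpha j) x.

Definition hermite_heat_series (beta t : R) (g : Rn R d -> R) (x : Rn R d) :
    R^nat :=
  series (fun k : nat =>
    expR (- (t * (2 * k + d)%:R `^ beta)) * hermite_proj k g x).

(* e^{-t H^beta} g for t > 0.  As g need not be in L^2, the spectral series is
   summed pointwise. *)
Definition hermite_heat (beta t : R) (g : Rn R d -> R) (x : Rn R d) : R :=
  limn (hermite_heat_series beta t g x).

(* Both \int and limn are total; this predicate says that hermite_heat beta t g
   involves no junk value: all the pairings <g, Phi_alpha> exist and the
   series converges almost everywhere. *)
Definition hermite_heat_defined (beta t : R) (g : Rn R d -> R) : Prop :=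
  (forall alpha : 'I_d -> nat,
    mu.-integrable setT (EFin \o (fun x => g x * hermite_Phi alpha x))) /\
  {ae mu, forall x, cvgn (hermite_heat_series beta t g x)}.

End hermite.

Section expL.
Context {R : realType} {d : nat}.
Local Notation mu := (@lebesgue_Rn R d).
Implicit Types (u phi : Rn R d -> R) (p : R).

(* L^1_loc: every compact set lies in some cube [-M, M]^d *)
Definition L1loc u : Prop :=
  measurable_fun setT u /\
  forall M : R, (\int[mu]_(x in [set x : Rn R d |
    forall j, (`|tnth x j| <= M)%R]) `|u x|%:E < +oo)%E.

Definition expL_modular p (k : R) u : \bar R :=
  (\int[mu]_x (expR (`|u x| `^ p / k `^ p) - 1)%:E)%E.

Definition in_expL p u : Prop :=
  L1loc u /\ exists2 k : R, 0 < k & (expL_modular p k u < +oo)%E.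

(* Luxemburg norm *)
Definition norm_expL p u : \bar R :=
  ereal_inf [set k%:E | k in [set k : R | 0 < k /\ (expL_modular p k u <= 1)%E]].

Definition psi p (s : R) : R := expR (s `^ p) - 1.

Definition psi_conj p (r : R) : \bar R :=
  ereal_sup [set (r * s - psi p s)%:E | s in [set s : R | 0 <= s]].

Definition in_predual p phi : Prop :=
  L1loc phi /\
  exists2 k : R, 0 < k & (\int[mu]_x psi_conj p (`|phi x| / k) < +oo)%E.

Definition weak_star_cvg0 p (u : R -> Rn R d -> R) (u0 : Rn R d -> R) : Prop :=
  forall phi, in_predual p phi ->
    (\int[mu]_x (u t x * phi x))%R @[t --> 0^'+] -->
    (\int[mu]_x (u0 x * phi x))%R.

End expL.

Section bochner.
Context {R : realType} {d : nat}.
Local Notation mu := (@lebesgue_Rn R d).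
Local Notation leb := (@lebesgue_measure R).

(* the step function \sum_i 1_(A_i) g_i with values in exp L^p *)
Record expL_step (p : R) := ExpLStep {
  step_size : nat;
  step_set : 'I_step_size -> set R;
  step_val : 'I_step_size -> Rn R d -> R;
  step_measurable : forall i, measurable (step_set i : set (measurableTypeR R));
  step_finite : forall i, (leb (step_set i) < +oo)%E;
  step_in_expL : forall i, in_expL p (step_val i) }.

Arguments step_set {p} _ _.
Arguments step_val {p} _ _.

Definition step_eval p (S : expL_step p) (t : R) (x : Rn R d) : R :=
  \sum_i \1_(step_set S i) t * step_val S i x.

Definition step_integral p (S : expL_step p) (D : set R) (x : Rn R d) : R :=
  \sum_i fine (leb (step_set S i `&` D)) * step_val S i x.

Definition step_approx p (D : set R) (v : R -> Rn R d -> R)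
    (S : nat -> expL_step p) : Prop :=
  {ae leb, forall t, D t ->
    norm_expL p (fun x => v t x - step_eval (S n) t x) @[n --> \oo] --> 0%E}.

Definition strongly_measurable p (D : set R) (v : R -> Rn R d -> R) : Prop :=
  {ae leb, forall t, D t -> in_expL p (v t)} /\
  exists S : nat -> expL_step p, step_approx D v S.

(* I = \int_D v(t) dt as a Bochner integral in exp L^p *)
Definition is_bochner_integral p (D : set R) (v : R -> Rn R d -> R)
    (I : Rn R d -> R) : Prop :=
  {ae leb, forall t, D t -> in_expL p (v t)} /\ in_expL p I /\
  exists S : nat -> expL_step p,
    [/\ step_approx D v S,
        (\int[leb]_(t in D) norm_expL p (fun x => v t x - step_eval (S n) t x)%R)%E
          @[n --> \oo] --> 0%E
      & norm_expL p (fun x => I x - step_integral (S n) D x) @[n --> \oo] --> 0%E].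

(* v \in L^oo(D, exp L^p) *)
Definition in_Linfty_expL p (D : set R) (v : R -> Rn R d -> R) : Prop :=
  [/\ forall t, D t -> in_expL p (v t), strongly_measurable p D v
    & exists M : R, {ae leb, forall t, D t -> (norm_expL p (v t) <= M%:E)%E}].

End bochner.

Section weak_mild.
Context {R : realType} {d : nat}.
Local Notation mu := (@lebesgue_Rn R d).
Local Notation leb := (@lebesgue_measure R).

Definition time_interval (T : \bar R) : set R :=
  [set t | 0 < t /\ (t%:E < T)%E].

(* u(t) = e^{-t H^beta} u0 + \int_0^t e^{-(t-s) H^beta} f(u(s)) ds *)
Definition mild_equation_at (beta p : R) (f : R -> R)
    (u0 : Rn R d -> R) (u : R -> Rn R d -> R) (t : R) : Prop :=
  [/\ hermite_heat_defined beta t u0,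
      {ae leb, forall s, 0 < s < t ->
        hermite_heat_defined beta (t - s) (f \o u s)}
    & exists2 I : Rn R d -> R,
        is_bochner_integral p [set s | 0 < s < t]
          (fun s => hermite_heat beta (t - s) (f \o u s)) I
      & {ae mu, forall x, u t x = hermite_heat beta t u0 x + I x}].

Definition weak_mild_solution (beta p : R) (f : R -> R) (T : \bar R)
    (u0 : Rn R d -> R) (u : R -> Rn R d -> R) : Prop :=
  [/\ in_Linfty_expL p (time_interval T) u,
      {ae leb, forall t, time_interval T t -> mild_equation_at beta p f u0 u t}
    & weak_star_cvg0 p u u0].

Definition global_weak_mild_solution (beta p : R) (f : R -> R)
    (u0 : Rn R d -> R) (u : R -> Rn R d -> R) : Prop :=
  weak_mild_solution beta p f +oo%E u0 u.

End weak_mild.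

(* Main.v *)
Require Import Defs.
From HB Require Import structures.
From mathcomp Require Import all_boot all_order all_algebra.
From mathcomp Require Import all_classical all_reals all_analysis.
From mathcomp Require Import measurable_realfun.
From mathcomp Require Import ring lra.

Set Implicit Arguments.
Unset Strict Implicit.
Unset Printing Implicit Defensive.

Import Order.TTheory GRing.Theory Num.Theory.
Import numFieldNormedType.Exports.

Local Open Scope classical_set_scope.
Local Open Scope ring_scope.

(** The kernel of e^{-tH} is a tensor product of Mehler kernels, and
    l |-> exp (- t l^beta) is a limit of convex combinations of the exponentials
    exp (- s l).  Hence positivity, contractivity and pointwise bounds pass from
    e^{-tH} to e^{-tH^beta}, while the crude bounds |Phi_a| <= C (1 + |a|)^N wt
    and the spectral gap bound the kernel by C t^{-n} e^{-t/2} wt wt.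
    Interpolating, e^{-tH^beta} maps L^1 \cap L^r into L^1 \cap L^oo with norm
    O(t^{-1/2} e^{-t/2}) once r is large.

    If u is small in exp L^p, then f(u) is small in L^1 \cap L^r for every r
    (the condition m >= p gives integrability where u is small).  So
    u = e^{-tH^beta} u0 + v is found by Picard iteration on v, in the set of
    paths with v(t) = O(e^{-t/4}) in L^1 \cap L^oo; it comes out with
    v(t) = O(1 - e^{-sqrt t}).  The exponential decay dominates every negative
    power of t, whence the L^a bounds for all a > d (m - 1) / (2 beta), a range
    which contains the three cases.

    For the weak-star continuity, symmetry of the heat kernel gives
    convergence against the indicator of a box; Dynkin's lemma, simple functions
    and the Delta_2 condition of the conjugate function psi* extend it to the
    predual. *)

(** No subordinating measure is constructed. The bounds to be carried over have the form
    [a + b * expR (- s)], and such inequalities survive convex combinations and pointwise limits;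
    the form also keeps the rate [1 - expR (- t)] at which indicators of boxes are approached. All
    eigenvalues are at least 1, and this decay is spent in portions: e^{-t/2} is left in the kernel
    after the spectral sum, e^{-t/4} after t^{-1/2} has been replaced by the weight [Wk], whose
    integral over ]0, +oo[ equals 2. The constants of the fixed point are therefore uniform in time,
    and the solution is global at once. A Bochner integral asks for step functions approximating in
    norm. The linear evolution need not be norm continuous at s = 0, and the kernel is singular at s
    = t. Uniform continuity is therefore carried along on compact subintervals only, and the two end
    layers are controlled by their small integrals. Since \int and limn are total, each pairing
    travels with its integrability, each spectral series with its convergence. *)

Section series_facts.
Context {R : realType}.
Implicit Types (u v B c lam : R^nat).

Lemma cvg_sum_nat (T : Type) (F : set_system T) (FF : Filter F) N (f : nat -> T -> R)
    (l : nat -> R) : (forall k, f k x @[x --> F] --> l k) ->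
  (\sum_(0 <= k < N) f k x) @[x --> F] --> \sum_(0 <= k < N) l k.
Proof.
move=> fl; elim: N => [|N IH].
  by rewrite big_geq//; under eq_fun do rewrite big_geq//; exact: cvg_cst.
rewrite big_nat_recr//=; under eq_fun do rewrite big_nat_recr//=.
exact: cvgD.
Qed.

Lemma le_cvg_series u B : (forall k, `|u k| <= B k) -> cvgn (series B) ->
  cvgn (series (fun k => `|u k|)).
Proof. by move=> uB; apply: series_le_cvg => // k; exact: le_trans (uB k). Qed.

Lemma cvg_expR (T : Type) (F : set_system T) (FF : Filter F) (f : T -> R) (l : R) :
  f x @[x --> F] --> l -> expR (f x) @[x --> F] --> expR l.
Proof. by move=> fl; apply: continuous_cvg => //; exact: continuous_expR. Qed.

Lemma series_tail u B N : (forall k, `|u k| <= B k) -> cvgn (series B) ->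
  `|limn (series u) - series u N| <= limn (series B) - series B N.
Proof.
move=> uB cB.
have cu : cvgn (series u).
  by apply: normed_cvg; exact: le_cvg_series cB.
have cN : `|series u n - series u N| @[n --> \oo] --> `|limn (series u) - series u N|.
  by apply: cvg_norm; apply: cvgB => //; exact: cvg_cst.
have h : \forall n \near \oo, `|series u n - series u N| <= limn (series B) - series B N.
  near=> n.
  have Nn : (N <= n)%N by near: n; exact: nbhs_infty_ge.
  rewrite sub_series_geq//.
  apply: (le_trans (ler_norm_sum _ _ _)).
  apply: (@le_trans _ _ (\sum_(N <= k < n) B k)); first exact: ler_sum.
  rewrite -sub_series_geq// lerB//.
  apply: nondecreasing_cvgn_le => //.
  apply/nondecreasing_seqP => k; rewrite seriesSr lerDl.
  exact: le_trans (uB k).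
exact: (cvgr_to_le cN h).
Unshelve. all: by end_near. Qed.

Lemma limr_series_norm_le u B : (forall k, `|u k| <= B k) -> cvgn (series B) ->
  `|limn (series u)| <= limn (series B).
Proof.
move=> uB cB; have := series_tail 0 uB cB.
by rewrite /series/= !big_geq// !subr0.
Qed.

(** Dominated convergence for series: the majorant makes all tails beyond one N small, uniformly in
    n, and the remaining finite sums converge termwise. *)
Lemma tannery (u : nat -> R^nat) v B : (forall k, u n k @[n --> \oo] --> v k) ->
  (forall n k, `|u n k| <= B k) -> cvgn (series B) ->
  limn (series (u n)) @[n --> \oo] --> limn (series v).
Proof.
move=> uv uB cB.
have vB k : `|v k| <= B k.
  have h : `|u n k| @[n --> \oo] --> `|v k| by apply: cvg_norm; exact: uv.
  by apply: (cvgr_to_le h); exact: nearW.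
apply/cvgrPdist_le => e e0.
have e3 : 0 < e / 3 by rewrite divr_gt0.
have cB' : series B n @[n --> \oo] --> limn (series B) by exact: cB.
have /cvgrPdist_le/(_ _ e3)[N _ hN] := cB'.
have {}hN : limn (series B) - series B N <= e / 3.
  by apply: le_trans (hN N _); [exact: ler_norm|exact: leqnn].
have fin : series (u n) N @[n --> \oo] --> series v N.
  rewrite /series/=.
  exact: cvg_sum_nat.
near=> n.
have h1 : `|series v N - series (u n) N| <= e / 3.
  by near: n; move/cvgrPdist_le : fin; apply.
have h2 := le_trans (series_tail N vB cB) hN.
have h3 := le_trans (series_tail N (uB n) cB) hN.
rewrite distrC in h3.
have -> : limn (series v) - limn (series (u n)) =
  (limn (series v) - series v N) + (series v N - series (u n) N) +
  (series (u n) N - limn (series (u n))) by ring.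
apply: (le_trans (ler_normD _ _)); apply: (le_trans (lerD (ler_normD _ _) (lexx _))).
lra.
Unshelve. all: by end_near. Qed.

Lemma abs_cvg_series u : cvgn (series (fun k => `|u k|)) -> cvgn (series u).
Proof. exact: normed_cvg. Qed.

Lemma limn_seriesD u v : cvgn (series u) -> cvgn (series v) ->
  limn (series (fun k => u k + v k)) = limn (series u) + limn (series v).
Proof.
move=> cu cv; rewrite -limD//; congr (limn _).
by apply/funext => n; rewrite /series/= big_split.
Qed.

Lemma limn_seriesZ (a : R) u : cvgn (series u) ->
  limn (series (fun k => a * u k)) = a * limn (series u).
Proof.
move=> cu; apply/cvg_lim => //.
rewrite (_ : series _ = fun n => a * series u n); last first.
  by apply/funext => n; rewrite /series/= mulr_sumr.
exact: cvgMr.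
Qed.

End series_facts.

(** * Subordination *)

Section laplace.
Context {R : realType}.
Implicit Types (c lam : R^nat) (f g psi : R -> R).

(* Laplace transforms of probability measures on [0, +oo[, generated from the
   Dirac masses by convex combinations and pointwise limits. *)
Inductive laplace_prob : (R -> R) -> Prop :=
| laplace_exp s : 0 <= s -> laplace_prob (fun l => expR (- (s * l)))
| laplace_conv a f g : 0 <= a <= 1 -> laplace_prob f -> laplace_prob g ->
    laplace_prob (fun l => a * f l + (1 - a) * g l)
| laplace_lim (F : nat -> R -> R) g : (forall n, laplace_prob (F n)) ->
    (forall l, 0 <= l -> F n l @[n --> \oo] --> g l) -> laplace_prob g.

(** Only the values on [0, +oo[ matter: a constant sequence in [laplace_lim] changes the
    representative. *)
Lemma laplace_ext f g : laplace_prob f -> (forall l, 0 <= l -> f l = g l) ->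
  laplace_prob g.
Proof.
move=> lf fg; apply: (@laplace_lim (fun _ => f)) => // l l0.
by rewrite fg//; exact: cvg_cst.
Qed.

Lemma laplace_bounds f : laplace_prob f -> forall l, 0 <= l -> 0 <= f l <= 1.
Proof.
elim=> [s s0 l l0|a f1 g1 /andP[a0 a1] _ f1b _ g1b l l0|F g1 _ Fb Fg l l0].
- by rewrite expR_ge0 expR_le1 oppr_le0 mulr_ge0.
- have /andP[? ?] := f1b _ l0; have /andP[? ?] := g1b _ l0.
  by apply/andP; split; nra.
- apply/andP; split.
    by apply: (cvgr_to_ge (Fg _ l0)); apply: nearW => n; case/andP: (Fb n _ l0).
  by apply: (cvgr_to_le (Fg _ l0)); apply: nearW => n; case/andP: (Fb n _ l0).
Qed.

(** The product corresponds to the convolution of the underlying measures; a double induction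
    reduces it to the product of two exponentials. *)
Lemma laplace_mul f g : laplace_prob f -> laplace_prob g ->
  laplace_prob (fun l => f l * g l).
Proof.
move=> lf; elim: lf g.
- move=> s s0 g; elim.
  + move=> s' s'0; apply: (laplace_ext (laplace_exp (addr_ge0 s0 s'0))) => l _.
    by rewrite -expRD; congr expR; ring.
  + move=> a f1 g1 a01 _ hf _ hg.
    by apply: (laplace_ext (laplace_conv a01 hf hg)) => l _; ring.
  + move=> F g1 _ hF Fg; apply: (laplace_lim hF) => l l0.
    by apply: cvgM; [exact: cvg_cst|exact: Fg].
- move=> a f1 g1 a01 _ hf _ hg g lg.
  by apply: (laplace_ext (laplace_conv a01 (hf _ lg) (hg _ lg))) => l _; ring.
- move=> F g1 _ hF Fg g lg; apply: (laplace_lim (fun n => hF n _ lg)) => l l0.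
  by apply: cvgM; [exact: Fg|exact: cvg_cst].
Qed.

(** The transform of the compound Poisson law of rate w whose jumps all equal s. Its truncations,
    with Poisson weights renormalized by [A n], are finite convex combinations of Dirac masses at
    multiples of s. *)
Lemma laplace_poisson (w s : R) : 0 <= w -> 0 <= s ->
  laplace_prob (fun l => expR (- (w * (1 - expR (- (s * l)))))).
Proof.
move=> w0 s0.
pose A n := series (exp_coeff w) n.+1.
have A0 n : 0 < A n.
  rewrite /A seriesSr; elim: n => [|n IH].
    by rewrite /series/= big_geq// add0r /exp_coeff/= expr0 fact0 divr1 ltr01.
  rewrite seriesSr; apply: ltr_wpDr => //; exact: exp_coeff_ge0.
apply: (@laplace_lim (fun n l => series (exp_coeff (w * expR (- (s * l)))) n.+1 / A n)).
  elim=> [|n IH].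
    apply: (laplace_ext (laplace_exp (lexx 0))) => l _.
    rewrite /A /series/= !big_nat1 /exp_coeff/= !expr0 fact0 divr1 mul0r oppr0 expR0 divr1//.
  have cc : 0 <= exp_coeff w n.+1 by exact: exp_coeff_ge0.
  have AS : A n.+1 = A n + exp_coeff w n.+1 by rewrite /A seriesSr.
  (* The next truncation gives weight [A n / A n.+1] to the previous one and the rest to the mass at
     (n + 1) s. *)
  have a01 : 0 <= A n / A n.+1 <= 1.
    by rewrite divr_ge0 ?(ltW (A0 _))//= ler_pdivrMr// mul1r AS lerDl.
  have ns0 : 0 <= n.+1%:R * s by rewrite mulr_ge0.
  apply: (laplace_ext (laplace_conv a01 IH (laplace_exp ns0))) => l _.
  have An := lt0r_neq0 (A0 n); have An1 := lt0r_neq0 (A0 n.+1).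
  have -> : 1 - A n / A n.+1 = exp_coeff w n.+1 / A n.+1.
    by rewrite AS in An1 *; field.
  rewrite [in RHS]seriesSr /exp_coeff/= exprMn -expRM_natl.
  rewrite (_ : n.+1%:R * - (s * l) = - (n.+1%:R * s * l)); last by ring.
  have fa : (n.+1)`!%:R != 0 :> R by rewrite pnatr_eq0 -lt0n fact_gt0.
  by field; rewrite fa An An1.
move=> l l0.
have -> : expR (- (w * (1 - expR (- (s * l))))) = expR (w * expR (- (s * l))) / expR w.
  by rewrite -expRN -expRD; congr expR; ring.
apply: cvgM.
  by rewrite (@cvg_shiftS _ (series _)); exact: is_cvg_series_exp_coeff.
apply: cvgV; first by rewrite expR_eq0.
rewrite /A (@cvg_shiftS _ (series _)); exact: is_cvg_series_exp_coeff.
Qed.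

(** The Laplace exponents of subordinators. The class is closed under sums, nonnegative multiples
    and pointwise limits, which is how l^b is reached from the Poisson exponents. *)
Definition bernstein psi := forall t, 0 <= t -> laplace_prob (fun l => expR (- (t * psi l))).

Lemma bernstein_poisson (w s : R) : 0 <= w -> 0 <= s ->
  bernstein (fun l => w * (1 - expR (- (s * l)))).
Proof.
move=> w0 s0 t t0; apply: (laplace_ext (laplace_poisson (mulr_ge0 t0 w0) s0)) => l _.
by rewrite mulrA.
Qed.

Lemma bernsteinD psi1 psi2 : bernstein psi1 -> bernstein psi2 ->
  bernstein (fun l => psi1 l + psi2 l).
Proof.
move=> h1 h2 t t0; apply: (laplace_ext (laplace_mul (h1 _ t0) (h2 _ t0))) => l _.
by rewrite -expRD; congr expR; ring.
Qed.

Lemma bernsteinZ (a : R) psi : 0 <= a -> bernstein psi -> bernstein (fun l => a * psi l).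
Proof.
move=> a0 h t t0; apply: (laplace_ext (h _ (mulr_ge0 t0 a0))) => l _.
by rewrite mulrA.
Qed.

Lemma bernstein_lim (Psi : nat -> R -> R) psi : (forall n, bernstein (Psi n)) ->
  (forall l, 0 <= l -> Psi n l @[n --> \oo] --> psi l) -> bernstein psi.
Proof.
move=> h hp t t0; apply: (laplace_lim (fun n => h n _ t0)) => l l0.
apply: cvg_expR.
by apply: cvgN; apply: cvgM; [exact: cvg_cst|exact: hp].
Qed.

(* The series S l = \sum_(j : int) e^(-jhb) (1 - exp (- e^(jh) l)) satisfies
   S (l e^h) = e^(hb) S l, so S / S 1 agrees with l^b on the powers of e^h;
   being monotone, it tends to l^b as h -> 0. *)
Section power.
Variables (b h : R).
Hypotheses (b01 : 0 < b < 1) (h0 : 0 < h).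

Let phi (j l : R) : R := expR (- (j * h * b)) * (1 - expR (- (expR (j * h) * l))).

Let phi_ge0 j l : 0 <= l -> 0 <= phi j l.
Proof.
by move=> l0; rewrite mulr_ge0 ?expR_ge0// subr_ge0 expR_le1 oppr_le0 mulr_ge0 ?expR_ge0.
Qed.

Let phi_le j l l' : l <= l' -> phi j l <= phi j l'.
Proof.
move=> ll'; rewrite ler_pM2l ?expR_gt0// lerD2l lerN2 ler_expR lerN2.
by rewrite ler_pM2l ?expR_gt0.
Qed.

Let phiS j l : phi j (l * expR h) = expR (h * b) * phi (j + 1) l.
Proof.
rewrite /phi [RHS]mulrA -expRD; congr (expR _ * (1 - expR _)); first by ring.
by rewrite (_ : (j + 1) * h = j * h + h) ?expRD; ring.
Qed.

Let S_ (l : R) : R^nat := fun n =>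
  phi 0 l + \sum_(0 <= i < n) (phi i.+1%:R l + phi (- i.+1%:R) l).

(** Scaling l by e^h shifts the summation index, so the window from -n to n gains one boundary term
    and loses another; both vanish in the limit. *)
Let S_shift l n : S_ (l * expR h) n =
  expR (h * b) * (S_ l n + phi n.+1%:R l - phi (- n%:R) l).
Proof.
elim: n => [|n IH]; rewrite /S_.
  by rewrite !big_geq// !addr0 phiS add0r oppr0 (addrC (phi 0 l)) addrK.
rewrite [in LHS]big_nat_recr; last by [].
rewrite addrA -/(S_ (l * expR h) n) IH !phiS.
rewrite big_nat_recr; last by [].
have -> : n.+1%:R + 1 = n.+2%:R :> R by rewrite natr1.
have -> : - n.+1%:R + 1 = - n%:R :> R by rewrite -natr1; ring.
rewrite /S_; move: (phi 0 l) (phi n.+1%:R l) (phi n.+2%:R l) (phi (- n%:R) l) (phi _ l) (phi _ l).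
move=> a1 a2 a3 a4 a5 a8; move: (\sum_(0 <= i < n) _) (expR _) => a6 a7.
by rewrite /=; ring.
Qed.

(** For positive indices the factor 1 - exp(...) is at most 1, which leaves a geometric series of
    ratio e^{-hb}; this uses b > 0. *)
Let cvg_up l : 0 <= l -> cvgn (series (fun i => phi i.+1%:R l)).
Proof.
move=> l0; have b0 : 0 < b by case/andP: b01.
apply: (@series_le_cvg _ _ (geometric 1 (expR (- (h * b))))).
- by move=> n; exact: phi_ge0.
- by move=> n; rewrite /geometric/= mul1r exprn_ge0 ?expR_ge0.
- move=> n; rewrite /geometric/= mul1r -expRM_natl /phi.
  rewrite -[leRHS]mulr1 ler_pM ?expR_ge0//.
  + by rewrite subr_ge0 expR_le1 oppr_le0 mulr_ge0 ?expR_ge0.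
  + rewrite ler_expR mulrN lerN2 -mulrA ler_wpM2r ?ler_nat//.
    by rewrite mulr_ge0// ltW.
- apply: is_cvg_geometric_series; rewrite ger0_norm ?expR_ge0//.
  by rewrite expR_lt1 oppr_lt0 mulr_gt0.
Qed.

(** For negative indices 1 - e^{-x} <= x leaves the ratio e^{-h(1-b)}; this uses b < 1. *)
Let cvg_dn l : 0 <= l -> cvgn (series (fun i => phi (- i.+1%:R) l)).
Proof.
move=> l0; have /andP[b0 b1] := b01.
have q0 : 0 < h * (1 - b) by rewrite mulr_gt0// subr_gt0.
apply: (@series_le_cvg _ _ (geometric l (expR (- (h * (1 - b)))))).
- by move=> n; exact: phi_ge0.
- by move=> n; rewrite /geometric/= mulr_ge0// exprn_ge0 ?expR_ge0.
- move=> n; rewrite /geometric/= -expRM_natl /phi.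
  have e1 : 1 - expR (- (expR (- n.+1%:R * h) * l)) <= expR (- n.+1%:R * h) * l.
    have := expR_ge1Dx (- (expR (- n.+1%:R * h) * l)); lra.
  apply: (@le_trans _ _ (expR (- (- n.+1%:R * h * b)) * (expR (- n.+1%:R * h) * l))).
    by rewrite ler_pM2l ?expR_gt0.
  rewrite mulrA -expRD mulrC ler_wpM2l// ler_expR.
  rewrite (_ : _ + _ = - (n.+1%:R * (h * (1 - b)))); last by ring.
  by rewrite mulrN lerN2 ler_wpM2r ?ler_nat// ltW.
- apply: is_cvg_geometric_series; rewrite ger0_norm ?expR_ge0//.
  by rewrite expR_lt1 oppr_lt0.
Qed.

Let S_cvg l : 0 <= l -> cvgn (S_ l).
Proof.
move=> l0; rewrite (_ : S_ l = fun n => phi 0 l + (series (fun i => phi i.+1%:R l) n +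
   series (fun i => phi (- i.+1%:R) l) n)); last first.
  by apply/funext => n; rewrite /S_ /series/= big_split.
by apply: is_cvgD; [exact: is_cvg_cst|apply: is_cvgD; [exact: cvg_up|exact: cvg_dn]].
Qed.

Let S l := limn (S_ l).

Let S_mulh l : 0 <= l -> S (l * expR h) = expR (h * b) * S l.
Proof.
move=> l0; apply/cvg_lim => //.
rewrite (_ : S_ _ = fun n => expR (h * b) * (S_ l n + phi n.+1%:R l - phi (- n%:R) l));
  last by apply/funext => n; exact: S_shift.
apply: cvgMr.
have -> : S l = S l + 0 - 0 by rewrite addr0 subr0.
apply: cvgB; first apply: cvgD; first exact: S_cvg.
  exact: (cvg_series_cvg_0 (cvg_up l0)).
rewrite -(@cvg_shiftS _ (fun n => phi (- n%:R) l)).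
exact: (cvg_series_cvg_0 (cvg_dn l0)).
Qed.

Let S_expn l n : 0 <= l -> S (l * expR (n%:R * h)) = expR (n%:R * h * b) * S l.
Proof.
move=> l0; elim: n => [|n IH]; first by rewrite !mul0r expR0 mulr1 mul1r.
rewrite -natr1 mulrDl mul1r expRD mulrA S_mulh ?IH; last first.
  by rewrite mulr_ge0 ?expR_ge0.
by rewrite mulrA -expRD; congr (expR _ * _); ring.
Qed.

Let S_exp (j : int) : S (expR (j%:~R * h)) = expR (j%:~R * h * b) * S 1.
Proof.
case: j => n; first by rewrite -[X in S X]mul1r S_expn.
have := @S_expn (expR ((Negz n)%:~R * h)) n.+1 (expR_ge0 _).
rewrite NegzE -expRD mulrNz -mulrDl addrC subrr mul0r expR0 => ->.
by rewrite mulrA -expRD !mulNr addrC subrr expR0 mul1r.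
Qed.

Let S_le l l' : 0 <= l -> l <= l' -> S l <= S l'.
Proof.
move=> l0 ll'; apply: ler_lim; [exact: S_cvg|apply: S_cvg; exact: le_trans ll'|].
apply: nearW => n; rewrite /S_ lerD ?phi_le//; apply: ler_sum => i _.
by rewrite lerD ?phi_le.
Qed.

Let S1_gt0 : 0 < S 1.
Proof.
apply: (@lt_le_trans _ _ (phi 0 1)).
  by rewrite mulr_gt0 ?expR_gt0// subr_gt0 mulr1 expR_lt1 oppr_lt0 expR_gt0.
apply: (cvgr_to_ge (S_cvg ler01)); apply: nearW => n.
by rewrite /S_ lerDl sumr_ge0// => i _; rewrite addr_ge0 ?phi_ge0.
Qed.

Let S0 : S 0 = 0.
Proof.
apply/cvg_lim => //; rewrite (_ : S_ 0 = cst 0); first exact: cvg_cst.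
apply/funext => n; rewrite /S_ big1 => [|i _];
  by rewrite /phi !mulr0 oppr0 expR0 subrr !mulr0 addr0.
Qed.

Lemma bernstein_power_approx : exists psi, [/\ bernstein psi, psi 0 = 0 &
  forall l, 0 < l -> l `^ b * expR (- (b * h)) <= psi l <= l `^ b * expR (b * h)].
Proof.
exists (fun l => (S 1)^-1 * S l); split.
- apply: bernsteinZ; first by rewrite invr_ge0 ltW.
  apply: (@bernstein_lim (fun n l => S_ l n)) => [n|l l0]; last exact: S_cvg.
  have hphi j : bernstein (phi j).
    by apply: bernstein_poisson; exact: expR_ge0.
  rewrite /S_; apply: bernsteinD => //.
  elim: n => [|n IH].
    move=> t t0; apply: (laplace_ext (laplace_exp (lexx 0))) => l _.
    by rewrite big_geq// mulr0 mul0r.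
  move=> t t0; apply: (laplace_ext (bernsteinD IH
      (bernsteinD (hphi n.+1%:R) (hphi (- n.+1%:R))) t0)) => l _.
  by rewrite big_nat_recr.
- by rewrite S0 mulr0.
- move=> l l0; have b0 : 0 < b by case/andP: b01.
  pose x := ln l; have lx : l = expR x by rewrite lnK// posrE.
  (* l lies between the consecutive grid points e^{jh} and e^{(j+1)h}, where the value of S is
     known; by monotonicity the error is at most a factor e^{bh}. *)
  pose j := Num.floor (x / h).
  have jl : j%:~R * h <= x by rewrite -ler_pdivlMr// floor_le.
  have ju : x <= (j + 1)%:~R * h by rewrite -ler_pdivrMr// ltW// floorD1_gt.
  have -> : l `^ b = expR (b * x) by rewrite {1}lx -expRM mulrC.
  rewrite -!expRD ![_^-1 * _]mulrC ler_pdivlMr// ler_pdivrMr//; apply/andP; split.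
    apply: (@le_trans _ _ (S (expR (j%:~R * h)))).
      rewrite S_exp ler_wpM2r ?(ltW S1_gt0)// ler_expR.
      rewrite intrD mulrDl mul1r in ju; nra.
    by apply: S_le; rewrite ?expR_ge0// lx ler_expR.
  apply: (@le_trans _ _ (S (expR ((j + 1)%:~R * h)))).
    by apply: S_le; rewrite ?(ltW l0)// lx ler_expR.
  rewrite S_exp ler_wpM2r ?(ltW S1_gt0)// ler_expR.
  rewrite intrD mulrDl mul1r; nra.
Qed.

End power.

(** For b = 1 the measure is the Dirac mass at t; this case is separate because the approximating
    series diverges there. For b < 1 the mesh h = 1/(n + 1) is sent to 0. *)
Lemma bernstein_power (b : R) : 0 < b <= 1 -> bernstein (fun l => l `^ b).
Proof.
move=> /andP[b0]; rewrite le_eqVlt => /orP[/eqP ->|b1].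
  move=> t t0; apply: (laplace_ext (laplace_exp t0)) => l l0.
  by rewrite powRr1.
have b01 : 0 < b < 1 by rewrite b0.
have hn n : 0 < n.+1%:R^-1 :> R by rewrite invr_gt0.
have /choice[psi hpsi] n := bernstein_power_approx b01 (hn n).
apply: (@bernstein_lim psi) => [n|l]; first by have [] := hpsi n.
rewrite le_eqVlt => /orP[/eqP <-|l0].
  rewrite powR0 ?gt_eqF// (_ : (fun n => _) = cst 0); first exact: cvg_cst.
  by apply/funext => n; have [] := hpsi n.
have bh : b * n.+1%:R^-1 @[n --> \oo] --> 0.
  by rewrite -(mulr0 b); apply: cvgMr; exact: cvg_harmonic.
apply: (@squeeze_cvgr _ _ _ _ (fun n => l `^ b * expR (- (b * n.+1%:R^-1)))
    (fun n => l `^ b * expR (b * n.+1%:R^-1))).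
- by apply: nearW => n; have [_ _] := hpsi n; exact.
- rewrite -[X in _ --> X](_ : l `^ b * expR (- 0) = _); last by rewrite oppr0 expR0 mulr1.
  by apply: cvgMr; apply: cvg_expR; apply: cvgN.
- rewrite -[X in _ --> X](_ : l `^ b * expR 0 = _); last by rewrite expR0 mulr1.
  by apply: cvgMr; exact: cvg_expR.
Qed.

(** Integrating a + b e^{-s} against the probability measure behind f gives a + b f(1). Induction on
    f replaces that integral, and the absolute summability of c dominates the limit step. *)
Lemma laplace_series_le f : laplace_prob f -> forall c lam (a b : R),
  (forall k, 0 <= lam k) -> cvgn (series (fun k => `|c k|)) ->
  (forall s, 0 <= s ->
    limn (series (fun k => expR (- (s * lam k)) * c k)) <= a + b * expR (- s)) ->
  limn (series (fun k => f (lam k) * c k)) <= a + b * f 1.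
Proof.
move=> lf c lam a b lam0 cc hab.
have cf g : laplace_prob g -> forall k, `|g (lam k) * c k| <= `|c k|.
  move=> lg k; have /andP[g0 g1] := laplace_bounds lg (lam0 k).
  by rewrite normrM ger0_norm// ler_piMl.
elim: lf => [s s0|q f1 g1 /andP[q0 q1] lf1 h1 lg1 h2|F g lF hF Fg].
- by rewrite mulr1; exact: hab.
- have cs g : laplace_prob g -> cvgn (series (fun k => g (lam k) * c k)).
    by move=> lg; apply: abs_cvg_series; apply: (le_cvg_series (cf _ lg)).
  have -> : (fun k => (q * f1 (lam k) + (1 - q) * g1 (lam k)) * c k) =
    (fun k => q * (f1 (lam k) * c k) + (1 - q) * (g1 (lam k) * c k)).
    by apply/funext => k; ring.
  have cs' p g : laplace_prob g -> cvgn (series (fun k => p * (g (lam k) * c k))).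
    move=> lg; rewrite (_ : series _ = fun n => p * series (fun k => g (lam k) * c k) n).
      by apply: is_cvgMr; exact: cs.
    by apply/funext => n; rewrite /series/= mulr_sumr.
  rewrite limn_seriesD; [|exact: cs'|exact: cs'].
  rewrite !limn_seriesZ; [|exact: cs|exact: cs].
  have q1' : 0 <= 1 - q by rewrite subr_ge0.
  have := ler_wpM2l q0 h1; have := ler_wpM2l q1' h2; lra.
- have t1 : limn (series (fun k => F n (lam k) * c k)) @[n --> \oo] -->
      limn (series (fun k => g (lam k) * c k)).
    apply: (tannery _ (fun n => cf _ (lF n)) cc) => k.
    by apply: cvgM; [exact: Fg|exact: cvg_cst].
  have t2 : a + b * F n 1 @[n --> \oo] --> a + b * g 1.
    by apply: cvgD; [exact: cvg_cst|apply: cvgMr; exact: Fg].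
  by apply: (ler_cvg_to t1 t2); exact: nearW.
Qed.

Lemma subordination (beta t : R) c lam (a b : R) : 0 < beta <= 1 -> 0 <= t ->
  (forall k, 0 <= lam k) ->
  (forall e, 0 < e -> cvgn (series (fun k => `|expR (- (e * lam k)) * c k|))) ->
  cvgn (series (fun k => `|expR (- (t * lam k `^ beta)) * c k|)) ->
  (forall s, 0 < s ->
    limn (series (fun k => expR (- (s * lam k)) * c k)) <= a + b * expR (- s)) ->
  limn (series (fun k => expR (- (t * lam k `^ beta)) * c k)) <= a + b * expR (- t).
Proof.
move=> beta01 t0 lam0 ce ct hab.
pose f l := expR (- (t * l `^ beta)).
have lf : laplace_prob f by exact: bernstein_power.
pose e n : R := n.+1%:R^-1.
have e0 n : 0 < e n by rewrite invr_gt0.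
have ecvg : expR (- e n) @[n --> \oo] --> (1 : R).
  rewrite -[X in _ --> X](_ : expR (- 0) = _); last by rewrite oppr0 expR0.
  by apply: cvg_expR; apply: cvgN; exact: cvg_harmonic.
have key n : limn (series (fun k => f (lam k) * (expR (- (e n * lam k)) * c k))) <=
    a + b * expR (- e n) * f 1.
  apply: laplace_series_le; [by []|by []|exact: ce|].
  move=> s s0; have := hab _ (ltr_wpDl s0 (e0 n)).
  rewrite (_ : (fun k => expR (- (s * lam k)) * _) =
    (fun k => expR (- ((s + e n) * lam k)) * c k)); last first.
    by apply/funext => k; rewrite mulrA -expRD; congr (expR _ * _); ring.
  by rewrite opprD expRD (mulrC (expR (- s))) mulrA.
have f1 : f 1 = expR (- t) by rewrite /f powR1 mulr1.
rewrite -f1.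
have t1 : limn (series (fun k => f (lam k) * (expR (- (e n * lam k)) * c k))) @[n --> \oo]
    --> limn (series (fun k => f (lam k) * c k)).
  apply: (@tannery _ _ _ (fun k => `|f (lam k) * c k|)) => // [k|n k].
  - apply: cvgM; first exact: cvg_cst.
    rewrite -[X in _ --> X]mul1r; apply: cvgM; last exact: cvg_cst.
    rewrite -[X in _ --> X](_ : expR (- (0 * lam k)) = _); last by rewrite mul0r oppr0 expR0.
    apply: cvg_expR; apply: cvgN.
    by apply: cvgM; [exact: cvg_harmonic|exact: cvg_cst].
  - rewrite mulrCA normrM ler_piMl// ger0_norm ?expR_ge0//.
    by rewrite expR_le1 oppr_le0 mulr_ge0// ltW.
have t2 : a + b * expR (- e n) * f 1 @[n --> \oo] --> a + b * f 1.
  apply: cvgD; first exact: cvg_cst.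
  apply: cvgM; last exact: cvg_cst.
  by rewrite -[X in _ --> X]mulr1; apply: cvgMr.
by apply: (ler_cvg_to t1 t2); exact: nearW.
Qed.

End laplace.

(** * Hermite functions and the Mehler kernel *)

Section subexponential.
Context {R : realType}.
Implicit Types (u v : R^nat) (r : R).

(** Equivalently, the power series with coefficients u converges on the open unit disc. The form
    with constants is stable under products and shifts. *)
Definition subexp u := forall th : R, 1 < th -> exists2 C, 0 <= C & forall k, `|u k| <= C * th ^+ k.

Lemma subexp_le u v : subexp v -> (forall k, `|u k| <= `|v k|) -> subexp u.
Proof.
move=> hv uv th th1; have [C C0 hC] := hv _ th1; exists C => // k.
exact: le_trans (uv k) (hC k).
Qed.

Lemma subexpM u v : subexp u -> subexp v -> subexp (fun k => u k * v k).
Proof.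
move=> hu hv th th1.
have s1 : 1 < Num.sqrt th by rewrite -sqrtr1 ltr_sqrt// (lt_trans _ th1).
have [C C0 hC] := hu _ s1; have [D D0 hD] := hv _ s1.
exists (C * D); first exact: mulr_ge0.
move=> k; rewrite normrM.
have -> : C * D * th ^+ k = (C * Num.sqrt th ^+ k) * (D * Num.sqrt th ^+ k).
  by rewrite -{1}(@sqr_sqrtr _ th) ?(le_trans ler01 (ltW th1))// -exprM mulnC exprM; ring.
by apply: ler_pM.
Qed.

Lemma subexpZ (a : R) u : subexp u -> subexp (fun k => a * u k).
Proof.
move=> hu th th1; have [C C0 hC] := hu _ th1; exists (`|a| * C); first by rewrite mulr_ge0.
by move=> k; rewrite normrM -mulrA ler_wpM2l.
Qed.

Lemma subexpS u : subexp u -> subexp (fun k => u k.+1).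
Proof.
move=> hu th th1; have [C C0 hC] := hu _ th1; exists (C * th).
  by rewrite mulr_ge0// ltW// (lt_trans _ th1).
by move=> k; rewrite -mulrA -exprS.
Qed.

Lemma subexp_nat : subexp (fun k => k.+1%:R).
Proof.
move=> th th1; have d0 : 0 < th - 1 by rewrite subr_gt0.
exists (1 + (th - 1)^-1); first by rewrite addr_ge0// invr_ge0 ltW.
move=> k; rewrite ger0_norm//.
(* Bernoulli's inequality. *)
have key : 1 + k%:R * (th - 1) <= th ^+ k.
  elim: k => [|k IH]; first by rewrite mul0r addr0 expr0.
  rewrite exprS -natr1; have th0 : 0 <= th by rewrite ltW// (lt_trans _ th1).
  have k0 : 0 <= k%:R * (th - 1) ^+ 2 :> R by rewrite mulr_ge0// sqr_ge0.
  apply: le_trans (ler_wpM2l th0 IH); rewrite -subr_ge0; apply: le_trans k0 _.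
  by rewrite le_eqVlt; apply/orP; left; apply/eqP; ring.
have h1 : 1 <= th ^+ k by rewrite exprn_ege1// ltW.
have h2 : k%:R <= (th - 1)^-1 * th ^+ k.
  by rewrite mulrC ler_pdivlMr//; lra.
by rewrite mulrDl mul1r -natr1 addrC lerD.
Qed.

Lemma subexp_cvg u r : subexp u -> `|r| < 1 -> cvgn (series (fun k => `|u k * r ^+ k|)).
Proof.
move=> hu r1; pose th := 2 / (1 + `|r|).
have r0 : 0 <= `|r| by [].
have th1 : 1 < th by rewrite ltr_pdivlMr; lra.
have thr : th * `|r| < 1 by rewrite /th mulrAC ltr_pdivrMr; lra.
have [C C0 hC] := hu _ th1.
apply: (@le_cvg_series _ _ (geometric C (th * `|r|))).
  move=> k; rewrite /geometric/= normrM normrX exprMn mulrA ler_wpM2r ?exprn_ge0//.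
apply: is_cvg_geometric_series; rewrite ger0_norm// mulr_ge0//.
by rewrite ltW// (lt_trans _ th1).
Qed.

Definition psum u r := limn (series (fun k => u k * r ^+ k)).

Lemma psum_shift u r : subexp u -> `|r| < 1 ->
  psum u r = u 0%N + r * psum (fun k => u k.+1) r.
Proof.
move=> hu r1; rewrite /psum -limn_seriesZ; last first.
  by apply: abs_cvg_series; apply: subexp_cvg => //; exact: subexpS.
apply/cvg_lim => //; rewrite -(@cvg_shiftS _ (series _)).
rewrite (_ : (fun n => _) = (fun n => u 0%N + series (fun k => r * (u k.+1 * r ^+ k)) n)).
  apply: cvgD; first exact: cvg_cst.
  rewrite -/(cvgn _) (_ : series _ = fun n => r * series (fun k => u k.+1 * r ^+ k) n).
    by apply: is_cvgMr; apply: abs_cvg_series; apply: subexp_cvg => //; exact: subexpS.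
  by apply/funext => n; rewrite /series/= mulr_sumr.
apply/funext => n; rewrite /series/= big_nat_recl// expr0 mulr1; congr (_ + _).
by apply: eq_bigr => i _; rewrite exprS; ring.
Qed.

Lemma psumD (a b : R) u v r : subexp u -> subexp v -> `|r| < 1 ->
  psum (fun k => a * u k + b * v k) r = a * psum u r + b * psum v r.
Proof.
move=> hu hv r1.
have cz w (e : R) : subexp w -> cvgn (series (fun k => e * (w k * r ^+ k))).
  move=> hw; rewrite (_ : series _ = fun n => e * series (fun k => w k * r ^+ k) n).
    by apply: is_cvgMr; apply: abs_cvg_series; exact: subexp_cvg.
  by apply/funext => n; rewrite /series/= mulr_sumr.
rewrite /psum (_ : (fun k => _) = (fun k => a * (u k * r ^+ k) + b * (v k * r ^+ k))).
  rewrite limn_seriesD; [|exact: cz|exact: cz].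
  by rewrite !limn_seriesZ//; apply: abs_cvg_series; exact: subexp_cvg.
by apply/funext => k; ring.
Qed.

Lemma psum_derive u r : subexp u -> `|r| < 1 ->
  is_derive r (1 : R) (psum u) (psum (fun k => k.+1%:R * u k.+1) r).
Proof.
move=> hu r1; pose K := (1 + `|r|) / 2.
have r0 : 0 <= `|r| by [].
have K0 : 0 <= K by rewrite /K; lra.
have K1 : `|K| < 1 by rewrite ger0_norm// /K; lra.
have rK : `|r| < `|K| by rewrite (ger0_norm K0) /K; lra.
have hd : subexp (pseries_diffs u) by apply: subexpM subexp_nat (subexpS hu).
have hdd : subexp (pseries_diffs (pseries_diffs u)).
  by apply: subexpM subexp_nat (subexpS hd).
have := @pseries_snd_diffs R u K r; apply.
- exact: abs_cvg_series (subexp_cvg hu K1).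
- exact: abs_cvg_series (subexp_cvg hd K1).
- exact: abs_cvg_series (subexp_cvg hdd K1).
- exact: rK.
Qed.

End subexponential.

(** * Hermite polynomials: recurrences, growth and generating functions *)

Section hermite1.
Context {R : realType}.
Implicit Types (x y r : R) (k : nat).

Lemma hermite_poly_deriv k :
  (@hermite_poly R k.+1)^`() = (2 * k.+1%:R) *: hermite_poly k.
Proof.
elim: k => [|k IH].
  by rewrite /= !mulr1 derivC subr0 derivZ derivX alg_polyC.
have E : @hermite_poly R k.+2 =
   2%:R *: ('X * hermite_poly k.+1) - (hermite_poly k.+1)^`() by [].
have E1 : @hermite_poly R k.+1 = 2%:R *: ('X * hermite_poly k) - (hermite_poly k)^`() by [].
rewrite {}E; move: E1 IH; move: (@hermite_poly R k) (@hermite_poly R k.+1) => p q E1 IH.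
have p' : p^`() = 2%:R *: ('X * p) - q by rewrite E1 opprB addrC subrK.
rewrite derivB derivZ derivM derivX mul1r IH derivZ p'.
rewrite -!mul_polyC !polyCM; set c := (k.+1%:R)%:P.
have -> : (k.+2%:R)%:P = c + 1 by rewrite -natr1 polyCD.
by rewrite rmorph_nat; ring.
Qed.

Definition herm k x := (@hermite_poly R k).[x].

Lemma herm0 x : herm 0 x = 1. Proof. by rewrite /herm hornerC. Qed.

Lemma herm1 x : herm 1 x = 2 * x.
Proof. by rewrite /herm/= mulr1 derivC subr0 hornerZ hornerX. Qed.

Lemma hermSS k x : herm k.+2 x = 2 * x * herm k.+1 x - 2 * k.+1%:R * herm k x.
Proof.
have E : @hermite_poly R k.+2 =
   2%:R *: ('X * hermite_poly k.+1) - (hermite_poly k.+1)^`() by [].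
by rewrite /herm E hermite_poly_deriv hornerD hornerN !hornerZ hornerM hornerX; ring.
Qed.

Definition herm_norm2 k : R := 2 ^+ k * k`!%:R.

Lemma herm_norm2_gt0 k : 0 < herm_norm2 k.
Proof. by rewrite mulr_gt0 ?exprn_gt0// ltr0n fact_gt0. Qed.

Lemma herm_norm2S k : herm_norm2 k.+1 = 2 * k.+1%:R * herm_norm2 k.
Proof. by rewrite /herm_norm2 exprS factS natrM; ring. Qed.

Definition herm_unit k x := herm k x / Num.sqrt (herm_norm2 k).

Lemma herm_unitSS k x : herm_unit k.+2 x =
  Num.sqrt (2 / k.+2%:R) * x * herm_unit k.+1 x - Num.sqrt (k.+1%:R / k.+2%:R) * herm_unit k x.
Proof.
rewrite /herm_unit hermSS herm_norm2S (herm_norm2S k); move: (herm_norm2 k) (herm_norm2_gt0 k) => N N0.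
have n0 : 0 < Num.sqrt N by rewrite sqrtr_gt0.
have k20 : 0 < k.+2%:R :> R by [].
have k10 : 0 < k.+1%:R :> R by [].
set s := Num.sqrt N.
set a := Num.sqrt (2 : R); set b := Num.sqrt (k.+2%:R : R); set c := Num.sqrt (k.+1%:R : R).
have a0 : 0 < a by rewrite sqrtr_gt0.
have b0 : 0 < b by rewrite sqrtr_gt0.
have c0 : 0 < c by rewrite sqrtr_gt0.
have -> : Num.sqrt (2 * k.+2%:R * (2 * k.+1%:R * N)) = a * b * (a * c * s).
  by rewrite !sqrtrM ?mulr_ge0.
have -> : Num.sqrt (2 * k.+1%:R * N) = a * c * s by rewrite !sqrtrM ?mulr_ge0.
have -> : Num.sqrt (2 / k.+2%:R) = a / b by rewrite sqrtrM// sqrtrV.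
have -> : Num.sqrt (k.+1%:R / k.+2%:R) = c / b by rewrite sqrtrM// sqrtrV.
have a2 : 2 = a * a by rewrite -expr2 sqr_sqrtr.
have c2 : k.+1%:R = c * c by rewrite -expr2 sqr_sqrtr.
rewrite {1 2}a2 c2.
by field; rewrite !gt_eqF.
Qed.

Lemma herm_unit_subexp x : subexp (herm_unit ^~ x).
Proof.
move=> th th1; have th0 : 0 < th by rewrite (lt_trans _ th1).
(* Chosen so that th^2 = d th + 1: once the first coefficient of the recurrence is at most d and the
   second at most 1, the bound C th^k propagates. *)
pose d := th - th^-1.
have d0 : 0 < d by rewrite subr_gt0 (lt_trans _ th1)// invf_lt1.
have [K hK] : exists K : nat, forall k, (K <= k)%N -> Num.sqrt (2 / k.+2%:R) * `|x| <= d.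
  exists (Num.truncn (2 * (`|x| / d) ^+ 2)).+1 => k Kk.
  have [->|x0] := eqVneq x 0; first by rewrite normr0 mulr0 ltW.
  have x0' : 0 < `|x| by rewrite normr_gt0.
  rewrite -ler_pdivlMr// -[leRHS]ger0_norm; last by rewrite divr_ge0// ltW.
  rewrite -sqrtr_sqr ler_wsqrtr// ler_pdivrMr//.
  have : 2 * (`|x| / d) ^+ 2 <= k.+2%:R.
    apply: le_trans (ltW (truncnS_gt _)) _.
    by rewrite ler_nat; apply: leq_trans Kk _; rewrite ltnW.
  rewrite !expr_div_n mulrA ler_pdivrMr ?exprn_gt0// => h.
  by rewrite mulrC mulrA ler_pdivlMr ?exprn_gt0.
pose C := \sum_(i < K.+2) `|herm_unit i x|.
have C0 : 0 <= C by apply: sumr_ge0.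
exists C => //; elim/ltn_ind => k IH.
have [kK|] := ltnP k K.+2.
  apply: (@le_trans _ _ C).
    by rewrite /C (bigD1 (Ordinal kK))//= lerDl sumr_ge0.
  by rewrite ler_peMr// exprn_ege1// ltW.
case: k IH => [//|[//|k]] IH; rewrite !ltnS => Kk.
have h0 := IH k (ltnW (ltnSn _)); have h1 := IH k.+1 (ltnSn _).
rewrite herm_unitSS; apply: (le_trans (ler_normB _ _)).
rewrite (normrM _ (herm_unit k.+1 x)) (normrM _ (herm_unit k x)) (normrM _ x) !(ger0_norm (sqrtr_ge0 _)).
have e1 : Num.sqrt (k.+1%:R / k.+2%:R : R) <= 1.
  rewrite -[leRHS]sqrtr1 ler_wsqrtr// ler_pdivrMr// mul1r ler_nat//.
apply: (@le_trans _ _ (d * (C * th ^+ k.+1) + 1 * (C * th ^+ k))).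
  apply: lerD; first by rewrite ler_pM// ?mulr_ge0 ?sqrtr_ge0// hK// ltnW.
  by rewrite ler_pM// sqrtr_ge0.
rewrite /d !exprS le_eqVlt; apply/orP; left; apply/eqP; field.
by rewrite gt_eqF.
Qed.

Definition mehler_coef x y k := herm k x * herm k y / herm_norm2 k.
(** Mixed coefficients with shifted first index; they close the recurrences of [mehler_coef] into a
    first-order system for the generating functions. *)
Definition mehler_coefS x y k := herm k.+1 x * herm k y / herm_norm2 k.

Lemma mehler_coefE x y k : mehler_coef x y k = herm_unit k x * herm_unit k y.
Proof.
rewrite /mehler_coef /herm_unit mulrACA -invfM -expr2 sqr_sqrtr//; exact/ltW/herm_norm2_gt0.
Qed.

Lemma mehler_coef_subexp x y : subexp (mehler_coef x y).
Proof.
apply: (subexp_le (subexpM (herm_unit_subexp x) (herm_unit_subexp y))) => k.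
by rewrite mehler_coefE.
Qed.

Lemma mehler_coefS_subexp x y : subexp (mehler_coefS x y).
Proof.
apply: (subexp_le (subexpM (subexpZ 2 subexp_nat)
   (subexpM (subexpS (herm_unit_subexp x)) (herm_unit_subexp y)))) => k.
have n0 := herm_norm2_gt0 k; have n1 := herm_norm2_gt0 k.+1.
have -> : mehler_coefS x y k = Num.sqrt (2 * k.+1%:R) * (herm_unit k.+1 x * herm_unit k y).
  rewrite /mehler_coefS /herm_unit herm_norm2S; move: (herm_norm2 k) n0 => N n0.
  rewrite (@sqrtrM _ (2 * k.+1%:R)) ?mulr_ge0//.
  have s0 : 0 < Num.sqrt (N) by rewrite sqrtr_gt0.
  have s1 : 0 < Num.sqrt (2 * k.+1%:R : R) by rewrite sqrtr_gt0 mulr_gt0.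
  have E : N = Num.sqrt (N) * Num.sqrt (N) by rewrite -expr2 sqr_sqrtr// ltW.
  by rewrite {1}E; field; rewrite !gt_eqF.
rewrite normrM [leRHS]normrM ler_wpM2r// !ger0_norm ?sqrtr_ge0 ?mulr_ge0//.
rewrite -[leRHS]ger0_norm ?mulr_ge0// -sqrtr_sqr ler_wsqrtr// expr2 ler_peMl ?mulr_ge0//.
by rewrite -natrM ler1n.
Qed.

Lemma mehler_coef_sym x y : mehler_coef x y = mehler_coef y x.
Proof. by apply/funext => k; rewrite /mehler_coef (mulrC (herm k x)). Qed.

(** The three-term recurrence read on generating functions. With the same relation for x and y
    exchanged, it is a linear system of determinant 1 - r^2 for the two mixed sums. *)
Lemma mehler_coefS_psum x y r : `|r| < 1 ->
  psum (mehler_coefS x y) r = 2 * x * psum (mehler_coef x y) r - r * psum (mehler_coefS y x) r.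
Proof.
move=> r1; rewrite (psum_shift (mehler_coefS_subexp x y) r1) (psum_shift (mehler_coef_subexp x y) r1).
rewrite (_ : (fun k => mehler_coefS x y k.+1) = (fun k => (2 * x) * mehler_coef x y k.+1 + (- 1) * mehler_coefS y x k)).
  rewrite psumD//; [|exact: subexpS (mehler_coef_subexp _ _)|exact: mehler_coefS_subexp].
  by rewrite /mehler_coefS /mehler_coef herm1 !herm0; ring.
apply/funext => k; rewrite /mehler_coefS /mehler_coef hermSS herm_norm2S.
have n0 := herm_norm2_gt0 k; have k0 : 0 < k.+1%:R :> R by [].
by field; rewrite !gt_eqF.
Qed.

(** Both factors of index k + 2 are lowered by the recurrence. The coefficients weighted by k + 1
    that appear sum to r D plus the generating function itself, whence the factor 1 - r^2. *)
Lemma mehler_coef_diff_psum x y r : `|r| < 1 -> let D := psum (fun k => k.+1%:R * mehler_coef x y k.+1) r in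
  (1 - r ^+ 2) * D = (x - r * y) * psum (mehler_coefS y x) r + r * psum (mehler_coef x y) r.
Proof.
move=> r1 D.
have sD : subexp (fun k => k.+1%:R * mehler_coef x y k.+1).
  exact: subexpM subexp_nat (subexpS (mehler_coef_subexp x y)).
have sk : subexp (fun k => k.+1%:R * mehler_coef x y k) by exact: subexpM subexp_nat (mehler_coef_subexp x y).
have kc : psum (fun k => k.+1%:R * mehler_coef x y k) r = r * D + psum (mehler_coef x y) r.
  rewrite (psum_shift sk r1) (psum_shift (mehler_coef_subexp x y) r1).
  rewrite (_ : (fun k => k.+2%:R * _) = (fun k => 1 * (k.+1%:R * mehler_coef x y k.+1) + 1 * mehler_coef x y k.+1)).
    by rewrite psumD//; [rewrite /D; ring|exact: subexpS (mehler_coef_subexp _ _)].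
  by apply/funext => k; rewrite -natr1; ring.
have key : D = x * psum (mehler_coefS y x) r - r * y * psum (mehler_coefS y x) r +
    r * psum (fun k => k.+1%:R * mehler_coef x y k) r.
  rewrite /D (psum_shift sD r1).
  rewrite (_ : (fun k => k.+2%:R * mehler_coef x y k.+2) = (fun k => 1 * (x * mehler_coefS y x k.+1 + (- y) * mehler_coefS y x k) +
     1 * (k.+1%:R * mehler_coef x y k))).
    have s1 := mehler_coefS_subexp y x; have s2 := subexpS s1.
    rewrite psumD//; last first.
      move=> th th1; have [C C0 hC] := subexpZ x s2 th1; have [C' C0' hC'] := subexpZ (- y) s1 th1.
      exists (C + C'); first exact: addr_ge0.
      by move=> k; rewrite mulrDl; apply: le_trans (ler_normD _ _) _; exact: lerD.
    rewrite psumD// [in X in _ = X - _ + _](psum_shift s1 r1).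
    by rewrite /mehler_coefS /mehler_coef herm_norm2S !herm1 !herm0 /herm_norm2 expr0 fact0; field.
  apply/funext => k; rewrite /mehler_coefS /mehler_coef !hermSS !herm_norm2S.
  have n0 := herm_norm2_gt0 k; have k0 : 0 < k.+1%:R :> R by []; have k1 : 0 < k.+2%:R :> R by [].
  by field; rewrite !gt_eqF.
rewrite kc in key; lra.
Qed.

End hermite1.

(** * Mehler's formula and Gaussian bounds in dimension one *)

Section mehler.
Context {R : realType}.
Implicit Types (x y r t : R) (k : nat).

(* F t = \sum_k H_k(x) H_k(y) t^k / (2^k k!) solves F' = - psi' F, by the
   three-term recurrence. *)
Let psi x y t := 2^-1 * ln (1 - t) + 2^-1 * ln (1 + t) - (x ^+ 2 + y ^+ 2) +
  (x - y) ^+ 2 / 2 * (1 - t)^-1 + (x + y) ^+ 2 / 2 * (1 + t)^-1.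

Let is_derive_psi x y t : `|t| < 1 -> is_derive t (1 : R) (psi x y)
  (- (2^-1 / (1 - t)) + 2^-1 / (1 + t) + (x - y) ^+ 2 / 2 / (1 - t) ^+ 2
   - (x + y) ^+ 2 / 2 / (1 + t) ^+ 2).
Proof.
rewrite ltr_norml => /andP[t1 t2].
have a0 : 0 < 1 - t by lra.
have b0 : 0 < 1 + t by lra.
have dC (c : R) : is_derive t (1 : R) (fun _ : R => c) 0 by exact: is_derive_cst.
have dadd (f g : R -> R) (a b : R) : is_derive t (1 : R) f a -> is_derive t (1 : R) g b ->
  is_derive t (1 : R) (fun s => f s + g s) (a + b) by exact: is_deriveD.
have dmul (f : R -> R) (c a : R) : is_derive t (1 : R) f a ->
  is_derive t (1 : R) (fun s => c * f s) (c * a) by exact: is_deriveZ.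
have did : is_derive t (1 : R) (fun s : R => s) 1 by exact: is_derive_id.
have d1 : is_derive t (1 : R) (fun t : R => 1 - t) (- 1).
  have := dadd _ _ _ _ (dC 1) (dmul _ (- 1) _ did); rewrite add0r mulr1.
  by under eq_fun do rewrite mulN1r.
have d2 : is_derive t (1 : R) (fun t : R => 1 + t) 1.
  by have := dadd _ _ _ _ (dC 1) did; rewrite add0r.
have l1 : is_derive t (1 : R) (fun t : R => ln (1 - t)) (- (1 - t)^-1).
  have := @is_derive1_comp _ (@ln R) (fun t : R => 1 - t) t _ _ (is_derive1_ln a0) d1.
  by rewrite mulrN1.
have l2 : is_derive t (1 : R) (fun t : R => ln (1 + t)) ((1 + t)^-1).
  have := @is_derive1_comp _ (@ln R) (fun t : R => 1 + t) t _ _ (is_derive1_ln b0) d2.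
  by rewrite mulr1.
have v1 : is_derive t (1 : R) (fun t : R => (1 - t)^-1) ((1 - t) ^- 2).
  have := @is_deriveV _ (fun t : R => 1 - t) t _ 1 (lt0r_neq0 a0) d1.
  by rewrite /GRing.scale/= mulrN1 opprK.
have v2 : is_derive t (1 : R) (fun t : R => (1 + t)^-1) (- (1 + t) ^- 2).
  have := @is_deriveV _ (fun t : R => 1 + t) t _ 1 (lt0r_neq0 b0) d2.
  by rewrite /GRing.scale/= mulr1.
have := dadd _ _ _ _ (dadd _ _ _ _ (dadd _ _ _ _ (dadd _ _ _ _ (dmul _ 2^-1 _ l1)
  (dmul _ 2^-1 _ l2)) (dC (- (x ^+ 2 + y ^+ 2)))) (dmul _ ((x - y) ^+ 2 / 2) _ v1))
  (dmul _ ((x + y) ^+ 2 / 2) _ v2).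
move=> h; apply: (is_derive_eq h).
by field; rewrite !gt_eqF.
Qed.

Lemma mehler_psum x y r : 0 <= r < 1 -> psum (mehler_coef x y) r = expR (- psi x y r).
Proof.
move=> /andP[r0 r1].
(* By the differential equation the product with exp(psi) has zero derivative; its value at 0 is
   1. *)
pose Z t := psum (mehler_coef x y) t * expR (psi x y t).
have dZ t : `|t| < 1 -> is_derive t (1 : R) Z 0.
  move=> t1.
  have dF := psum_derive (mehler_coef_subexp x y) t1.
  have de := is_derive1_comp (is_derive_expR (psi x y t)) (is_derive_psi x y t1).
  have h := is_deriveM dF de; apply: (is_derive_eq h); rewrite /GRing.scale/=.
  have e1 := mehler_coefS_psum x y t1; have e2 := mehler_coefS_psum y x t1; rewrite (mehler_coef_sym y x) in e2.
  have e3 := mehler_coef_diff_psum x y t1; rewrite /= in e3.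
  move: e1 e2 e3; set F := psum (mehler_coef x y) t; set D := psum (fun k => k.+1%:R * _) t.
  move: (psum (mehler_coefS x y) t) (psum (mehler_coefS y x) t) (expR _) => E1 E2 e e1 e2 e3.
  move: t1; rewrite ltr_norml => /andP[t1 t2].
  have a0 : 1 - t != 0 by rewrite gt_eqF//; lra.
  have b0 : 1 + t != 0 by rewrite gt_eqF//; lra.
  have q0 : (1 - t ^+ 2) != 0.
    by rewrite (_ : 1 - t ^+ 2 = (1 - t) * (1 + t)) ?mulf_neq0//; ring.
  (* The two-by-two system is solved for one mixed sum, which then determines the derivative. *)
  have hE2 : E2 = (2 * y - 2 * t * x) * F / (1 - t ^+ 2).
    by apply: (mulIf q0); rewrite mulfVK//; rewrite e1 in e2; lra.
  have hD : D = ((x - t * y) * E2 + t * F) / (1 - t ^+ 2).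
    by apply: (mulIf q0); rewrite mulfVK//; lra.
  rewrite hD hE2.
  by field; rewrite q0 a0 b0.
have Z0 : Z 0 = 1.
  rewrite /Z (psum_shift (mehler_coef_subexp x y)) ?normr0 ?ltr01// mul0r addr0.
  rewrite /mehler_coef !herm0 /herm_norm2 expr0 fact0 !mul1r invr1 mul1r /psi subr0 addr0 ln1 !mulr0 invr1 !mulr1.
  rewrite (_ : _ + _ = 0) ?expR0//.
  by field.
have Zr : Z r = 1.
  move: r0; rewrite le_eqVlt => /orP[/eqP <-//|r0'].
  have nr t : 0 <= t <= r -> `|t| < 1.
    by move=> /andP[t0 tr]; rewrite ger0_norm// (le_lt_trans tr).
  have cZ : {within `[0, r], continuous Z}.
    apply: derivable_within_continuous => t; rewrite in_itv/= => /nr /dZ h.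
    exact: ex_derive.
  have dZ' t : t \in `]0, r[ -> is_derive t (1 : R) Z 0.
    rewrite in_itv/= => /andP[t0 tr]; apply/dZ/nr; by rewrite !ltW.
  have [c _] := @MVT _ Z (fun _ => 0) 0 r r0' dZ' cZ.
  by rewrite mul0r => /subr0_eq ->.
by rewrite expRN -[LHS]mulr1 -(mulfV (lt0r_neq0 (expR_gt0 (psi x y r)))) mulrA -/(Z r) Zr mul1r.
Qed.

(** Mehler's closed form of \sum_k r^k h_k(x) h_k(y). Separating x - y from x + y exhibits two
    Gaussian factors: as r tends to 1 the first concentrates and the second spreads out. *)
Definition mehler r x y : R := (Num.sqrt (pi * (1 - r ^+ 2)))^-1 *
  expR (- (((x - y) ^+ 2 * ((1 + r) / (1 - r)) + (x + y) ^+ 2 * ((1 - r) / (1 + r))) / 4)).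

Lemma hermite_funE k x :
  hermite_fun k x = herm_unit k x * expR (- (x ^+ 2 / 2)) / Num.sqrt (Num.sqrt pi).
Proof.
rewrite /hermite_fun /herm_unit -/(herm k x) -/(herm_norm2 k) sqrtrM ?(ltW (herm_norm2_gt0 _))//.
by rewrite invfM; ring.
Qed.

Lemma hermite_fun_mulE k x y : hermite_fun k x * hermite_fun k y =
  mehler_coef x y k * (expR (- ((x ^+ 2 + y ^+ 2) / 2)) / Num.sqrt pi).
Proof.
rewrite !hermite_funE mehler_coefE (_ : - ((x ^+ 2 + y ^+ 2) / 2) = - (x ^+ 2 / 2) + - (y ^+ 2 / 2));
  last by ring.
rewrite expRD -[in RHS](@sqr_sqrtr _ (Num.sqrt pi)) ?sqrtr_ge0// expr2.
have : 0 < Num.sqrt (Num.sqrt pi) :> R by rewrite !sqrtr_gt0 pi_gt0.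
move: (Num.sqrt _) (herm_unit _ _) (herm_unit _ _) (expR _) (expR _) => s a b c d s0.
by field; rewrite gt_eqF.
Qed.

Lemma mehler_cvg r x y : `|r| < 1 ->
  cvgn (series (fun k => `|r ^+ k * (hermite_fun k x * hermite_fun k y)|)).
Proof.
move=> r1; rewrite (_ : (fun k => `|_|) = (fun k => `|(expR (- ((x ^+ 2 + y ^+ 2) / 2)) / Num.sqrt pi *
    mehler_coef x y k) * r ^+ k|)).
  by apply: subexp_cvg => //; apply: subexpZ; exact: mehler_coef_subexp.
by apply/funext => k; rewrite hermite_fun_mulE; congr (`|_|); ring.
Qed.

Lemma mehlerE r x y : 0 <= r < 1 ->
  limn (series (fun k => r ^+ k * (hermite_fun k x * hermite_fun k y))) = mehler r x y.
Proof.
move=> r01; have /andP[r0 r1] := r01.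
rewrite (_ : (fun k => _) = (fun k => (expR (- ((x ^+ 2 + y ^+ 2) / 2)) / Num.sqrt pi) *
    (mehler_coef x y k * r ^+ k))); last first.
  by apply/funext => k; rewrite hermite_fun_mulE; ring.
rewrite limn_seriesZ; last first.
  by apply: abs_cvg_series; apply: subexp_cvg (mehler_coef_subexp x y) _; rewrite ger0_norm.
rewrite -/(psum (mehler_coef x y) r) mehler_psum// /mehler.
have a0 : 0 < 1 - r by lra.
have b0 : 0 < 1 + r by lra.
rewrite (_ : - psi x y r = - (2^-1 * (ln (1 - r) + ln (1 + r))) +
  ((x ^+ 2 + y ^+ 2) - (x - y) ^+ 2 / 2 * (1 - r)^-1 - (x + y) ^+ 2 / 2 * (1 + r)^-1));
  last by rewrite /psi; ring.
rewrite expRD -lnM ?posrE// (_ : (1 - r) * (1 + r) = 1 - r ^+ 2); last by ring.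
have v0 : 0 < 1 - r ^+ 2 by nra.
have -> : expR (- (2^-1 * ln (1 - r ^+ 2))) = (Num.sqrt (1 - r ^+ 2))^-1.
  by rewrite expRN mulrC expRM lnK ?posrE// powR12_sqrt// ltW.
rewrite sqrtrM ?pi_ge0// invfM; set A := expR _; set B := expR _.
transitivity ((Num.sqrt pi)^-1 / Num.sqrt (1 - r ^+ 2) * (A * B)); first by ring.
rewrite /A /B -expRD; congr (_ * expR _).
by field; rewrite !gt_eqF.
Qed.

Lemma mehler_gt0 r x y : 0 <= r < 1 -> 0 < mehler r x y.
Proof.
move=> /andP[r0 r1]; rewrite mulr_gt0 ?expR_gt0// invr_gt0 sqrtr_gt0 mulr_gt0 ?pi_gt0//.
nra.
Qed.

(** On the diagonal all terms of Mehler's series are nonnegative, so each is at most the kernel. For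
    r = (k + 1)/(k + 2) the kernel is at most 1/(1 - r) = k + 2, while r^k stays above 1/e. *)
Lemma hermite_fun_bound : exists2 C : R, 0 < C & forall k x, `|hermite_fun k x| <= C * k.+1%:R.
Proof.
exists (expR 1 * 2); first by rewrite mulr_gt0// expR_gt0.
move=> k x; pose r : R := k.+1%:R / k.+2%:R.
have k0 : 0 < k.+1%:R :> R by [].
have k2 : k.+2%:R = k.+1%:R + 1 :> R by rewrite natr1.
have r1 : r < 1 by rewrite ltr_pdivrMr// mul1r ltr_nat.
have r0 : 0 < r by rewrite divr_gt0.
have r01 : 0 <= r < 1 by rewrite ltW.
have h : r ^+ k * (hermite_fun k x * hermite_fun k x) <= mehler r x x.
  rewrite -(mehlerE x x r01).
  have c : cvgn (series (fun k => r ^+ k * (hermite_fun k x * hermite_fun k x))).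
    by apply: abs_cvg_series; apply: mehler_cvg; rewrite ger0_norm// ltW.
  have t0 j : 0 <= r ^+ j * (hermite_fun j x * hermite_fun j x).
    by rewrite mulr_ge0 ?exprn_ge0 ?(ltW r0)// -expr2 sqr_ge0.
  apply: (@le_trans _ _ (series (fun k => r ^+ k * (hermite_fun k x * hermite_fun k x)) k.+1)).
    by rewrite seriesSr lerDr /series/= sumr_ge0.
  apply: nondecreasing_cvgn_le => //.
  by apply/nondecreasing_seqP => n; rewrite seriesSr lerDl.
have e1 : 1 <= expR 1 :> R by rewrite -expR0 ler_expR.
have v0 : 0 < 1 - r by rewrite subr_gt0.
have m1 : mehler r x x <= k.+2%:R.
  rewrite /mehler -[leRHS]mulr1 ler_pM ?expR_ge0 ?invr_ge0 ?sqrtr_ge0//; last first.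
    rewrite expR_le1 oppr_le0 divr_ge0// subrr expr0n/= mul0r add0r mulr_ge0 ?sqr_ge0//.
    by rewrite divr_ge0 ?(ltW v0)// addr_ge0// ltW.
  have w : 1 - r = k.+2%:R^-1.
    have w' a : 0 < a -> 1 - a / (a + 1) = (a + 1)^-1 :> R.
      by move=> a0; field; rewrite gt_eqF// addr_gt0.
    by rewrite /r k2 w'.
  rewrite -[leRHS]invrK lef_pV2 ?posrE ?invr_gt0 ?sqrtr_gt0 ?mulr_gt0 ?pi_gt0//; last by nra.
  have wpos : 0 <= k.+2%:R^-1 :> R by rewrite invr_ge0.
  rewrite -[leLHS]ger0_norm// -sqrtr_sqr ler_wsqrtr// -w.
  have v : 0 <= 1 - r ^+ 2 by nra.
  have : 1 * (1 - r ^+ 2) <= pi * (1 - r ^+ 2).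
    by rewrite ler_wpM2r// (le_trans _ (pi_ge2 R))// ler1n.
  nra.
have rk : expR (- 1) <= r ^+ k.
  have -> : r = (1 + k.+1%:R^-1)^-1.
    have w' a : 0 < a -> a / (a + 1) = (1 + a^-1)^-1 :> R.
      by move=> a0; field; rewrite !gt_eqF// addr_gt0.
    by rewrite /r k2 w'.
  rewrite exprVn expRN lef_pV2 ?posrE ?exprn_gt0 ?expR_gt0 ?addr_gt0 ?invr_gt0//.
  apply: (@le_trans _ _ (expR (k.+1%:R^-1) ^+ k)).
    by rewrite lerXn2r ?nnegrE ?expR_ge0 ?addr_ge0 ?invr_ge0// expR_ge1Dx.
  by rewrite -expRM_natl ler_expR ler_pdivrMr// mul1r ler_nat.
have hk : `|hermite_fun k x| ^+ 2 <= expR 1 * k.+2%:R.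
  rewrite real_normK ?num_real// -ler_pdivrMl ?expR_gt0// -expRN.
  apply: le_trans (le_trans h m1); rewrite expr2 ler_wpM2r// -expr2 sqr_ge0//.
have C0 : 0 <= expR 1 * 2 * k.+1%:R :> R by rewrite !mulr_ge0 ?expR_ge0.
rewrite -(@ler_pXn2r _ 2) ?nnegrE//; apply: (le_trans hk).
rewrite k2; have k1 : 1 <= k.+1%:R :> R by rewrite ler1n.
move: (expR 1) (k.+1%:R) k1 e1 => e K K1 E1 {C0 hk h m1}.
have z1 : 1 <= e * 2 * K by nra.
by apply: (@le_trans _ _ (e * 2 * K)); [nra|rewrite expr2 ler_peMl//; lra].
Qed.

(** The three-term recurrence for the normalized functions. At k = 0 the index [k.-1] is 0,
    harmlessly, since its coefficient vanishes. *)
Lemma herm_mulx k x : x * hermite_fun k x =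
  Num.sqrt (k.+1%:R / 2) * hermite_fun k.+1 x + Num.sqrt (k%:R / 2) * hermite_fun k.-1 x.
Proof.
rewrite !hermite_funE; set g := expR _; set q := Num.sqrt (Num.sqrt pi).
have -> : x * (herm_unit k x * g / q) = (x * herm_unit k x) * (g / q) by ring.
rewrite (_ : _ + _ = (Num.sqrt (k.+1%:R / 2) * herm_unit k.+1 x +
  Num.sqrt (k%:R / 2) * herm_unit k.-1 x) * (g / q)); last by ring.
congr (_ * _).
case: k => [|k].
  rewrite /herm_unit herm1 herm0 mul0r sqrtr0 mul0r addr0 herm_norm2S /herm_norm2 expr0 fact0 !mulr1 sqrtr1 divr1.
  rewrite mul1r mulr1 sqrtrV// mulrA mulrAC -invfM -expr2 sqr_sqrtr//.
  by field.
rewrite herm_unitSS /=.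
have k20 : 0 < k.+2%:R :> R by [].
have k10 : 0 < k.+1%:R :> R by [].
set a := Num.sqrt (2 : R); set b := Num.sqrt (k.+2%:R : R); set c := Num.sqrt (k.+1%:R : R).
have a0 : 0 < a by rewrite sqrtr_gt0.
have b0 : 0 < b by rewrite sqrtr_gt0.
have c0 : 0 < c by rewrite sqrtr_gt0.
rewrite !sqrtrM// !sqrtrV// -/a -/b -/c.
by field; rewrite !gt_eqF.
Qed.

Let herm_mulx_bound n (C w x : R) : 0 <= C -> 0 <= w ->
  (forall k, `|hermite_fun k x| * w <= C * k.+1%:R ^+ n) ->
  forall k, `|hermite_fun k x| * (w * `|x|) <= 2 ^+ n.+1 * C * k.+1%:R ^+ n.+1.
Proof.
move=> C0 w0 h k; have -> : `|hermite_fun k x| * (w * `|x|) = `|x * hermite_fun k x| * w.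
  by rewrite (normrM x); ring.
rewrite herm_mulx.
have k10 : 0 < k.+1%:R :> R by [].
have k1 : 1 <= k.+1%:R :> R by rewrite ler1n.
have sk (j : R) : 0 <= j <= k.+1%:R -> Num.sqrt (j / 2) <= k.+1%:R.
  move=> /andP[j0 jk]; rewrite -[leRHS]ger0_norm ?(ltW k10)// -sqrtr_sqr ler_wsqrtr//.
  rewrite expr2; nra.
apply: (@le_trans _ _ ((k.+1%:R * `|hermite_fun k.+1 x| + k.+1%:R * `|hermite_fun k.-1 x|) * w)).
  apply: ler_wpM2r => //; apply: (le_trans (ler_normD _ _)).
  rewrite !normrM !(ger0_norm (sqrtr_ge0 _)) lerD// ler_wpM2r// sk//.
    by rewrite lexx andbT.
  by rewrite ler0n ler_nat leqnSn.
rewrite mulrDl -!mulrA.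
have e : C * k.-1.+1%:R ^+ n <= C * k.+2%:R ^+ n.
  rewrite ler_wpM2l// lerXn2r ?nnegrE// ler_nat; case: k {h k10 k1 sk} => //= k.
  by rewrite ltnS ltnW// ltnW.
apply: (@le_trans _ _ (k.+1%:R * (C * k.+2%:R ^+ n) + k.+1%:R * (C * k.+2%:R ^+ n))).
  by rewrite lerD// ler_wpM2l// ?(le_trans (h _))// (ltW k10).
have : k.+2%:R ^+ n <= 2 ^+ n * k.+1%:R ^+ n :> R.
  rewrite -exprMn lerXn2r ?nnegrE ?mulr_ge0//.
  by rewrite -natrM ler_nat mulSn mul1n addSn addnS !ltnS leq_addr.
rewrite !exprS; move: (k.+2%:R ^+ n) (2 ^+ n) (k.+1%:R ^+ n) => A B D hA.
have h1 : C * A <= C * (B * D) by rewrite ler_wpM2l.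
move: (k.+1%:R : R) k10 => K K0; nra.
Qed.

(* Multiplication by x shifts the index by one: applied twice, it trades the
   decay in x for powers of k. *)
Lemma hermite_fun_decay : exists2 C : R, 0 < C &
  forall k x, `|hermite_fun k x| <= C * k.+1%:R ^+ 3 / (1 + x ^+ 2).
Proof.
have [C C0 hC] := hermite_fun_bound.
(* 33 = 2^2 * 2^3 + 1: two multiplications by x, plus the bound without weight. *)
exists (33 * C); first by rewrite mulr_gt0.
move=> k x; rewrite ler_pdivlMr ?ltr_pwDl ?sqr_ge0// mulrDr mulr1.
have h1 j : `|hermite_fun j x| * 1 <= C * j.+1%:R ^+ 1 by rewrite mulr1 expr1.
have h2 := herm_mulx_bound (ltW C0) ler01 h1.
have c0 : 0 <= 2 ^+ 2 * C by rewrite mulr_ge0// ltW.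
have := herm_mulx_bound c0 (mulr_ge0 ler01 (normr_ge0 x)) h2 k.
rewrite mul1r -expr2 real_normK ?num_real//.
have k1 : 1 <= k.+1%:R :> R by rewrite ler1n.
have := hC k x.
have : C * k.+1%:R <= C * k.+1%:R ^+ 3 by rewrite ler_wpM2l ?(ltW C0)// ler_eXnr.
rewrite (_ : 2 ^+ 3 * (2 ^+ 2 * C) = 32 * C); last by ring.
by move: (k.+1%:R ^+ 3) => K; lra.
Qed.

(* the kernel of e^{-sH} in dimension one, with r = e^{-2s} *)
Definition mehler1 r x y : R := Num.sqrt r * mehler r x y.

Lemma mehler1_gt0 r x y : 0 < r < 1 -> 0 < mehler1 r x y.
Proof. by move=> /andP[r0 r1]; rewrite mulr_gt0 ?sqrtr_gt0// mehler_gt0// ltW. Qed.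

(** Completing the square in y: up to its mass the kernel is a normal density, of mean 2rx/(1 + r^2)
    and variance (1 - r^2)/(1 + r^2), so its integral is explicit. *)
Lemma mehler1_normal r x y : 0 < r < 1 -> mehler1 r x y =
  Num.sqrt (2 * r / (1 + r ^+ 2)) *
  expR (- (2^-1 * ((1 - r ^+ 2) / (1 + r ^+ 2)) * x ^+ 2)) *
  normal_pdf (2 * r / (1 + r ^+ 2) * x) (Num.sqrt ((1 - r ^+ 2) / (1 + r ^+ 2))) y.
Proof.
move=> /andP[r0 r1].
have a0 : 0 < 1 - r by lra.
have b0 : 0 < 1 + r by lra.
have v0 : 0 < 1 - r ^+ 2 by nra.
have w0 : 0 < 1 + r ^+ 2 by nra.
have p0 : 0 < pi :> R by exact: pi_gt0.
rewrite normal_pdfE; last by rewrite gt_eqF// sqrtr_gt0 divr_gt0.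
rewrite /normal_peak /normal_fun /mehler1 /mehler.
rewrite !sqr_sqrtr ?divr_ge0 ?ltW//.
have -> : Num.sqrt r * ((Num.sqrt (pi * (1 - r ^+ 2)))^-1 * expR
   (- (((x - y) ^+ 2 * ((1 + r) / (1 - r)) + (x + y) ^+ 2 * ((1 - r) / (1 + r))) / 4))) =
   Num.sqrt (r / (pi * (1 - r ^+ 2))) * expR
   (- (((x - y) ^+ 2 * ((1 + r) / (1 - r)) + (x + y) ^+ 2 * ((1 - r) / (1 + r))) / 4)).
  have pv0 : 0 <= pi * (1 - r ^+ 2) by rewrite ltW// mulr_gt0.
  by rewrite (@sqrtrM _ r) ?(ltW r0)// (sqrtrV pv0); ring.
have -> : r / (pi * (1 - r ^+ 2)) = 2 * r / (1 + r ^+ 2) *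
    ((1 - r ^+ 2) / (1 + r ^+ 2) * pi *+ 2)^-1.
  rewrite -mulr_natr; move: (pi : R) p0 => q q0.
  by field; rewrite !gt_eqF.
rewrite sqrtrM ?divr_ge0 ?mulr_ge0 ?ltW// sqrtrV; last first.
  by rewrite mulrn_wge0// mulr_ge0 ?divr_ge0 ?ltW.
rewrite [RHS]mulrACA -expRD; congr (_ * expR _).
by rewrite -mulr_natr; field; rewrite !gt_eqF.
Qed.

Lemma measurable_mehler1 r x : 0 < r < 1 ->
  measurable_fun setT (mehler1 r x : measurableTypeR R -> R).
Proof.
move=> r01.
have -> : mehler1 r x = (fun y => Num.sqrt (2 * r / (1 + r ^+ 2)) *
  expR (- (2^-1 * ((1 - r ^+ 2) / (1 + r ^+ 2)) * x ^+ 2)) *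
  normal_pdf (2 * r / (1 + r ^+ 2) * x) (Num.sqrt ((1 - r ^+ 2) / (1 + r ^+ 2))) y).
  by apply/funext => y; exact: mehler1_normal.
by apply: measurable_funM => //; exact: measurable_normal_pdf.
Qed.

Lemma integral_mehler1 r x : 0 < r < 1 ->
  (\int[lebesgue_measure]_y (mehler1 r x y)%:E =
  (Num.sqrt (2 * r / (1 + r ^+ 2)) *
  expR (- (2^-1 * ((1 - r ^+ 2) / (1 + r ^+ 2)) * x ^+ 2)))%:E)%E.
Proof.
move=> r01; under eq_integral do rewrite mehler1_normal// EFinM.
rewrite ge0_integralZl_EFin//; last 2 first.
- by move=> y _; rewrite lee_fin normal_pdf_ge0.
- by apply: measurableT_comp => //; exact: measurable_normal_pdf.
by rewrite integral_normal_pdf mule1.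
Qed.

Lemma integral_mehler1_le1 r x : 0 < r < 1 ->
  (\int[lebesgue_measure]_y (mehler1 r x y)%:E <= 1)%E.
Proof.
move=> r01; rewrite integral_mehler1// lee_fin.
have /andP[r0 r1] := r01.
have w0 : 0 < 1 + r ^+ 2 by nra.
rewrite -[leRHS]mulr1 ler_pM ?sqrtr_ge0 ?expR_ge0//.
  rewrite -[leRHS]sqrtr1 ler_wsqrtr// ler_pdivrMr// mul1r.
  by have := sqr_ge0 (1 - r); nra.
rewrite expR_le1 oppr_le0 mulr_ge0 ?sqr_ge0// mulr_ge0// divr_ge0 ?ltW//.
by nra.
Qed.

(** The mass deficit is linear in 1 - r and quadratic in x; at a fixed point this becomes a linear
    rate in time. *)
Lemma integral_mehler1_ge r x : 0 < r < 1 ->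
  ((1 - (1 - r) * (1 + x ^+ 2))%:E <= \int[lebesgue_measure]_y (mehler1 r x y)%:E)%E.
Proof.
move=> r01; rewrite integral_mehler1// lee_fin.
have /andP[r0 r1] := r01.
have w0 : 0 < 1 + r ^+ 2 by nra.
have h1 : r <= Num.sqrt (2 * r / (1 + r ^+ 2)).
  rewrite -[leLHS]ger0_norm ?(ltW r0)// -sqrtr_sqr ler_wsqrtr// ler_pdivlMr//.
  have : r ^+ 2 <= r by rewrite expr2 ler_piMl// ltW.
  have : 0 <= r ^+ 2 by exact: sqr_ge0.
  nra.
have h2 : 1 - (1 - r) * x ^+ 2 <= expR (- (2^-1 * ((1 - r ^+ 2) / (1 + r ^+ 2)) * x ^+ 2)).
  apply: le_trans (expR_ge1Dx _); rewrite lerD2l lerN2 ler_wpM2r ?sqr_ge0//.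
  rewrite mulrA ler_pdivrMr//.
  have : 0 <= (1 - r) * r ^+ 2 by rewrite mulr_ge0 ?sqr_ge0//; lra.
  nra.
set e := expR _ in h2 *.
have e0 : 0 <= e by exact: expR_ge0.
have x0 : 0 <= (1 - r) * x ^+ 2 by rewrite mulr_ge0 ?sqr_ge0//; lra.
apply: (@le_trans _ _ (r * e)); last by rewrite ler_wpM2r.
apply: (@le_trans _ _ (r * (1 - (1 - r) * x ^+ 2))); last by rewrite ler_wpM2l// ltW.
nra.
Qed.

Let expR_inv_le (z : R) : 0 < z -> expR (- z) <= z^-1.
Proof.
move=> z0; rewrite expRN lef_pV2 ?posrE ?expR_gt0//.
by apply: le_trans (expR_ge1Dx z); rewrite lerDr.
Qed.

(** Half of the Gaussian exponent supplies the tail factor through e^{-z} <= 1/z, the other half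
    remains as a normal density of mass one. The gain is a full factor 1 - r. *)
Lemma integral_mehler1_tail r x eta : 0 < r < 1 -> 0 < eta ->
  (\int[lebesgue_measure]_(y in [set y | (eta <= `|y - x|)%R]) (mehler1 r x y)%:E
   <= (24 * (1 - r) / eta ^+ 2)%:E)%E.
Proof.
move=> r01 eta0; have /andP[r0 r1] := r01.
have a0 : 0 < 1 - r by lra.
have b0 : 0 < 1 + r by lra.
have v0 : 0 < 1 - r ^+ 2 by nra.
have p0 : 0 < pi :> R by exact: pi_gt0.
pose ka := (1 + r) / (1 - r).
have ka0 : 0 < ka by rewrite divr_gt0.
(* s^2 is twice the variance of the Gaussian exp(- ka (x - y)^2 / 4), so the density of deviation s
   retains half of its exponent. *)
pose s := Num.sqrt (4 / ka).
have s0 : 0 < s by rewrite sqrtr_gt0 divr_gt0.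
(* 24 = 3 * 8: the factor 3 compares the prefactors, 8 comes from the discarded half of the
   exponent. *)
have key y : eta <= `|y - x| ->
    mehler1 r x y <= 24 * (1 - r) / eta ^+ 2 * normal_pdf x s y.
  move=> he; rewrite normal_pdfE ?gt_eqF// /normal_peak /normal_fun.
  rewrite sqr_sqrtr ?divr_ge0 ?(ltW ka0)//.
  set N := (Num.sqrt (4 / ka * pi *+ 2))^-1.
  have N0 : 0 <= N by rewrite invr_ge0 sqrtr_ge0.
  have pre : Num.sqrt r / Num.sqrt (pi * (1 - r ^+ 2)) <= 3 * N.
    rewrite -sqrtrV ?mulr_ge0 ?(ltW p0) ?(ltW v0)// -sqrtrM ?(ltW r0)//.
    have Np : 0 <= 4 / ka * pi *+ 2 by rewrite mulrn_wge0// ltW// mulr_gt0// divr_gt0.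
    rewrite /N -(sqrtrV Np).
    have -> : 3 = Num.sqrt 9 :> R by rewrite (_ : 9 = 3 ^+ 2) ?sqrtr_sqr ?ger0_norm//; ring.
    rewrite -sqrtrM// ler_wsqrtr//.
    rewrite (_ : (4 / ka * pi *+ 2)^-1 = (1 + r) / (8 * (1 - r) * pi)); last first.
      rewrite /ka -mulr_natr; move: (pi : R) p0 => q q0.
      by field; rewrite !gt_eqF//; lra.
    rewrite (_ : pi * (1 - r ^+ 2) = (1 - r) * pi * (1 + r)); last by ring.
    rewrite mulrA ler_pdivlMr ?mulr_gt0// mulrAC ler_pdivrMr ?mulr_gt0//.
    have : 0 < (1 - r) * pi by rewrite mulr_gt0.
    rewrite (_ : 8 * (1 - r) * pi = 8 * ((1 - r) * pi)); last by ring.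
    move: ((1 - r) * pi) => q q0.
    have : 8 * r <= 9 * (1 + r) ^+ 2 by nra.
    rewrite -subr_ge0 => /mulr_ge0/(_ (ltW q0)); nra.
  have ex : expR (- (((x - y) ^+ 2 * ((1 + r) / (1 - r)) + (x + y) ^+ 2 * ((1 - r) / (1 + r))) / 4))
     <= (8 * (1 - r) / eta ^+ 2) * expR (- (y - x) ^+ 2 / (4 / ka *+ 2)).
    apply: (@le_trans _ _ (expR (- (ka * eta ^+ 2 / 8)) * expR (- (y - x) ^+ 2 / (4 / ka *+ 2)))).
      rewrite -expRD ler_expR.
      have -> : - (y - x) ^+ 2 / (4 / ka *+ 2) = - (ka * (y - x) ^+ 2 / 8).
        by rewrite -mulr_natr; field; rewrite gt_eqF.
      rewrite -/ka.
      have e1 : eta ^+ 2 <= (y - x) ^+ 2.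
        by rewrite -[leRHS]real_normK ?num_real// lerXn2r ?nnegrE// ltW.
      have e2 : 0 <= (x + y) ^+ 2 * ((1 - r) / (1 + r)).
        by rewrite mulr_ge0 ?sqr_ge0// divr_ge0 ?ltW.
      have e3 : ka * eta ^+ 2 <= ka * (y - x) ^+ 2 by rewrite ler_pM2l.
      have e4 : (x - y) ^+ 2 * ka = ka * (y - x) ^+ 2 by ring.
      rewrite e4; lra.
    rewrite ler_wpM2r ?expR_ge0//.
    apply: (le_trans (expR_inv_le _)); first by rewrite divr_gt0// mulr_gt0// exprn_gt0.
    rewrite (_ : (ka * eta ^+ 2 / 8)^-1 = 8 * (1 - r) / eta ^+ 2 / (1 + r)); last first.
      by rewrite /ka; field; rewrite !gt_eqF ?exprn_gt0.
    rewrite ler_pdivrMr// ler_peMr//; last lra.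
    by rewrite divr_ge0 ?sqr_ge0// mulr_ge0// ltW.
  rewrite /mehler1 /mehler [leLHS]mulrA.
  apply: le_trans (ler_pM _ _ pre ex) _; rewrite ?expR_ge0//.
  - by rewrite le_eqVlt; apply/orP; left; apply/eqP; ring.
  - exact: ltW.
  - exact: ltW.
have mS : measurable [set y : measurableTypeR R | eta <= `|y - x|].
  rewrite (_ : [set y | _] = (fun y : measurableTypeR R => `|y - x|) @^-1` `[eta, +oo[%classic); last first.
    by apply/seteqP; split => y /=; rewrite in_itv/= andbT.
  have mf : measurable_fun setT (fun y : measurableTypeR R => `|y - x|).
    by apply: measurableT_comp => //; exact: measurable_funB.
  by have := mf measurableT _ (measurable_itv `[eta, +oo[); rewrite setTI.
have C0 : 0 <= 24 * (1 - r) / eta ^+ 2.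
  by rewrite divr_ge0 ?sqr_ge0// mulr_ge0// ltW.
have mpdf : measurable_fun setT (fun y : measurableTypeR R => (normal_pdf x s y)%:E).
  by apply: measurableT_comp => //; exact: measurable_normal_pdf.
apply: (@le_trans _ _ (\int[lebesgue_measure]_(y in [set y | (eta <= `|y - x|)%R])
   ((24 * (1 - r) / eta ^+ 2)%:E * (normal_pdf x s y)%:E))%E).
  apply: ge0_le_integral.
  - exact: mS.
  - by move=> y _; rewrite lee_fin ltW// mehler1_gt0.
  - by apply: measurable_funTS; apply: measurableT_comp => //; exact: measurable_mehler1.
  - by apply: measurable_funeM; exact: measurable_funTS.
  - by move=> y /= hy; rewrite -EFinM lee_fin; exact: key.
rewrite ge0_integralZl_EFin//; last 2 first.
- by move=> y _; rewrite lee_fin normal_pdf_ge0.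
- exact: measurable_funTS.
rewrite -[leRHS]mule1 lee_wpmul2l ?lee_fin// -(integral_normal_pdf x s).
apply: ge0_subset_integral => //.
by move=> y _; rewrite lee_fin normal_pdf_ge0.
Qed.

(** Uniformity in r is the point. For |x| >= 2L both |x - y| and |x + y| are at least |x|/2, and
    e^{-z} <= 1/z turns the exponent into a factor 1/c that absorbs the prefactor, singular as r
    tends to 1. *)
Lemma integral_mehler1_bounded (L : R) : 1 <= L -> exists2 C, 0 < C & forall r x, 0 < r < 1 ->
  (\int[lebesgue_measure]_(y in `[(- L)%R, L]) (mehler1 r x y)%:E <= (C / (1 + x ^+ 2))%:E)%E.
Proof.
move=> L1; exists (1 + 4 * L ^+ 2 + 32 * L); first by have := sqr_ge0 L; nra.
move=> r x r01; have /andP[r0 r1] := r01.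
have a0 : 0 < 1 - r by lra.
have b0 : 0 < 1 + r by lra.
have v0 : 0 < 1 - r ^+ 2 by nra.
have w0 : 0 < 1 + r ^+ 2 by nra.
have p0 : 0 < pi :> R by exact: pi_gt0.
have x20 : 0 < 1 + x ^+ 2 by have := sqr_ge0 x; lra.
have L2 : 0 <= L ^+ 2 by exact: sqr_ge0.
have mm : measurable_fun setT (EFin \o (mehler1 r x : measurableTypeR R -> R)).
  by apply: measurableT_comp => //; exact: measurable_mehler1.
have m0 y : (0 <= (mehler1 r x y)%:E)%E by rewrite lee_fin ltW// mehler1_gt0.
have [xL|xL] := ltP `|x| (2 * L).
  apply: (@le_trans _ _ 1%E).
    apply: le_trans (integral_mehler1_le1 x r01).
    by apply: ge0_subset_integral.
  rewrite lee_fin ler_pdivlMr// mul1r.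
  have : x ^+ 2 <= (2 * L) ^+ 2.
    by rewrite -[leLHS]real_normK ?num_real// lerXn2r ?nnegrE ?(ltW xL)// mulr_ge0//; lra.
  nra.
have x24 : (2 * L) ^+ 2 <= x ^+ 2.
  by rewrite -[leRHS]real_normK ?num_real// lerXn2r ?nnegrE// mulr_ge0//; lra.
have x2pos : 0 < x ^+ 2 by nra.
have xn0 : x != 0 by rewrite -normr_gt0 (lt_le_trans _ xL)//; lra.
have key y : -L <= y <= L -> mehler1 r x y <= 8 / x ^+ 2.
  move=> /andP[y1 y2]; pose c := (1 + r ^+ 2) / (1 - r ^+ 2).
  have c0 : 0 < c by rewrite divr_gt0.
  have hx (z : R) : `|z| <= L -> x ^+ 2 / 4 <= (x + z) ^+ 2.
    move=> zL; rewrite -[leRHS]real_normK ?num_real//.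
    have : `|x| / 2 <= `|x + z|.
      have := ler_normB (x + z) z; rewrite addrK; lra.
    move=> h; have : (`|x| / 2) ^+ 2 <= `|x + z| ^+ 2 by rewrite lerXn2r ?nnegrE// divr_ge0.
    by rewrite (_ : (`|x| / 2) ^+ 2 = x ^+ 2 / 4)// expr_div_n real_normK ?num_real//; congr (_ / _); ring.
  have yL : `|y| <= L by rewrite ler_norml y1 y2.
  have h1 := hx _ yL; have h2 : x ^+ 2 / 4 <= (x - y) ^+ 2 by apply: hx; rewrite normrN.
  have ex : expR (- (((x - y) ^+ 2 * ((1 + r) / (1 - r)) + (x + y) ^+ 2 * ((1 - r) / (1 + r))) / 4))
     <= 8 / (x ^+ 2 * c).
    apply: (@le_trans _ _ (expR (- (x ^+ 2 * c / 8)))).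
      rewrite ler_expR lerN2.
      have -> : x ^+ 2 * c / 8 = (x ^+ 2 / 4 * ((1 + r) / (1 - r)) + x ^+ 2 / 4 * ((1 - r) / (1 + r))) / 4.
        by rewrite /c; field; rewrite !gt_eqF.
      by rewrite ler_pM2r// lerD// ler_wpM2r// divr_ge0// ltW.
    apply: (le_trans (expR_inv_le _)); first by rewrite divr_gt0// mulr_gt0.
    by rewrite invf_div.
  have pre : Num.sqrt r / Num.sqrt (pi * (1 - r ^+ 2)) <= c.
    rewrite -sqrtrV ?mulr_ge0 ?(ltW p0) ?(ltW v0)// -sqrtrM ?(ltW r0)//.
    rewrite -[leRHS]ger0_norm ?(ltW c0)// -sqrtr_sqr ler_wsqrtr//.
    rewrite /c expr_div_n ler_pdivlMr ?exprn_gt0// mulrAC ler_pdivrMr ?mulr_gt0//.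
    have p1 : 2 <= pi :> R by exact: pi_ge2.
    rewrite (_ : r * (1 - r ^+ 2) ^+ 2 = (r * (1 - r ^+ 2)) * (1 - r ^+ 2)); last by ring.
    rewrite mulrA ler_pM2r//.
    have w1 : 1 <= (1 + r ^+ 2) ^+ 2 by rewrite exprn_ege1//; nra.
    nra.
  rewrite /mehler1 /mehler [leLHS]mulrA; apply: le_trans (ler_pM _ _ pre ex) _; rewrite ?expR_ge0//.
  have cn0 := lt0r_neq0 c0; rewrite le_eqVlt; apply/orP; left; apply/eqP.
  by clearbody c; field; rewrite cn0 xn0.
apply: (@le_trans _ _ (\int[lebesgue_measure]_(y in `[(- L)%R, L]) (8 / x ^+ 2)%:E)%E).
  apply: ge0_le_integral.
  - exact: measurable_itv.
  - by [].
  - exact: measurable_funTS.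
  - exact: measurable_cst.
  - by move=> y /=; rewrite in_itv/= => hy; rewrite lee_fin key.
rewrite integral_cst//= lebesgue_measure_itv/= lte_fin ifT; last lra.
rewrite -EFinB -EFinM lee_fin ler_pdivlMr//.
rewrite (_ : 8 / x ^+ 2 * (L - - L) * (1 + x ^+ 2) = 16 * L + 16 * L / x ^+ 2); last first.
  by field.
have : 16 * L / x ^+ 2 <= 16 * L.
  rewrite ler_pdivrMr// ler_peMr; nra.
nra.
Qed.

End mehler.

(** * The heat kernel in dimension d *)

Section tensor.
Context {R : realType}.
Local Notation leb := (@lebesgue_measure R).

Lemma integral_lebesgue_RnS n (F : Rn R n.+1 -> \bar R) : measurable_fun setT F ->
  (forall x, 0 <= F x)%E ->
  (\int[lebesgue_Rn n.+1]_x F x = \int[leb]_y \int[lebesgue_Rn n]_z F (cons_Rn (y, z)))%E.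
Proof.
move=> mF F0.
transitivity (\int[(leb \x @lebesgue_Rn R n)%E]_z F (cons_Rn z))%E.
  rewrite -[RHS](@ge0_integral_pushforward _ _ _ _ _ (@cons_Rn R n) (@measurable_cons_Rn R n)
    (leb \x @lebesgue_Rn R n)%E setT F)//.
rewrite fubini_tonelli1//.
by apply: measurableT_comp => //; exact: measurable_cons_Rn.
Qed.

Lemma measurable_tensor n (f : 'I_n -> R -> R) :
  (forall j, measurable_fun setT (f j : measurableTypeR R -> R)) ->
  measurable_fun setT (fun x : Rn R n => \prod_(j < n) f j (tnth x j)).
Proof.
move=> mf; apply: measurable_prod => j _.
apply: (measurableT_comp (mf j)); exact: measurable_tnth.
Qed.

Lemma integral_tensor n (f : 'I_n -> R -> R) :
  (forall j, measurable_fun setT (f j : measurableTypeR R -> R)) ->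
  (forall j x, 0 <= f j x) ->
  (\int[lebesgue_Rn n]_x (\prod_(j < n) f j (tnth x j))%:E =
   \prod_(j < n) \int[leb]_y (f j y)%:E)%E.
Proof.
elim: n f => [|n IH] f mf f0.
  rewrite big_ord0; under eq_integral do rewrite big_ord0.
  by rewrite integral_cst//= diracT mul1e.
rewrite integral_lebesgue_RnS; last 2 first.
- by apply/measurable_EFinP; exact: measurable_tensor.
- by move=> x; rewrite lee_fin prodr_ge0.
rewrite big_ord_recl -IH; last 2 first.
- by move=> j; exact: mf.
- by move=> j x; exact: f0.
set P := (\int[lebesgue_Rn n]_x _)%E.
have P0 : (0 <= P)%E by apply: integral_ge0 => x _; rewrite lee_fin prodr_ge0.
transitivity (\int[leb]_y ((f ord0 y)%:E * P))%E.
  apply: eq_integral => y _; rewrite /P -ge0_integralZl_EFin//; last 2 first.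
  - by move=> x _; rewrite lee_fin prodr_ge0.
  - by apply/measurable_EFinP; exact: (@measurable_tensor n (fun j => f (lift ord0 j))).
  apply: eq_integral => z _; rewrite big_ord_recl -EFinM; congr (_ * _)%:E.
  by apply: eq_bigr => j _; rewrite tnthS.
rewrite ge0_integralZr//.
- by apply/measurable_EFinP; exact: mf.
- by move=> y _; rewrite lee_fin.
Qed.

Lemma integral_tensor_le n (f : 'I_n -> R -> R) (a : 'I_n -> R) :
  (forall j, measurable_fun setT (f j : measurableTypeR R -> R)) ->
  (forall j x, 0 <= f j x) -> (forall j, \int[leb]_y (f j y)%:E <= (a j)%:E)%E ->
  (\int[lebesgue_Rn n]_x (\prod_(j < n) f j (tnth x j))%:E <= (\prod_(j < n) a j)%:E)%E.
Proof.
move=> mf f0 fa; rewrite integral_tensor//.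
elim: n f a mf f0 fa => [|n IH] f a mf f0 fa; first by rewrite !big_ord0.
rewrite !big_ord_recl EFinM lee_pmul//.
- by apply: integral_ge0 => x _; rewrite lee_fin.
- elim/big_rec: _ => // i x _ x0; rewrite mule_ge0//.
  by apply: integral_ge0 => y _; rewrite lee_fin.
- by apply: (IH (fun j => f (lift ord0 j)) (fun j => a (lift ord0 j))) => j.
Qed.

End tensor.

Lemma cvg_prod_seq {R : realType} (I : Type) (r : seq I) (u : I -> R^nat) (l : I -> R) :
  (forall i, u i n @[n --> \oo] --> l i) ->
  \prod_(i <- r) u i n @[n --> \oo] --> \prod_(i <- r) l i.
Proof.
move=> ul; elim: r => [|i r IH].
  by rewrite big_nil; under eq_fun do rewrite big_nil; exact: cvg_cst.
by rewrite big_cons; under eq_fun do rewrite big_cons; exact: cvgM.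
Qed.

(** * Multiple series summed along |a| = k *)

Section product_series.
Context {R : realType} {d : nat}.
Implicit Types (z : 'I_d -> nat -> R) (F : ('I_d -> nat) -> R) (N M k : nat).

(** The index type of the multi-indices in [hermite_proj] depends on k; sums are moved to a common
    type, the bound on the entries becoming a condition. *)
Lemma sum_ffun_widen F (P : ('I_d -> nat) -> bool) N M : (N < M)%N ->
  \sum_(a : {ffun 'I_d -> 'I_N.+1} | P (fun j => a j)) F (fun j => a j) =
  \sum_(a : {ffun 'I_d -> 'I_M} | [forall j, (a j <= N)%N] && P (fun j => a j)) F (fun j => a j).
Proof.
move=> NM.
rewrite [RHS](reindex_onto (fun a : {ffun 'I_d -> 'I_N.+1} => [ffun j => widen_ord NM (a j)])
    (fun b : {ffun 'I_d -> 'I_M} => [ffun j => inord (b j)])); last first.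
  move=> b /andP[/forallP bN _]; apply/ffunP => j; rewrite !ffunE; apply/val_inj => /=.
  by rewrite inordK ?ltnS.
have E (a : {ffun 'I_d -> 'I_N.+1}) :
    (fun j => nat_of_ord ([ffun j => widen_ord NM (a j)] j)) = (fun j => nat_of_ord (a j)).
  by apply/funext => j; rewrite ffunE.
apply: eq_big => [a|a _]; last by rewrite E.
rewrite E.
have -> : [forall j, ([ffun j0 => widen_ord NM (a j0)] j <= N)%N].
  by apply/forallP => j; rewrite ffunE/= -ltnS.
rewrite (_ : [ffun j => inord _] == a) ?andbT//; apply/eqP/ffunP => j.
by rewrite !ffunE/=; apply/val_inj; rewrite /= inordK.
Qed.

(** Encoded as in [hermite_proj]. Partial sums of [diag] run over simplices, products of partial
    sums over cubes. *)
Definition diag F k := \sum_(a : {ffun 'I_d -> 'I_k.+1} | (\sum_(j < d) a j)%N == k) F (fun j => a j).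

Lemma series_diag F N M : (N <= M)%N -> series (diag F) N =
  \sum_(a : {ffun 'I_d -> 'I_M} | (\sum_(j < d) a j < N)%N) F (fun j => a j).
Proof.
move=> NM; rewrite /series/= big_mkord.
transitivity (\sum_(k < N) \sum_(a : {ffun 'I_d -> 'I_M} | (\sum_(j < d) a j)%N == k) F (fun j => a j)).
  apply: eq_bigr => k _; rewrite /diag.
  rewrite (@sum_ffun_widen F (fun a => (\sum_(j < d) a j)%N == k) k M); last first.
    exact: leq_trans (ltn_ord k) NM.
  apply: eq_bigl => a; rewrite andb_idl// => /eqP ak; apply/forallP => j.
  by rewrite -ak (bigD1 j)//= leq_addr.
rewrite (eq_bigr (fun k : 'I_N => \sum_(a : {ffun 'I_d -> 'I_M})
  (if (\sum_(j < d) a j)%N == k then F (fun j => a j) else 0))); last first.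
  by move=> k _; rewrite -big_mkcond.
rewrite exchange_big/= [RHS]big_mkcond; apply: eq_bigr => a _.
case: ifPn => [aN|aN].
  rewrite (bigD1 (Ordinal aN))//= eqxx big1 ?addr0// => k /eqP kN.
  by case: ifPn => // /eqP ak; exfalso; apply: kN; apply/val_inj.
rewrite big1// => k _; case: ifPn => // /eqP ak.
by move: aN; rewrite ak ltn_ord.
Qed.

Lemma prod_series_ffun z N :
  \prod_(j < d) series (z j) N = \sum_(a : {ffun 'I_d -> 'I_N}) \prod_(j < d) z j (a j).
Proof.
under eq_bigr do rewrite /series/= big_mkord.
by rewrite bigA_distr_bigA.
Qed.

Let prodz z (a : 'I_d -> nat) := \prod_(j < d) z j (a j).

Lemma diag_prod_abs z : (forall j, cvgn (series (fun i => `|z j i|))) ->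
  let A := series (diag (prodz (fun j i => `|z j i|))) in
  let B := fun N => \prod_(j < d) series (fun i => `|z j i|) N in
  [/\ cvgn A, forall N, A N <= B N & B n - A n @[n --> \oo] --> (0 : R)].
Proof.
move=> cz A B.
have z0 a : 0 <= prodz (fun j i => `|z j i|) a by apply: prodr_ge0 => j _.
have AB N : A N <= B N.
  rewrite /A /B (series_diag _ (leqnn N)) prod_series_ffun [leLHS]big_mkcond.
  by apply: ler_sum => a _; case: ifPn => // _; exact: (z0 (fun j => a j)).
have BA N : B N.+1 <= A (d * N).+1.
  rewrite /B prod_series_ffun.
  pose M := (maxn (d * N).+1 N.+1).
  rewrite /A (series_diag _ (leq_maxl _ N.+1)) -/M.
  have NM : (N < M)%N by exact: leq_maxr.
  have /= -> := @sum_ffun_widen (prodz (fun j i => `|z j i|)) (fun _ => true) N M NM.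
  rewrite [leLHS]big_mkcond [leRHS]big_mkcond; apply: ler_sum => a _.
  rewrite andbT; case: ifPn => [/forallP aN|_]; last by case: ifPn.
  rewrite ifT// ltnS; apply: (@leq_trans (\sum_(j < d) N)%N); first exact: leq_sum.
  by rewrite sum_nat_const card_ord.
have ndA : nondecreasing_seq A.
  apply/nondecreasing_seqP => n; rewrite /A seriesSr lerDl.
  by apply: sumr_ge0 => a _.
have cB : cvgn B.
  have cB0 : B n @[n --> \oo] --> \prod_(j < d) limn (series (fun i => `|z j i|)).
    by apply: cvg_prod_seq => j; exact: cz.
  exact: (cvgP _ cB0).
have Bub N : B N <= limn B.
  apply: nondecreasing_cvgn_le => //; apply/nondecreasing_seqP => n; rewrite /B.
  by apply: ler_prod => j _; rewrite seriesSr lerDl normr_ge0 andbT sumr_ge0.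
have cA : cvgn A.
  apply: nondecreasing_is_cvgn => //; exists (limn B) => _ [n _ <-].
  exact: le_trans (AB n) (Bub n).
split => //.
have AB' : limn A = limn B.
  apply/eqP; rewrite eq_le; apply/andP; split.
    by apply: ler_lim => //; exact: nearW.
  have cB1 : B n.+1 @[n --> \oo] --> limn B by rewrite (@cvg_shiftS _ B).
  apply: (cvgr_to_le cB1); apply: nearW => n; apply: le_trans (BA n) _.
  exact: nondecreasing_cvgn_le.
by rewrite -(subrr (limn B)) -{2}AB'; exact: cvgB.
Qed.

(** The terms in the cube but outside the simplex are dominated by those of the absolute series,
    whose two exhaustions differ by o(1). *)
Lemma diag_prod_cvg z : (forall j, cvgn (series (fun i => `|z j i|))) ->
  cvgn (series (fun k => `|diag (prodz z) k|)) /\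
  limn (series (diag (prodz z))) = \prod_(j < d) limn (series (z j)).
Proof.
move=> cz; pose A := series (diag (prodz (fun j i => `|z j i|))).
pose B := fun N => \prod_(j < d) series (fun i => `|z j i|) N.
have [cA AB BA0] : [/\ cvgn A, forall N, A N <= B N & B n - A n @[n --> \oo] --> (0 : R)].
  exact: diag_prod_abs.
split.
  apply: le_cvg_series cA => k; rewrite /diag; apply: le_trans (ler_norm_sum _ _ _) _.
  by apply: ler_sum => a _; rewrite /prodz normr_prod.
pose A' := series (diag (prodz z)); pose B' N := \prod_(j < d) series (z j) N.
have cB' : B' n @[n --> \oo] --> \prod_(j < d) limn (series (z j)).
  by apply: cvg_prod_seq => j; apply: abs_cvg_series; exact: cz.
have d0 : B' n - A' n @[n --> \oo] --> (0 : R).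
  apply/norm_cvg0P.
  apply: (@squeeze_cvgr _ _ _ _ (fun _ => 0) (fun n => B n - A n)); [|exact: cvg_cst|exact: BA0].
  apply: nearW => N; rewrite normr_ge0/=.
  rewrite /B' /A' /B /A !prod_series_ffun !(series_diag _ (leqnn N)).
  rewrite [X in X - _](bigID (fun a : {ffun 'I_d -> 'I_N} => (\sum_(j < d) a j < N)%N))/=.
  rewrite addrAC subrr add0r.
  rewrite [X in _ <= X - _](bigID (fun a : {ffun 'I_d -> 'I_N} => (\sum_(j < d) a j < N)%N))/=.
  rewrite addrAC subrr add0r; apply: le_trans (ler_norm_sum _ _ _) _.
  by apply: ler_sum => a _; rewrite normr_prod.
apply/cvg_lim => //.
rewrite -/(prodz z) -/A'.
have -> : A' = fun n => B' n - (B' n - A' n) by apply/funext => n; ring.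
by rewrite -[X in _ --> X]subr0; exact: cvgB.
Qed.

End product_series.

(** * Dominated integrals of real functions *)

Section integral_tools.
Context {disp : measure_display} {T : measurableType disp} {R : realType}.
Variable mu : {measure set T -> \bar R}.
Implicit Types (f g h : T -> R).

Lemma integrable_dominated f g : measurable_fun setT f -> (forall x, `|f x| <= g x) ->
  mu.-integrable setT (EFin \o g) -> mu.-integrable setT (EFin \o f).
Proof.
move=> mf fg ig; apply: (le_integrable _ _ _ ig) => //.
  exact/measurable_EFinP.
move=> x _ /=; rewrite lee_fin; apply: le_trans (fg x) (ler_norm _).
Qed.

Lemma normr_Rintegral_le f g : measurable_fun setT f -> (forall x, `|f x| <= g x) ->
  mu.-integrable setT (EFin \o g) -> `|\int[mu]_x f x| <= \int[mu]_x g x.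
Proof.
move=> mf fg ig; have if' := integrable_dominated mf fg ig.
apply: (le_trans (le_normr_Rintegral _ _)) => //.
apply: le_Rintegral => //; exact: (integrable_norm if').
Qed.

Lemma dominated_cvg_Rintegral (f_ : nat -> T -> R) f g :
  (forall n, measurable_fun setT (f_ n)) -> (forall x, f_ n x @[n --> \oo] --> f x) ->
  (forall n x, `|f_ n x| <= g x) -> mu.-integrable setT (EFin \o g) ->
  [/\ measurable_fun setT f, mu.-integrable setT (EFin \o f) &
   \int[mu]_x (f_ n x) @[n --> \oo] --> \int[mu]_x (f x)].
Proof.
move=> mf_ ff fg ig.
have mf : measurable_fun setT f.
  by apply: (@measurable_fun_cvg _ _ _ setT f_) => // x _; exact: ff.
have [] := @dominated_convergence _ _ _ mu setT measurableT (fun n => EFin \o f_ n) (EFin \o f)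
   (EFin \o g).
- by move=> n; exact/measurable_EFinP.
- exact/measurable_EFinP.
- by apply: aeW => x _; apply: cvg_EFin; [exact: nearW|exact: ff].
- exact: ig.
- by apply: aeW => x n _; rewrite /= lee_fin.
move=> if' _ h; split => //.
have fi n : (\int[mu]_x (f_ n x)%:E \is a fin_num)%E.
  by apply: integrable_fin_num => //; exact: integrable_dominated ig.
apply: fine_cvg; rewrite fineK; first exact: h.
exact: integrable_fin_num.
Qed.

Lemma measurable_sum_cond (I : Type) (r : seq I) (P : pred I) (h : I -> T -> R) :
  (forall i, measurable_fun setT (h i)) ->
  measurable_fun setT (fun x => \sum_(i <- r | P i) h i x).
Proof.
move=> mh; have m' i : measurable_fun setT (fun x => if P i then h i x else 0).
  by case: (P i).
by have := measurable_sum r m'; under eq_fun do rewrite -big_mkcond.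
Qed.

Lemma Rintegral_sumZ (I : Type) (r : seq I) (P : pred I) (c : I -> R) (h : I -> T -> R) :
  (forall i, P i -> mu.-integrable setT (EFin \o h i)) ->
  mu.-integrable setT (EFin \o (fun x => \sum_(i <- r | P i) c i * h i x)) /\
  \int[mu]_x (\sum_(i <- r | P i) c i * h i x) = \sum_(i <- r | P i) c i * \int[mu]_x (h i x).
Proof.
move=> ih; elim: r => [|i r [IH1 IH2]].
  split.
    rewrite (_ : EFin \o _ = cst 0%E); first exact: integrable0.
    by apply/funext => x /=; rewrite big_nil.
  rewrite big_nil; under eq_Rintegral do rewrite big_nil.
  by rewrite Rintegral_cst// mul0r.
have [Pi|Pi] := boolP (P i); last first.
  rewrite (_ : (fun x => \sum_(i <- i :: r | P i) _) = (fun x => \sum_(i <- r | P i) c i * h i x)).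
    by rewrite big_cons (negbTE Pi).
  by apply/funext => x; rewrite big_cons (negbTE Pi).
have i1 : mu.-integrable setT (EFin \o (fun x => c i * h i x)).
  by have := integrableZl measurableT (c i) (ih _ Pi).
rewrite (_ : (fun x => \sum_(i <- i :: r | P i) _) =
    (fun x => c i * h i x + \sum_(i <- r | P i) c i * h i x)); last first.
  by apply/funext => x; rewrite big_cons Pi.
split; first by have := integrableD measurableT i1 IH1.
rewrite RintegralD// IH2 big_cons Pi; congr (_ + _).
by rewrite RintegralZl//; exact: ih.
Qed.

End integral_tools.

(** * The kernels of the spectral projections *)

Section kernel.
Context {R : realType} {d : nat}.
Local Notation mu := (@lebesgue_Rn R d).
Implicit Types (x y : Rn R d) (t beta : R) (k : nat).

(* |Phi_a| is bounded by wt, up to a polynomial factor in |a| *)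
Definition wt x : R := \prod_(j < d) (1 + tnth x j ^+ 2)^-1.

Lemma wt_gt0 x : 0 < wt x.
Proof. by apply: prodr_gt0 => j _; rewrite invr_gt0 ltr_pwDl// sqr_ge0. Qed.

Lemma wt_le1 x : wt x <= 1.
Proof.
apply: prodr_ile1 => j; rewrite invr_ge0 addr_ge0 ?sqr_ge0//=.
by rewrite invf_le1 ?lerDl ?sqr_ge0// ltr_pwDl// sqr_ge0.
Qed.

Lemma measurable_wt : measurable_fun setT wt.
Proof.
have h := @measurable_tensor R d (fun _ (y : R) => (1 + y ^+ 2)^-1); apply: h => _.
by apply: continuous_measurable_fun; exact: continuous_oneDsqrV.
Qed.

Lemma integral_wt : (\int[mu]_x (wt x)%:E <= (pi ^+ d)%:E)%E.
Proof.
rewrite (_ : pi ^+ d = \prod_(j < d) pi); last by rewrite prodr_const card_ord.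
have h := @integral_tensor_le R d (fun _ (y : R) => (1 + y ^+ 2)^-1) (fun _ => pi); apply: h => j.
- by apply: continuous_measurable_fun; exact: continuous_oneDsqrV.
- by move=> y; rewrite invr_ge0 addr_ge0 ?sqr_ge0.
- rewrite (ge0_symfun_integralT (f := fun y : R => (1 + y ^+ 2)^-1)); last 3 first.
  + by move=> y; rewrite invr_ge0 addr_ge0 ?sqr_ge0.
  + exact: continuous_oneDsqrV.
  + by move=> y; rewrite /= sqrrN.
  rewrite (_ : [set x : R | 0 <= x] = `[0, +oo[%classic); last first.
    by apply/seteqP; split => y/=; rewrite in_itv/= andbT.
  rewrite integral0y_oneDsqr -EFinM lee_fin.
  by rewrite mulrC divfK.
Qed.

Lemma hermite_Phi_bound : exists2 C : R, 0 < C & forall k (a : 'I_d -> nat) x,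
  (forall j, (a j <= k)%N) -> `|hermite_Phi a x| <= C * k.+1%:R ^+ (3 * d) * wt x.
Proof.
have [C C0 hC] := @hermite_fun_decay R.
exists (C ^+ d); first by rewrite exprn_gt0.
move=> k a x ak; rewrite /hermite_Phi normr_prod /wt.
have -> : C ^+ d * k.+1%:R ^+ (3 * d) * \prod_(j < d) (1 + tnth x j ^+ 2)^-1 =
   \prod_(j < d) (C * k.+1%:R ^+ 3 / (1 + tnth x j ^+ 2)).
  by rewrite big_split/= prodr_const card_ord exprMn exprM.
apply: ler_prod => j _; rewrite normr_ge0/=; apply: le_trans (hC _ _) _.
rewrite ler_wpM2r ?invr_ge0 ?addr_ge0 ?sqr_ge0// ler_wpM2l ?(ltW C0)//.
by rewrite lerXn2r ?nnegrE// ler_nat ltnS.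
Qed.

Lemma measurable_hermite_Phi (a : 'I_d -> nat) : measurable_fun setT (@hermite_Phi R d a).
Proof.
have h := @measurable_tensor R d (fun j (y : R) => hermite_fun (a j) y); apply: h => j; rewrite /hermite_fun.
apply: measurable_funM => //; apply: measurable_funM.
  apply: continuous_measurable_fun; exact: continuous_horner.
apply: measurableT_comp => //; apply: measurableT_comp => //.
by apply: measurable_funM => //; exact: measurable_funX.
Qed.

Definition proj_kernel k x y : R := diag (fun a => hermite_Phi a x * hermite_Phi a y) k.

Lemma proj_kernel_sym k x y : proj_kernel k x y = proj_kernel k y x.
Proof. by apply: eq_bigr => a _; rewrite mulrC. Qed.

Lemma measurable_proj_kernel k x : measurable_fun setT (proj_kernel k x).
Proof.
apply: measurable_sum_cond => a.
by apply: measurable_funM => //; exact: measurable_hermite_Phi.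
Qed.

(** 7d = 3d + 3d + d: the two factors Phi_a, and the (k + 1)^d elements of the index type. *)
Lemma proj_kernel_bound : exists2 C : R, 0 < C & forall k x y,
  `|proj_kernel k x y| <= C * k.+1%:R ^+ (7 * d) * (wt x * wt y).
Proof.
have [C C0 hC] := hermite_Phi_bound.
exists (C ^+ 2); first by rewrite exprn_gt0.
move=> k x y; rewrite /proj_kernel /diag; apply: le_trans (ler_norm_sum _ _ _) _.
apply: (@le_trans _ _ (\sum_(a : {ffun 'I_d -> 'I_k.+1})
   (C ^+ 2 * k.+1%:R ^+ (6 * d) * (wt x * wt y)))).
  rewrite [leLHS]big_mkcond; apply: ler_sum => a _; case: ifPn => _; last first.
    by rewrite !mulr_ge0 ?(ltW (wt_gt0 _))// ?exprn_ge0// ltW.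
  have ak j : (a j <= k)%N by rewrite -ltnS.
  rewrite normrM; have := ler_pM (normr_ge0 _) (normr_ge0 _) (hC k _ x ak) (hC k _ y ak).
  move/le_trans; apply; rewrite le_eqVlt; apply/orP; left; apply/eqP.
  by rewrite (_ : (6 * d)%N = (3 * d + 3 * d)%N) ?exprD; [ring|rewrite -mulnDl].
rewrite sumr_const card_ffun !card_ord -[leLHS]mulr_natr natrX.
rewrite le_eqVlt; apply/orP; left; apply/eqP.
by rewrite (_ : (7 * d)%N = (6 * d + d)%N) ?exprD; [ring|rewrite mulSn addnC].
Qed.

Definition hermite_level k : R := (2 * k + d)%:R.

Definition heatK beta t x y : R :=
  limn (series (fun k => expR (- (t * hermite_level k `^ beta)) * proj_kernel k x y)).

End kernel.

(** * Spectral sums of exponentials against polynomials *)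

Section exp_sum.
Context {R : realType} (d : nat).
Hypothesis hd : (0 < d)%N.
Local Notation lam := (@hermite_level R d).

Lemma hermite_level_ge k : k.+1%:R <= lam k.
Proof. by rewrite /hermite_level ler_nat -addn1 leq_add// leq_pmull. Qed.

Lemma hermite_level_le k : lam k <= (d + 2)%:R * k.+1%:R.
Proof.
rewrite /hermite_level -natrM ler_nat mulnDl mulnS addnC.
by apply: leq_add; [rewrite leq_addr|rewrite leq_mul2l /= leqnSn].
Qed.

Lemma series_inv_sqr : cvgn (series (fun k => (k.+1%:R ^- 2 : R))) /\
  limn (series (fun k => (k.+1%:R ^- 2 : R))) <= 2.
Proof.
have S n : series (fun k => (k.+1%:R ^- 2 : R)) n <= 2 - 2 / n.+1%:R.
  elim: n => [|n IH]; first by rewrite /series/= big_geq// divr1 subrr.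
  rewrite seriesSr; apply: (le_trans (lerD IH (lexx _))).
  have -> : n.+2%:R = n.+1%:R + 1 :> R by rewrite natr1.
  have n0 : 1 <= n.+1%:R :> R by rewrite ler1n.
  move: (n.+1%:R : R) n0 => a a1.
  have a0 : 0 < a by lra.
  rewrite -subr_ge0 (_ : _ - _ = (a - 1) / (a ^+ 2 * (a + 1))); last first.
    by field; rewrite !gt_eqF//; lra.
  by rewrite divr_ge0 ?subr_ge0// mulr_ge0 ?sqr_ge0//; lra.
have S2 n : series (fun k => (k.+1%:R ^- 2 : R)) n <= 2.
  by apply: le_trans (S n) _; rewrite lerBlDr lerDl divr_ge0.
have c : cvgn (series (fun k => (k.+1%:R ^- 2 : R))).
  apply: nondecreasing_is_cvgn.
    by apply/nondecreasing_seqP => n; rewrite seriesSr lerDl invr_ge0 exprn_ge0.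
  by exists 2 => _ [n _ <-].
by split => //; apply: limr_le => //; exact: nearW.
Qed.

(** Half of the exponent is kept as e^{-t/2}, the eigenvalues being at least 1. The other half, with
    z = t (k + 1)^beta / 2, beats the polynomial through e^{-z} <= (n + 1)! / z^{n+1}, where n is
    such that beta (n + 1) >= N + 2. *)
Lemma exp_poly_term N (beta : R) : 0 < beta <= 1 -> exists2 C : R, 0 < C & exists n : nat,
  forall t, 0 < t -> forall k, expR (- (t * lam k `^ beta)) * k.+1%:R ^+ N <=
    C * expR (- (t / 2)) / t ^+ n.+1 * k.+1%:R ^- 2.
Proof.
move=> /andP[b0 b1]; pose n := Num.truncn (N.+2%:R / beta).
exists (n.+1`!%:R * 2 ^+ n.+1).
  by rewrite mulr_gt0 ?exprn_gt0// ltr0n fact_gt0.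
exists n => t t0 k.
have k1 : 1 <= k.+1%:R :> R by rewrite ler1n.
have k0 : 0 < k.+1%:R :> R by [].
pose K := k.+1%:R `^ beta : R.
have K1 : 1 <= K.
  have := @ge0_ler_powR R beta (ltW b0) 1 k.+1%:R; rewrite !nnegrE powR1 => h.
  by apply: h => //; exact: ltW.
have Kl : K <= lam k `^ beta.
  by rewrite ge0_ler_powR ?nnegrE ?hermite_level_ge ?(ltW b0) ?(ltW k0)// /hermite_level.
pose z := t * K / 2.
have z0 : 0 < z by rewrite /z divr_gt0// mulr_gt0//; lra.
apply: (@le_trans _ _ (expR (- (t / 2)) * expR (- z) * k.+1%:R ^+ N)).
  rewrite ler_wpM2r ?exprn_ge0// -expRD ler_expR /z.
  have : t * K <= t * lam k `^ beta by rewrite ler_pM2l.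
  have : t <= t * K by rewrite ler_peMr// ltW.
  lra.
have ez : expR (- z) <= n.+1`!%:R / z ^+ n.+1.
  have f0 : 0 < n.+1`!%:R :> R by rewrite ltr0n fact_gt0.
  rewrite expRN -[leRHS]invrK lef_pV2 ?posrE ?expR_gt0 ?invr_gt0 ?divr_gt0 ?exprn_gt0//.
  rewrite invf_div; apply: le_trans (expR_ge1Dxn n (ltW z0)); rewrite lerDr//.
have Kn : k.+1%:R ^+ (N + 2) <= K ^+ n.+1.
  rewrite -(powR_mulrn _ (ltW k0)) -[leRHS]powR_mulrn ?(le_trans _ K1)// /K -powRrM.
  rewrite ler_powR//.
  have := truncnS_gt (N.+2%:R / beta); rewrite -/n ltr_pdivrMr// addn2 => /ltW.
  by rewrite mulrC.
rewrite [leRHS](_ : _ = expR (- (t / 2)) * ((n.+1)`!%:R * 2 ^+ n.+1 / t ^+ n.+1 / k.+1%:R ^+ 2));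
  last by ring.
rewrite -mulrA ler_wpM2l ?expR_ge0//.
apply: (@le_trans _ _ (n.+1`!%:R / z ^+ n.+1 * k.+1%:R ^+ N)).
  by rewrite ler_wpM2r// exprn_ge0.
rewrite /z !exprMn exprVn.
have tn : 0 < t ^+ n.+1 by rewrite exprn_gt0.
have Kn0 : 0 < K ^+ n.+1 by rewrite exprn_gt0//; lra.
have k20 : 0 < k.+1%:R ^+ 2 :> R by rewrite exprn_gt0.
rewrite (_ : _ * _ = (n.+1)`!%:R * 2 ^+ n.+1 / t ^+ n.+1 * (k.+1%:R ^+ N / K ^+ n.+1)).
  rewrite ler_wpM2l ?divr_ge0 ?mulr_ge0 ?exprn_ge0 ?(ltW t0)//.
  by rewrite ler_pdivrMr// mulrC ler_pdivlMr// -exprD.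
have e20 : 0 < 2 ^+ n.+1 :> R by rewrite exprn_gt0.
move: (t ^+ n.+1) (K ^+ n.+1) (2 ^+ n.+1) tn Kn0 e20 => a b c a0 b0' c0.
by field; rewrite !gt_eqF.
Qed.

Lemma exp_poly_sum N (beta : R) : 0 < beta <= 1 -> exists2 C : R, 0 < C & exists n : nat,
  forall t, 0 < t -> forall u : R^nat, forall D : R, 0 <= D ->
   (forall k, `|u k| <= D * (expR (- (t * lam k `^ beta)) * k.+1%:R ^+ N)) ->
   cvgn (series (fun k => `|u k|)) /\
   `|limn (series u)| <= D * (C * expR (- (t / 2)) / t ^+ n.+1).
Proof.
move=> b01; have [C C0 [n hC]] := exp_poly_term N b01.
exists (C * 2); first by rewrite mulr_gt0.
exists n => t t0 u D D0 uD.
have [c2 l2] := series_inv_sqr.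
pose Q := D * (C * expR (- (t / 2)) / t ^+ n.+1).
have Q0 : 0 <= Q by rewrite mulr_ge0// divr_ge0 ?exprn_ge0 ?(ltW t0)// mulr_ge0 ?expR_ge0// ltW.
have uQ k : `|u k| <= Q * k.+1%:R ^- 2.
  by apply: le_trans (uD k) _; rewrite /Q -mulrA ler_wpM2l// hC.
have cQ : cvgn (series (fun k => Q * k.+1%:R ^- 2)).
  rewrite (_ : series _ = fun m => Q * series (fun k => k.+1%:R ^- 2) m).
    exact: is_cvgMr.
  by apply/funext => m; rewrite /series/= mulr_sumr.
split; first exact: le_cvg_series cQ.
apply: le_trans (limr_series_norm_le uQ cQ) _; rewrite limn_seriesZ//.
rewrite (_ : D * _ = Q * 2); last by rewrite /Q; ring.
by rewrite ler_wpM2l.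
Qed.

End exp_sum.

Lemma is_cvg_seriesZ {R : realType} (a : R) (u : R^nat) :
  cvgn (series u) -> cvgn (series (fun k => a * u k)).
Proof.
move=> cu; rewrite (_ : series _ = fun n => a * series u n); first exact: is_cvgMr.
by apply/funext => n; rewrite /series/= mulr_sumr.
Qed.

(** * Size, time regularity and measurability of the heat kernel *)

Section heat_kernel.
Context {R : realType} {d : nat}.
Hypothesis hd : (0 < d)%N.
Variable beta : R.
Hypothesis b01 : 0 < beta <= 1.
Local Notation mu := (@lebesgue_Rn R d).
Local Notation lam := (@hermite_level R d).
Implicit Types (x y : Rn R d) (t s : R) (k : nat).

(** A time difference costs a factor (t - s) lam_k^beta, at most linear in k as beta <= 1. Starting
    from the exponent 7d + 1 lets one constant and one power n serve both estimates. *)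
Lemma heatK_facts : exists2 C : R, 0 < C & exists n : nat,
  (forall t x y, 0 < t ->
    cvgn (series (fun k => `|expR (- (t * lam k `^ beta)) * proj_kernel k x y|)) /\
    `|heatK beta t x y| <= C * expR (- (t / 2)) / t ^+ n.+1 * (wt x * wt y)) /\
  (forall s t x y, 0 < s -> s <= t ->
    `|heatK beta t x y - heatK beta s x y| <= C * (t - s) / s ^+ n.+1 * (wt x * wt y)).
Proof.
have [P P0 hP] := @proj_kernel_bound R d.
have [Q Q0 [n hQ]] := @exp_poly_sum R d hd (7 * d).+1 beta b01.
have hP' k x y : `|proj_kernel k x y| <= P * k.+1%:R ^+ (7 * d).+1 * (wt x * wt y).
  apply: (le_trans (hP k x y)); rewrite ler_wpM2r ?mulr_ge0 ?(ltW (wt_gt0 _))//.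
  rewrite ler_wpM2l ?(ltW P0)// exprS ler_peMl ?exprn_ge0//.
  by rewrite ler1n.
have d20 : 1 <= (d + 2)%:R :> R by rewrite ler1n addn2.
have D1 : 0 < (d + 2)%:R :> R by rewrite (lt_le_trans ltr01).
exists (P * (d + 2)%:R * Q); first by rewrite !mulr_gt0.
have w0 x y : 0 <= wt x * wt y by rewrite mulr_ge0// ltW// wt_gt0.
have c1 t x y : 0 < t -> cvgn (series (fun k => `|expR (- (t * lam k `^ beta)) * proj_kernel k x y|)) /\
    `|heatK beta t x y| <= P * (wt x * wt y) * (Q * expR (- (t / 2)) / t ^+ n.+1).
  move=> t0; apply: hQ => //; first by rewrite mulr_ge0// ltW.
  move=> k; rewrite normrM ger0_norm ?expR_ge0//.
  rewrite [leRHS](_ : _ = expR (- (t * lam k `^ beta)) *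
    (P * k.+1%:R ^+ (7 * d).+1 * (wt x * wt y))); last by ring.
  by rewrite ler_wpM2l ?expR_ge0.
have tn t : 0 < t -> 0 <= expR (- (t / 2)) / t ^+ n.+1.
  by move=> t0; rewrite divr_ge0 ?expR_ge0// exprn_ge0// ltW.
exists n; split.
  move=> t x y t0; have [c h] := c1 t x y t0; split => //; apply: (le_trans h).
  rewrite [leLHS](_ : _ = P * 1 * Q * (expR (- (t / 2)) / t ^+ n.+1 * (wt x * wt y))); last by ring.
  rewrite [leRHS](_ : _ = P * (d + 2)%:R * Q * (expR (- (t / 2)) / t ^+ n.+1 * (wt x * wt y)));
    last by ring.
  rewrite ler_wpM2r ?mulr_ge0 ?tn ?expR_ge0 ?invr_ge0 ?exprn_ge0 ?(ltW t0)//.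
    by rewrite ltW// wt_gt0.
    by rewrite ltW// wt_gt0.
  by rewrite ler_wpM2r ?(ltW Q0)// ler_wpM2l// ltW.
move=> s t x y s0 st; have t0 : 0 < t by exact: lt_le_trans st.
have [cs _] := c1 s x y s0; have [ct _] := c1 t x y t0.
have -> : heatK beta t x y - heatK beta s x y =
  limn (series (fun k => (expR (- (t * lam k `^ beta)) - expR (- (s * lam k `^ beta))) * proj_kernel k x y)).
  rewrite (_ : (fun k => (_ - _) * _) = (fun k => expR (- (t * lam k `^ beta)) * proj_kernel k x y +
     (- 1) * (expR (- (s * lam k `^ beta)) * proj_kernel k x y))); last by apply/funext => k; ring.
  have cs' := abs_cvg_series cs.
  rewrite limn_seriesD; [|exact: abs_cvg_series|exact: is_cvg_seriesZ].
  by rewrite limn_seriesZ// mulN1r.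
have ts0 : 0 <= t - s by rewrite subr_ge0.
have hQs := hQ s s0 (fun k => (expR (- (t * lam k `^ beta)) - expR (- (s * lam k `^ beta))) * proj_kernel k x y)
    (P * (d + 2)%:R * (t - s) * (wt x * wt y)).
apply: le_trans (proj2 (hQs _ _)) _.
- by rewrite !mulr_ge0 ?(ltW P0)// ltW// wt_gt0.
- move=> k; rewrite normrM.
  have L0 : 0 <= lam k `^ beta by exact: powR_ge0.
  have L1 : lam k `^ beta <= (d + 2)%:R * k.+1%:R.
    apply: le_trans (@hermite_level_le R d k); apply: ler1_powR.
      by apply: le_trans (@hermite_level_ge R d hd k); rewrite ler1n.
    by case/andP: b01.
  have e1 : `|expR (- (t * lam k `^ beta)) - expR (- (s * lam k `^ beta))| <=
      expR (- (s * lam k `^ beta)) * ((t - s) * ((d + 2)%:R * k.+1%:R)).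
    rewrite (_ : - (t * lam k `^ beta) = - (s * lam k `^ beta) + - ((t - s) * lam k `^ beta));
      last by ring.
    rewrite expRD -[X in _ * _ - X]mulr1 -mulrBr normrM ger0_norm ?expR_ge0//.
    rewrite ler_wpM2l ?expR_ge0// ler0_norm; last first.
      by rewrite subr_le0 expR_le1 oppr_le0 mulr_ge0.
    rewrite opprB; apply: (@le_trans _ _ ((t - s) * lam k `^ beta)).
      have := expR_ge1Dx (- ((t - s) * lam k `^ beta)); lra.
    by rewrite ler_wpM2l.
  apply: le_trans (ler_pM (normr_ge0 _) (normr_ge0 _) e1 (hP k x y)) _.
  rewrite exprS le_eqVlt; apply/orP; left; apply/eqP; ring.
have e2 : expR (- (s / 2)) <= 1 by rewrite expR_le1 oppr_le0 divr_ge0// ltW.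
rewrite [leLHS](_ : _ = expR (- (s / 2)) * (P * (d + 2)%:R * Q * (t - s) / s ^+ n.+1 * (wt x * wt y)));
  last by ring.
rewrite ler_piMl// !mulr_ge0 ?(ltW P0) ?(ltW Q0) ?(ltW (wt_gt0 _))//.
by rewrite invr_ge0 exprn_ge0// ltW.
Qed.

Lemma heatK_sym t x y : heatK beta t x y = heatK beta t y x.
Proof. by rewrite /heatK; congr (limn (series _)); apply/funext => k; rewrite proj_kernel_sym. Qed.

Lemma measurable_heatK t x : 0 < t -> measurable_fun setT (heatK beta t x).
Proof.
move=> t0; have [C C0 [n [h _]]] := heatK_facts.
apply: (@measurable_fun_cvg _ _ _ setT
  (fun N y => series (fun k => expR (- (t * lam k `^ beta)) * proj_kernel k x y) N)).
  move=> N; rewrite /series/=; apply: measurable_sum_cond => k.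
  by apply: measurable_funM => //; exact: measurable_proj_kernel.
move=> y _; have [/abs_cvg_series c _] := h t x y t0.
exact: c.
Qed.

Lemma measurable_proj_kernel2 k : measurable_fun setT (fun z : Rn R d * Rn R d => proj_kernel k z.1 z.2).
Proof.
rewrite /proj_kernel /diag; apply: measurable_sum_cond => a.
by apply: measurable_funM; apply: (measurableT_comp (measurable_hermite_Phi _)).
Qed.

Lemma measurable_heatK2 t : 0 < t ->
  measurable_fun setT (fun z : Rn R d * Rn R d => heatK beta t z.1 z.2).
Proof.
move=> t0; have [C C0 [n [h _]]] := heatK_facts.
apply: (@measurable_fun_cvg _ _ _ setT
  (fun N (z : Rn R d * Rn R d) => series (fun k => expR (- (t * lam k `^ beta)) * proj_kernel k z.1 z.2) N)).
  move=> N; rewrite /series/=; apply: measurable_sum_cond => k.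
  by apply: measurable_funM => //; exact: measurable_proj_kernel2.
move=> z _; have [/abs_cvg_series c _] := h t z.1 z.2 t0.
exact: c.
Qed.

(** Polynomial growth of the coefficients supplies all convergence hypotheses of [subordination]. *)
Lemma subordination_hermite_level t (c : R^nat) (D a b : R) N : 0 < t ->
  (forall k, `|c k| <= D * k.+1%:R ^+ N) ->
  (forall s, 0 < s -> limn (series (fun k => expR (- (s * lam k `^ 1)) * c k)) <= a + b * expR (- s)) ->
  limn (series (fun k => expR (- (t * lam k `^ beta)) * c k)) <= a + b * expR (- t).
Proof.
move=> t0 cD hab.
have D0 : 0 <= D by have := cD 0%N; rewrite expr1n mulr1; apply: le_trans.
have cvg b' : 0 < b' <= 1 -> forall s, 0 < s ->
    cvgn (series (fun k => `|expR (- (s * lam k `^ b')) * c k|)).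
  move=> b01' s s0; have [Q Q0 [n hQ]] := @exp_poly_sum R d hd N b' b01'.
  have [] := hQ s s0 (fun k => expR (- (s * lam k `^ b')) * c k) D D0 _ => // k.
  rewrite normrM ger0_norm ?expR_ge0// mulrCA ler_wpM2l ?expR_ge0//.
have l1 k : lam k `^ 1 = lam k by rewrite powRr1.
apply: subordination => //; first exact: ltW.
- move=> e e0; have := cvg 1 _ e e0; under eq_fun do rewrite l1.
  by apply; rewrite ltr01 lexx.
- exact: cvg.
- by move=> s s0; have := hab s s0; under eq_fun do rewrite l1.
Qed.

End heat_kernel.

(** * Product form and positivity of the kernel *)

Section mehler_kernel.
Context {R : realType} {d : nat}.
Hypothesis hd : (0 < d)%N.
Implicit Types (x y : Rn R d) (s : R).

(** e^{-s(2|a| + d)} factors over the coordinates as e^{-s} r^{a_j} with r = e^{-2s}, so the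
    spectral sum is a product of one-dimensional Mehler series, summed along |a| = k. *)
Lemma heatK1E s x y : 0 < s ->
  heatK 1 s x y = \prod_(j < d) mehler1 (expR (- (2 * s))) (tnth x j) (tnth y j).
Proof.
move=> s0; pose r := expR (- (2 * s)).
have r0 : 0 < r by exact: expR_gt0.
have r1 : r < 1 by rewrite expR_lt1 oppr_lt0 mulr_gt0.
have r01 : 0 <= r < 1 by rewrite ltW.
pose q (j : 'I_d) i := hermite_fun i (tnth x j) * hermite_fun i (tnth y j).
pose z j i := expR (- s) * (r ^+ i * q j i).
have cq j : cvgn (series (fun i => `|r ^+ i * q j i|)).
  by apply: mehler_cvg; rewrite ger0_norm// ltW.
have cz j : cvgn (series (fun i => `|z j i|)).
  rewrite (_ : series _ = fun n => expR (- s) * series (fun i => `|r ^+ i * q j i|) n).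
    exact: is_cvgMr.
  apply/funext => n; rewrite /series/= mulr_sumr; apply: eq_bigr => i _.
  by rewrite /z normrM ger0_norm ?expR_ge0.
have [_ h] := diag_prod_cvg cz.
transitivity (\prod_(j < d) limn (series (z j))).
  rewrite -h /heatK; congr (limn (series _)); apply/funext => k.
  rewrite /proj_kernel /diag mulr_sumr; apply: eq_bigr => a /eqP ak.
  rewrite /hermite_Phi -big_split/= powRr1 ?/hermite_level//.
  have -> : expR (- (s * (2 * k + d)%:R)) = \prod_(j < d) (expR (- s) * r ^+ a j).
    rewrite big_split/= prodr_const card_ord -expRM_natl.
    rewrite (eq_bigr (fun j => expR ((a j)%:R * - (2 * s)))); last first.
      by move=> j _; rewrite -expRM_natl.
    rewrite -expR_sum -expRD -mulr_suml -natr_sum ak natrD natrM; congr expR; ring.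
  rewrite -big_split/=; apply: eq_bigr => j _.
  by rewrite /z /q; ring.
apply: eq_bigr => j _; rewrite /z limn_seriesZ; last exact: abs_cvg_series.
rewrite /q mehlerE// /mehler1; congr (_ * _).
rewrite -/r (_ : r = expR (- s) ^+ 2) ?sqrtr_sqr ?ger0_norm ?expR_ge0//.
by rewrite -expRM_natl; congr expR; ring.
Qed.

Lemma heatK1_ge0 s x y : 0 < s -> 0 <= heatK 1 s x y.
Proof.
move=> s0; rewrite heatK1E//; apply: prodr_ge0 => j _; apply/ltW/mehler1_gt0.
by rewrite expR_gt0 expR_lt1 oppr_lt0 mulr_gt0.
Qed.

(** Subordination with a = b = 0, applied to the opposite coefficients because the principle yields
    upper bounds. *)
Lemma heatK_ge0 beta t x y : 0 < beta <= 1 -> 0 < t -> 0 <= heatK beta t x y.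
Proof.
move=> b01 t0; have [C C0 hC] := @proj_kernel_bound R d.
have cvg b' : 0 < b' <= 1 -> forall s, 0 < s ->
  cvgn (series (fun k => expR (- (s * @hermite_level R d k `^ b')) * proj_kernel k x y)).
  move=> b01' s s0; have [D D0 [n [h _]]] := heatK_facts hd b01'.
  by have [/abs_cvg_series] := h s x y s0.
have neg b' s : 0 < b' <= 1 -> 0 < s ->
  limn (series (fun k => expR (- (s * @hermite_level R d k `^ b')) * (- proj_kernel k x y))) = - heatK b' s x y.
  move=> b01' s0; rewrite /heatK -mulN1r -limn_seriesZ; last exact: cvg.
  by congr (limn (series _)); apply/funext => k; ring.
have := @subordination_hermite_level R d hd beta b01 t (fun k => - proj_kernel k x y) (C * (wt x * wt y)) 0 0 (7 * d) t0.
rewrite neg// mul0r addr0 oppr_le0; apply.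
  by move=> k; rewrite normrN mulrAC hC.
move=> s s0; rewrite neg//; last by rewrite ltr01 lexx.
by rewrite mul0r addr0 oppr_le0 heatK1_ge0.
Qed.

End mehler_kernel.

(** * The heat operator on a weighted L^1 space *)

Section heat_operator.
Context {R : realType} {d : nat}.
Local Notation mu := (@lebesgue_Rn R d).
Local Notation lam := (@hermite_level R d).
Implicit Types (x y : Rn R d) (t s : R) (k : nat) (g h : Rn R d -> R).

(* A space containing exp L^p on which the spectral series converges, with the
   heat kernel as integral kernel. *)
Definition wL1 g := measurable_fun setT g /\ mu.-integrable setT (EFin \o (fun x => g x * wt x)).

Definition wn g := \int[mu]_x (`|g x| * wt x).

Lemma wL1_norm g : wL1 g -> mu.-integrable setT (EFin \o (fun x => `|g x| * wt x)).
Proof.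
move=> [mg /integrable_norm]; congr (mu.-integrable _ (_ \o _)).
by apply/funext => x /=; rewrite normrM (ger0_norm (ltW (wt_gt0 x))).
Qed.

Lemma wn_ge0 g : 0 <= wn g.
Proof. by apply: Rintegral_ge0 => x _; rewrite mulr_ge0// ltW// wt_gt0. Qed.

Lemma wL1_pairing g h C : wL1 g -> measurable_fun setT h ->
  (forall y, `|h y| <= C * wt y) ->
  mu.-integrable setT (EFin \o (fun y => g y * h y)) /\
  `|\int[mu]_y (g y * h y)| <= C * wn g.
Proof.
move=> gW mh hC; have [mg ig] := gW.
have mgh : measurable_fun setT (fun y => g y * h y) by exact: measurable_funM.
have b y : `|g y * h y| <= C * (`|g y| * wt y).
  by rewrite normrM mulrCA ler_wpM2l.
have iC : mu.-integrable setT (EFin \o (fun y => C * (`|g y| * wt y))).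
  by have := integrableZl measurableT C (wL1_norm gW).
split; first exact: (integrable_dominated mgh b iC).
apply: le_trans (normr_Rintegral_le mgh b iC) _.
by rewrite RintegralZl//; exact: wL1_norm.
Qed.

Lemma wL1_bounded g C : measurable_fun setT g -> (forall x, `|g x| <= C) -> wL1 g.
Proof.
move=> mg gC; split => //.
have mw := @measurable_wt R d.
have iw : mu.-integrable setT (EFin \o @wt R d).
  apply/integrableP; split; first exact/measurable_EFinP.
  apply: le_lt_trans (ltry (pi ^+ d)); apply: le_trans (@integral_wt R d).
  rewrite le_eqVlt; apply/orP; left; apply/eqP; apply: eq_integral => x _ /=.
  by rewrite ger0_norm// ltW// wt_gt0.
apply: (@integrable_dominated _ _ _ _ _ (fun x => C * wt x)).
- exact: measurable_funM.
- by move=> x; rewrite normrM (ger0_norm (ltW (wt_gt0 x))) ler_wpM2r// ltW// wt_gt0.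
- by have := integrableZl measurableT C iw.
Qed.

Lemma wL1B g h : wL1 g -> wL1 h -> wL1 (fun x => g x - h x).
Proof.
move=> [mg ig] [mh ih]; split; first exact: measurable_funB.
have := integrableB measurableT ig ih; congr (mu.-integrable _ _).
by apply/funext => x /=; rewrite mulrBl EFinB.
Qed.

Hypothesis hd : (0 < d)%N.

Lemma hermite_projE : exists2 C, 0 < C & forall g k x, wL1 g ->
  [/\ mu.-integrable setT (EFin \o (fun y => g y * proj_kernel k x y)),
      hermite_proj k g x = \int[mu]_y (g y * proj_kernel k x y) &
      `|hermite_proj k g x| <= C * k.+1%:R ^+ (7 * d) * (wt x * wn g)].
Proof.
have [C C0 hC] := @proj_kernel_bound R d; have [C' C'0 hC'] := @hermite_Phi_bound R d.
exists C => // g k x gW.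
have b y : `|proj_kernel k x y| <= C * k.+1%:R ^+ (7 * d) * wt x * wt y by rewrite -mulrA.
have [i1 h1] := wL1_pairing gW (measurable_proj_kernel k x) b.
have E : hermite_proj k g x = \int[mu]_y (g y * proj_kernel k x y).
  rewrite /hermite_proj /proj_kernel /diag /hermite_coef.
  pose c (a : {ffun 'I_d -> 'I_k.+1}) : R := hermite_Phi (fun j => a j) x.
  pose H (a : {ffun 'I_d -> 'I_k.+1}) y := g y * hermite_Phi (fun j => a j) y.
  have iH a : mu.-integrable setT (EFin \o H a).
    have bH y : `|hermite_Phi (fun j => a j) y| <= C' * k.+1%:R ^+ (3 * d) * wt y.
      by apply: hC' => j; rewrite -ltnS.
    by have [] := wL1_pairing gW (measurable_hermite_Phi _) bH.
  have [_ e] := Rintegral_sumZ (index_enum _)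
    (P := fun a : {ffun 'I_d -> 'I_k.+1} => (\sum_(j < d) a j)%N == k) c (fun a _ => iH a).
  transitivity (\sum_(a : {ffun 'I_d -> 'I_k.+1} | (\sum_(j < d) a j)%N == k)
    c a * \int[mu]_y (H a y)); first by apply: eq_bigr => a _; rewrite mulrC.
  rewrite -e; apply: eq_Rintegral => y _; rewrite mulr_sumr; apply: eq_bigr => a _.
  by rewrite /c /H; ring.
by split => //; rewrite E mulrA.
Qed.

Variable beta : R.
Hypothesis b01 : 0 < beta <= 1.

(** The partial sums of the kernel are dominated by a multiple of wt(x) wt(y), so sum and integral
    may be exchanged; convergence holds at every x. *)
Lemma hermite_heatE g t x : wL1 g -> 0 < t ->
  cvgn (hermite_heat_series beta t g x) /\
  hermite_heat beta t g x = \int[mu]_y (g y * heatK beta t x y).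
Proof.
move=> gW t0; have [mg ig] := gW.
have [P P0 hP] := @proj_kernel_bound R d.
have [Q Q0 [n hQ]] := @exp_poly_sum R d hd (7 * d) beta b01.
have [C C0 [m [hK _]]] := heatK_facts hd b01.
have [C' C'0 hproj] := hermite_projE.
pose KN N y := series (fun k => expR (- (t * lam k `^ beta)) * proj_kernel k x y) N.
have w0 y : 0 <= wt x * wt y by rewrite mulr_ge0// ltW// wt_gt0.
pose q k := expR (- (t * lam k `^ beta)) * k.+1%:R ^+ (7 * d).
have q0 k : 0 <= q k by rewrite mulr_ge0 ?expR_ge0// exprn_ge0.
have cq : cvgn (series (fun k => `|q k|)).
  have hq k : `|q k| <= 1 * q k by rewrite mul1r ger0_norm.
  by have [] := hQ t t0 q 1 ler01 hq.
have cq' : cvgn (series q) by exact: abs_cvg_series.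
have KNb N y : `|KN N y| <= P * limn (series q) * wt x * wt y.
  rewrite /KN /series/=; apply: le_trans (ler_norm_sum _ _ _) _.
  apply: (@le_trans _ _ (\sum_(0 <= k < N) (P * (wt x * wt y)) * q k)).
    apply: ler_sum => k _; rewrite normrM ger0_norm ?expR_ge0// /q.
    rewrite [leRHS](_ : _ = expR (- (t * lam k `^ beta)) *
      (P * k.+1%:R ^+ (7 * d) * (wt x * wt y))); last by ring.
    by rewrite ler_wpM2l ?expR_ge0.
  rewrite -mulr_sumr [leRHS](_ : _ = P * (wt x * wt y) * limn (series q)); last by ring.
  rewrite ler_wpM2l ?mulr_ge0 ?(ltW P0)// ?(ltW (wt_gt0 _))//.
  apply: (@nondecreasing_cvgn_le _ (series q)) => //.
  by apply/nondecreasing_seqP => j; rewrite seriesSr lerDl.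
have mKN N : measurable_fun setT (KN N).
  by rewrite /KN /series/=; apply: measurable_sum_cond => k; apply: measurable_funM => //;
     exact: measurable_proj_kernel.
have E N : hermite_heat_series beta t g x N = \int[mu]_y (g y * KN N y).
  rewrite /hermite_heat_series /KN /series/=.
  have [_ e] := @Rintegral_sumZ _ _ R mu nat (index_iota 0 N) xpredT
    (fun k => expR (- (t * lam k `^ beta))) (fun k y => g y * proj_kernel k x y)
    (fun k _ => let: And3 i _ _ := hproj g k x gW in i).
  transitivity (\sum_(0 <= k < N) expR (- (t * lam k `^ beta)) * \int[mu]_y (g y * proj_kernel k x y)).
    by apply: eq_bigr => k _; have [_ -> _] := hproj g k x gW.
  rewrite -e; apply: eq_Rintegral => y _; rewrite mulr_sumr; apply: eq_bigr => k _.
  by ring.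
have gK N y : `|g y * KN N y| <= P * limn (series q) * wt x * (`|g y| * wt y).
  by rewrite normrM mulrCA ler_wpM2l.
have ibd : mu.-integrable setT (EFin \o (fun y => P * limn (series q) * wt x * (`|g y| * wt y))).
  by have := integrableZl measurableT (P * limn (series q) * wt x) (wL1_norm gW).
have [_ _ cv] : [/\ measurable_fun setT (fun y => g y * heatK beta t x y),
  mu.-integrable setT (EFin \o (fun y => g y * heatK beta t x y)) &
   \int[mu]_y (g y * KN N y) @[N --> \oo] --> \int[mu]_y (g y * heatK beta t x y)].
  apply: (dominated_cvg_Rintegral _ _ gK ibd).
    by move=> N; exact: measurable_funM.
  move=> y; apply: cvgM; first exact: cvg_cst.
  by have [/abs_cvg_series c _] := hK t x y t0.
have cv' : hermite_heat_series beta t g x N @[N --> \oo] --> \int[mu]_y (g y * heatK beta t x y).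
  by rewrite (_ : hermite_heat_series beta t g x = fun N => \int[mu]_y (g y * KN N y))//; apply/funext.
by split; [exact: cvgP cv'|exact/cvg_lim].
Qed.

Lemma hermite_heat_definedW g t : wL1 g -> 0 < t -> hermite_heat_defined beta t g.
Proof.
move=> gW t0; split; last first.
  by apply: aeW => x; have [] := hermite_heatE x gW t0.
move=> a; have [C C0 hC] := @hermite_Phi_bound R d.
have b y : `|hermite_Phi a y| <= C * (\sum_(j < d) a j).+1%:R ^+ (3 * d) * wt y.
  by apply: hC => j; rewrite (bigD1 j)//= leq_addr.
by have [] := wL1_pairing gW (measurable_hermite_Phi a) b.
Qed.

Lemma heat_pairing g t x : wL1 g -> 0 < t ->
  mu.-integrable setT (EFin \o (fun y => g y * heatK beta t x y)).
Proof.
move=> gW t0; have [C C0 [n [h _]]] := heatK_facts hd b01.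
have b y : `|heatK beta t x y| <= C * expR (- (t / 2)) / t ^+ n.+1 * wt x * wt y.
  by rewrite -mulrA; have [] := h t x y t0.
by have [] := wL1_pairing gW (measurable_heatK hd b01 x t0) b.
Qed.

Lemma heat_facts : exists2 C : R, 0 < C & exists n : nat,
  (forall g t x, wL1 g -> 0 < t ->
    `|hermite_heat beta t g x| <= C * expR (- (t / 2)) / t ^+ n.+1 * wt x * wn g) /\
  (forall g s t x, wL1 g -> 0 < s -> s <= t ->
    `|hermite_heat beta t g x - hermite_heat beta s g x| <=
     C * (t - s) / s ^+ n.+1 * wt x * wn g).
Proof.
have [C C0 [n [h1 h2]]] := heatK_facts hd b01; exists C => //; exists n; split.
  move=> g t x gW t0; have [_ ->] := hermite_heatE x gW t0.
  have b y : `|heatK beta t x y| <= C * expR (- (t / 2)) / t ^+ n.+1 * wt x * wt y.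
    by rewrite -mulrA; have [] := h1 t x y t0.
  by have [] := wL1_pairing gW (measurable_heatK hd b01 x t0) b.
move=> g s t x gW s0 st; have t0 : 0 < t by exact: lt_le_trans st.
have [_ ->] := hermite_heatE x gW t0; have [_ ->] := hermite_heatE x gW s0.
rewrite -RintegralB//; [|exact: heat_pairing|exact: heat_pairing].
under eq_Rintegral do rewrite -mulrBr.
have b y : `|heatK beta t x y - heatK beta s x y| <= C * (t - s) / s ^+ n.+1 * wt x * wt y.
  by rewrite -mulrA; exact: h2.
have m : measurable_fun setT (fun y => heatK beta t x y - heatK beta s x y).
  by apply: measurable_funB; exact: measurable_heatK.
by have [] := wL1_pairing gW m b.
Qed.

Lemma hermite_heatB g h t x : wL1 g -> wL1 h -> 0 < t ->
  hermite_heat beta t (fun y => g y - h y) x = hermite_heat beta t g x - hermite_heat beta t h x.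
Proof.
move=> gW hW t0; have [_ ->] := hermite_heatE x (wL1B gW hW) t0.
have [_ ->] := hermite_heatE x gW t0; have [_ ->] := hermite_heatE x hW t0.
rewrite -RintegralB//; [|exact: heat_pairing|exact: heat_pairing].
by apply: eq_Rintegral => y _; rewrite mulrBl.
Qed.

Lemma measurable_hermite_heat g t : wL1 g -> 0 < t ->
  measurable_fun setT (hermite_heat beta t g).
Proof.
move=> gW t0.
apply: (@measurable_fun_cvg _ _ _ setT (fun N x => hermite_heat_series beta t g x N)).
  move=> N; rewrite /hermite_heat_series /series/=; apply: measurable_sum_cond => k.
  apply: measurable_funM => //; apply: measurable_sum_cond => a.
  by apply: measurable_funM => //; exact: measurable_hermite_Phi.
by move=> x _; have [c _] := hermite_heatE x gW t0; exact: c.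
Qed.

Lemma hermite_heat_norm_le g t x : wL1 g -> 0 < t ->
  (`|hermite_heat beta t g x|%:E <= \int[mu]_y (heatK beta t x y * `|g y|)%:E)%E.
Proof.
move=> gW t0; have [_ ->] := hermite_heatE x gW t0; have ip := heat_pairing x gW t0.
rewrite EFin_normr_Rintegral//; apply: le_trans (le_abse_integral _ _ _) _ => //.
  by have /integrableP[] := ip.
rewrite le_eqVlt; apply/orP; left; apply/eqP; apply: eq_integral => y _ /=.
by rewrite normrM mulrC (ger0_norm (heatK_ge0 hd x y b01 t0)).
Qed.

Lemma heat_subordination g t x (a b : R) : wL1 g -> 0 < t ->
  (forall s, 0 < s -> hermite_heat 1 s g x <= a + b * expR (- s)) ->
  hermite_heat beta t g x <= a + b * expR (- t).
Proof.
move=> gW t0 h; have [C C0 hproj] := hermite_projE.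
apply: (@subordination_hermite_level R d hd beta b01 t (fun k => hermite_proj k g x)
  (C * (wt x * wn g)) a b (7 * d)) => // k.
by have [_ _] := hproj g k x gW; rewrite mulrAC.
Qed.

End heat_operator.

Lemma integrableMl_EFin (disp : measure_display) (T : measurableType disp) (R : realType)
  (mu : {measure set T -> \bar R}) (f : T -> R) (c : R) :
  mu.-integrable setT (EFin \o f) -> mu.-integrable setT (EFin \o (fun y => c * f y)).
Proof.
move=> fi; apply: (@eq_integrable _ _ _ mu setT measurableT (fun y => c%:E * (EFin \o f) y)%E) => //.
exact: integrableZl.
Qed.

Lemma normr_Rintegral_leE (disp : measure_display) (T : measurableType disp) (R : realType)
  (mu : {measure set T -> \bar R}) (f : T -> R) : mu.-integrable setT (EFin \o f) ->
  (`|\int[mu]_x f x|%:E <= \int[mu]_x (`|f x|)%:E)%E.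
Proof.
move=> fi; rewrite (EFin_normr_Rintegral measurableT fi).
by apply: le_abse_integral => //; exact: measurable_int fi.
Qed.

(** * Mass of the kernel, and its action on indicators of boxes *)

Section mehler_box.
Context {R : realType} {d : nat}.
Hypothesis hd : (0 < d)%N.
Local Notation mu := (@lebesgue_Rn R d).
Local Notation leb := (@lebesgue_measure R).
Implicit Types (x y : Rn R d) (t s : R).

Let ex01 s : 0 < s -> 0 < expR (- (2 * s)) < 1.
Proof. by move=> s0; rewrite expR_gt0 expR_lt1 oppr_lt0 mulr_gt0. Qed.

Lemma measurable_cond_mehler1 (A : set (measurableTypeR R)) (r z : R) : measurable A -> 0 < r < 1 ->
  measurable_fun setT (fun y : measurableTypeR R => \1_A y * mehler1 r z y).
Proof.
by move=> mA r01; apply: measurable_funM => //; exact: measurable_mehler1.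
Qed.

Lemma integral_indic_mul (A : set (measurableTypeR R)) (f : R -> R) : measurable A ->
  (\int[leb]_y (\1_A y * f y)%:E = \int[leb]_(y in A) (f y)%:E)%E.
Proof.
move=> mA; rewrite [RHS]integral_mkcond; apply: eq_integral => y _.
by rewrite patchE indicE; case: ifPn => _; rewrite ?mul1r ?mul0r.
Qed.

Lemma integral_box_heatK1 (A : 'I_d -> set (measurableTypeR R)) (a : 'I_d -> R) s x :
  0 < s -> (forall j, measurable (A j)) ->
  (forall j, \int[leb]_(y in A j) (mehler1 (expR (- (2 * s))) (tnth x j) y)%:E <= (a j)%:E)%E ->
  (\int[mu]_y ((\prod_(j < d) \1_(A j) (tnth y j)) * heatK 1 s x y)%:E <= (\prod_(j < d) a j)%:E)%E.
Proof.
move=> s0 mA ha.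
under eq_integral do rewrite heatK1E// -big_split/=.
have := @integral_tensor_le R d (fun j (y : R) => \1_(A j) y * mehler1 (expR (- (2 * s))) (tnth x j) y) a.
apply => [j|j y|j].
- by apply: measurable_cond_mehler1 => //; exact: ex01.
- by rewrite mulr_ge0// ltW// mehler1_gt0// ex01.
- by rewrite integral_indic_mul.
Qed.

Lemma integral_heatK1_le1 s x : 0 < s -> (\int[mu]_y (heatK 1 s x y)%:E <= 1)%E.
Proof.
move=> s0; have := @integral_box_heatK1 (fun _ => setT) (fun _ => 1) s x s0 (fun _ => measurableT).
rewrite prodr_const expr1n; under eq_integral do
  (rewrite big1 ?mul1r; last by move=> j _; rewrite indicT).
by apply => j; apply: integral_mehler1_le1; exact: ex01.
Qed.

Lemma wL1_cst1 : wL1 (fun _ : Rn R d => 1 : R).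
Proof. by apply: (@wL1_bounded _ _ _ 1) => // x; rewrite normr1. Qed.

Lemma hermite_heat_EFin beta g t x : 0 < beta <= 1 -> 0 < t -> wL1 g ->
  (hermite_heat beta t g x)%:E = (\int[mu]_y (g y * heatK beta t x y)%:E)%E.
Proof.
move=> b01 t0 gW; have [_ ->] := hermite_heatE hd b01 x gW t0.
by rewrite /Rintegral fineK//; apply: integrable_fin_num => //; exact: heat_pairing.
Qed.

Let b11 : is_true ((0 : R) < 1 <= (1 : R)). Proof. by rewrite ltr01 lexx. Qed.

(** Subordination for g = 1, with a = 1 and b = 0. *)
Lemma heat_submarkov beta t x : 0 < beta <= 1 -> 0 < t ->
  (\int[mu]_y (heatK beta t x y)%:E <= 1)%E.
Proof.
move=> b01 t0.
have E b' s : 0 < b' <= 1 -> 0 < s ->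
    (hermite_heat b' s (fun _ => 1) x)%:E = (\int[mu]_y (heatK b' s x y)%:E)%E.
  move=> b01' s0; rewrite hermite_heat_EFin//; last exact: wL1_cst1.
  by apply: eq_integral => y _; rewrite mul1r.
rewrite -E// lee_fin.
have := @heat_subordination R d hd beta b01 _ t x 1 0 wL1_cst1 t0.
rewrite mul0r addr0; apply => s s0; rewrite mul0r addr0 -lee_fin E//.
exact: integral_heatK1_le1.
Qed.

(** For t <= 1 the mass is at most 1 <= e^{1/2} e^{-t/2}; for t > 1 the negative power of t in the
    kernel bound is harmless, and wt is integrable. *)
Lemma heat_mass beta : 0 < beta <= 1 -> exists2 C, 0 < C & forall t x, 0 < t ->
  (\int[mu]_y (heatK beta t x y)%:E <= (C * expR (- (t / 2)))%:E)%E.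
Proof.
move=> b01; have [C C0 [n [h _]]] := heatK_facts hd b01.
have pd : 0 < pi ^+ d :> R by rewrite exprn_gt0// pi_gt0.
exists (expR (2^-1) + C * pi ^+ d); first by rewrite addr_gt0 ?expR_gt0// mulr_gt0.
move=> t x t0; have [t1|t1] := leP t 1.
  apply: le_trans (heat_submarkov x b01 t0) _; rewrite lee_fin.
  apply: (@le_trans _ _ (expR 2^-1 * expR (- (t / 2)))).
    by rewrite -expRD -[leLHS]expR0 ler_expR; lra.
  by rewrite ler_wpM2r ?expR_ge0// lerDl mulr_ge0 ?(ltW C0)// ltW.
have tn : 1 <= t ^+ n.+1 by rewrite exprn_ege1// ltW.
apply: (@le_trans _ _ (\int[mu]_y ((C * expR (- (t / 2)))%:E * (wt y)%:E))%E).
  apply: ge0_le_integral => //.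
  - by move=> y _; rewrite lee_fin heatK_ge0.
  - by apply/measurable_EFinP; exact: measurable_heatK.
  - apply: measurable_funeM; apply/measurable_EFinP; exact: measurable_wt.
  - move=> y _; rewrite -EFinM lee_fin; apply: le_trans (ler_norm _) _.
    have [_ h'] := h t x y t0; apply: (le_trans h').
    have e0 := expR_ge0 (- (t / 2)); have w0 := ltW (wt_gt0 y).
    rewrite ler_pM ?mulr_ge0 ?divr_ge0 ?(ltW C0) ?(ltW (wt_gt0 _))//.
      by rewrite invr_ge0 (le_trans _ tn).
      by rewrite ler_pdivrMr ?(lt_le_trans ltr01)// ler_peMr// mulr_ge0// ltW.
    by rewrite ler_piMl// wt_le1.
rewrite ge0_integralZl_EFin//; last 3 first.
- by move=> y _; rewrite lee_fin ltW// wt_gt0.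
- by apply/measurable_EFinP; exact: measurable_wt.
- by rewrite mulr_ge0 ?expR_ge0// ltW.
apply: le_trans (lee_wpmul2l _ (@integral_wt R d)) _.
  by rewrite lee_fin mulr_ge0 ?expR_ge0// ltW.
rewrite -EFinM lee_fin mulrAC ler_wpM2r ?expR_ge0// lerDr expR_ge0//.
Qed.

(** The constant depends neither on t nor on beta, so C wt is a majorant as t tends to 0. It is the
    product over the coordinates of the bound uniform in r, carried over by subordination with b =
    0. *)
Lemma heat_box_decay (L : R) : 1 <= L -> exists2 C, 0 < C & forall beta t (g : Rn R d -> R) x,
  0 < beta <= 1 -> 0 < t -> measurable_fun setT g ->
  (forall y, 0 <= g y <= \prod_(j < d) \1_(`[(- L)%R, L]%classic : set (measurableTypeR R)) (tnth y j)) ->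
  0 <= hermite_heat beta t g x <= C * wt x.
Proof.
move=> L1; have [C C0 hC] := integral_mehler1_bounded L1.
exists (C ^+ d); first by rewrite exprn_gt0.
move=> beta t g x b01 t0 mg hg.
have gW : wL1 g.
  apply: (@wL1_bounded _ _ _ 1) => // y; have /andP[g0 g1] := hg y.
  rewrite ger0_norm//; apply: le_trans g1 _; apply: prodr_ile1 => j _.
  by rewrite indicE; case: (_ \in _); rewrite ?lexx ler01.
apply/andP; split.
  rewrite -lee_fin hermite_heat_EFin//; apply: integral_ge0 => y _; rewrite lee_fin mulr_ge0//.
    by case/andP: (hg y).
  exact: heatK_ge0.
have := @heat_subordination R d hd beta b01 g t x (C ^+ d * wt x) 0 gW t0.
rewrite mul0r addr0; apply => s s0; rewrite mul0r addr0 -lee_fin hermite_heat_EFin//.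
apply: (@le_trans _ _ (\int[mu]_y ((\prod_(j < d) \1_(`[(- L)%R, L]%classic : set (measurableTypeR R))
    (tnth y j)) * heatK 1 s x y)%:E)%E).
  apply: ge0_le_integral => //.
  - move=> y _; rewrite lee_fin mulr_ge0//; first by case/andP: (hg y).
    exact: heatK_ge0.
  - apply/measurable_EFinP; apply: measurable_funM => //; exact: measurable_heatK.
  - apply/measurable_EFinP; apply: measurable_funM; last exact: measurable_heatK.
    have := @measurable_tensor R d (fun _ => \1_(`[(- L)%R, L]%classic : set (measurableTypeR R))).
    by apply => j; exact: measurable_indic.
  - move=> y _; rewrite lee_fin ler_wpM2r//; last by case/andP: (hg y).
    exact: heatK_ge0.
have := @integral_box_heatK1 (fun _ => `[(- L)%R, L]%classic) (fun j => C / (1 + tnth x j ^+ 2)) s x s0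
  (fun _ => measurable_itv _).
rewrite big_split/= prodr_const card_ord; apply => j.
by apply: hC; exact: ex01.
Qed.

Let measurable_far (eta z0 : R) : measurable [set z : measurableTypeR R | (eta <= `|z - z0|)%R].
Proof.
rewrite (_ : [set _ | _] = (fun y : measurableTypeR R => `|y - z0|) @^-1` `[eta, +oo[%classic); last first.
  by apply/seteqP; split => y /=; rewrite in_itv/= andbT.
have mf : measurable_fun setT (fun y : measurableTypeR R => `|y - z0|).
  by apply: measurableT_comp => //; exact: measurable_funB.
by have := mf measurableT _ (measurable_itv `[eta, +oo[); rewrite setTI.
Qed.

(** Union bound over the coordinates: in the j-th summand coordinate j contributes a tail and each
    other coordinate a mass at most 1. *)
Let tail_sum (eta : R) x s : 0 < s -> 0 < eta ->
  (\int[mu]_y ((\sum_(j < d) (\1_[set z : measurableTypeR R | (eta <= `|z - tnth x j|)%R] (tnth y j)))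
     * heatK 1 s x y)%:E <= (d%:R * (24 * (1 - expR (- (2 * s))) / eta ^+ 2))%:E)%E.
Proof.
move=> s0 eta0; have r01 := ex01 s0; have /andP[r0 r1] := r01.
pose A j := [set z : measurableTypeR R | (eta <= `|z - tnth x j|)%R].
have mA j : measurable (A j) by exact: measurable_far.
have mI j : measurable_fun setT (fun y : Rn R d => \1_(A j) (tnth y j) : R).
  have mi : measurable_fun setT (\1_(A j) : measurableTypeR R -> R) by exact: measurable_indic.
  exact: (measurableT_comp mi (measurable_tnth j)).
under eq_integral do rewrite mulr_suml -sumEFin.
rewrite ge0_integral_sum//; last 2 first.
- move=> j; apply/measurable_EFinP; apply: measurable_funM; first exact: mI.
  by apply: measurable_heatK.
- by move=> j y _; rewrite lee_fin mulr_ge0// heatK_ge0.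
set b := 24 * _ / _.
have -> : (d%:R * b)%:E = (\sum_(j < d) b%:E)%E.
  by rewrite sumEFin sumr_const card_ord mulr_natl.
apply: lee_sum => j _.
have := @integral_box_heatK1 (fun i => if i == j then A j else setT)
  (fun i => if i == j then b else 1) s x s0.
rewrite (bigD1 j)//= eqxx big1 ?mulr1; last by move=> i /negbTE ->.
rewrite (_ : (fun y => _ : \bar R) = (fun y => (\1_(A j) (tnth y j) * heatK 1 s x y)%:E)); last first.
  apply/funext => y; rewrite (bigD1 j)//= eqxx big1 ?mulr1// => i /negbTE ->.
  by rewrite indicT.
apply => i; first by case: ifP.
case: eqP => [->|_]; first exact: integral_mehler1_tail.
exact: integral_mehler1_le1.
Qed.

(** Weierstrass's product inequality; the induction also carries that the product stays in
    [0, 1]. *)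
Lemma one_sub_prod_le (I : Type) (r : seq I) (a : I -> R) : (forall i, 0 <= a i <= 1) ->
  1 - \prod_(i <- r) a i <= \sum_(i <- r) (1 - a i).
Proof.
move=> a01; suff : 0 <= \prod_(i <- r) a i <= 1 /\ 1 - \prod_(i <- r) a i <= \sum_(i <- r) (1 - a i).
  by case.
elim: r => [|i r [/andP[p0 p1] IH]]; first by rewrite !big_nil subrr ler01 lexx.
have /andP[a0 a1] := a01 i; rewrite !big_cons; split.
  by rewrite mulr_ge0//= mulr_ile1.
have : (1 - a i) * (1 - \prod_(j <- r) a j) >= 0 by rewrite mulr_ge0// subr_ge0.
lra.
Qed.

Lemma integral_heatK1_ge s x : 0 < s ->
  ((1 - (1 - expR (- (2 * s))) * \sum_(j < d) (1 + tnth x j ^+ 2))%:E <=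
   \int[mu]_y (heatK 1 s x y)%:E)%E.
Proof.
move=> s0; have r01 := ex01 s0.
under eq_integral do rewrite heatK1E//.
have := @integral_tensor R d (fun j (y : R) => mehler1 (expR (- (2 * s))) (tnth x j) y).
move=> ->; last 2 first.
- by move=> j; exact: measurable_mehler1.
- by move=> j y; rewrite ltW// mehler1_gt0.
pose a j := fine (\int[leb]_y (mehler1 (expR (- (2 * s))) (tnth x j) y)%:E)%E.
have i0 j : (0 <= \int[leb]_y (mehler1 (expR (- (2 * s))) (tnth x j) y)%:E)%E.
  by apply: integral_ge0 => y _; rewrite lee_fin ltW// mehler1_gt0.
have i1 j : (\int[leb]_y (mehler1 (expR (- (2 * s))) (tnth x j) y)%:E <= 1)%E.
  exact: integral_mehler1_le1.
have aE j : (\int[leb]_y (mehler1 (expR (- (2 * s))) (tnth x j) y)%:E)%E = (a j)%:E.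
  by rewrite /a fineK// ge0_fin_numE// (le_lt_trans (i1 j))// ltry.
rewrite (eq_bigr (fun j => (a j)%:E)); last by move=> j _; exact: aE.
rewrite prodEFin lee_fin.
have a01 j : 0 <= a j <= 1 by rewrite -!lee_fin -aE i0 i1.
have := one_sub_prod_le (index_enum 'I_d) a01.
suff : \sum_(j < d) (1 - a j) <= (1 - expR (- (2 * s))) * \sum_(j < d) (1 + tnth x j ^+ 2) by lra.
rewrite mulr_sumr; apply: ler_sum => j _.
have := integral_mehler1_ge (tnth x j) r01; rewrite aE lee_fin; lra.
Qed.

Let wL1_indic (E : set (Rn R d)) : measurable E -> wL1 (\1_E : Rn R d -> R).
Proof.
move=> mE; apply: (@wL1_bounded _ _ _ 1) => [|x]; first exact: measurable_indic.
by rewrite indicE; case: (_ \in _); rewrite ?normr1// normr0.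
Qed.

(** Where the indicator differs from its value at x, some coordinate has moved by eta or more. *)
Let near_tail (E : set (Rn R d)) x (eta : R) y : 0 < eta ->
  (forall y, (forall j, `|tnth y j - tnth x j| < eta) -> E y = E x) ->
  `|\1_E y - \1_E x| <= \sum_(j < d) (\1_[set z : measurableTypeR R | (eta <= `|z - tnth x j|)%R] (tnth y j)) :> R.
Proof.
move=> eta0 hE.
have s0 (P : pred 'I_d) : 0 <= \sum_(j < d | P j) (\1_[set z : measurableTypeR R | (eta <= `|z - tnth x j|)%R] (tnth y j)) :> R.
  by apply: sumr_ge0 => j _; rewrite indicE; case: (_ \in _).
have [h|/existsNP[j /negP]] := pselect (forall j, `|tnth y j - tnth x j| < eta).
  have -> : \1_E y = \1_E x :> R by rewrite !indicE; congr (nat_of_bool _)%:R; rewrite /in_mem /= /in_set hE.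
  by rewrite subrr normr0 s0.
rewrite -leNgt => hj; rewrite (bigD1 j)//= [X in _ <= X + _]indicE mem_set//=.
apply: (@le_trans _ _ 1); last by rewrite lerDl.
by rewrite !indicE; case: (_ \in _); case: (_ \in _);
  rewrite ?subrr ?subr0 ?sub0r ?normrN ?normr1 ?normr0.
Qed.

Lemma heat1_indic_near (E : set (Rn R d)) x (eta s : R) : measurable E -> 0 < eta ->
  (forall y, (forall j, `|tnth y j - tnth x j| < eta) -> E y = E x) -> 0 < s ->
  (\int[mu]_y (`|\1_E y - \1_E x| * heatK 1 s x y)%:E <=
    (d%:R * (24 * (1 - expR (- (2 * s))) / eta ^+ 2))%:E)%E.
Proof.
move=> mE eta0 hE s0; apply: le_trans (tail_sum x s0 eta0).
apply: ge0_le_integral => //.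
- by move=> y _; rewrite lee_fin mulr_ge0//; apply: heatK_ge0.
- apply/measurable_EFinP; apply: measurable_funM; last exact: measurable_heatK.
  apply: measurableT_comp => //; apply: measurable_funB => //; exact: measurable_indic.
- apply/measurable_EFinP; apply: measurable_funM; last exact: measurable_heatK.
  apply: measurable_sum => j.
  have mi : measurable_fun setT (\1_[set z : measurableTypeR R | (eta <= `|z - tnth x j|)%R] : measurableTypeR R -> R).
    by apply: measurable_indic; exact: measurable_far.
  exact: (measurableT_comp mi (measurable_tnth j)).
- move=> y _; rewrite lee_fin ler_wpM2r ?heatK_ge0//; exact: near_tail.
Qed.

(** At a point near which E is constant, the error consists of a tail and a mass deficit, both at
    most a multiple of 1 - e^{-2s} <= 2(1 - e^{-s}). The last expression is affine in e^{-s}, so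
    subordination carries the rate over to every beta. *)
Lemma heat_indic_near (E : set (Rn R d)) x (eta : R) : measurable E -> 0 < eta ->
  (forall y, (forall j, `|tnth y j - tnth x j| < eta) -> E y = E x) ->
  exists A : R, forall beta t, 0 < beta <= 1 -> 0 < t ->
    `|hermite_heat beta t (\1_E : Rn R d -> R) x - \1_E x| <= A * (1 - expR (- t)).
Proof.
move=> mE eta0 hE.
pose S := \sum_(j < d) (1 + tnth x j ^+ 2).
pose A := 2 * (S + d%:R * (24 / eta ^+ 2)).
have S0 : 0 <= S by apply: sumr_ge0 => j _; rewrite addr_ge0// sqr_ge0.
have D0 : 0 <= d%:R * (24 / eta ^+ 2) by rewrite mulr_ge0// divr_ge0// sqr_ge0.
exists A => beta t b01 t0.
have EW := wL1_indic mE.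
have W0 : wL1 (fun _ : Rn R d => 0 : R) by apply: (@wL1_bounded _ _ _ 0) => // y; rewrite normr0.
have T0 b s : 0 < b <= 1 -> 0 < s -> hermite_heat b s (fun _ : Rn R d => 0 : R) x = 0.
  move=> b01' s0; have [_ ->] := hermite_heatE hd b01' x W0 s0.
  rewrite /Rintegral (_ : (fun y => _) = cst 0%E) ?integral0//.
  by apply/funext => y; rewrite mul0r.
have TN b s : 0 < b <= 1 -> 0 < s ->
    hermite_heat b s (fun y => 0 - \1_E y) x = - hermite_heat b s (\1_E : Rn R d -> R) x.
  by move=> b01' s0; rewrite hermite_heatB// T0// sub0r.
have i0 y : 0 <= \1_E y :> R by rewrite indicE; case: (_ \in _).
have i1 y : \1_E y <= 1 :> R by rewrite indicE; case: (_ \in _).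
have up : hermite_heat beta t (\1_E : Rn R d -> R) x <= 1.
  rewrite -lee_fin hermite_heat_EFin//; apply: le_trans (heat_submarkov x b01 t0).
  apply: ge0_le_integral => //.
  - by move=> y _; rewrite lee_fin mulr_ge0//; apply: heatK_ge0.
  - apply/measurable_EFinP; apply: measurable_funM; last exact: measurable_heatK.
    exact: measurable_indic.
  - by apply/measurable_EFinP; exact: measurable_heatK.
  - by move=> y _; rewrite lee_fin ler_piMl// heatK_ge0.
have lo : 0 <= hermite_heat beta t (\1_E : Rn R d -> R) x.
  rewrite -lee_fin hermite_heat_EFin//; apply: integral_ge0 => y _.
  by rewrite lee_fin mulr_ge0// heatK_ge0.
have r1 s : 0 < s -> 0 <= 1 - expR (- (2 * s)) <= 2 * (1 - expR (- s)).
  move=> s0; have e1 : expR (- s) <= 1 by rewrite expR_le1 oppr_le0 ltW.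
  have -> : expR (- (2 * s)) = expR (- s) ^+ 2 by rewrite -expRM_natl; congr expR; ring.
  have e0 := expR_ge0 (- s); apply/andP; split; nra.
have key s : 0 < s -> `|hermite_heat 1 s (\1_E : Rn R d -> R) x - \1_E x| <= A * (1 - expR (- s)).
  move=> s0; have /andP[r0 rs] := r1 s s0.
  have near1 := heat1_indic_near mE eta0 hE s0.
  have Kint : mu.-integrable setT (EFin \o heatK 1 s x).
    by have := heat_pairing hd b11 x wL1_cst1 s0; under eq_fun do rewrite mul1r.
  have Eint := heat_pairing hd b11 x EW s0.
  pose m := \int[mu]_y heatK 1 s x y.
  have mE' : (\int[mu]_y (heatK 1 s x y)%:E = m%:E)%E.
    by rewrite /m /Rintegral fineK//; apply: integrable_fin_num.
  have m1 : m <= 1 by rewrite -lee_fin -mE'; exact: integral_heatK1_le1.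
  have m2 : 1 - (1 - expR (- (2 * s))) * S <= m.
    by rewrite -lee_fin -mE'; exact: integral_heatK1_ge.
  have [_ ->] := hermite_heatE hd b11 x EW s0.
  have D1 : `|\int[mu]_y (\1_E y * heatK 1 s x y) - \1_E x * m| <=
     d%:R * (24 * (1 - expR (- (2 * s))) / eta ^+ 2).
    have cint : mu.-integrable setT (EFin \o (fun y => \1_E x * heatK 1 s x y)).
      by have := @integrableMl_EFin _ _ _ mu (heatK 1 s x) (\1_E x) Kint.
    rewrite -RintegralZl// -RintegralB//.
    have dint := integrableB measurableT Eint cint.
    rewrite -lee_fin; apply: le_trans near1.
    apply: le_trans (normr_Rintegral_leE dint) _.
    apply: ge0_le_integral.
    - exact: measurableT.
    - by move=> y _; rewrite lee_fin normr_ge0.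
    - by move: dint => /measurable_int /measurable_EFinP h; apply/measurable_EFinP; apply: measurableT_comp.
    - apply/measurable_EFinP; apply: measurable_funM; last exact: measurable_heatK.
      by apply: measurableT_comp => //; apply: measurable_funB => //; exact: measurable_indic.
    - move=> y _; rewrite lee_fin -mulrBl normrM.
      by rewrite (ger0_norm (heatK_ge0 hd x y b11 s0)).
  rewrite -(subrKA (\1_E x * m)).
  apply: le_trans (ler_normD _ _) _.
  have D2 : `|\1_E x * m - \1_E x| <= (1 - expR (- (2 * s))) * S.
    rewrite -{2}(mulr1 (\1_E x)) -mulrBr normrM (ger0_norm (i0 x)) distrC ger0_norm ?subr_ge0//.
    apply: (@le_trans _ _ (1 - m)); last by lra.
    by rewrite ler_piMl// subr_ge0.
  have -> : A * (1 - expR (- s)) = d%:R * (24 / eta ^+ 2) * (2 * (1 - expR (- s))) + (2 * (1 - expR (- s))) * S by rewrite /A; ring.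
  apply: lerD; last by apply: le_trans D2 _; rewrite ler_wpM2r.
  apply: le_trans D1 _.
  have -> : d%:R * (24 * (1 - expR (- (2 * s))) / eta ^+ 2) = d%:R * (24 / eta ^+ 2) * (1 - expR (- (2 * s))) by ring.
  by rewrite ler_wpM2l.
have ring1 (a q e : R) : a + q + - q * e = a + q * (1 - e) by ring.
have neg1 (a b c : R) : - c <= a - b -> - a <= - b + c by lra.
(* The two sides of the absolute value are subordinated separately, the lower one through the
   opposite of the indicator. *)
have hu : hermite_heat beta t (\1_E : Rn R d -> R) x <= (\1_E x + A) + (- A) * expR (- t).
  apply: (heat_subordination hd b01 EW t0) => s s0.
  have := key s s0; rewrite ler_norml => /andP[_].
  by rewrite ring1 lerBlDl.
have hl : hermite_heat beta t (fun y => 0 - \1_E y) x <= (- \1_E x + A) + (- A) * expR (- t).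
  apply: (heat_subordination hd b01 (wL1B W0 EW) t0) => s s0; rewrite TN//.
  have := key s s0; rewrite ler_norml => /andP[+ _].
  by rewrite ring1; apply: neg1.
rewrite TN// in hl.
move: hu hl; rewrite !ring1.
move: (hermite_heat _ _ _ _) (\1_E x) (A * _) => a b c h1 h2.
by rewrite ler_norml lerBlDl h1 andbT; lra.
Qed.

End mehler_box.

(** * The space exp L^p *)

Section real_integral.
Context (disp : measure_display) (T : measurableType disp) (R : realType).
Variable mu : {measure set T -> \bar R}.
Implicit Types (f g h : T -> R).

Lemma le_integral_EFin f g : measurable_fun setT f -> measurable_fun setT g ->
  (forall x, 0 <= f x <= g x) -> (\int[mu]_x (f x)%:E <= \int[mu]_x (g x)%:E)%E.
Proof.
move=> mf mg fg; apply: ge0_le_integral.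
- exact: measurableT.
- by move=> x _; rewrite lee_fin; case/andP: (fg x).
- exact/measurable_EFinP.
- exact/measurable_EFinP.
- by move=> x _; rewrite lee_fin; case/andP: (fg x).
Qed.

Lemma integralZl_EFin f (c : R) : measurable_fun setT f -> (forall x, 0 <= f x) -> 0 <= c ->
  (\int[mu]_x (c * f x)%:E = c%:E * \int[mu]_x (f x)%:E)%E.
Proof.
move=> mf f0 c0; under eq_integral do rewrite EFinM.
apply: ge0_integralZl_EFin; [exact: measurableT| |exact/measurable_EFinP|exact: c0].
by move=> x _; rewrite lee_fin.
Qed.

Lemma integralD_EFin f g : measurable_fun setT f -> (forall x, 0 <= f x) ->
  measurable_fun setT g -> (forall x, 0 <= g x) ->
  (\int[mu]_x (f x + g x)%:E = \int[mu]_x (f x)%:E + \int[mu]_x (g x)%:E)%E.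
Proof.
move=> mf f0 mg g0; under eq_integral do rewrite EFinD.
apply: ge0_integralD; [exact: measurableT| |exact/measurable_EFinP| |exact/measurable_EFinP].
  by move=> x _; rewrite lee_fin.
by move=> x _; rewrite lee_fin.
Qed.

Lemma integrable_EFin_ge0 f : measurable_fun setT f -> (forall x, 0 <= f x) ->
  (\int[mu]_x (f x)%:E < +oo)%E -> mu.-integrable setT (EFin \o f).
Proof.
move=> mf f0 fi; apply/integrableP; split; first exact/measurable_EFinP.
by under eq_integral do rewrite /= ger0_norm//.
Qed.

Lemma EFin_Rintegral f : mu.-integrable setT (EFin \o f) ->
  (\int[mu]_x f x)%:E = (\int[mu]_x (f x)%:E)%E.
Proof. by move=> fi; rewrite /Rintegral fineK//; apply: integrable_fin_num. Qed.

End real_integral.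

(** * Inequalities for the Young function psi *)

Section psi.
Context {R : realType}.
Variable p : R.
Hypothesis p1 : 1 < p.
Implicit Types (s z k : R).
Let p0 : 0 < p. Proof. exact: lt_trans ltr01 p1. Qed.

Lemma psi_ge0 s : 0 <= psi p s.
Proof. by rewrite subr_ge0 -[leLHS]expR0 ler_expR powR_ge0. Qed.

Lemma psi0 : psi p 0 = 0.
Proof. by rewrite /psi powR0 ?gt_eqF// expR0 subrr. Qed.

Lemma le_psi s z : 0 <= s -> s <= z -> psi p s <= psi p z.
Proof.
move=> s0 sz; rewrite lerB// ler_expR ge0_ler_powR// ?nnegrE ?(ltW p0)//.
exact: le_trans sz.
Qed.

Lemma le1_psi s : 0 <= s -> s <= 1 + psi p s.
Proof.
move=> s0; rewrite /psi addrC subrK.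
have [s1|s1] := leP s 1; first by apply: (le_trans s1); rewrite -[leLHS]expR0 ler_expR powR_ge0.
apply: (@le_trans _ _ (s `^ p)); first by rewrite le1r_powR ?ltW.
by apply: le_trans (expR_ge1Dx _); rewrite lerDr.
Qed.

Lemma psi_half s : 0 <= s -> psi p (s / 2) <= psi p s / 2.
Proof.
move=> s0; rewrite /psi powRM//.
have h : 2^-1 `^ p <= 2^-1 :> R.
  by rewrite -[leRHS]powRr1//; apply: ger_powR; [lra | exact: ltW].
apply: (@le_trans _ _ (expR (s `^ p / 2) - 1)).
  by rewrite lerB// ler_expR ler_wpM2l// powR_ge0.
have -> : expR (s `^ p) = expR (s `^ p / 2) ^+ 2.
  by rewrite -expRM_natl; congr expR; field.
have : 1 <= expR (s `^ p / 2) by rewrite -[leLHS]expR0 ler_expR divr_ge0// powR_ge0.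
move: (expR _) => e; nra.
Qed.

(** Young's inequality for s and z^{p-1}, rearranged into the tangent line of s^p at z. *)
Lemma powR_tangent s z : 0 <= s -> 0 <= z ->
  p * z `^ (p - 1) * (s - z) <= s `^ p - z `^ p.
Proof.
move=> s0 z0; have q0 : 0 < p - 1 by rewrite subr_gt0.
have H := @conjugate_powR R s (z `^ (p - 1)) p (p / (p - 1)) s0 (powR_ge0 _ _) p0 (divr_gt0 p0 q0).
have pe : p^-1 + (p / (p - 1))^-1 = 1 by field; rewrite ?gt_eqF//.
have {H} := H pe.
have -> : (z `^ (p - 1)) `^ (p / (p - 1)) = z `^ p.
  by rewrite -powRrM; congr (_ `^ _); field; rewrite gt_eqF.
have zE : z * z `^ (p - 1) = z `^ p by rewrite mulr_powRB1.
move: (s `^ p) (z `^ p) (z `^ (p - 1)) zE => a b c zE h.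
have h2 : p * (s * c) <= a + (p - 1) * b.
  apply: (@le_trans _ _ (p * (a / p + b / (p / (p - 1))))); first by rewrite ler_pM2l.
  by rewrite le_eqVlt; apply/orP; left; apply/eqP; field; rewrite !gt_eqF.
have -> : p * c * (s - z) = p * (s * c) - p * (z * c) by ring.
rewrite zE; lra.
Qed.

(** The supporting line of the convex function psi at z, composed from the tangents of exp and of
    s^p; Jensen's inequality is used in this form. *)
Lemma psi_tangent z : 0 <= z -> exists2 c, 0 <= c &
  forall s, 0 <= s -> psi p z + c * s <= psi p s + c * z.
Proof.
move=> z0; exists (expR (z `^ p) * (p * z `^ (p - 1))).
  by rewrite mulr_ge0 ?expR_ge0// mulr_ge0 ?(ltW p0)// powR_ge0.
move=> s s0; rewrite /psi.
have h := powR_tangent s0 z0.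
have h2 : expR (z `^ p) * (1 + (s `^ p - z `^ p)) <= expR (s `^ p).
  have -> : s `^ p = z `^ p + (s `^ p - z `^ p) by ring.
  by rewrite expRD addrAC subrr add0r ler_pM2l ?expR_gt0// expR_ge1Dx.
have e0 := expR_gt0 (z `^ p).
move: (expR _) e0 h2 h => e e0; move: (p * _) (_ - _ `^ _) (expR _) => c q r h2 h.
have : e * (c * (s - z)) <= e * q by rewrite ler_pM2l.
lra.
Qed.

Lemma psi_le_linear s : 0 <= s <= 1 -> psi p s <= expR 1 * s.
Proof.
move=> /andP[s0 s1]; rewrite /psi.
have sp : s `^ p <= s.
  have [->|sn0] := eqVneq s 0; first by rewrite powR0 ?gt_eqF.
  by apply: ge1r_powR; rewrite ?(ltW p1)// s1 andbT lt_neqAle eq_sym sn0 s0.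
have h := expR_ge1Dx (- s `^ p); rewrite expRN in h.
have e0 := expR_gt0 (s `^ p).
have e1 : expR (s `^ p) <= expR 1 by rewrite ler_expR (le_trans sp).
have h' : expR (s `^ p) * (1 - s `^ p) <= 1.
  by rewrite mulrC -ler_pdivlMr// div1r.
have sp0 : 0 <= s `^ p := powR_ge0 _ _.
move: (expR (s `^ p)) (s `^ p) (expR 1) e0 e1 h' sp sp0 => e q e' e0 e1 h' sp sp0; nra.
Qed.

(** The mediant (a + b)/(k + l) is at most the larger of a/k and b/l. Adding the two values of psi
    is the source of the bound 2 for modulars of sums. *)
Lemma psi_add a b k l : 0 < k -> 0 < l -> 0 <= a -> 0 <= b ->
  psi p ((a + b) / (k + l)) <= psi p (a / k) + psi p (b / l).
Proof.
move=> k0 l0 a0 b0; have kl0 : 0 < k + l by rewrite addr_gt0.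
have s0 : 0 <= (a + b) / (k + l) by rewrite divr_ge0 ?addr_ge0// ltW.
have [h|h] := leP (a / k) (b / l).
  apply: (@le_trans _ _ (psi p (b / l))); last by rewrite lerDr psi_ge0.
  apply: le_psi => //; rewrite ler_pdivrMr//.
  have bl : b / l * l = b by rewrite divfK// gt_eqF.
  have : a <= b / l * k by rewrite -ler_pdivrMr.
  move: (b / l) bl => c; nra.
apply: (@le_trans _ _ (psi p (a / k))); last by rewrite lerDl psi_ge0.
apply: le_psi => //; rewrite ler_pdivrMr//.
have ak : a / k * k = a by rewrite divfK// gt_eqF.
have : b <= a / k * l by rewrite -ler_pdivrMr// ltW.
move: (a / k) ak => c; nra.
Qed.

(** A further quarter of the exponent absorbs y^{a-1}, and y e^{3y/4} is then compared with e^y - 1.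
    The latter vanishes linearly at 0, which is why a >= 1. *)
Lemma powR_expR_half (a : R) : 1 <= a -> exists2 C, 0 < C &
  forall y, 0 <= y -> y `^ a * expR (y / 2) <= C * (expR y - 1).
Proof.
(* This makes (a - 1)/N at most 1/4, and the summand 1 keeps N positive at a = 1. *)
move=> a1; pose N := 4 * (a - 1) + 1.
have N0 : 0 < N by rewrite /N; lra.
exists (4 * N `^ (a - 1)); first by rewrite mulr_gt0// powR_gt0.
move=> y y0.
have h1 : y <= N * expR (y / N).
  rewrite mulrC -ler_pdivrMr//; have := expR_ge1Dx (y / N); lra.
have h2 : y `^ (a - 1) <= N `^ (a - 1) * expR (y / 4).
  apply: (@le_trans _ _ ((N * expR (y / N)) `^ (a - 1))).
    by rewrite ge0_ler_powR ?nnegrE ?subr_ge0// mulr_ge0 ?expR_ge0// ltW.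
  rewrite powRM ?expR_ge0 ?(ltW N0)// ler_wpM2l ?powR_ge0//.
  rewrite -expRM ler_expR mulrAC ler_pdivrMr// -mulrA ler_wpM2l// /N; lra.
have h3 : y * expR (3 * (y / 4)) <= 4 * (expR y - 1).
  have e4 : expR y = expR (y / 4) ^+ 4 by rewrite -expRM_natl; congr expR; field.
  have -> : expR (3 * (y / 4)) = expR (y / 4) ^+ 3 by rewrite -expRM_natl.
  rewrite e4; have := expR_ge1Dx (y / 4); have : 1 <= expR (y / 4) by rewrite -[leLHS]expR0 ler_expR divr_ge0.
  move: (expR _) => e e1 e2.
  have y4 : y <= 4 * (e - 1) by lra.
  have e3 : 1 <= e ^+ 3 by rewrite exprn_ege1.
  have : y * e ^+ 3 <= 4 * (e - 1) * e ^+ 3 by rewrite ler_wpM2r// (le_trans ler01).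
  rewrite (exprS e 3); move: (e ^+ 3) e3 => f; nra.
have -> : y `^ a = y * y `^ (a - 1) by rewrite mulr_powRB1// (lt_le_trans ltr01).
have E : expR (3 * (y / 4)) = expR (y / 4) * expR (y / 2) by rewrite -expRD; congr expR; field.
rewrite E in h3.
apply: (@le_trans _ _ (y * (N `^ (a - 1) * expR (y / 4)) * expR (y / 2))).
  by rewrite ler_wpM2r ?expR_ge0// ler_wpM2l.
have n0 : 0 <= N `^ (a - 1) by rewrite powR_ge0.
move: (N `^ _) n0 => n n0; move: (expR (y / 4)) (expR (y / 2)) (expR y) h3 => a' b' c' h3.
have -> : y * (n * a') * b' = n * (y * (a' * b')) by ring.
have -> : 4 * n * (c' - 1) = n * (4 * (c' - 1)) by ring.
by rewrite ler_wpM2l.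
Qed.

End psi.

(** * The modular of exp L^p and the class L^1 \cap L^oo *)

Section expL_facts.
Context {R : realType} {d : nat}.
Variable p : R.
Hypothesis p1 : 1 < p.
Local Notation mu := (@lebesgue_Rn R d).
Implicit Types (u v g : Rn R d -> R) (x : Rn R d) (k l : R).

Lemma expL_modularE k (k0 : 0 < k) u :
  expL_modular p k u = (\int[mu]_x (psi p (`|u x| / k))%:E)%E.
Proof.
apply: eq_integral => x _; congr ((expR _ - 1)%:E).
rewrite powRM ?invr_ge0 ?(ltW k0)//; congr (_ * _).
by rewrite -[in RHS]powR_inv1 ?(ltW k0)// -powRrM mulN1r powRN.
Qed.

Lemma measurable_psi (disp : measure_display) (T : measurableType disp) (h : T -> R) :
  measurable_fun setT h -> measurable_fun setT (fun y => psi p (h y)).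
Proof.
move=> mh; apply: measurable_funB => //; apply: measurableT_comp => //.
exact: (measurableT_comp (measurable_powR p) mh).
Qed.

Lemma measurable_psi_abs k u : measurable_fun setT u ->
  measurable_fun setT (fun x => psi p (`|u x| / k)).
Proof.
move=> mu'; apply: measurable_psi; apply: measurable_funM => //.
exact: measurableT_comp.
Qed.

Lemma expL_modular_mono k l u : 0 < k -> k <= l -> measurable_fun setT u ->
  (expL_modular p l u <= expL_modular p k u)%E.
Proof.
move=> k0 kl mu'; have l0 := lt_le_trans k0 kl; rewrite (expL_modularE k0 u) (expL_modularE l0 u).
apply: le_integral_EFin => [||x].
- exact: measurable_psi_abs.
- exact: measurable_psi_abs.
- rewrite psi_ge0//= le_psi// ?divr_ge0 ?(ltW l0)// ler_wpM2l//.
  by rewrite lef_pV2.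
Qed.

Lemma norm_expL_le k u : 0 < k -> (expL_modular p k u <= 1)%E -> (norm_expL p u <= k%:E)%E.
Proof. by move=> k0 h; apply: ereal_inf_lbound; exists k. Qed.

Lemma norm_expL_ge0 u : (0 <= norm_expL p u)%E.
Proof. by apply: le_ereal_inf_tmp => _ [k [k0 _] <-]; rewrite lee_fin ltW. Qed.

(** The strict inequality bypasses the question whether the infimum in the Luxemburg norm is
    attained. *)
Lemma norm_expL_modular (eps k : R) u : eps < k -> measurable_fun setT u ->
  (norm_expL p u <= eps%:E)%E -> (expL_modular p k u <= 1)%E.
Proof.
move=> epsk mu' h.
have : (norm_expL p u < k%:E)%E by apply: (le_lt_trans h); rewrite lte_fin.
move=> /ereal_inf_lt[_ [l [l0 hl] <-]]; rewrite lte_fin => lk.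
by apply: le_trans hl; apply: expL_modular_mono => //; exact: ltW.
Qed.

Lemma lebesgue_cube_lty (M : R) : measurable [set x : Rn R d | forall j, `|tnth x j| <= M] /\
  (mu [set x : Rn R d | forall j, (`|tnth x j| <= M)%R] < +oo)%E.
Proof.
have E : [set x : Rn R d | forall j, `|tnth x j| <= M] =
    [set x | forall j, `[(- M)%R, M]%classic (tnth x j)].
  by apply/seteqP; split => x h j; have := h j; rewrite /= in_itv/= ler_norml.
rewrite E; split.
  rewrite (_ : [set x | _] = \big[setI/setT]_(j < d) ((fun x : Rn R d => tnth x j) @^-1` `[(- M)%R, M])); last first.
    apply/seteqP; split => x.
      by move=> h; elim/big_rec: _ => // j B _ Bx; split => //; exact: h.
    by move=> h j; move: h; rewrite (bigD1 j)//= => -[].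
  apply: bigsetI_measurable => j _; rewrite -[X in measurable X]setTI.
  by apply: measurable_tnth => //; exact: measurable_itv.
rewrite (@lebesgue_Rn_box R d (fun _ => `[(- M)%R, M]%classic)); last by move=> j; exact: measurable_itv.
rewrite (eq_bigr (fun=> (Num.max (M + M) 0)%:E)); last first.
  move=> j _; rewrite (@lebesgue_measure_itv R `[(- M)%R, M])/= lte_fin -EFinD opprK.
  case: ifPn => h; first by rewrite max_l//; lra.
  by rewrite max_r// leNgt; apply: contra h => h; lra.
by rewrite prodEFin ltry.
Qed.

(** Local integrability follows from s <= 1 + psi(s), a cube having finite measure. *)
Lemma in_expL_modular k u : 0 < k -> measurable_fun setT u ->
  (expL_modular p k u < +oo)%E -> in_expL p u.
Proof.
move=> k0 mu' h; split; last by exists k.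
split => // M.
have [mC Cfin] := lebesgue_cube_lty M.
apply: (@le_lt_trans _ _ (\int[mu]_x (k * (\1_[set x : Rn R d | forall j, `|tnth x j| <= M] x + psi p (`|u x| / k)))%:E)%E).
  rewrite integral_mkcond.
  rewrite (_ : _ \_ _ = fun x => (\1_[set x : Rn R d | forall j, `|tnth x j| <= M] x * `|u x|)%:E); last first.
    by apply/funext => x; rewrite patchE indicE; case: ifPn => _; rewrite ?mul1r ?mul0r.
  apply: le_integral_EFin => [||x].
  - by apply: measurable_funM; [exact: measurable_indic|exact: measurableT_comp].
  - apply: measurable_funM => //; apply: measurable_funD; [exact: measurable_indic|exact: measurable_psi_abs].
  - rewrite indicE; case: (_ \in _); rewrite ?mul1r ?mul0r; last first.
      by rewrite lexx mulr_ge0 ?add0r ?psi_ge0// ltW.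
    rewrite normr_ge0/= mulrC -ler_pdivrMr//; apply: le1_psi => //.
    by rewrite divr_ge0// ltW.
rewrite integralZl_EFin; [|  |  |exact: ltW]; last 2 first.
- by apply: measurable_funD; [exact: measurable_indic|exact: measurable_psi_abs].
- by move=> x; rewrite addr_ge0 ?psi_ge0// indicE.
rewrite integralD_EFin; [| exact: measurable_indic| by move=> x; rewrite indicE|exact: measurable_psi_abs
  | by move=> x; rewrite psi_ge0].
rewrite -(expL_modularE k0 u) integral_indic// setIT.
by apply: lte_mul_pinfty => //; [rewrite lee_fin ltW|exact: lte_add_pinfty].
Qed.

(** From s <= 1 + psi(s) and wt <= 1 one gets |u| wt <= k (wt + psi(|u|/k)): exp L^p embeds into the
    weighted space on which the heat operator is represented by its kernel. *)
Lemma expL_modular_wL1 k u : 0 < k -> measurable_fun setT u ->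
  (expL_modular p k u <= 1)%E -> wL1 u /\ wn u <= k * (pi ^+ d + 1).
Proof.
move=> k0 mu' h; have mw := @measurable_wt R d.
have H : (\int[mu]_x (`|u x| * wt x)%:E <= (k * (pi ^+ d + 1))%:E)%E.
  apply: (@le_trans _ _ (\int[mu]_x (k * (wt x + psi p (`|u x| / k)))%:E)%E).
    apply: le_integral_EFin => [||x].
    - by apply: measurable_funM => //; exact: measurableT_comp.
    - by apply: measurable_funM => //; apply: measurable_funD => //; exact: measurable_psi_abs.
    - rewrite mulr_ge0//=; last by rewrite ltW// wt_gt0.
      have a0 : 0 <= `|u x| / k by rewrite divr_ge0// ltW.
      have := le1_psi p1 a0; have ps := psi_ge0 p (`|u x| / k).
      have ua : `|u x| = k * (`|u x| / k) by rewrite mulrC divfK// gt_eqF.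
      move=> q; have := wt_le1 x; have := wt_gt0 x; rewrite [X in X * _]ua -mulrA ler_pM2l//.
      move: (psi _ _) ps q => b ps; move: (_ / k) a0 (wt x) => a a0 w q w0 w1.
      have h1 := ler_wpM2r (ltW w0) q; have h2 := ler_wpM2l ps w1; lra.
  rewrite integralZl_EFin; [| | |exact: ltW]; last 2 first.
  - by apply: measurable_funD => //; exact: measurable_psi_abs.
  - by move=> x; rewrite addr_ge0 ?psi_ge0// ltW// wt_gt0.
  rewrite integralD_EFin//; [|by move=> x; rewrite ltW// wt_gt0|exact: measurable_psi_abs
    | by move=> x; rewrite psi_ge0].
  rewrite -(expL_modularE k0 u) EFinM lee_pmul2l ?lte_fin// EFinD.
  by apply: leeD => //; exact: integral_wt.
have wi : mu.-integrable setT (EFin \o (fun x => `|u x| * wt x)).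
  apply: integrable_EFin_ge0; last by rewrite (le_lt_trans H)// ltry.
    by apply: measurable_funM => //; exact: measurableT_comp.
  by move=> x; rewrite mulr_ge0// ltW// wt_gt0.
split; last by rewrite -lee_fin /wn EFin_Rintegral.
split => //; apply: (integrable_dominated _ _ wi) => [|x].
  exact: measurable_funM.
by rewrite normrM (ger0_norm (ltW (wt_gt0 x))).
Qed.

(** Convexity, as psi(s/2) <= psi(s)/2, trades a factor 2 in the modular for a factor 2 in the
    scale. *)
Lemma expL_modular_half k u : 0 < k -> measurable_fun setT u ->
  (expL_modular p k u <= 2)%E -> (expL_modular p (2 * k) u <= 1)%E.
Proof.
move=> k0 mu' h; have k20 : 0 < 2 * k by rewrite mulr_gt0.
rewrite (expL_modularE k20 u).
apply: (@le_trans _ _ (\int[mu]_x (2^-1 * psi p (`|u x| / k))%:E)%E).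
  apply: le_integral_EFin => [||x].
  - exact: measurable_psi_abs.
  - by apply: measurable_funM => //; exact: measurable_psi_abs.
  - rewrite psi_ge0/= [leRHS]mulrC (_ : `|u x| / (2 * k) = `|u x| / k / 2); last by rewrite invfM mulrA mulrAC.
    by rewrite psi_half// divr_ge0// ltW.
rewrite integralZl_EFin//; [|exact: measurable_psi_abs|by move=> x; rewrite psi_ge0].
rewrite -(expL_modularE k0 u); apply: le_trans (lee_wpmul2l _ h) _; first by rewrite lee_fin.
by rewrite -EFinM mulVf.
Qed.

Lemma expL_modular_add2 k l u v : 0 < k -> 0 < l -> measurable_fun setT u -> measurable_fun setT v ->
  (expL_modular p k u <= 1)%E -> (expL_modular p l v <= 1)%E ->
  (expL_modular p (k + l) (fun x => (u x + v x)%R) <= 2)%E.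
Proof.
move=> k0 l0 mu' mv hu hv.
have kl0 : 0 < k + l by rewrite addr_gt0.
rewrite (expL_modularE kl0).
apply: (@le_trans _ _ (\int[mu]_x (psi p (`|u x| / k) + psi p (`|v x| / l))%:E)%E).
  apply: le_integral_EFin => [||x].
  - by apply: measurable_psi_abs; exact: measurable_funD.
  - by apply: measurable_funD; exact: measurable_psi_abs.
  - rewrite psi_ge0/=; apply: le_trans (psi_add p1 k0 l0 (normr_ge0 _) (normr_ge0 _)).
    by rewrite le_psi// ?divr_ge0 ?(ltW kl0)// ler_pM2r ?invr_gt0// ler_normD.
rewrite integralD_EFin; [|exact: measurable_psi_abs|by move=> x; rewrite psi_ge0
  |exact: measurable_psi_abs|by move=> x; rewrite psi_ge0].
rewrite -(expL_modularE k0 u) -(expL_modularE l0 v); apply: le_trans (leeD hu hv) _.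
by rewrite -EFinD.
Qed.

(* g lies in L^1 \cap L^oo, with both norms at most A. *)
Definition bnd (g : Rn R d -> R) (A : R) :=
  [/\ measurable_fun setT g, forall x, `|g x| <= A & (\int[mu]_x (`|g x|)%:E <= A%:E)%E].

Lemma bnd_ge0 g A : bnd g A -> 0 <= A.
Proof. by case=> _ h _; apply: le_trans (h [tuple of nseq d 0]). Qed.

Lemma bnd_le g A B : bnd g A -> A <= B -> bnd g B.
Proof.
by case=> mg h1 h2 AB; split => // [x|]; [exact: le_trans AB|apply: (le_trans h2); rewrite lee_fin].
Qed.

Lemma bndN g A : bnd g A -> bnd (fun x => - g x) A.
Proof.
case=> mg h1 h2; split => [|x|]; first exact: measurableT_comp.
  by rewrite normrN.
by under eq_integral do rewrite normrN.
Qed.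

Lemma bndD g h A B : bnd g A -> bnd h B -> bnd (fun x => g x + h x) (A + B).
Proof.
case=> mg g1 g2 [mh h1 h2]; have mn f : measurable_fun setT f -> measurable_fun setT (fun x : Rn R d => `|f x : R|).
  by move=> mf; exact: measurableT_comp.
split; first exact: measurable_funD.
  by move=> x; rewrite (le_trans (ler_normD _ _))// lerD.
apply: (@le_trans _ _ (\int[mu]_x (`|g x| + `|h x|)%:E)%E).
  apply: le_integral_EFin => [||x].
  - by apply: mn; exact: measurable_funD.
  - by apply: measurable_funD; exact: mn.
  - by rewrite normr_ge0 ler_normD.
rewrite integralD_EFin//; [|exact: mn|exact: mn].
by rewrite EFinD leeD.
Qed.

Lemma bndB g h A B : bnd g A -> bnd h B -> bnd (fun x => g x - h x) (A + B).
Proof. by move=> gA /bndN; exact: bndD. Qed.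

Lemma bnd0 : bnd (fun=> 0) 0.
Proof.
split => // [x|]; first by rewrite normr0.
by under eq_integral do rewrite normr0; rewrite integral0.
Qed.

(** The sup bound keeps |g|/k in [0, 1], where psi(s) <= e s; the L^1 bound then controls the
    modular. *)
Lemma bnd_modular g A k : bnd g A -> 0 < k -> expR 1 * A <= k -> (expL_modular p k g <= 1)%E.
Proof.
move=> gA k0 Ak; have A0 := bnd_ge0 gA; case: gA => mg g1 g2.
have e0 : 1 < expR 1 :> R by rewrite expR_gt1.
have gk x : `|g x| <= k.
  by apply: le_trans (g1 x) _; apply: le_trans Ak; rewrite ler_peMl// ltW.
rewrite (expL_modularE k0 g).
apply: (@le_trans _ _ (\int[mu]_x ((expR 1 / k) * `|g x|)%:E)%E).
  apply: le_integral_EFin => [||x].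
  - exact: measurable_psi_abs.
  - by apply: measurable_funM => //; exact: measurableT_comp.
  - rewrite psi_ge0/= -mulrA (mulrC k^-1) psi_le_linear// divr_ge0 ?(ltW k0)//=.
    by rewrite ler_pdivrMr// mul1r.
rewrite integralZl_EFin//; [|exact: measurableT_comp|by rewrite divr_ge0 ?expR_ge0// ltW].
apply: le_trans (lee_wpmul2l _ g2) _; first by rewrite lee_fin divr_ge0 ?expR_ge0// ltW.
by rewrite -EFinM lee_fin mulrAC ler_pdivrMr// mul1r.
Qed.

Lemma bnd_norm_expL g A : bnd g A -> (norm_expL p g <= (expR 1 * A)%:E)%E.
Proof.
move=> gA; have A0 := bnd_ge0 gA; apply/lee_addgt0Pr => e e0.
have eA0 : 0 <= expR 1 * A by rewrite mulr_ge0 ?expR_ge0.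
rewrite -EFinD; apply: norm_expL_le; first by rewrite ltr_wpDl.
by apply: (bnd_modular gA); [rewrite ltr_wpDl | rewrite lerDl ltW].
Qed.

Lemma bnd_in_expL g A : bnd g A -> in_expL p g.
Proof.
move=> gA; have A0 := bnd_ge0 gA.
have k0 : 0 < expR 1 * A + 1 by rewrite ltr_wpDl// mulr_ge0 ?expR_ge0.
apply: (in_expL_modular k0); first by case: gA.
apply: (@le_lt_trans _ _ 1%E); last exact: ltry.
by apply: (bnd_modular gA) => //; rewrite lerDl.
Qed.

End expL_facts.

Lemma measurable_cstM (disp : measure_display) (T : measurableType disp) (R : realType)
  (c : R) (f : T -> R) : measurable_fun setT f -> measurable_fun setT (fun x => c * f x).
Proof. by move=> mf; apply: measurable_funM => //; exact: measurable_cst. Qed.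

Lemma lee_EFin_addr (R : realDomainType) (I : \bar R) (a b q : R) :
  (0 <= I)%E -> (a%:E <= I + b%:E)%E -> q + b <= a -> (q%:E <= I)%E.
Proof.
move=> I0 h1 h2; case: I I0 h1 => [r| |] I0 h1; [|exact: leey|by move: I0; rewrite leeNy_eq].
by move: h1; rewrite -EFinD !lee_fin => h1; have := le_trans h2 h1; rewrite lerD2r.
Qed.

(** * Contraction, decay and smoothing of the heat operator *)

Section heat_expL.
Context {R : realType} {d : nat}.
Hypothesis hd : (0 < d)%N.
Variables beta p : R.
Hypothesis b01 : 0 < beta <= 1.
Hypothesis p1 : 1 < p.
Local Notation mu := (@lebesgue_Rn R d).
Local Notation heat := (@hermite_heat R d beta).
Implicit Types (u v g : Rn R d -> R) (x : Rn R d) (k l t : R).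

Let mK t x : 0 < t -> measurable_fun setT (heatK beta t x).
Proof. exact: measurable_heatK. Qed.

Let K0 t x y : 0 < t -> 0 <= heatK beta t x y.
Proof. by move=> t0; exact: heatK_ge0. Qed.

(** The kernel is symmetric, so the bound on its integral in y also bounds the integral in x that
    Tonelli's theorem produces. *)
Lemma heat_tonelli t (h : Rn R d -> R) (c : R) : 0 < t -> measurable_fun setT h -> (forall x, 0 <= h x) ->
  (forall x, \int[mu]_y (heatK beta t x y)%:E <= c%:E)%E ->
  (\int[mu]_x \int[mu]_y (heatK beta t x y * h y)%:E <= c%:E * \int[mu]_y (h y)%:E)%E.
Proof.
move=> t0 mh h0 hc.
have c0 : 0 <= c.
  rewrite -lee_fin; apply: le_trans (hc [tuple of nseq d 0]).
  by apply: integral_ge0 => y _; rewrite lee_fin K0.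
have mF : measurable_fun setT (fun z : Rn R d * Rn R d => (heatK beta t z.1 z.2 * h z.2)%:E).
  apply/measurable_EFinP; apply: measurable_funM; first exact: measurable_heatK2.
  by apply: (measurableT_comp mh); exact: measurable_snd.
rewrite (@fubini_tonelli _ _ _ _ R mu mu _ mF) => [|z]; last by rewrite lee_fin mulr_ge0 ?K0.
rewrite -integralZl_EFin//; apply: ge0_le_integral.
- exact: measurableT.
- by move=> y _; apply: integral_ge0 => x _; rewrite lee_fin mulr_ge0 ?K0.
- by apply: (@measurable_fun_fubini_tonelli_G _ _ _ _ R mu _ mF) => z; rewrite lee_fin mulr_ge0 ?K0.
- by apply/measurable_EFinP; exact: measurable_funM.
- move=> y _ /=.
  under eq_integral do rewrite heatK_sym mulrC.
  rewrite integralZl_EFin//; [|exact: mK|by move=> x; exact: K0].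
  by rewrite mulrC EFinM lee_wpmul2l ?lee_fin.
Qed.

(* Jensen's inequality by means of the tangent lines of psi, the kernel having
   mass at most 1. *)
Lemma heat_jensen k t u x : 0 < k -> 0 < t -> wL1 u ->
  ((psi p (`|heat t u x| / k))%:E <= \int[mu]_y (heatK beta t x y * psi p (`|u y| / k))%:E)%E.
Proof.
move=> k0 t0 uW; have [mu' _] := uW.
have mau : measurable_fun setT (fun y => `|u y| / k).
  by apply: measurable_funM => //; exact: measurableT_comp.
have auW : wL1 (fun y => `|u y| / k).
  split => //; apply: (@eq_integrable _ _ _ mu setT measurableT (EFin \o (fun x => k^-1 * (`|u x| * wt x)))).
    by move=> y _ /=; congr (_%:E); ring.
  by apply: integrableMl_EFin; exact: wL1_norm.
have i1 := heat_pairing hd b01 x auW t0.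
pose z := \int[mu]_y (`|u y| / k * heatK beta t x y).
have zE : (z%:E = \int[mu]_y (heatK beta t x y * (`|u y| / k))%:E)%E.
  by rewrite /z EFin_Rintegral//; apply: eq_integral => y _; rewrite mulrC.
have z0 : 0 <= z by apply: Rintegral_ge0 => y _; rewrite mulr_ge0 ?K0// divr_ge0// ltW.
have Tz : `|heat t u x| / k <= z.
  rewrite ler_pdivrMr// -lee_fin (le_trans (hermite_heat_norm_le hd b01 x uW t0))//.
  rewrite mulrC EFinM zE -integralZl_EFin; last 3 first.
  - by apply: measurable_funM => //; exact: mK.
  - by move=> y; rewrite mulr_ge0 ?K0// divr_ge0// ltW.
  - exact: ltW.
  rewrite le_eqVlt; apply/orP; left; apply/eqP; apply: eq_integral => y _; congr (_%:E).
  by rewrite mulrCA; congr (_ * _); rewrite mulrC divfK// gt_eqF.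
have [c c0 hc] := psi_tangent p1 z0.
have M1 := heat_submarkov hd x b01 t0.
pose M := \int[mu]_y heatK beta t x y.
have Kint : mu.-integrable setT (EFin \o heatK beta t x).
  apply: integrable_EFin_ge0; [exact: mK|by move=> y; exact: K0|].
  exact: le_lt_trans M1 (ltry _).
have ME : (M%:E = \int[mu]_y (heatK beta t x y)%:E)%E by rewrite /M EFin_Rintegral.
have M0 : 0 <= M by rewrite -lee_fin ME; apply: integral_ge0 => y _; rewrite lee_fin K0.
rewrite -ME lee_fin in M1.
have mp : measurable_fun setT (fun y => psi p (`|u y| / k)) by exact: measurable_psi.
apply: (@le_trans _ _ (psi p z)%:E).
  by rewrite lee_fin le_psi// divr_ge0// ltW.
have : (\int[mu]_y (psi p z * heatK beta t x y + c * (heatK beta t x y * (`|u y| / k)))%:E <=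
        \int[mu]_y (heatK beta t x y * psi p (`|u y| / k) + (c * z) * heatK beta t x y)%:E)%E.
  have mKx : measurable_fun setT (heatK beta t x) by exact: mK.
  have mKu : measurable_fun setT (fun y => heatK beta t x y * (`|u y| / k)) by exact: measurable_funM.
  apply: le_integral_EFin => [||y].
  - by apply: measurable_funD; apply: measurable_cstM.
  - apply: measurable_funD; first exact: measurable_funM mKx mp.
    exact: measurable_cstM.
  - have a0 : 0 <= `|u y| / k by rewrite divr_ge0// ltW.
    have pz : 0 <= psi p z by rewrite psi_ge0.
    have Ky := K0 x y t0; apply/andP; split.
      by rewrite addr_ge0// mulr_ge0// mulr_ge0.
    have := hc _ a0; move: (heatK _ _ _ _) Ky (_ / k) a0 (psi p _) (psi p _) => K Kp a a0 P Q h.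
    have := ler_wpM2l Kp h; lra.
rewrite integralD_EFin; last 4 first.
- by apply: measurable_cstM; exact: mK.
- by move=> y; rewrite mulr_ge0 ?psi_ge0 ?K0.
- by apply: measurable_cstM; exact: measurable_funM (mK x t0) mau.
- by move=> y; rewrite mulr_ge0// mulr_ge0 ?K0// divr_ge0// ltW.
rewrite integralD_EFin; last 4 first.
- exact: measurable_funM (mK x t0) mp.
- by move=> y; rewrite mulr_ge0 ?psi_ge0 ?K0.
- by apply: measurable_cstM; exact: mK.
- by move=> y; rewrite mulr_ge0 ?K0// mulr_ge0.
rewrite (integralZl_EFin _ (mK x t0)) ?psi_ge0//; last by move=> y; exact: K0.
rewrite (integralZl_EFin _ (mK x t0)) ?mulr_ge0//; last by move=> y; exact: K0.
rewrite integralZl_EFin//; last 2 first.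
- by apply: measurable_funM => //; exact: mK.
- by move=> y; rewrite mulr_ge0 ?K0// divr_ge0// ltW.
rewrite -ME -zE.
pose I : \bar R := (\int[mu]_y (heatK beta t x y * psi p (`|u y| / k))%:E)%E; rewrite -/I.
have : (0 <= I)%E.
  by apply: integral_ge0 => y _; rewrite lee_fin mulr_ge0 ?K0 ?psi_ge0.
rewrite -!EFinM -!EFinD => I0 hI; apply: (lee_EFin_addr I0 hI).
(* The mass M may be less than 1: the tangent inequality at s = 0 reads psi(z) <= c z, which pays
   for the deficit. *)
have := hc 0 (lexx 0); rewrite mulr0 addr0 psi0// add0r.
have := psi_ge0 p z; move: (psi p z) => P P0 h1; nra.
Qed.

Lemma heat_expL_modular k t u : 0 < k -> 0 < t -> wL1 u ->
  (expL_modular p k (heat t u) <= expL_modular p k u)%E.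
Proof.
move=> k0 t0 uW; have [mu' _] := uW.
rewrite (expL_modularE p k0 u) (expL_modularE p k0 (heat t u)).
have mp : measurable_fun setT (fun y => psi p (`|u y| / k)) by exact: measurable_psi_abs.
apply: (@le_trans _ _ (\int[mu]_x \int[mu]_y (heatK beta t x y * psi p (`|u y| / k))%:E)%E).
  apply: ge0_le_integral.
  - exact: measurableT.
  - by move=> x _; rewrite lee_fin psi_ge0.
  - by apply/measurable_EFinP; apply: measurable_psi_abs; exact: measurable_hermite_heat.
  - have mF : measurable_fun setT (fun z : Rn R d * Rn R d => (heatK beta t z.1 z.2 * psi p (`|u z.2| / k))%:E).
      apply/measurable_EFinP; apply: measurable_funM; first exact: measurable_heatK2.
      by apply: (measurableT_comp mp); exact: measurable_snd.
    by apply: (@measurable_fun_fubini_tonelli_F _ _ _ _ R mu _ mF) => z; rewrite lee_fin mulr_ge0 ?K0// psi_ge0.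
  - by move=> x _; exact: heat_jensen.
apply: le_trans (@heat_tonelli t (fun y => psi p (`|u y| / k)) 1 t0 mp _ _) _.
- by move=> y; exact: psi_ge0.
- by move=> x; exact: heat_submarkov.
- by rewrite mul1e.
Qed.

Lemma L1_wL1 g (B : R) : measurable_fun setT g -> (\int[mu]_x (`|g x|)%:E <= B%:E)%E ->
  wL1 g /\ wn g <= B.
Proof.
move=> mg gB; have mag : measurable_fun setT (fun x => `|g x| : R) by exact: measurableT_comp.
have mgw : measurable_fun setT (fun x => `|g x| * wt x).
  by apply: measurable_funM => //; exact: measurable_wt.
have H : (\int[mu]_x (`|g x| * wt x)%:E <= B%:E)%E.
  apply: le_trans gB; apply: le_integral_EFin => // x.
  by rewrite mulr_ge0 ?(ltW (wt_gt0 x))//= ler_piMr// wt_le1.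
have gi : mu.-integrable setT (EFin \o (fun x => `|g x| * wt x)).
  apply: integrable_EFin_ge0 => // [x|]; last exact: le_lt_trans H (ltry _).
  by rewrite mulr_ge0// ltW// wt_gt0.
have gW : wL1 g.
  split => //; apply: (integrable_dominated _ _ gi) => [|x].
    by apply: measurable_funM => //; exact: measurable_wt.
  by rewrite normrM (ger0_norm (ltW (wt_gt0 x))).
by split => //; rewrite -lee_fin /wn EFin_Rintegral.
Qed.

Lemma wt_bnd g (a : R) : 0 <= a -> measurable_fun setT g -> (forall x, `|g x| <= a * wt x) ->
  bnd g (a * (pi ^+ d + 1)).
Proof.
move=> a0 mg ga; have pd : 0 <= pi ^+ d :> R by rewrite exprn_ge0// pi_ge0.
split => // [x|].
  apply: le_trans (ga x) _; rewrite ler_wpM2l// (le_trans (wt_le1 x))// lerDr//.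
apply: (@le_trans _ _ (\int[mu]_x (a * wt x)%:E)%E).
  apply: le_integral_EFin => [||x]; last by rewrite normr_ge0 ga.
    exact: measurableT_comp.
  by apply: measurable_funM => //; exact: measurable_wt.
rewrite integralZl_EFin//; [|exact: measurable_wt|by move=> x; rewrite ltW// wt_gt0].
by rewrite EFinM lee_wpmul2l ?lee_fin// (le_trans (@integral_wt R d))// lee_fin lerDl.
Qed.

Lemma heat_L1 : exists2 C, 0 < C & forall t g, 0 < t -> wL1 g ->
  (\int[mu]_x (`|heat t g x|)%:E <= (C * expR (- (t / 2)))%:E * \int[mu]_x (`|g x|)%:E)%E.
Proof.
have [C C0 hC] := heat_mass hd b01; exists C => // t g t0 gW; have [mg _] := gW.
have mag : measurable_fun setT (fun x => `|g x| : R) by exact: measurableT_comp.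
apply: le_trans (@heat_tonelli t (fun y => `|g y|) _ t0 mag _ (fun x => hC t x t0)) => //.
apply: ge0_le_integral.
- exact: measurableT.
- by move=> x _; rewrite lee_fin.
- apply/measurable_EFinP; apply: measurableT_comp => //; exact: measurable_hermite_heat.
- have mF : measurable_fun setT (fun z : Rn R d * Rn R d => (heatK beta t z.1 z.2 * `|g z.2|)%:E).
    apply/measurable_EFinP; apply: measurable_funM; first exact: measurable_heatK2.
    by apply: (measurableT_comp mag); exact: measurable_snd.
  by apply: (@measurable_fun_fubini_tonelli_F _ _ _ _ R mu _ mF) => z; rewrite lee_fin mulr_ge0 ?K0.
- by move=> x _; exact: hermite_heat_norm_le.
Qed.

(** For t <= 1 the modular contracts and e^{1/2} compensates e^{-t/2}. For t > 1 the kernel bound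
    maps into L^1 \cap L^oo with the decay e^{-t/2}. *)
Lemma heat_decay : exists2 M, 0 < M & forall t k u, 0 < t -> 0 < k -> measurable_fun setT u ->
  (expL_modular p k u <= 1)%E -> (expL_modular p (M * expR (- (t / 2)) * k) (heat t u) <= 1)%E.
Proof.
have [C C0 [n [h _]]] := heat_facts hd b01.
pose P : R := pi ^+ d + 1; have P0 : 0 < P by rewrite ltr_wpDl// exprn_ge0// pi_ge0.
have e1 : 1 < expR 1 :> R by rewrite expR_gt1.
exists (expR 2^-1 + expR 1 * (C * P ^+ 2)).
  by rewrite addr_gt0 ?expR_gt0// mulr_gt0 ?expR_gt0// mulr_gt0// exprn_gt0.
move=> t k u t0 k0 mu' hu.
have [uW wu] := expL_modular_wL1 p1 k0 mu' hu.
have mT : measurable_fun setT (heat t u) by exact: measurable_hermite_heat.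
have D0 : 0 <= expR 1 * (C * P ^+ 2) by rewrite mulr_ge0 ?expR_ge0// mulr_ge0 ?(ltW C0)// sqr_ge0.
have et := expR_gt0 (- (t / 2)).
have M0 : 0 < (expR 2^-1 + expR 1 * (C * P ^+ 2)) * expR (- (t / 2)) * k.
  by rewrite !mulr_gt0// ltr_wpDr// expR_gt0.
have [t1|t1] := leP t 1.
  apply: (@le_trans _ _ (expL_modular p k (heat t u))); last first.
    exact: le_trans (heat_expL_modular k0 t0 uW) hu.
  apply: expL_modular_mono => //; rewrite ler_peMl ?(ltW k0)//.
  apply: (@le_trans _ _ (expR 2^-1 * expR (- (t / 2)))).
    by rewrite -expRD -[leLHS]expR0 ler_expR; lra.
  by rewrite ler_wpM2r ?(ltW et)// lerDl.
have tn : 1 <= t ^+ n.+1 by rewrite exprn_ege1// ltW.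
have B : bnd (heat t u) (C * expR (- (t / 2)) * (k * P) * P).
  apply: wt_bnd => //; first by rewrite !mulr_ge0 ?expR_ge0 ?(ltW C0) ?(ltW k0) ?(ltW P0).
  move=> x; apply: le_trans (h u t x uW t0) _.
  have w0 := ltW (wt_gt0 x); rewrite mulrAC; apply: ler_wpM2r => //.
  apply: ler_pM => //; [|exact: wn_ge0|].
    by rewrite divr_ge0 ?mulr_ge0 ?expR_ge0 ?(ltW C0)// (le_trans ler01).
  by rewrite ler_pdivrMr ?(lt_le_trans ltr01)// ler_peMr// mulr_ge0 ?expR_ge0// ltW.
apply: (bnd_modular p1 B) => //.
have -> : expR 1 * (C * expR (- (t / 2)) * (k * P) * P) = (expR 1 * (C * P ^+ 2)) * expR (- (t / 2)) * k by ring.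
by rewrite ler_pM2r// ler_pM2r// lerDr expR_ge0.
Qed.

Lemma heat_time_bnd : exists2 C, 0 < C & exists n : nat, forall s t u, 0 < s -> s <= t -> wL1 u ->
  bnd (fun x => heat t u x - heat s u x) (C * (t - s) / s ^+ n.+1 * wn u).
Proof.
have [C C0 [n [_ h]]] := heat_facts hd b01.
have P0 : 0 < pi ^+ d + 1 :> R by rewrite ltr_wpDl// exprn_ge0// pi_ge0.
exists (C * (pi ^+ d + 1)); first exact: mulr_gt0.
exists n => s t u s0 st uW; have t0 := lt_le_trans s0 st.
have -> : C * (pi ^+ d + 1) * (t - s) / s ^+ n.+1 * wn u = (C * (t - s) / s ^+ n.+1 * wn u) * (pi ^+ d + 1) by ring.
have sn : 0 < s ^+ n.+1 by rewrite exprn_gt0.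
apply: wt_bnd.
- by rewrite mulr_ge0 ?wn_ge0// divr_ge0 ?(ltW sn)// mulr_ge0 ?(ltW C0)// subr_ge0.
- by apply: measurable_funB; apply: measurable_hermite_heat.
- by move=> x; rewrite mulrAC; exact: h.
Qed.

(* \|g\|_{L^1} and \|g\|_{L^r} are both at most B. *)
Definition L1r (r : nat) (g : Rn R d -> R) (B : R) :=
  [/\ measurable_fun setT g, (\int[mu]_x (`|g x|)%:E <= B%:E)%E
    & (\int[mu]_x (`|g x| ^+ r)%:E <= (B ^+ r)%:E)%E].

(* For large r, splitting g at the height B t^(-1/2) beats the singularity
   t^(-n) of the kernel. *)
Lemma heat_smoothing : exists2 C, 0 < C & exists r0 : nat, forall r t g (B : R), (r0 <= r)%N ->
  0 < t -> 0 < B -> L1r r.+1 g B ->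
  bnd (heat t g) (C * expR (- (t / 2)) * B * (1 + (Num.sqrt t)^-1)).
Proof.
have [C C0 [n [h _]]] := heat_facts hd b01.
have [C1 C10 h1] := heat_mass hd b01.
have [C2 C20 h2] := heat_L1.
exists (2 * (C + C1) + C2); first by rewrite addr_gt0// mulr_gt0// addr_gt0.
(* For t <= 1 and the height B t^{-1/2}, the part above the height costs t^{r/2 - (n+1)}, which is
   at most 1 from this exponent on. *)
exists (2 * n.+1)%N => r t g B rn t0 B0 [mg g1 gr].
have [gW wg] := L1_wL1 mg g1.
have mag : measurable_fun setT (fun x => `|g x| : R) by exact: measurableT_comp.
have mgr : measurable_fun setT (fun x => `|g x| ^+ r.+1) by exact: measurable_funX.
have st0 : 0 < Num.sqrt t by rewrite sqrtr_gt0.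
have et := expR_gt0 (- (t / 2)).
have Q1 : 1 <= 1 + (Num.sqrt t)^-1 by rewrite lerDl invr_ge0 ltW.
split; first exact: measurable_hermite_heat.
- move=> x.
  have [grW wgr] : wL1 (fun x => `|g x| ^+ r.+1) /\ wn (fun x => `|g x| ^+ r.+1) <= B ^+ r.+1.
    apply: L1_wL1 => //; under eq_integral do rewrite ger0_norm ?exprn_ge0//.
    exact: gr.
  (* Splitting at the height A = B a: the part below is controlled by the mass of the kernel, the
     part above by |g|^{r+1} / A^r and the singular kernel bound. *)
  have key (a : R) : 0 < a -> `|heat t g x| <= (C1 + C) * expR (- (t / 2)) * B * (a + (a ^+ r * t ^+ n.+1)^-1).
    move=> a0; pose A := B * a; have A0 : 0 < A by exact: mulr_gt0.
    have sp y : `|g y| <= A + `|g y| ^+ r.+1 / A ^+ r.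
      have [le|lt] := leP `|g y| A.
        by apply: (le_trans le); rewrite lerDl divr_ge0 ?exprn_ge0// ltW.
      apply: (@le_trans _ _ (`|g y| ^+ r.+1 / A ^+ r)); last by rewrite lerDr ltW.
      rewrite ler_pdivlMr ?exprn_gt0// exprS ler_wpM2l//.
      by rewrite lerXn2r ?nnegrE ?(ltW A0)// ltW.
    rewrite -lee_fin; apply: le_trans (hermite_heat_norm_le hd b01 x gW t0) _.
    apply: (@le_trans _ _ (\int[mu]_y (A * heatK beta t x y + (A ^+ r)^-1 * (`|g y| ^+ r.+1 * heatK beta t x y))%:E)%E).
      have mKx : measurable_fun setT (heatK beta t x) by exact: mK.
      apply: le_integral_EFin => [||y].
      + exact: measurable_funM.
      + by apply: measurable_funD; apply: measurable_cstM => //; exact: measurable_funM.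
      + rewrite mulr_ge0 ?K0//=.
        apply: le_trans (ler_wpM2l (K0 x y t0) (sp y)) _.
        by rewrite le_eqVlt; apply/orP; left; apply/eqP; ring.
    rewrite integralD_EFin; last 4 first.
    + by apply: measurable_cstM; exact: mK.
    + by move=> y; rewrite mulr_ge0 ?K0// ltW.
    + by apply: measurable_cstM; exact: measurable_funM mgr (mK x t0).
    + by move=> y; rewrite mulr_ge0 ?invr_ge0 ?exprn_ge0 ?(ltW A0)// mulr_ge0 ?exprn_ge0 ?K0.
    rewrite (integralZl_EFin _ (mK x t0)) ?(ltW A0)//; last by move=> y; exact: K0.
    rewrite integralZl_EFin; last 3 first.
    + exact: measurable_funM mgr (mK x t0).
    + by move=> y; rewrite mulr_ge0 ?exprn_ge0 ?K0.
    + by rewrite invr_ge0 exprn_ge0// ltW.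
    rewrite -(hermite_heat_EFin hd x b01 t0 grW).
    have b1 : (A%:E * \int[mu]_y (heatK beta t x y)%:E <= (A * (C1 * expR (- (t / 2))))%:E)%E.
      by rewrite (EFinM A) lee_wpmul2l ?lee_fin ?(ltW A0)// h1.
    have tn0 : 0 < t ^+ n.+1 by rewrite exprn_gt0.
    have b2 : heat t (fun x => `|g x| ^+ r.+1) x <= C * expR (- (t / 2)) / t ^+ n.+1 * B ^+ r.+1.
      apply: le_trans (ler_norm _) _; apply: (le_trans (h _ t x grW t0)).
      have w0 := ltW (wt_gt0 x); have w1 := wt_le1 x.
      have c0 : 0 <= C * expR (- (t / 2)) / t ^+ n.+1 by rewrite divr_ge0 ?mulr_ge0 ?(ltW C0) ?(ltW et)// ltW.
      apply: ler_pM => //; [exact: mulr_ge0|exact: wn_ge0|by rewrite ler_piMr].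
    have b3 : (A ^+ r)^-1 * heat t (fun x => `|g x| ^+ r.+1) x <= (A ^+ r)^-1 * (C * expR (- (t / 2)) / t ^+ n.+1 * B ^+ r.+1).
      by rewrite ler_wpM2l// invr_ge0 exprn_ge0// ltW.
    apply: le_trans (leeD b1 (_ : (_ <= (A ^- r * (C * expR (- (t / 2)) / t ^+ n.+1 * B ^+ r.+1))%:E)%E)) _.
      by rewrite -EFinM lee_fin; exact: b3.
    rewrite -EFinD lee_fin.
    have -> : (A ^+ r)^-1 * (C * expR (- (t / 2)) / t ^+ n.+1 * B ^+ r.+1) =
        C * expR (- (t / 2)) * B * (a ^+ r * t ^+ n.+1)^-1.
      have := exprn_gt0 r a0; have := exprn_gt0 r B0; rewrite /A exprMn (exprS B r).
      move: (t ^+ n.+1) tn0 (a ^+ r) (B ^+ r) (expR _) => T T0 a' B' e B'0 a'0.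
      by field; rewrite ?gt_eqF.
    have I0 : 0 <= (a ^+ r * t ^+ n.+1)^-1 by rewrite invr_ge0 mulr_ge0 ?exprn_ge0 ?(ltW a0)// ltW.
    have eB : 0 <= expR (- (t / 2)) * B by rewrite mulr_ge0// ltW.
    rewrite /A; move: (_^-1) I0 (expR _) eB => I I0 e eB.
    have f1 : 0 <= C * (e * B) * a by rewrite mulr_ge0 ?(ltW a0)// mulr_ge0// ltW.
    have f2 : 0 <= C1 * (e * B) * I by rewrite mulr_ge0// mulr_ge0// ltW.
    nra.
  apply: (@le_trans _ _ ((C1 + C) * expR (- (t / 2)) * B * (2 * (1 + (Num.sqrt t)^-1)))); last first.
    have -> : (C1 + C) * expR (- (t / 2)) * B * (2 * (1 + (Num.sqrt t)^-1)) = (2 * (C + C1)) * (expR (- (t / 2)) * B * (1 + (Num.sqrt t)^-1)) by ring.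
    have -> : (2 * (C + C1) + C2) * expR (- (t / 2)) * B * (1 + (Num.sqrt t)^-1) = (2 * (C + C1) + C2) * (expR (- (t / 2)) * B * (1 + (Num.sqrt t)^-1)) by ring.
    apply: ler_wpM2r; last by rewrite lerDl ltW.
    by apply: mulr_ge0; [rewrite mulr_ge0// ltW|exact: le_trans ler01 Q1].
  have c0 : 0 <= (C1 + C) * expR (- (t / 2)) * B by rewrite !mulr_ge0 ?addr_ge0 ?(ltW C10) ?(ltW C0) ?(ltW et) ?(ltW B0).
  have [t1|t1] := leP t 1.
    have s1 : Num.sqrt t <= 1 by rewrite -sqrtr1 ler_sqrt.
    apply: le_trans (key (Num.sqrt t)^-1 _) _; first by rewrite invr_gt0.
    apply: ler_wpM2l => //.
    suff : ((Num.sqrt t)^-1 ^+ r * t ^+ n.+1)^-1 <= 1 by have := Q1; lra.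
    have tE : t = Num.sqrt t ^+ 2 by rewrite sqr_sqrtr// ltW.
    rewrite {2}tE -exprM exprVn invfM invrK ler_pdivrMr ?exprn_gt0// mul1r.
    by rewrite ler_wiXn2l// ltW.
  apply: le_trans (key 1 ltr01) _; apply: ler_wpM2l => //.
  have : (1 ^+ r * t ^+ n.+1)^-1 <= 1.
    by rewrite expr1n mul1r invf_le1 ?exprn_gt0// exprn_ege1// ltW.
  by have := Q1; lra.
- apply: le_trans (h2 t g t0 gW) _.
  apply: le_trans (lee_wpmul2l _ g1) _; first by rewrite lee_fin mulr_ge0// ltW.
  rewrite -EFinM lee_fin.
  have eB : 0 <= expR (- (t / 2)) * B by rewrite mulr_ge0// ltW.
  have -> : (2 * (C + C1) + C2) * expR (- (t / 2)) * B * (1 + (Num.sqrt t)^-1) =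
    (2 * (C + C1) + C2) * (1 + (Num.sqrt t)^-1) * (expR (- (t / 2)) * B) by ring.
  rewrite -[leLHS]mulrA; apply: ler_wpM2r => //.
  have D0 : 0 <= 2 * (C + C1) by rewrite mulr_ge0// addr_ge0// ltW.
  by move: (_^-1) Q1 => s q1; move: (2 * _) D0 C20 => D D0 C20; nra.
Qed.

End heat_expL.

(* Measurability of s |-> norm_expL p (v s) is not known in general. *)
Lemma ge0_le_integral_nonmeasurable (disp : measure_display) (T : measurableType disp) (R : realType)
  (mu : {measure set T -> \bar R}) (D : set T) (f g : T -> \bar R) :
  (forall x, D x -> (0 <= f x)%E) -> (forall x, D x -> (f x <= g x)%E) ->
  (\int[mu]_(x in D) f x <= \int[mu]_(x in D) g x)%E.
Proof.
move=> f0 fg; have g0 x : D x -> (0 <= g x)%E by move=> Dx; exact: le_trans (f0 x Dx) (fg x Dx).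
rewrite (ge0_integralE _ f0) (ge0_integralE _ g0); apply: ereal_sup_le => _ [h /= hf <-].
exists h => // x; apply: le_trans (hf x) _.
by rewrite !patchE; case: ifPn => //; rewrite inE; exact: fg.
Qed.

(** * Bochner integrals of paths in L^1 \cap L^oo *)

Section singular_weight.
Context {R : realType}.
Local Notation leb := (@lebesgue_measure R).
Implicit Types (a b s t : R).

(* a majorant of the singularity t^(-1/2), with primitive -2 exp (- sqrt t) *)
Definition Wk t : R := expR (- Num.sqrt t) * (Num.sqrt t)^-1.

Lemma Wk_ge0 t : 0 <= Wk t.
Proof. by rewrite mulr_ge0 ?expR_ge0// invr_ge0 sqrtr_ge0. Qed.

Lemma measurable_sqrt : measurable_fun setT (@Num.sqrt R).
Proof. by apply: continuous_measurable_fun; exact: sqrt_continuous. Qed.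

Lemma measurable_Wk : measurable_fun setT Wk.
Proof.
have ms := measurable_sqrt.
apply: measurable_funM.
  by apply: measurableT_comp => //; exact: measurableT_comp.
rewrite (_ : (fun x => _) = (fun t => Num.sqrt t `^ (-1))); last first.
  by apply/funext => t; rewrite powR_inv1// sqrtr_ge0.
exact: (measurableT_comp (measurable_powR (-1)) ms).
Qed.

(** With q = sqrt t one has 1 + q <= e^q and q - q^2/2 <= 4 - q - q^2/4, the latter being (q - 4)^2
    >= 0. *)
Lemma expR_smoothing_Wk t : 0 < t ->
  expR (- (t / 2)) * (1 + (Num.sqrt t)^-1) <= expR 4 * (expR (- (t / 4)) * Wk t).
Proof.
move=> t0; have q0 : 0 < Num.sqrt t by rewrite sqrtr_gt0.
have tE : t = Num.sqrt t ^+ 2 by rewrite sqr_sqrtr// ltW.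
rewrite /Wk; move: (Num.sqrt t) q0 tE => q q0 tE.
have -> : 1 + q^-1 = (1 + q) / q by rewrite mulrDl divff ?gt_eqF// mul1r addrC.
rewrite !mulrA ler_pM2r ?invr_gt0//.
apply: (@le_trans _ _ (expR (- (t / 2)) * expR q)).
  by rewrite ler_wpM2l ?expR_ge0// expR_ge1Dx.
rewrite -!expRD ler_expR tE.
have := sqr_ge0 (q - 4); nra.
Qed.

Lemma is_derive_expR_sqrt t s : s < t ->
  is_derive s 1 (fun u => 2 * expR (- Num.sqrt (t - u))) (Wk (t - s)).
Proof.
move=> st; have ts : 0 < t - s by rewrite subr_gt0.
have h1 : is_derive s 1 (fun u => t - u) (-1).
  have := @is_deriveB _ _ _ (cst t) id s 1 0 1 (is_derive_cst _ _ _) (is_derive_id _ _).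
  by rewrite sub0r.
have h2 := @is_derive1_sqrt R _ ts.
have h3 : is_derive s 1 (fun u => Num.sqrt (t - u)) ((2 * Num.sqrt (t - s))^-1 * -1).
  exact: (@is_derive1_comp R (@Num.sqrt R) (fun u => t - u) s _ _ h2 h1).
have h4 : is_derive s 1 (fun u => - Num.sqrt (t - u)) (- ((2 * Num.sqrt (t - s))^-1 * -1)) by exact: is_deriveN.
have h5 : is_derive s 1 (fun u => expR (- Num.sqrt (t - u)))
    (expR (- Num.sqrt (t - s)) * - ((2 * Num.sqrt (t - s))^-1 * -1)).
  exact: (@is_derive1_comp R (@expR R) (fun u => - Num.sqrt (t - u)) s _ _ (is_derive_expR _) h4).
have h6 := @is_deriveZ _ _ _ _ 2 _ _ _ h5.
apply: (is_derive_eq h6); rewrite /Wk.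
have q0 : Num.sqrt (t - s) != 0 by rewrite gt_eqF// sqrtr_gt0.
by rewrite /GRing.scale/=; field.
Qed.

Lemma integral_Wk_lt a b t : a < b -> b < t ->
  (\int[leb]_(s in `[a, b]) (Wk (t - s))%:E =
   (2 * expR (- Num.sqrt (t - b)) - 2 * expR (- Num.sqrt (t - a)))%:E)%E.
Proof.
move=> ab bt; have dW s := @is_derive_expR_sqrt t s.
have cF s : s < t -> {for s, continuous (fun u => 2 * expR (- Num.sqrt (t - u)))}.
  move=> st; apply/differentiable_continuous/derivable1_diffP.
  exact: (@ex_derive _ _ _ _ _ _ _ (dW s st)).
rewrite (@continuous_FTC2 R (fun s => Wk (t - s)) (fun u => 2 * expR (- Num.sqrt (t - u))))//.
- apply: continuous_in_subspaceT => s; rewrite inE/= in_itv/= => /andP[_ sb].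
  have st : 0 < t - s by rewrite subr_gt0 (le_lt_trans sb).
  have ct : {for s, continuous (fun u => t - u)} by apply: continuousB => //; exact: cst_continuous.
  have cs : {for s, continuous (fun u => Num.sqrt (t - u))}.
    by apply: (@continuous_comp _ _ _ (fun u => t - u) (@Num.sqrt R)) => //; exact: sqrt_continuous.
  have ce : {for s, continuous (fun u => expR (- Num.sqrt (t - u)))}.
    apply: (@continuous_comp _ _ _ (fun u => - Num.sqrt (t - u)) expR); last exact: continuous_expR.
    exact: continuousN.
  have cV : {for s, continuous (fun u => (Num.sqrt (t - u))^-1)}.
    by apply: continuousV => //; rewrite gt_eqF// sqrtr_gt0.
  exact: (continuousM ce cV).
- split => [s|| ].
  + rewrite in_itv/= => /andP[_ sb].
    exact: (@ex_derive _ _ _ _ _ _ _ (dW s (lt_trans sb bt))).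
  + by apply: cvg_at_right_filter; apply: cF; exact: lt_trans bt.
  + by apply: cvg_at_left_filter; exact: cF.
- move=> s; rewrite in_itv/= => /andP[_ sb]; rewrite derive1E.
  exact: (@derive_val _ _ _ _ _ _ _ (dW s (lt_trans sb bt))).
Qed.

(** The bound depends on the length b - a alone. The case b = t, where the weight is singular, is
    reached by monotone convergence along the intervals [a, b - h n]. *)
Lemma integral_Wk a b t : a <= b -> b <= t ->
  (\int[leb]_(s in `[a, b[) (Wk (t - s))%:E <= (2 * (1 - expR (- Num.sqrt (b - a))))%:E)%E.
Proof.
rewrite le_eqVlt => /predU1P[->|ab bt].
  by rewrite set_itvco0 integral_set0 => _; rewrite subrr sqrtr0 oppr0 expR0 subrr mulr0.
have mW D : measurable_fun D (fun s => (Wk (t - s))%:E).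
  apply: (@measurable_funS _ _ _ _ setT) => //; apply/measurable_EFinP.
  by apply: (measurableT_comp measurable_Wk); exact: measurable_funB.
pose h (n : nat) := (b - a) / n.+2%:R.
have n0 n : 0 < n.+2%:R :> R by [].
have h0 n : 0 < h n by rewrite divr_gt0// subr_gt0.
have h1 n : h n < b - a by rewrite /h ltr_pdivrMr// ltr_pMr ?subr_gt0// ltr1n.
pose F n := `[a, b - h n]%classic.
have FU : \bigcup_n F n = `[a, b[%classic.
  apply/seteqP; split => s.
    move=> [n _]; rewrite /F/= !in_itv/= => /andP[-> sb]; rewrite (le_lt_trans sb)//.
    by rewrite ltrBlDr ltrDl.
  rewrite /= in_itv/= => /andP[sa sb].
  have bs : 0 < b - s by rewrite subr_gt0.
  exists (Num.truncn ((b - a) / (b - s))) => //; rewrite /F/= in_itv/= sa/= lerBrDr -lerBrDl.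
  rewrite /h ler_pdivrMr// -ler_pdivrMl// mulrC.
  have := truncnS_gt ((b - a) / (b - s)).
  by move=> /ltW /le_trans; apply; rewrite ler_nat.
have := @ge0_nondecreasing_set_cvg_integral _ (measurableTypeR R) R F (fun s => (Wk (t - s))%:E) leb.
rewrite FU => cvgI; have {}cvgI := cvgI _ _ _ _.
have ndF : nondecreasing_seq F.
  move=> m n mn; rewrite subsetEset => s; rewrite /F/= !in_itv/= => /andP[-> /le_trans]; apply.
  rewrite lerB// /h ler_wpM2l ?subr_ge0 ?(ltW ab)// lef_pV2 ?posrE// ler_nat !ltnS//.
have {cvgI} := cvgI ndF (fun=> measurable_itv _) (fun=> mW _) (fun i x _ => _).
move=> cvgI;
have W0 (x : R) : (0 <= (Wk (t - x))%:E)%E by rewrite lee_fin Wk_ge0.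
have {W0}cvgI := cvgI W0.
rewrite -(cvg_lim _ cvgI)//; apply: lime_le; first by apply/cvg_ex; eexists; exact: cvgI.
apply: nearW => n.
rewrite integral_Wk_lt; last 2 first.
- by rewrite ltrBrDr -ltrBrDl.
- by apply: lt_le_trans bt; rewrite ltrBlDr ltrDl.
rewrite lee_fin -mulrBr ler_pM2l//.
set x := t - (b - h n); set y := t - a.
have x0 : 0 <= x by rewrite subr_ge0 (le_trans _ bt)// lerBlDr lerDl ltW.
have xy : x <= y by rewrite /x /y lerB// lerBrDr -lerBrDl ltW.
have yx : y - x <= b - a by rewrite /x /y; have := h0 n; lra.
(* Subadditivity of the square root removes the dependence on the distance from b to t. *)
have sq : Num.sqrt y <= Num.sqrt x + Num.sqrt (b - a).
  rewrite -(@ler_pXn2r _ 2) ?nnegrE ?addr_ge0 ?sqrtr_ge0//.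
  have y0 := le_trans x0 xy; have ba0 : 0 <= b - a by rewrite subr_ge0 ltW.
  rewrite sqrrD !sqr_sqrtr//.
  have : 0 <= Num.sqrt x * Num.sqrt (b - a) by rewrite mulr_ge0 ?sqrtr_ge0.
  rewrite mulr2n; lra.
have e2 : expR (- Num.sqrt x) * expR (- Num.sqrt (b - a)) <= expR (- Num.sqrt y).
  by rewrite -expRD ler_expR -opprD lerN2.
have e3 : expR (- Num.sqrt x) <= 1 by rewrite expR_le1 oppr_le0 sqrtr_ge0.
have e4 : expR (- Num.sqrt (b - a)) <= 1 by rewrite expR_le1 oppr_le0 sqrtr_ge0.
move: (expR _) (expR (- Num.sqrt (b - a))) (expR (- Num.sqrt y)) e2 e3 e4 => p q r *; nra.
Qed.

End singular_weight.

(** * Limits and time integrals in L^1 \cap L^oo *)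

Section bnd_limits.
Context {R : realType} {d : nat}.
Local Notation mu := (@lebesgue_Rn R d).
Local Notation leb := (@lebesgue_measure R).
Implicit Types (x : Rn R d) (s t : R).

Lemma bnd_lim (g_ : nat -> Rn R d -> R) (g : Rn R d -> R) (A : R) :
  (forall n, bnd (g_ n) A) -> (forall x, g_ n x @[n --> \oo] --> g x) -> bnd g A.
Proof.
move=> gA gg; have mg : measurable_fun setT g.
  by apply: (@measurable_fun_cvg _ _ _ setT g_) => [n|x _]; [case: (gA n)|exact: gg].
split => // [x|].
  apply: (cvgr_to_le (cvg_norm (gg x))); apply: nearW => n; by case: (gA n).
have mn n : measurable_fun setT (fun x => (`|g_ n x|)%:E).
  by apply/measurable_EFinP; apply: measurableT_comp => //; case: (gA n).
have F := @fatou _ _ R mu setT measurableT (fun n x => (`|g_ n x|)%:E) mn (fun n x _ => normr_ge0 _).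
have -> : (\int[mu]_x (`|g x|)%:E = \int[mu]_x limn_einf (fun n => (`|g_ n x|)%:E))%E.
  apply: eq_integral => x _.
  have c : (`|g_ n x|)%:E @[n --> \oo] --> (`|g x|)%:E by apply: cvg_EFin; [exact: nearW|exact: cvg_norm].
  rewrite is_cvg_limn_einfE; first by apply/esym/cvg_lim.
  by apply/cvg_ex; eexists; exact: c.
apply: (le_trans F); rewrite limn_einf_lim; apply: lime_le; first exact: is_cvg_einfs.
apply: nearW => n; apply: ge_ereal_inf; exists (\int[mu]_x (`|g_ n x|)%:E)%E; last by case: (gA n).
by exists n => /=.
Qed.

(** Minkowski's inequality for integrals, pointwise for the sup bound and by Tonelli's theorem for
    the L^1 bound; the one majorant b serves both. *)
Lemma bnd_integralT (H : R -> Rn R d -> R) (b : R -> R) (A : R) :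
  measurable_fun setT (fun z : measurableTypeR R * Rn R d => H z.1 z.2) ->
  measurable_fun setT (b : measurableTypeR R -> R) ->
  (forall s, bnd (H s) (b s)) -> (\int[leb]_s (b s)%:E <= A%:E)%E ->
  (forall x, leb.-integrable setT (EFin \o (H ^~ x))) /\
  bnd (fun x => \int[leb]_s H s x) A.
Proof.
move=> mH mb hb bA.
have b0 s : 0 <= b s by exact: bnd_ge0 (hb s).
have mHx x : measurable_fun setT ((H ^~ x) : measurableTypeR R -> R).
  have mp : measurable_fun setT (fun s : measurableTypeR R => (s, x)).
    by apply: measurable_fun_pair; [exact: measurable_id|exact: measurable_cst].
  exact: (measurableT_comp mH mp).
have ib : leb.-integrable setT (EFin \o b).
  by apply: integrable_EFin_ge0 => //; exact: le_lt_trans bA (ltry _).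
have iH x : leb.-integrable setT (EFin \o (H ^~ x)).
  by apply: (integrable_dominated (mHx x) _ ib) => s; case: (hb s).
split => //.
have mE : measurable_fun setT (fun z : measurableTypeR R * Rn R d => (H z.1 z.2)%:E).
  exact/measurable_EFinP.
have mI : measurable_fun setT (fun x => \int[leb]_s H s x).
  apply/measurable_EFinP.
  rewrite (_ : _ \o _ = fun x => (\int[leb]_s (H s x)%:E)%E); last first.
    by apply/funext => x /=; rewrite EFin_Rintegral.
  under eq_fun do rewrite integralE.
  pose e (z : measurableTypeR R * Rn R d) := (H z.1 z.2)%:E.
  have mP : measurable_fun setT (e^\+)%E by exact: measurable_funepos.
  have mM : measurable_fun setT (e^\-)%E by exact: measurable_funeneg.
  have P0 z : (0 <= e^\+ z)%E by exact: funepos_ge0.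
  have M0 z : (0 <= e^\- z)%E by exact: funeneg_ge0.
  apply: emeasurable_funB.
    rewrite (_ : (fun x => _) = fubini_G leb (e^\+)%E); first exact: measurable_fun_fubini_tonelli_G.
    by apply/funext => x; rewrite /fubini_G; apply: eq_integral => s _; rewrite /e !funeposE.
  rewrite (_ : (fun x => _) = fubini_G leb (e^\-)%E); first exact: measurable_fun_fubini_tonelli_G.
  by apply/funext => x; rewrite /fubini_G; apply: eq_integral => s _; rewrite /e !funenegE.
have mN : measurable_fun setT (fun z : measurableTypeR R * Rn R d => (`|H z.1 z.2|)%:E).
  by apply/measurable_EFinP; exact: measurableT_comp.
have N0 (z : measurableTypeR R * Rn R d) : (0 <= (`|H z.1 z.2|)%:E)%E by rewrite lee_fin.
split => // [x|].
  rewrite -lee_fin; apply: le_trans (normr_Rintegral_leE (iH x)) _; apply: le_trans bA.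
  apply: le_integral_EFin => // [|s]; first exact: measurableT_comp.
  by rewrite normr_ge0; case: (hb s) => _ -> _.
apply: (@le_trans _ _ (\int[mu]_x \int[leb]_s (`|H s x|)%:E)%E).
  apply: ge0_le_integral.
  - exact: measurableT.
  - by move=> x _; rewrite lee_fin.
  - by apply/measurable_EFinP; exact: measurableT_comp.
  - have h := measurable_fun_fubini_tonelli_G (m1 := leb) _ mN N0; exact h.
  - by move=> x _; exact: normr_Rintegral_leE.
rewrite -(@fubini_tonelli _ _ _ _ R leb mu _ mN N0).
apply: le_trans bA; apply: ge0_le_integral.
- exact: measurableT.
- by move=> s _; apply: integral_ge0 => x _; rewrite lee_fin.
- have h := measurable_fun_fubini_tonelli_F (m2 := mu) _ mN N0; exact h.
- exact/measurable_EFinP.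
- by move=> s _ /=; case: (hb s).
Qed.

Lemma bnd_integral (D : set R) (G : R -> Rn R d -> R) (b : R -> R) (A : R) :
  measurable (D : set (measurableTypeR R)) ->
  measurable_fun setT (fun z : measurableTypeR R * Rn R d => \1_D z.1 * G z.1 z.2) ->
  measurable_fun setT (b : measurableTypeR R -> R) ->
  (forall s, D s -> bnd (G s) (b s)) -> (\int[leb]_(s in D) (b s)%:E <= A%:E)%E ->
  (forall x, leb.-integrable D (EFin \o (G ^~ x))) /\
  bnd (fun x => \int[leb]_(s in D) G s x) A.
Proof.
move=> mD mG mb hb bA.
have mi : measurable_fun setT (\1_D : measurableTypeR R -> R) by exact: measurable_indic.
have := @bnd_integralT (fun s x => \1_D s * G s x) (fun s => \1_D s * b s) A mG (measurable_funM mi mb).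
have hb' s : bnd (fun x => \1_D s * G s x) (\1_D s * b s).
  have [sD|sD] := pselect (D s).
    have -> : \1_D s = 1 :> R by rewrite indicE mem_set.
    by rewrite mul1r; under eq_fun do rewrite mul1r; exact: hb.
  have -> : \1_D s = 0 :> R by rewrite indicE memNset.
  by rewrite mul0r; under eq_fun do rewrite mul0r; exact: bnd0.
have E h : (fun s : R => (\1_D s * h s)%:E) = ((EFin \o h) \_ D).
  by apply/funext => s; rewrite patchE indicE /=; case: (_ \in _); rewrite ?mul1r ?mul0r.
move=> /(_ hb'); have <- : (\int[leb]_(s in D) (b s)%:E = \int[leb]_s (\1_D s * b s)%:E)%E.
  by rewrite E -integral_mkcond.
move=> /(_ bA)[h1 h2]; split => [x|].
  apply/(integrable_mkcond _ mD).
  by have := h1 x; congr (leb.-integrable _ _); exact: E.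
congr (bnd _ A): h2; apply/funext => x.
by rewrite [RHS]Rintegral_mkcond; apply: eq_Rintegral => s _; rewrite patchE indicE; case: (_ \in _); rewrite ?mul1r ?mul0r.
Qed.

End bnd_limits.

Lemma lebesgue_indic (R : realType) (A : set (measurableTypeR R)) : measurable A ->
  (\int[@lebesgue_measure R]_s (\1_A s)%:E = @lebesgue_measure R A)%E.
Proof. by move=> mA; rewrite integral_indic// setIT. Qed.

(** * Step functions and Bochner integrals of norm-continuous paths *)

Section steps.
Context {R : realType} {d : nat}.
Variable p : R.
Hypothesis p1 : 1 < p.
Local Notation mu := (@lebesgue_Rn R d).
Local Notation leb := (@lebesgue_measure R).
Implicit Types (x : Rn R d) (s t : R) (G : R -> Rn R d -> R).

(* uniform continuity on [eta, T] for the norm of L^1 \cap L^oo *)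
Definition ucon (eta T : R) G := forall e, 0 < e -> exists2 h, 0 < h &
  forall s s', eta <= s -> s <= s' -> s' <= T -> s' - s <= h ->
  bnd (fun x => G s' x - G s x) e.

Lemma ucon_add eta T G H : ucon eta T G -> ucon eta T H -> ucon eta T (fun s x => G s x + H s x).
Proof.
move=> uG uH e e0; have e2 : 0 < e / 2 by rewrite divr_gt0.
have [h h0 hG] := uG _ e2; have [k k0 hH] := uH _ e2.
exists (Num.min h k); first by rewrite lt_min h0 k0.
move=> s s' es ss' s'T; rewrite le_min => /andP[sh sk].
rewrite [X in bnd _ X]splitr.
rewrite (_ : (fun x => _) = (fun x => (G s' x - G s x) + (H s' x - H s x))).
  by apply: bndD; [exact: hG|exact: hH].
by apply/funext => x; ring.
Qed.

(** Sampling at the left endpoints of a uniform grid whose mesh is at most the modulus of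
    continuity; half-open cells make exactly one summand active at each time. *)
Lemma step_exists eta T e G : eta < T -> 0 < e -> (forall s, eta <= s <= T -> in_expL p (G s)) ->
  ucon eta T G -> exists S : @expL_step R d p,
  (forall s, eta <= s < T -> bnd (fun x => G s x - step_eval S s x) e) /\
  (forall s x, ~~ (eta <= s < T) -> step_eval S s x = 0).
Proof.
move=> etaT e0 iG uG; have [h h0 hG] := uG e e0.
pose N := Num.truncn ((T - eta) / h); pose k := (T - eta) / N.+1%:R.
have TE : 0 < T - eta by rewrite subr_gt0.
have k0 : 0 < k by rewrite divr_gt0.
have kh : k <= h.
  rewrite /k ler_pdivrMr// mulrC -ler_pdivrMr// ltW//.
  by have /andP[_] := truncn_itv (ltW (divr_gt0 TE h0)).
have Nk : N.+1%:R * k = T - eta by rewrite mulrC divfK// pnatr_eq0.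
pose A (i : 'I_N.+1) : set R := `[eta + i%:R * k, eta + i.+1%:R * k[%classic.
have mA i : measurable (A i : set (measurableTypeR R)) by exact: measurable_itv.
have fA i : (leb (A i) < +oo)%E.
  rewrite /A (@lebesgue_measure_itv R `[eta + i%:R * k, eta + i.+1%:R * k[)/=.
  by case: ifPn => _; rewrite ?ltry// -EFinB ltry.
have iA (i : 'I_N.+1) : in_expL p (G (eta + i%:R * k)).
  apply: iG; rewrite lerDl mulr_ge0 ?(ltW k0)//= -lerBrDl -Nk ler_pM2r// ler_nat.
  exact: ltnW.
exists (@ExpLStep R d p N.+1 A (fun i => G (eta + i%:R * k)) mA fA iA); split.
  move=> s /andP[es sT].
  have q0 : 0 <= (s - eta) / k by rewrite divr_ge0 ?(ltW k0)// subr_ge0.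
  have /andP[i1 i2] := truncn_itv q0.
  set i0 := Num.truncn _ in i1 i2.
  have iN : (i0 < N.+1)%N.
    rewrite -(ltr_nat R); apply: (le_lt_trans i1).
    by rewrite ltr_pdivrMr// Nk ltrD2r.
  rewrite ler_pdivlMr// in i1; rewrite ltr_pdivrMr// in i2.
  have E x : step_eval (@ExpLStep R d p N.+1 A (fun i => G (eta + i%:R * k)) mA fA iA) s x = G (eta + i0%:R * k) x.
    rewrite /step_eval/= (bigD1 (Ordinal iN))//= big1 => [|j jn].
      by rewrite addr0 indicE mem_set ?mul1r// /A/= in_itv/= -lerBrDl i1 -ltrBlDl.
    rewrite indicE memNset ?mul0r// /A/= in_itv/= => /andP[]; rewrite -lerBrDl -ltrBlDl => j1 j2.
    have a1 : (j%:R < i0.+1%:R :> R) by rewrite -(ltr_pM2r k0) (le_lt_trans j1).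
    have a2 : (i0%:R < j.+1%:R :> R) by rewrite -(ltr_pM2r k0) (le_lt_trans i1).
    move: a1 a2 jn; rewrite !ltr_nat !ltnS => a1 a2; rewrite -val_eqE/=.
    by rewrite eqn_leq a1 a2.
  under eq_fun do rewrite E.
  apply: hG.
  - by rewrite lerDl mulr_ge0// ltW.
  - by rewrite -lerBrDl.
  - exact: ltW.
  - apply: le_trans kh; rewrite opprD addrA lerBlDr ltW//.
    by move: i2; rewrite -natr1 mulrDl mul1r (addrC _ k).
move=> s x sn; rewrite /step_eval/= big1// => i _.
rewrite indicE memNset ?mul0r// /A/= in_itv/= => /andP[j1 j2].
case/negP: sn; apply/andP; split.
  by apply: le_trans j1; rewrite lerDl mulr_ge0// ltW.
apply: (lt_le_trans j2); rewrite -lerBrDl -Nk ler_pM2r// ler_nat.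
exact: ltn_ord.
Qed.

Lemma measurable_step_eval (S : @expL_step R d p) :
  measurable_fun setT (fun z : measurableTypeR R * Rn R d => step_eval S z.1 z.2).
Proof.
rewrite /step_eval; apply: measurable_sum => i; apply: measurable_funM.
  have mi : measurable_fun setT (\1_(step_set i) : measurableTypeR R -> R).
    by apply: measurable_indic; exact: step_measurable.
  exact: (measurableT_comp mi measurable_fst).
have mv : measurable_fun setT (step_val i) by case: (step_in_expL i) => -[].
exact: (measurableT_comp mv measurable_snd).
Qed.

Lemma step_integralE (S : @expL_step R d p) (D : set R) x : measurable (D : set (measurableTypeR R)) ->
  leb.-integrable D (EFin \o (fun s => step_eval S s x)) /\
  step_integral S D x = \int[leb]_(s in D) step_eval S s x.
Proof.
move=> mD; pose A i := @step_set R d p S i; pose h i : R -> R := \1_(A i `&` D).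
have mh i : measurable (A i `&` D : set (measurableTypeR R)).
  by apply: measurableI => //; exact: step_measurable.
have hfin i : (leb (A i `&` D) < +oo)%E.
  by apply: le_lt_trans (step_finite i); apply: le_measure; rewrite ?inE//; exact: step_measurable.
have ih i : leb.-integrable setT (EFin \o h i).
  apply: integrable_EFin_ge0 => [|s|]; first exact: measurable_indic.
    by rewrite /h indicE.
  by rewrite /h (lebesgue_indic (mh i)); exact: hfin.
have hI i : \int[leb]_s h i s = fine (leb (A i `&` D)).
  by rewrite /Rintegral /h (lebesgue_indic (mh i)).
have [h1 h2] := @Rintegral_sumZ _ (measurableTypeR R) R leb _ (index_enum 'I_(step_size S)) xpredT
  (fun i => step_val i x) h (fun i _ => ih i).
have E : (fun s => step_eval S s x) \_ D = (fun s => \sum_i step_val i x * h i s).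
  apply/funext => s; rewrite patchE; case: ifPn => sD.
    apply: eq_bigr => i _; rewrite mulrC /h !indicE in_setI sD andbT//.
  by rewrite big1// => i _; rewrite /h indicE in_setI (negbTE sD) andbF mulr0.
split.
  apply/(integrable_mkcond _ mD); move: h1; congr (leb.-integrable _ _).
  rewrite -E; apply/funext => s /=; rewrite !patchE; by case: ifPn.
rewrite Rintegral_mkcond E h2 /step_integral.
by apply: eq_bigr => i _; rewrite hI mulrC.
Qed.

(** The margin removed at both ends of ]0, t[; the factor 1/3 keeps the remaining interval
    nondegenerate already for n = 0. *)
Definition grid (t : R) (n : nat) : R := t / 3 / n.+1%:R.

Lemma grid_gt0 t n : 0 < t -> 0 < grid t n.
Proof. by move=> t0; rewrite /grid !divr_gt0. Qed.

Lemma grid_lt t n : 0 < t -> grid t n < t - grid t n.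
Proof.
move=> t0; have : grid t n <= t / 3; last by lra.
by rewrite /grid ler_pdivrMr// ler_peMr ?divr_ge0 ?(ltW t0)// ler1n.
Qed.

Lemma cvg_grid t : grid t n @[n --> \oo] --> (0 : R).
Proof.
rewrite -(mulr0 (t / 3)); apply: cvgM; first exact: cvg_cst.
exact: cvg_harmonic.
Qed.

Section open_interval.
Variables (t : R) (G : R -> Rn R d -> R).
Hypothesis t0 : 0 < t.
Hypothesis iG : forall s, 0 < s < t -> in_expL p (G s).
Hypothesis uG : forall eta T, 0 < eta -> T < t -> ucon eta T G.

Lemma grid_steps : exists S : nat -> @expL_step R d p, forall n,
  (forall s, grid t n <= s < t - grid t n ->
    bnd (fun x => G s x - step_eval (S n) s x) n.+1%:R^-1) /\
  (forall s x, ~~ (grid t n <= s < t - grid t n) -> step_eval (S n) s x = 0).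
Proof.
have /choice[S hS] : forall n, exists S : @expL_step R d p,
  (forall s, grid t n <= s < t - grid t n ->
    bnd (fun x => G s x - step_eval S s x) n.+1%:R^-1) /\
  (forall s x, ~~ (grid t n <= s < t - grid t n) -> step_eval S s x = 0).
  move=> n; have g0 := grid_gt0 n t0; apply: step_exists.
  - exact: grid_lt.
  - by rewrite invr_gt0.
  - move=> s /andP[s1 s2]; apply: iG; rewrite (lt_le_trans g0)//=.
    by rewrite (le_lt_trans s2)// ltrBlDr ltrDl.
  - by apply: uG => //; rewrite ltrBlDr ltrDl.
by exists S.
Qed.

Lemma near_grid s : 0 < s < t -> \forall n \near \oo, grid t n <= s < t - grid t n.
Proof.
move=> /andP[s0 st]; have m0 : 0 < Num.min s (t - s) by rewrite lt_min s0 subr_gt0.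
have /cvgrPdist_lt/(_ _ m0) := cvg_grid t.
apply: filterS => n; rewrite sub0r normrN (ger0_norm (ltW (grid_gt0 n t0))).
rewrite lt_min => /andP[a b]; rewrite (ltW a)/=; lra.
Qed.

Let D := [set s : R | 0 < s < t].

Lemma measurable_interval : measurable (D : set (measurableTypeR R)).
Proof.
rewrite (_ : D = `]0, t[%classic); first exact: measurable_itv.
by apply/seteqP; split => s; rewrite /D/= in_itv.
Qed.

(** The path is continuous in norm only; the sup part of [bnd] makes the step functions converge
    pointwise, and joint measurability passes to the limit. *)
Lemma measurable_path :
  measurable_fun setT (fun z : measurableTypeR R * Rn R d => \1_D z.1 * G z.1 z.2).
Proof.
have [S hS] := grid_steps.
apply: (@measurable_fun_cvg _ _ _ setT (fun n z => step_eval (S n) z.1 z.2)).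
  by move=> n; exact: measurable_step_eval.
move=> -[s x] _ /=; have [sD|sD] := pselect (D s); last first.
  rewrite indicE memNset// mul0r; apply: cvg_near_cst; apply: nearW => n.
  have [_ ->] := hS n => //; apply: contra_notN sD => /andP[a b].
  rewrite /D/= (lt_le_trans (grid_gt0 n t0) a)/= (lt_trans b)// ltrBlDr ltrDl.
  exact: grid_gt0.
rewrite indicE mem_set// mul1r; apply/cvgrPdist_le => e e0.
have /cvgrPdist_le/(_ _ e0) := @cvg_harmonic R.
move=> he; near=> n.
have hm : grid t n <= s < t - grid t n by near: n; exact: near_grid.
have [h1 _] := hS n; have [_ h2 _] := h1 s hm.
apply: (le_trans (h2 x)); have : `|0 - harmonic n| <= e :> R by near: n.
by rewrite sub0r normrN ger0_norm ?harmonic_ge0.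
Unshelve. all: end_near.
Qed.

Lemma integral_indic_Wk a b : 0 <= a -> a <= b -> b <= t ->
  (\int[leb]_s (\1_(`[a, b[%classic : set R) s * Wk (t - s))%:E <= (2 * (1 - expR (- Num.sqrt (b - a))))%:E)%E.
Proof.
move=> a0 ab bt; apply: le_trans (integral_Wk ab bt).
rewrite integral_indic_mul; first exact: lexx.
exact: measurable_itv.
Qed.

Lemma lebesgue_D : leb D = t%:E.
Proof.
rewrite (_ : D = `]0, t[%classic); last by apply/seteqP; split => s; rewrite /D/= in_itv.
by rewrite lebesgue_measure_itv/= lte_fin t0 oppr0 adde0.
Qed.

(** The step functions vanish on the two end layers, where the error is the integrand itself, of
    size C Wk; in between it is 1/(n + 1). The integral [a n] of this majorant controls both the
    approximation in L^1 of time and the difference of the integrals. *)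
Lemma bochner_path (C : R) : 0 <= C ->
  (forall s, 0 < s < t -> bnd (G s) (C * Wk (t - s))) ->
  is_bochner_integral p D G (fun x => \int[leb]_(s in D) G s x).
Proof.
move=> C0 hG; have [S hS] := grid_steps.
have mD := measurable_interval; have mG := measurable_path.
have mW : measurable_fun setT (fun s : measurableTypeR R => Wk (t - s)).
  by apply: (measurableT_comp (@measurable_Wk R)); exact: measurable_funB.
have mi (A : set R) : measurable (A : set (measurableTypeR R)) ->
    measurable_fun setT (\1_A : measurableTypeR R -> R).
  by move=> mA; exact: measurable_indic.
have [iGs bI] : (forall x, leb.-integrable D (EFin \o (G ^~ x))) /\
    bnd (fun x => \int[leb]_(s in D) G s x) (C * 2).
  apply: (@bnd_integral _ _ D G (fun s => C * Wk (t - s))) => //.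
    exact: measurable_cstM.
  apply: (@le_trans _ _ (C%:E * \int[leb]_s (\1_(`[0, t[%classic : set R) s * Wk (t - s))%:E)%E).
    rewrite -integralZl_EFin//; last 2 first.
    - by apply: measurable_funM => //; apply: mi; exact: measurable_itv.
    - by move=> s; rewrite mulr_ge0 ?Wk_ge0// indicE.
    rewrite -integral_indic_mul//; apply: le_integral_EFin.
    - by apply: measurable_funM; [exact: mi|exact: measurable_cstM].
    - apply: measurable_cstM; apply: measurable_funM => //; apply: mi; exact: measurable_itv.
    - move=> s; have W0 := Wk_ge0 (t - s); rewrite !indicE.
      have [sD|sD] := pselect (D s); last first.
        by rewrite memNset// mul0r lexx mulr_ge0// mulr_ge0.
      rewrite !mem_set//= ?mul1r ?lexx ?mulr_ge0//.
      by move: sD; rewrite /D/= in_itv/= => /andP[/ltW -> ->].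
  apply: le_trans (lee_wpmul2l _ (integral_indic_Wk (lexx 0) (ltW t0) (lexx t))) _.
    by rewrite lee_fin.
  rewrite -EFinM lee_fin ler_wpM2l// ler_piMr// lerBlDr lerDl expR_ge0//.
pose b n s := n.+1%:R^-1 + C * (\1_(`[0, grid t n[%classic : set R) s * Wk (t - s) +
  \1_(`[t - grid t n, t[%classic : set R) s * Wk (t - s)).
pose a n := n.+1%:R^-1 * t + C * (4 * (1 - expR (- Num.sqrt (grid t n)))).
have i0 (A : set R) s : 0 <= \1_A s :> R by rewrite indicE.
have b0 n s : 0 <= b n s.
  by rewrite addr_ge0 ?invr_ge0// mulr_ge0// addr_ge0// mulr_ge0 ?Wk_ge0.
have mb n : measurable_fun setT (b n : measurableTypeR R -> R).
  apply: measurable_funD; first exact: measurable_cst.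
  apply: measurable_cstM; apply: measurable_funD; apply: measurable_funM => //;
    apply: mi; exact: measurable_itv.
have ba n : (\int[leb]_(s in D) (b n s)%:E <= (a n)%:E)%E.
  rewrite -integral_indic_mul//.
  have g0 := grid_gt0 n t0; have gt := grid_lt n t0.
  have c1 := @integral_indic_Wk 0 (grid t n) (lexx 0) (ltW g0) (_ : _).
  have {}c1 := c1 (ltac:(lra)).
  have c2 := @integral_indic_Wk (t - grid t n) t (_ : _) (_ : _) (lexx t).
  have {}c2 := c2 (ltac:(lra)) (ltac:(lra)).
  apply: (@le_trans _ _ (\int[leb]_s (n.+1%:R^-1 * \1_D s + C * (\1_(`[0, grid t n[%classic : set R) s * Wk (t - s) +
    \1_(`[t - grid t n, t[%classic : set R) s * Wk (t - s)))%:E)%E).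
    apply: le_integral_EFin.
    - by apply: measurable_funM => //; exact: mi.
    - apply: measurable_funD; first by apply: measurable_cstM; exact: mi.
      apply: measurable_cstM; apply: measurable_funD; apply: measurable_funM => //;
      apply: mi; exact: measurable_itv.
    - move=> s; rewrite mulr_ge0//= /b mulrDr mulrC lerD2l.
      apply: ler_piMl; first by rewrite mulr_ge0// addr_ge0// mulr_ge0 ?Wk_ge0.
      by rewrite indicE; case: (_ \in _); rewrite ?lexx ?ler01.
  have mAW (A : set R) : measurable (A : set (measurableTypeR R)) ->
      measurable_fun setT (fun s : measurableTypeR R => \1_A s * Wk (t - s)).
    by move=> mA; apply: measurable_funM => //; exact: mi.
  have m1 := mAW _ (measurable_itv `[0, grid t n[).
  have m2 := mAW _ (measurable_itv `[t - grid t n, t[).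
  rewrite integralD_EFin; last 4 first.
  - by apply: measurable_cstM; exact: mi.
  - by move=> s; rewrite mulr_ge0.
  - by apply: measurable_cstM; exact: measurable_funD.
  - by move=> s; rewrite mulr_ge0// addr_ge0// mulr_ge0 ?Wk_ge0.
  rewrite (integralZl_EFin leb (mi D mD))//.
  rewrite (integralZl_EFin leb (measurable_funD m1 m2))//; last first.
    by move=> s; rewrite addr_ge0// mulr_ge0 ?Wk_ge0.
  have p1' (A : set R) s : 0 <= \1_A s * Wk (t - s) by rewrite mulr_ge0 ?Wk_ge0.
  rewrite (integralD_EFin leb m1 (p1' _) m2 (p1' _)).
  rewrite (lebesgue_indic mD) lebesgue_D /a EFinD (EFinM _ t); apply: leeD => //.
  rewrite EFinM lee_wpmul2l ?lee_fin//.
  apply: (le_trans (leeD c1 c2)); rewrite -EFinD lee_fin subr0 subKr.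
  move: (expR _) => e; lra.
have hb n s : D s -> bnd (fun x => G s x - step_eval (S n) s x) (b n s).
  move=> sD; have [m1 m2] := hS n.
  have [hm|hm] := boolP (grid t n <= s < t - grid t n).
    apply: (bnd_le (m1 s hm)); rewrite /b lerDl mulr_ge0// addr_ge0// mulr_ge0 ?Wk_ge0//.
  have -> : (fun x => G s x - step_eval (S n) s x) = G s.
    by apply/funext => x; rewrite m2// subr0.
  apply: (bnd_le (hG s sD)); rewrite /b.
  have [s0 st] := andP sD; have W0 := Wk_ge0 (t - s).
  apply: (@le_trans _ _ (C * (\1_(`[0, grid t n[%classic : set R) s * Wk (t - s) +
    \1_(`[t - grid t n, t[%classic : set R) s * Wk (t - s)))); last by rewrite lerDr invr_ge0.
  rewrite ler_wpM2l//; move: hm; rewrite negb_and -ltNge -leNgt => /orP[h|h].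
    rewrite [X in _ <= X * _ + _]indicE mem_set/= ?in_itv/= ?(ltW s0)// mul1r lerDl mulr_ge0//.
  rewrite [X in _ <= _ + X * _]indicE mem_set/= ?in_itv/= ?h// mul1r lerDr mulr_ge0//.
have a_cvg : (expR 1 * a n)%:E @[n --> \oo] --> (0 : \bar R).
  apply: cvg_EFin; first exact: nearW.
  rewrite -[X in _ --> X](mulr0 (expR 1)); apply: cvgM; first exact: cvg_cst.
  rewrite (_ : 0 = 0 * t + C * (4 * (1 - expR (- Num.sqrt 0)))) ; last first.
    by rewrite sqrtr0 oppr0 expR0 subrr !mulr0 mul0r addr0.
  apply: cvgD; first by apply: cvgM; [exact: cvg_harmonic|exact: cvg_cst].
  apply: cvgM; first exact: cvg_cst.
  apply: cvgM; first exact: cvg_cst.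
  apply: cvgB; first exact: cvg_cst.
  have cs : Num.sqrt (grid t n) @[n --> \oo] --> Num.sqrt (0 : R).
    exact: (cvg_comp _ _ (cvg_grid t) (@sqrt_continuous R 0)).
  by apply: cvg_expR; exact: cvgN.
have e0 : 0 <= expR 1 :> R := expR_ge0 1.
split; first by apply: aeW => s; exact: iG.
split; first exact: bnd_in_expL bI.
exists S; split.
- apply: aeW => s sD; apply: (@squeeze_cvge _ _ _ _ (fun=> 0%E) _ (fun n => (expR 1 * n.+1%:R^-1)%:E)).
  + have := near_grid sD; apply: filterS => n hm; rewrite norm_expL_ge0/=.
    by apply: bnd_norm_expL => //; have [h1 _] := hS n; exact: h1.
  + exact: cvg_cst.
  + apply: cvg_EFin; first exact: nearW.
    rewrite -[X in _ --> X](mulr0 (expR 1)); apply: cvgM; first exact: cvg_cst.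
    exact: cvg_harmonic.
- apply: (@squeeze_cvge _ _ _ _ (fun=> 0%E) _ (fun n => (expR 1 * a n)%:E)) => //; last exact: cvg_cst.
  apply: nearW => n; apply/andP; split; first by apply: integral_ge0 => s _; exact: norm_expL_ge0.
  apply: (@le_trans _ _ (\int[leb]_(s in D) ((expR 1)%:E * (b n s)%:E))%E).
    apply: ge0_le_integral_nonmeasurable => s sD; first exact: norm_expL_ge0.
    by rewrite -EFinM; apply: bnd_norm_expL => //; exact: hb.
  rewrite ge0_integralZl_EFin//.
  + by rewrite EFinM lee_wpmul2l.
  + by move=> s _; rewrite lee_fin.
  + apply: (@measurable_funS _ _ _ _ setT) => //; exact/measurable_EFinP.
- apply: (@squeeze_cvge _ _ _ _ (fun=> 0%E) _ (fun n => (expR 1 * a n)%:E)) => //; last exact: cvg_cst.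
  apply: nearW => n; rewrite norm_expL_ge0/=; apply: bnd_norm_expL => //.
  have mGS : measurable_fun setT (fun z : measurableTypeR R * Rn R d =>
      \1_D z.1 * (G z.1 z.2 - step_eval (S n) z.1 z.2)).
    under eq_fun do rewrite mulrBr.
    apply: measurable_funB => //; apply: measurable_funM; last exact: measurable_step_eval.
    exact: (measurableT_comp (mi _ mD) measurable_fst).
  have [_] := @bnd_integral R d D (fun s x => G s x - step_eval (S n) s x) (b n) (a n) mD mGS (mb n) (hb n) (ba n).
  congr (bnd _ (a n)); apply/funext => x.
  have [i1 ->] := step_integralE (S n) x mD.
  by rewrite RintegralB.
Qed.

End open_interval.
End steps.

(** * The nonlinearity *)

Section nonlinearity.
Context {R : realType} {d : nat}.
Variables (p m C0 lambda : R) (f : R -> R).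
Hypothesis p1 : 1 < p.
Hypothesis pm : p <= m.
Hypothesis f0 : f 0 = 0.
Hypothesis C00 : 0 < C0.
Hypothesis lambda0 : 0 < lambda.
Hypothesis hf : forall u v : R, `|f u - f v| <= C0 * `|u - v| *
  (`|u| `^ (m - 1) * expR (lambda * `|u| `^ p) + `|v| `^ (m - 1) * expR (lambda * `|v| `^ p)).
Local Notation mu := (@lebesgue_Rn R d).
Implicit Types (u v w : Rn R d -> R) (x : Rn R d) (k z : R) (q r : nat).

Let p0 : 0 < p. Proof. exact: lt_trans ltr01 p1. Qed.
Let m1 : 0 < m - 1. Proof. by rewrite subr_gt0 (lt_le_trans p1). Qed.

(** For b = m - 1 the growth of the local Lipschitz constant of f, for b = m that of f itself. *)
Let gr (b z : R) := `|z| `^ b * expR (lambda * `|z| `^ p).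

Let gr_ge0 b z : 0 <= gr b z.
Proof. by rewrite mulr_ge0 ?powR_ge0 ?expR_ge0. Qed.

Let le_gr b z z' : 0 <= b -> `|z| <= `|z'| -> gr b z <= gr b z'.
Proof.
move=> b0 zz; rewrite /gr ler_pM ?powR_ge0 ?expR_ge0//.
  by rewrite ge0_ler_powR.
by rewrite ler_expR ler_pM2l// ge0_ler_powR ?(ltW p0).
Qed.

Lemma nonlinearity_continuous : continuous f.
Proof.
move=> v; apply/cvgrPdist_le => e e0.
pose L := C0 * (2 * gr (m - 1) (`|v| + 1)) + 1.
have L0 : 0 < L by rewrite ltr_wpDl// mulr_ge0 ?(ltW C00)// mulr_ge0.
near=> w.
have w1 : `|v - w| <= 1 by near: w; apply: cvgr_dist_le; [exact: cvg_id|exact: ltr01].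
have w2 : `|v - w| <= e / L by near: w; apply: cvgr_dist_le; [exact: cvg_id|exact: divr_gt0].
apply: (le_trans (hf v w)).
have vv : `|v| <= `| (`|v| + 1) | by rewrite (@ger0_norm _ (`|v| + 1)) ?addr_ge0// lerDl.
have ww : `|w| <= `| (`|v| + 1) |.
  rewrite (@ger0_norm _ (`|v| + 1)) ?addr_ge0//.
  have -> : w = v - (v - w) by ring.
  by apply: le_trans (ler_normB _ _) _; rewrite lerD2l.
have g1 := le_gr (ltW m1) vv; have g2 := le_gr (ltW m1) ww.
have g3 := lerD g1 g2.
apply: (@le_trans _ _ (`|v - w| * L)).
  rewrite mulrAC mulrC ler_wpM2l// /L.
  apply: (@le_trans _ _ (C0 * (2 * gr (m - 1) (`|v| + 1)))); last by rewrite lerDl.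
  by rewrite (mulr_natl _ 2) mulr2n ler_pM2l//; exact: g3.
by rewrite -ler_pdivlMr.
Unshelve. all: end_near.
Qed.

Lemma measurable_nonlinearity u : measurable_fun setT u -> measurable_fun setT (f \o u).
Proof.
move=> mu'; apply: measurableT_comp => //.
exact: continuous_measurable_fun nonlinearity_continuous.
Qed.

Let f_le z : `|f z| <= C0 * gr m z.
Proof.
have := hf z 0; rewrite f0 !subr0 normr0 (powR0 (lt0r_neq0 m1)) mul0r addr0.
move=> h; apply: (le_trans h); rewrite /gr.
have -> : `|z| `^ m = `|z| * `|z| `^ (m - 1) by rewrite mulr_powRB1// (lt_le_trans p0).
by rewrite !mulrA.
Qed.

(** At a small scale k, the exponential in the (q + 1)-th power of the nonlinearity uses at most
    half of the exponent controlled by the modular. *)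
Lemma small_scale q : exists2 kap, 0 < kap & forall k, 0 < k -> k <= kap ->
  q.+1%:R * (lambda * k `^ p) <= 2^-1.
Proof.
pose a := (2 * (q.+1%:R * lambda))^-1; have a0 : 0 < a by rewrite invr_gt0 !mulr_gt0.
exists (a `^ p^-1); first exact: powR_gt0.
move=> k k0 kk; have : k `^ p <= a.
  apply: (@le_trans _ _ ((a `^ p^-1) `^ p)).
    by rewrite ge0_ler_powR ?nnegrE ?powR_ge0 ?(ltW p0) ?(ltW k0).
  by rewrite -powRrM mulVf ?powRr1 ?(ltW a0)// gt_eqF.
rewrite mulrA -ler_pdivlMl ?mulr_gt0// => h; apply: (le_trans h).
by rewrite /a invfM mulrC.
Qed.

(* With y = (|z| / k)^p, the growth |z|^b exp(lambda |z|^p) is k^b y^(b/p) exp(lambda k^p y). *)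
Let gr_scale (b z k : R) q : 0 <= b -> 0 < k -> q.+1%:R * (lambda * k `^ p) <= 2^-1 ->
  gr b z ^+ q.+1 <= (k `^ b) ^+ q.+1 *
    (((`|z| / k) `^ p) `^ (b * q.+1%:R / p) * expR ((`|z| / k) `^ p / 2)).
Proof.
move=> b0 k0 hk; set y := (`|z| / k) `^ p.
have y0 : 0 <= y by rewrite powR_ge0.
have zk : `|z| = k * (`|z| / k) by rewrite mulrC divfK// gt_eqF.
have zk0 : 0 <= `|z| / k by rewrite divr_ge0// ltW.
rewrite /gr exprMn -expRM_natl.
have -> : `|z| `^ b = k `^ b * (`|z| / k) `^ b by rewrite -powRM// ?(ltW k0)// -zk.
have -> : `|z| `^ p = k `^ p * y by rewrite /y -powRM// ?(ltW k0)// -zk.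
rewrite exprMn -!mulrA ler_wpM2l ?exprn_ge0 ?powR_ge0//.
apply: ler_pM; rewrite ?exprn_ge0 ?powR_ge0 ?expR_ge0//.
  have E1 : ((`|z| / k) `^ b) ^+ q.+1 = (`|z| / k) `^ (b * q.+1%:R) by rewrite powRrM powR_mulrn// powR_ge0.
  have E2 : y `^ (b * (q.+1%:R / p)) = (`|z| / k) `^ (b * q.+1%:R).
    by rewrite /y -powRrM; congr (_ `^ _); rewrite [LHS]mulrC mulrA divfK// gt_eqF.
  by rewrite E1 E2.
rewrite ler_expR [leRHS]mulrC mulrA mulrA ler_wpM2r//.
by rewrite -mulrA.
Qed.

(** The power (m - 1)(q + 1)/p of y may be below 1, and y^b e^{y/2} is then not O(e^y - 1) near 0;
    the summand 1 makes up for it. *)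
Let growth_bound q : exists2 C, 0 < C & forall z k, 0 < k -> q.+1%:R * (lambda * k `^ p) <= 2^-1 ->
  gr (m - 1) z ^+ q.+1 <= C * (k `^ (m - 1)) ^+ q.+1 * (1 + psi p (`|z| / k)).
Proof.
pose b := (m - 1) * q.+1%:R / p.
have b0 : 0 <= b by rewrite divr_ge0 ?(ltW p0)// mulr_ge0// ltW.
have [C C1 hC] := @powR_expR_half R (b + 1) (ltac:(by rewrite lerDr)).
exists (C + 1); first by rewrite addr_gt0.
move=> z k k0 hk; apply: le_trans (gr_scale z (ltW m1) k0 hk) _.
rewrite -/b /psi (addrC 1) subrK (mulrC (C + 1)) -mulrA ler_wpM2l ?exprn_ge0 ?powR_ge0//.
move: (_ `^ p) (powR_ge0 (`|z| / k) p) => y y0.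
have e0 := expR_gt0 (y / 2); have ey : expR (y / 2) <= expR y by rewrite ler_expR; lra.
have [y1|y1] := leP 1 y.
  apply: (@le_trans _ _ (y `^ (b + 1) * expR (y / 2))).
    by rewrite ler_wpM2r ?(ltW e0)// ler_powR// lerDl.
  apply: le_trans (hC y y0) _; have := expR_gt0 y; move: (expR y) => E; nra.
apply: (@le_trans _ _ (1 * expR y)).
  apply: ler_pM; rewrite ?powR_ge0 ?(ltW e0)//.
  have -> : 1 = 1 `^ b :> R by rewrite powR1.
  by rewrite ge0_ler_powR ?nnegrE ?ler01//; exact: ltW.
by rewrite ler_wpM2r ?expR_ge0// lerDr ltW.
Qed.

(** Here m >= p makes the power m(q + 1)/p at least 1, so no constant is left over and the bound is
    integrable over the whole space. *)
Let growth_bound_m q : exists2 C, 0 < C & forall z k, 0 < k -> q.+1%:R * (lambda * k `^ p) <= 2^-1 ->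
  gr m z ^+ q.+1 <= C * (k `^ m) ^+ q.+1 * psi p (`|z| / k).
Proof.
pose b := m * q.+1%:R / p.
have b1 : 1 <= b.
  rewrite ler_pdivlMr// mul1r (le_trans pm)// ler_peMr ?ler1n//.
  by rewrite (le_trans (ltW p0)).
have [C C1 hC] := @powR_expR_half R b b1.
exists C => // z k k0 hk; have mm : 0 <= m by rewrite (le_trans (ltW p0)).
apply: le_trans (gr_scale z mm k0 hk) _.
rewrite -/b /psi (mulrC C) -mulrA ler_wpM2l ?exprn_ge0 ?powR_ge0//.
exact: hC (powR_ge0 _ _).
Qed.

(** (1 + C)^{q+1} >= C moves a constant inside the power. *)
Let pow_absorb (C D : R) q : 0 <= C -> 0 <= D -> C * D ^+ q.+1 <= ((1 + C) * D) ^+ q.+1.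
Proof.
move=> c0 d0; rewrite exprMn ler_wpM2r ?exprn_ge0//.
apply: (@le_trans _ _ (1 + C)); first by rewrite lerDr.
by rewrite exprS ler_peMr ?addr_ge0// exprn_ege1// lerDl.
Qed.

Lemma nonlinear_Lq q : exists2 C, 0 < C & exists2 kap, 0 < kap & forall k u, 0 < k -> k <= kap ->
  measurable_fun setT u -> (expL_modular p k u <= 2)%E ->
  (\int[mu]_x (`|f (u x)| ^+ q.+1)%:E <= ((C * k `^ m) ^+ q.+1)%:E)%E.
Proof.
have [C C1 hC] := growth_bound_m q; have [kap kap0 hk] := small_scale q.
exists ((1 + 2 * C) * C0); first by rewrite mulr_gt0// addr_gt0// mulr_gt0.
exists kap => // k u k0 kk mu' hu; have {}hk := hk k k0 kk.
have km0 : 0 <= C0 * k `^ m by rewrite mulr_ge0 ?(ltW C00)// powR_ge0.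
apply: (@le_trans _ _ (\int[mu]_x ((C * (C0 * k `^ m) ^+ q.+1) * psi p (`|u x| / k))%:E)%E).
  apply: le_integral_EFin => [||x].
  - by apply: measurable_funX; apply: measurableT_comp => //; exact: measurable_nonlinearity.
  - by apply: measurable_cstM; exact: measurable_psi_abs.
  - rewrite exprn_ge0//=; apply: (@le_trans _ _ ((C0 * gr m (u x)) ^+ q.+1)).
      by rewrite lerXn2r ?nnegrE// mulr_ge0// ltW.
    rewrite !(exprMn q.+1 C0); apply: le_trans (ler_wpM2l _ (hC (u x) k k0 hk)) _; first by rewrite exprn_ge0// ltW.
    by rewrite le_eqVlt; apply/orP; left; apply/eqP; ring.
rewrite integralZl_EFin; last 3 first.
- exact: measurable_psi_abs.
- by move=> x; rewrite psi_ge0.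
- by rewrite mulr_ge0 ?exprn_ge0// ltW.
rewrite -(expL_modularE p k0 u); apply: le_trans (lee_wpmul2l _ hu) _.
  by rewrite lee_fin mulr_ge0 ?exprn_ge0// ltW.
rewrite -EFinM lee_fin mulrAC [C * 2]mulrC -mulrA.
by apply: pow_absorb => //; rewrite mulr_ge0// ltW.
Qed.

(** The summand 1 of [growth_bound] is not integrable by itself; it is paired with |u - v|^{q+1} <=
    A^q |u - v| and the L^1 bound. The modular terms take the sup bound A^{q+1}. *)
Lemma nonlinear_Lq_diff q : exists2 C, 0 < C & exists2 kap, 0 < kap & forall k u v (A : R),
  0 < k -> k <= kap -> measurable_fun setT u -> measurable_fun setT v ->
  (expL_modular p k u <= 2)%E -> (expL_modular p k v <= 2)%E ->
  bnd (fun x => u x - v x) A ->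
  (\int[mu]_x (`|f (u x) - f (v x)| ^+ q.+1)%:E <= ((C * A * k `^ (m - 1)) ^+ q.+1)%:E)%E.
Proof.
have [C C1 hC] := growth_bound q; have [kap kap0 hk] := small_scale q.
exists ((1 + 6 * C) * (2 * C0)); first by rewrite mulr_gt0 ?addr_gt0// mulr_gt0.
exists kap => // k u v A k0 kk mu' mv hu hv hA; have {}hk := hk k k0 kk.
have A0 := bnd_ge0 hA; case: hA => mw w1 w2.
pose D := 2 * C0 * k `^ (m - 1).
have D0 : 0 <= D by rewrite mulr_ge0 ?powR_ge0// mulr_ge0// ltW.
pose B := C * D ^+ q.+1; have B0 : 0 <= B by rewrite mulr_ge0 ?exprn_ge0// ltW.
have pu x : 0 <= psi p (`|u x| / k) by rewrite psi_ge0.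
have pv x : 0 <= psi p (`|v x| / k) by rewrite psi_ge0.
have mpu : measurable_fun setT (fun x => psi p (`|u x| / k)) by exact: measurable_psi_abs.
have mpv : measurable_fun setT (fun x => psi p (`|v x| / k)) by exact: measurable_psi_abs.
have maw : measurable_fun setT (fun x => `|u x - v x|) by exact: measurableT_comp.
have mfu := measurable_nonlinearity mu'; have mfv := measurable_nonlinearity mv.
apply: (@le_trans _ _ (\int[mu]_x (B * ((2 * A ^+ q) * `|u x - v x| +
    A ^+ q.+1 * (psi p (`|u x| / k) + psi p (`|v x| / k))))%:E)%E).
  apply: le_integral_EFin => [||x].
  - by apply: measurable_funX; apply: measurableT_comp => //; exact: measurable_funB.
  - exact: measurable_cstM (measurable_funD (measurable_cstM _ maw) (measurable_cstM _ (measurable_funD mpu mpv))).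
  - rewrite exprn_ge0//=.
    have gu := hC (u x) k k0 hk; have gv := hC (v x) k k0 hk.
    have g0 := gr_ge0 (m - 1) (u x); have g1 := gr_ge0 (m - 1) (v x).
    have step1 : `|f (u x) - f (v x)| ^+ q.+1 <=
        (C0 * `|u x - v x|) ^+ q.+1 * (2 ^+ q.+1 * (gr (m - 1) (u x) ^+ q.+1 + gr (m - 1) (v x) ^+ q.+1)).
      apply: (@le_trans _ _ ((C0 * `|u x - v x| * (gr (m - 1) (u x) + gr (m - 1) (v x))) ^+ q.+1)).
        apply: lerXn2r; [by rewrite nnegrE| |exact: hf].
        rewrite nnegrE; apply: mulr_ge0; last exact: (addr_ge0 g0 g1).
        by apply: mulr_ge0; [exact: ltW|exact: normr_ge0].
      rewrite exprMn ler_wpM2l ?exprn_ge0//; first by rewrite mulr_ge0// ltW.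
      move: (gr _ (u x)) (gr _ (v x)) g0 g1 => a b a0 b0.
      apply: (@le_trans _ _ ((2 * Num.max a b) ^+ q.+1)).
        rewrite lerXn2r ?nnegrE ?addr_ge0// ?mulr_ge0// ?le_max ?a0//.
        by rewrite mulr2n mulrDl mul1r lerD// le_max lexx ?orbT.
      rewrite exprMn ler_wpM2l ?exprn_ge0//.
      have [ab|/ltW ba] := leP a b; first by rewrite lerDr exprn_ge0.
      by rewrite lerDl exprn_ge0.
    apply: (le_trans step1).
    apply: (@le_trans _ _ ((C0 * `|u x - v x|) ^+ q.+1 * (2 ^+ q.+1 *
        (C * (k `^ (m - 1)) ^+ q.+1 * (2 + (psi p (`|u x| / k) + psi p (`|v x| / k))))))).
      rewrite ler_wpM2l ?exprn_ge0 ?mulr_ge0 ?(ltW C00)// ler_wpM2l ?exprn_ge0//.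
      apply: (le_trans (lerD gu gv)); move: (psi _ _) (psi _ _) (C * _) => P Q E.
      by rewrite le_eqVlt; apply/orP; left; apply/eqP; ring.
    have -> : (C0 * `|u x - v x|) ^+ q.+1 * (2 ^+ q.+1 *
        (C * (k `^ (m - 1)) ^+ q.+1 * (2 + (psi p (`|u x| / k) + psi p (`|v x| / k))))) =
      B * (`|u x - v x| ^+ q.+1 * (2 + (psi p (`|u x| / k) + psi p (`|v x| / k)))).
      rewrite /B /D (exprMn q.+1 C0) (exprMn q.+1 (2 * C0)) (exprMn q.+1 2).
      by move: (psi _ _ + _) (2 ^+ _) (C0 ^+ _) ((k `^ _) ^+ _) (`|u x - v x| ^+ _) => P a b c e; ring.
    rewrite ler_wpM2l//.
    have wq : `|u x - v x| ^+ q.+1 <= A ^+ q * `|u x - v x|.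
      by rewrite exprSr ler_wpM2r// lerXn2r ?nnegrE.
    have wq' : `|u x - v x| ^+ q.+1 <= A ^+ q.+1 by rewrite lerXn2r ?nnegrE.
    have := addr_ge0 (pu x) (pv x); move: (psi _ _ + _) => P P0.
    rewrite mulrDr lerD//; first by rewrite -mulrA mulrC ler_pM2l.
    by rewrite ler_wpM2r.
rewrite integralZl_EFin//; last 2 first.
- exact: measurable_funD (measurable_cstM _ maw) (measurable_cstM _ (measurable_funD mpu mpv)).
- move=> x; apply: addr_ge0; first by rewrite mulr_ge0// mulr_ge0// exprn_ge0.
  by apply: mulr_ge0; [rewrite exprn_ge0|exact: addr_ge0 (pu x) (pv x)].
rewrite integralD_EFin; last 4 first.
- exact: measurable_cstM.
- by move=> x; rewrite mulr_ge0// mulr_ge0// exprn_ge0.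
- exact: measurable_cstM (measurable_funD mpu mpv).
- by move=> x; apply: mulr_ge0; [rewrite exprn_ge0|exact: addr_ge0 (pu x) (pv x)].
rewrite integralZl_EFin//; last by rewrite mulr_ge0// exprn_ge0.
rewrite integralZl_EFin; last 3 first.
- exact: measurable_funD mpu mpv.
- by move=> x; exact: addr_ge0 (pu x) (pv x).
- by rewrite exprn_ge0.
rewrite (integralD_EFin mu mpu pu mpv pv) -(expL_modularE p k0 u) -(expL_modularE p k0 v).
have c1 : ((2 * A ^+ q)%:E * \int[mu]_x (`|u x - v x|)%:E <= (2 * A ^+ q)%:E * A%:E)%E.
  by rewrite lee_wpmul2l// lee_fin mulr_ge0// exprn_ge0.
have c2 : ((A ^+ q.+1)%:E * (expL_modular p k u + expL_modular p k v) <= (A ^+ q.+1)%:E * (2 + 2)%:E)%E.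
  apply: lee_wpmul2l; first by rewrite lee_fin exprn_ge0.
  by rewrite EFinD; exact: leeD hu hv.
apply: le_trans (lee_wpmul2l _ (leeD c1 c2)) _; first by rewrite lee_fin.
rewrite -[leLHS]/((B * (2 * A ^+ q * A + A ^+ q.+1 * (2 + 2)))%:E) lee_fin.
(* 6 = 2 + 4: the two constants 1, and two modulars of size 2. *)
have -> : B * (2 * A ^+ q * A + A ^+ q.+1 * (2 + 2)) = (6 * C) * (D * A) ^+ q.+1.
  by rewrite /B (exprMn q.+1 D) (exprSr A q); move: (D ^+ q.+1) => E; ring.
have -> : (1 + 6 * C) * (2 * C0) * A * k `^ (m - 1) = (1 + 6 * C) * (D * A) by rewrite /D; ring.
by apply: pow_absorb; [rewrite mulr_ge0// ltW|exact: mulr_ge0].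
Qed.

Lemma nonlinear_L1r r : exists2 C, 0 < C & exists2 kap, 0 < kap & forall k u, 0 < k -> k <= kap ->
  measurable_fun setT u -> (expL_modular p k u <= 2)%E -> L1r r.+1 (f \o u) (C * k `^ m).
Proof.
have [C C1 [kap kap0 h]] := nonlinear_Lq 0; have [C' C1' [kap' kap0' h']] := nonlinear_Lq r.
exists (Num.max C C'); first by rewrite lt_max C1.
exists (Num.min kap kap'); first by rewrite lt_min kap0.
move=> k u k0; rewrite le_min => /andP[k1 k2] mu' hu; split.
- exact: measurable_nonlinearity.
- apply: le_trans (h k u k0 k1 mu' hu) _; rewrite lee_fin expr1 ler_wpM2r ?powR_ge0//.
  by rewrite le_max lexx.
- apply: le_trans (h' k u k0 k2 mu' hu) _; rewrite lee_fin lerXn2r ?nnegrE//.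
  + by rewrite mulr_ge0 ?powR_ge0// ltW.
  + by rewrite mulr_ge0 ?powR_ge0// le_max (ltW C1).
  + by rewrite ler_wpM2r ?powR_ge0// le_max lexx orbT.
Qed.

Lemma nonlinear_L1r_diff r : exists2 C, 0 < C & exists2 kap, 0 < kap & forall k u v (A : R),
  0 < k -> k <= kap -> measurable_fun setT u -> measurable_fun setT v ->
  (expL_modular p k u <= 2)%E -> (expL_modular p k v <= 2)%E ->
  bnd (fun x => u x - v x) A ->
  L1r r.+1 (fun x => f (u x) - f (v x)) (C * A * k `^ (m - 1)).
Proof.
have [C C1 [kap kap0 h]] := nonlinear_Lq_diff 0; have [C' C1' [kap' kap0' h']] := nonlinear_Lq_diff r.
exists (Num.max C C'); first by rewrite lt_max C1.
exists (Num.min kap kap'); first by rewrite lt_min kap0.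
move=> k u v A k0; rewrite le_min => /andP[k1 k2] mu' mv hu hv hA; have A0 := bnd_ge0 hA; split.
- by apply: measurable_funB; apply: measurable_nonlinearity.
- apply: le_trans (h k u v A k0 k1 mu' mv hu hv hA) _.
  rewrite lee_fin expr1 ler_wpM2r ?powR_ge0// ler_wpM2r//.
  by rewrite le_max lexx.
- apply: le_trans (h' k u v A k0 k2 mu' mv hu hv hA) _; rewrite lee_fin lerXn2r ?nnegrE//.
  + by rewrite mulr_ge0 ?powR_ge0// mulr_ge0// ltW.
  + by rewrite mulr_ge0 ?powR_ge0// mulr_ge0// le_max (ltW C1).
  + by rewrite ler_wpM2r ?powR_ge0// ler_wpM2r// le_max lexx orbT.
Qed.

End nonlinearity.

(** * The Duhamel operator and the Picard iteration *)

Section duhamel.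
Context {R : realType} {d : nat}.
Hypothesis hd : (0 < d)%N.
Variables beta p : R.
Hypothesis b01 : 0 < beta <= 1.
Hypothesis p1 : 1 < p.
Local Notation mu := (@lebesgue_Rn R d).
Local Notation leb := (@lebesgue_measure R).
Local Notation heat := (@hermite_heat R d beta).
Implicit Types (x : Rn R d) (s t : R) (F H : R -> Rn R d -> R) (g : Rn R d -> R).

Definition duhamel F t x : R := \int[leb]_(s in [set s : R | 0 < s < t]) heat (t - s) (F s) x.

Lemma heat_smoothing_Wk : exists2 C, 0 < C & exists r : nat, forall t g (B : R),
  0 < t -> 0 < B -> L1r r.+1 g B -> bnd (heat t g) (C * B * expR (- (t / 4)) * Wk t).
Proof.
have [C C0 [r h]] := heat_smoothing hd b01.
exists (C * expR 4); first by rewrite mulr_gt0// expR_gt0.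
exists r => t g B t0 B0 gB; apply: bnd_le (h r t g B (leqnn r) t0 B0 gB) _.
have := expR_smoothing_Wk t0; rewrite -[leLHS]/(expR (- (t / 2)) * (1 + (Num.sqrt t)^-1)).
have cB : 0 <= C * B by rewrite mulr_ge0// ltW.
move: (expR (- (t / 2))) (1 + _) (expR 4) (expR (- (t / 4))) (Wk t) => a b c e w h1.
have := ler_wpM2l cB h1; lra.
Qed.

Lemma Wk_le t : 0 < t -> Wk t <= (Num.sqrt t)^-1.
Proof.
move=> t0; apply: ler_piMl; first by rewrite invr_ge0 sqrtr_ge0.
by rewrite expR_le1 oppr_le0 sqrtr_ge0.
Qed.

Lemma L1r_wL1 r g (B : R) : L1r r g B -> wL1 g /\ wn g <= B.
Proof. by case=> mg g1 _; exact: L1_wL1. Qed.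

(* uniform continuity on compact time intervals in L^1 \cap L^r *)
Definition forcing r F (B : R) :=
  (forall s, 0 < s -> L1r r.+1 (F s) (B * expR (- (s / 4)))) /\
  (forall eta T e : R, 0 < eta -> 0 < e -> exists2 h, 0 < h & forall s s',
     eta <= s -> s <= s' -> s' <= T -> s' - s <= h -> L1r r.+1 (fun x => F s' x - F s x) e).

Section smoothing.
Variables (C : R) (r : nat).
Hypothesis C0 : 0 < C.
Hypothesis smooth : forall t g (B : R), 0 < t -> 0 < B -> L1r r.+1 g B ->
  bnd (heat t g) (C * B * expR (- (t / 4)) * Wk t).

(** As e^{-(t-s)/4} e^{-s/4} = e^{-t/4}, the decay of the forcing is reproduced by the Duhamel
    integral. *)
Lemma duhamel_integrand F (B t s : R) : 0 < B ->
  (forall s, 0 < s -> L1r r.+1 (F s) (B * expR (- (s / 4)))) -> 0 < s < t ->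
  bnd (heat (t - s) (F s)) (C * B * expR (- (t / 4)) * Wk (t - s)).
Proof.
move=> B0 FB /andP[s0 st].
have ts : 0 < t - s by rewrite subr_gt0.
have := smooth ts (mulr_gt0 B0 (expR_gt0 (- (s / 4)))) (FB s s0).
congr (bnd _ _); rewrite -!mulrA; congr (_ * (_ * _)); rewrite mulrA -expRD.
by congr (expR _ * _); field.
Qed.

(** Staying below T < t keeps the elapsed time t - s away from the singularity. The increment splits
    into that of the forcing, which is smoothed, and that of the elapsed time. *)
Lemma duhamel_ucon F (B t eta T : R) : 0 < B -> forcing r F B -> 0 < eta -> T < t ->
  ucon eta T (fun s => heat (t - s) (F s)).
Proof.
move=> B0 [FB Fu] eta0 Tt e e0; have e2 : 0 < e / 2 by rewrite divr_gt0.
have [C' C'0 [n hC']] := heat_time_bnd hd b01.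
have tT : 0 < t - T by rewrite subr_gt0.
have sT : 0 < Num.sqrt (t - T) by rewrite sqrtr_gt0.
(* This tolerance cancels the factor C / sqrt(t - T) of the smoothing estimate. *)
have [h1 h10 hF] := Fu eta T (e / 2 * Num.sqrt (t - T) / C) eta0 (divr_gt0 (mulr_gt0 e2 sT) C0).
have tTn : 0 < (t - T) ^+ n.+1 by rewrite exprn_gt0.
pose h2 := e / 2 * (t - T) ^+ n.+1 / (C' * B).
have h20 : 0 < h2 by rewrite divr_gt0 ?mulr_gt0.
exists (Num.min h1 h2); first by rewrite lt_min h10.
move=> s s' es ss' s'T; rewrite le_min => /andP[sh1 sh2].
have s0 : 0 < s by exact: lt_le_trans es.
have s'0 : 0 < s' by exact: lt_le_trans ss'.
have ts' : 0 < t - s' by rewrite subr_gt0 (le_lt_trans s'T).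
have ts : 0 < t - s by rewrite subr_gt0 (le_lt_trans ss')// (le_lt_trans s'T).
have tTs' : t - T <= t - s' by rewrite lerB.
have [Fs'W _] := L1r_wL1 (FB s' s'0).
have [FsW Fswn] := L1r_wL1 (FB s s0).
rewrite (_ : (fun x => _) = (fun x => heat (t - s') (fun y => F s' y - F s y) x +
    - (heat (t - s) (F s) x - heat (t - s') (F s) x))); last first.
  by apply/funext => x; rewrite hermite_heatB//; move: (heat _ _ _) (heat _ _ _) (heat _ _ _) => a b c; ring.
rewrite [X in bnd _ X]splitr; apply: bndD.
  apply: bnd_le (smooth ts' _ (hF s s' es ss' s'T sh1)) _.
    by rewrite divr_gt0 ?mulr_gt0.
  have w1 : Wk (t - s') <= (Num.sqrt (t - T))^-1.
    apply: (le_trans (Wk_le ts')); rewrite lef_pV2 ?posrE ?sqrtr_gt0//.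
    by rewrite ler_sqrt// ltW.
  have e1 : expR (- ((t - s') / 4)) <= 1 by rewrite expR_le1 oppr_le0 divr_ge0// ltW.
  have -> : C * (e / 2 * Num.sqrt (t - T) / C) = e / 2 * Num.sqrt (t - T).
    by rewrite mulrC divfK// gt_eqF.
  apply: (@le_trans _ _ (e / 2 * Num.sqrt (t - T) * 1 * (Num.sqrt (t - T))^-1)).
    have W0 := Wk_ge0 (t - s').
    rewrite ler_pM// ?ler_wpM2l// ?mulr_ge0// ?sqrtr_ge0// ?expR_ge0// ltW//.
  by rewrite mulr1 mulfK// gt_eqF.
apply: bndN; apply: bnd_le (hC' (t - s') (t - s) (F s) ts' _ FsW) _; first by rewrite lerB.
have -> : t - s - (t - s') = s' - s by ring.
have b1 : wn (F s) <= B.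
  by apply: (le_trans Fswn); rewrite ler_piMr ?(ltW B0)// expR_le1 oppr_le0 divr_ge0// ltW.
have b2 : (t - s') ^- n.+1 <= (t - T) ^- n.+1.
  rewrite lef_pV2 ?posrE ?exprn_gt0// lerXn2r ?nnegrE// ltW//.
apply: (@le_trans _ _ (C' * h2 / (t - T) ^+ n.+1 * B)).
  have ss0 : 0 <= s' - s by rewrite subr_ge0.
  apply: ler_pM => //; [|exact: wn_ge0|].
    by apply: divr_ge0; [apply: mulr_ge0 => //; exact: ltW|rewrite exprn_ge0// ltW].
  apply: ler_pM => //; [by apply: mulr_ge0 => //; exact: ltW|by rewrite invr_ge0 exprn_ge0// ltW|].
  by rewrite ler_pM2l.
rewrite le_eqVlt; apply/orP; left; apply/eqP; rewrite /h2.
by move: ((t - T) ^+ n.+1) tTn => Q Q0; field; rewrite !gt_eqF.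
Qed.

Lemma integral_interval_Wk (c a b t : R) : 0 <= c -> a <= b -> b <= t ->
  (\int[leb]_(s in [set s : R | (a < s < b)%R]) (c * Wk (t - s))%:E <=
   (c * (2 * (1 - expR (- Num.sqrt (b - a)))))%:E)%E.
Proof.
move=> c0 ab bt.
have mW : measurable_fun setT (fun s : measurableTypeR R => Wk (t - s)).
  by apply: (measurableT_comp (@measurable_Wk R)); exact: measurable_funB.
have W0 s : 0 <= Wk (t - s) := Wk_ge0 _.
apply: (@le_trans _ _ (\int[leb]_(s in `[a, b[) (c%:E * (Wk (t - s))%:E))%E); last first.
  rewrite ge0_integralZl_EFin//; last 2 first.
  - by move=> s _; rewrite lee_fin.
  - by apply: (@measurable_funS _ _ _ _ setT) => //; exact/measurable_EFinP.
  by rewrite EFinM lee_wpmul2l ?lee_fin// integral_Wk.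
apply: ge0_subset_integral.
- by rewrite (_ : [set s | _] = `]a, b[%classic); [exact: measurable_itv|apply/seteqP; split => s; rewrite /= in_itv].
- exact: measurable_itv.
- apply: (@measurable_funS _ _ _ _ setT) => //; apply/measurable_EFinP; exact: measurable_cstM.
- by move=> s _; rewrite lee_fin mulr_ge0.
- by move=> s /=; rewrite in_itv/= => /andP[/ltW -> ->].
Qed.

Lemma heat_path_measurable F (B t : R) : 0 < B -> forcing r F B -> 0 < t ->
  measurable_fun setT (fun z : measurableTypeR R * Rn R d =>
    \1_[set s : R | 0 < s < t] z.1 * heat (t - z.1) (F z.1) z.2).
Proof.
move=> B0 FB t0; have [FB1 _] := FB.
apply: (@measurable_path _ _ p t (fun s => heat (t - s) (F s)) t0).
  by move=> s s0t; apply: (bnd_in_expL p1); exact: duhamel_integrand FB1 s0t.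
by move=> eta T eta0 Tt; exact: duhamel_ucon FB eta0 Tt.
Qed.

Lemma duhamel_bnd F (B t : R) : 0 < B -> forcing r F B -> 0 < t ->
  (forall x, leb.-integrable [set s : R | 0 < s < t] (EFin \o (fun s => heat (t - s) (F s) x))) /\
  bnd (duhamel F t) (C * B * expR (- (t / 4)) * (2 * (1 - expR (- Num.sqrt t)))).
Proof.
move=> B0 FB t0; have [FB1 _] := FB.
have c0 : 0 <= C * B * expR (- (t / 4)) by rewrite !mulr_ge0 ?expR_ge0// ltW.
apply: (@bnd_integral R d _ (fun s => heat (t - s) (F s)) (fun s => C * B * expR (- (t / 4)) * Wk (t - s))).
- exact: measurable_interval.
- exact: heat_path_measurable FB t0.
- apply: measurable_cstM; apply: (measurableT_comp (@measurable_Wk R)); exact: measurable_funB.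
- by move=> s s0t; exact: duhamel_integrand.
- by have := integral_interval_Wk c0 (ltW t0) (lexx t); rewrite subr0.
Qed.

Lemma duhamel_diff F H (B D A t : R) : 0 < B -> 0 < D -> 0 < A -> forcing r F B -> forcing r H D ->
  (forall s, 0 < s -> L1r r.+1 (fun x => F s x - H s x) (A * expR (- (s / 4)))) -> 0 < t ->
  bnd (fun x => duhamel F t x - duhamel H t x) (2 * C * A * expR (- (t / 4))).
Proof.
move=> B0 D0 A0 FB HD FH t0; have [iF _] := duhamel_bnd B0 FB t0; have [iH _] := duhamel_bnd D0 HD t0.
have mD : measurable ([set s : R | 0 < s < t] : set (measurableTypeR R)) by exact: measurable_interval.
have c0 : 0 <= C * A * expR (- (t / 4)) by rewrite !mulr_ge0 ?expR_ge0// ltW.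
have mG : measurable_fun setT (fun z : measurableTypeR R * Rn R d => \1_[set s : R | 0 < s < t] z.1 *
    (heat (t - z.1) (F z.1) z.2 - heat (t - z.1) (H z.1) z.2)).
  under eq_fun do rewrite mulrBr.
  by apply: measurable_funB; [exact: heat_path_measurable FB t0|exact: heat_path_measurable HD t0].
have mb : measurable_fun setT (fun s : measurableTypeR R => C * A * expR (- (t / 4)) * Wk (t - s)).
  by apply: measurable_cstM; apply: (measurableT_comp (@measurable_Wk R)); exact: measurable_funB.
have hb s : [set s : R | 0 < s < t] s ->
    bnd (fun x => heat (t - s) (F s) x - heat (t - s) (H s) x) (C * A * expR (- (t / 4)) * Wk (t - s)).
  move=> /= s0t; have /andP[s0 st] := s0t; have ts : 0 < t - s by rewrite subr_gt0.
  have [FW _] := L1r_wL1 (FB.1 s s0); have [HW _] := L1r_wL1 (HD.1 s s0).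
  have := @duhamel_integrand (fun s x => F s x - H s x) A t s A0 FH s0t.
  by congr (bnd _ _); apply/funext => x; exact: hermite_heatB.
have bA : (\int[leb]_(s in [set s : R | (0 < s < t)%R]) (C * A * expR (- (t / 4)) * Wk (t - s))%:E <=
    (2 * C * A * expR (- (t / 4)))%:E)%E.
  apply: le_trans (integral_interval_Wk c0 (ltW t0) (lexx t)) _; rewrite lee_fin subr0.
  have e1 := expR_ge0 (- Num.sqrt t); move: (expR (- Num.sqrt t)) e1 => e e1.
  have -> : 2 * C * A * expR (- (t / 4)) = C * A * expR (- (t / 4)) * 2 by ring.
  apply: ler_wpM2l => //; lra.
have [_] := bnd_integral mD mG mb hb bA.
congr (bnd _ _); apply/funext => x; rewrite /duhamel -RintegralB//.
Qed.

Lemma duhamel_indicE F t x :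
  duhamel F t x = \int[leb]_s (\1_[set s : R | 0 < s < t] s * heat (t - s) (F s) x).
Proof.
rewrite /duhamel Rintegral_mkcond; apply: eq_Rintegral => s _.
by rewrite patchE indicE; case: (_ \in _); rewrite ?mul1r ?mul0r.
Qed.

Let one_sub_expR (a : R) : 1 - expR (- a) <= a.
Proof. have := expR_ge1Dx (- a); lra. Qed.

(** The integral is cut at t - th. Before the cut both elapsed times exceed th and differ by t' - t;
    after it each integrand is at most c Wk, with integral O(sqrt th). *)
Lemma duhamel_path_ucon F (B eta T : R) : 0 < B -> forcing r F B -> 0 < eta ->
  ucon eta T (duhamel F).
Proof.
move=> B0 FB eta0 e e0; have [FB1 _] := FB.
have [C' C'0 [n hC']] := heat_time_bnd hd b01.
pose c := C * B; have c0 : 0 < c by exact: mulr_gt0.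
(* th <= eta/2 keeps t - th positive. The end layers contribute at most c (4 + 2) sqrt th, so sqrt
   th <= e / (12 c) leaves e/2 for the part before the cut. *)
pose th := Num.min (eta / 2) ((e / (12 * c)) ^+ 2).
have th0 : 0 < th by rewrite lt_min divr_gt0//= exprn_gt0// divr_gt0// mulr_gt0.
have th_eta : th <= eta / 2 by rewrite ge_min lexx.
have sth : Num.sqrt th <= e / (12 * c).
  have q0 : 0 <= e / (12 * c) by rewrite divr_ge0 ?(ltW e0)// mulr_ge0// ltW.
  by rewrite -(ger0_norm q0) -sqrtr_sqr ler_sqrt ?exprn_ge0// ge_min lexx orbT.
have thn : 0 < th ^+ n.+1 by rewrite exprn_gt0.
have T1 : 0 < `|T| + 1 by rewrite ltr_wpDl.
pose h := Num.min th (e / 2 * th ^+ n.+1 / (C' * B * (`|T| + 1))).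
have h0 : 0 < h by rewrite lt_min th0/= !divr_gt0 ?mulr_gt0// invr_gt0.
exists h => // t t' et tt' t'T t'th.
have t0 : 0 < t by exact: lt_le_trans et.
have t'0 : 0 < t' by exact: lt_le_trans tt'.
have hth : h <= th by rewrite ge_min lexx.
have tth : 0 < t - th by lra.
pose c1 := C' * h / th ^+ n.+1 * B.
have c10 : 0 <= c1 by rewrite mulr_ge0 ?divr_ge0 ?mulr_ge0// ltW.
have W0 s := @Wk_ge0 R s.
have i0 (A : set R) s : 0 <= \1_A s :> R by rewrite indicE.
pose b s := c1 * \1_(`[0, t - th[%classic : set R) s +
  c * (\1_(`[t - th, t'[%classic : set R) s * Wk (t' - s) + \1_(`[t - th, t[%classic : set R) s * Wk (t - s)).
pose H s x := \1_[set s : R | 0 < s < t'] s * heat (t' - s) (F s) x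
  - \1_[set s : R | 0 < s < t] s * heat (t - s) (F s) x.
have mi (A : set R) : measurable (A : set (measurableTypeR R)) ->
    measurable_fun setT (\1_A : measurableTypeR R -> R).
  by move=> mA; exact: measurable_indic.
have mW (u : R) : measurable_fun setT (fun s : measurableTypeR R => Wk (u - s)).
  by apply: (measurableT_comp (@measurable_Wk R)); exact: measurable_funB.
have mAW (a1 a2 u : R) : measurable_fun setT (fun s : measurableTypeR R => \1_(`[a1, a2[%classic : set R) s * Wk (u - s)).
  by apply: measurable_funM => //; apply: mi; exact: measurable_itv.
have mI := mi _ (measurable_itv `[0, t - th[).
have mS := measurable_funD (mAW (t - th) t' t') (mAW (t - th) t t).
have S0 s : 0 <= \1_(`[t - th, t'[%classic : set R) s * Wk (t' - s) + \1_(`[t - th, t[%classic : set R) s * Wk (t - s).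
  by rewrite addr_ge0// mulr_ge0.
have mb : measurable_fun setT (b : measurableTypeR R -> R).
  exact: measurable_funD (measurable_cstM _ mI) (measurable_cstM _ mS).
have mH : measurable_fun setT (fun z : measurableTypeR R * Rn R d => H z.1 z.2).
  by apply: measurable_funB; [exact: heat_path_measurable FB t'0|exact: heat_path_measurable FB t0].
have Fs s : 0 < s -> forall u, s < u -> bnd (heat (u - s) (F s)) (c * Wk (u - s)).
  move=> s0 u su; apply: bnd_le (@duhamel_integrand F B u s B0 FB1 _) _; first by rewrite s0.
  rewrite ler_wpM2r// -[leRHS]mulr1 ler_wpM2l ?(ltW c0)// expR_le1 oppr_le0 divr_ge0//.
  by rewrite ltW// (lt_trans s0).
have hb s : bnd (H s) (b s).
  have b0 : 0 <= b s by apply: addr_ge0; [exact: mulr_ge0|exact: mulr_ge0 (ltW c0) (S0 s)].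
  rewrite /H; have [s0|s0] := leP s 0.
    rewrite !indicE !memNset/=; try by move=> /andP[]; rewrite ltNge s0.
    by under eq_fun do rewrite !mul0r subrr; exact: bnd_le bnd0 b0.
  have [st'|s't] := ltP s t'; last first.
    rewrite !indicE !memNset/=; try (move=> /andP[_]; lra).
    by under eq_fun do rewrite !mul0r subrr; exact: bnd_le bnd0 b0.
  have i1 : \1_[set s : R | 0 < s < t'] s = 1 :> R by rewrite indicE mem_set//= s0.
  rewrite i1; under eq_fun do rewrite mul1r.
  have [st|ts] := ltP s t; last first.
    have i2 : \1_[set s : R | 0 < s < t] s = 0 :> R by rewrite indicE memNset//= s0/= ltNge ts.
    rewrite i2; under eq_fun do rewrite mul0r subr0.
    apply: (bnd_le (Fs s s0 t' st')); rewrite /b.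
    have -> : \1_(`[t - th, t'[%classic : set R) s = 1 :> R.
      by rewrite indicE mem_set//= in_itv/= st' andbT; lra.
    rewrite mul1r mulrDr addrCA lerDl; apply: addr_ge0; first exact: mulr_ge0.
    by apply: (mulr_ge0 (ltW c0)); exact: mulr_ge0.
  have i2 : \1_[set s : R | 0 < s < t] s = 1 :> R by rewrite indicE mem_set//= s0.
  rewrite i2; under eq_fun do rewrite mul1r.
  have [sth'|sth'] := ltP s (t - th).
    have [FW wF] := L1r_wL1 (FB1 s s0).
    apply: bnd_le (hC' (t - s) (t' - s) (F s) _ _ FW) _; [by rewrite subr_gt0|by rewrite lerB|].
    apply: (@le_trans _ _ c1); last first.
      rewrite /b indicE mem_set/=; last by rewrite in_itv/= (ltW s0).
      by rewrite mulr1 lerDl mulr_ge0// ltW.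
    have -> : t' - s - (t - s) = t' - t by ring.
    have tsn : 0 < (t - s) ^+ n.+1 by rewrite exprn_gt0// subr_gt0.
    have d0 : 0 <= t' - t by rewrite subr_ge0.
    apply: ler_pM; [|exact: wn_ge0| |].
    - by apply: divr_ge0; [apply: mulr_ge0 => //; exact: ltW|exact: ltW].
    - apply: ler_pM; [by apply: mulr_ge0 => //; exact: ltW|by rewrite invr_ge0 ltW| |].
        by rewrite ler_pM2l.
      rewrite lef_pV2 ?posrE// lerXn2r ?nnegrE ?(ltW th0)//; lra.
    - by apply: (le_trans wF); rewrite ler_piMr ?(ltW B0)// expR_le1 oppr_le0 divr_ge0// ltW.
  apply: bnd_le (bndB (Fs s s0 t' st') (Fs s s0 t st)) _; rewrite /b.
  have -> : \1_(`[t - th, t'[%classic : set R) s = 1 :> R by rewrite indicE mem_set//= in_itv/= st' sth'.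
  have -> : \1_(`[t - th, t[%classic : set R) s = 1 :> R by rewrite indicE mem_set//= in_itv/= st sth'.
  by rewrite !mul1r -mulrDr lerDr mulr_ge0.
have bA : (\int[leb]_s (b s)%:E <= e%:E)%E.
  rewrite integralD_EFin; last 4 first.
  - exact: measurable_cstM.
  - by move=> s; rewrite mulr_ge0.
  - exact: measurable_cstM.
  - by move=> s; rewrite mulr_ge0// ltW.
  rewrite (integralZl_EFin leb mI)// (integralZl_EFin leb mS) ?(ltW c0)//.
  have mW1 (a1 a2 u s : R) : 0 <= \1_(`[a1, a2[%classic : set R) s * Wk (u - s) by rewrite mulr_ge0.
  rewrite (integralD_EFin leb (mAW _ _ _) (mW1 _ _ _) (mAW _ _ _) (mW1 _ _ _)).
  rewrite (lebesgue_indic (measurable_itv _)) lebesgue_measure_itv/= lte_fin tth oppr0 adde0.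
  have j1 := @integral_indic_Wk R t' (t - th) t' (ltW tth) (ltac:(lra)) (lexx _).
  have j2 := @integral_indic_Wk R t (t - th) t (ltW tth) (ltac:(lra)) (lexx _).
  apply: (@le_trans _ _ (c1%:E * (t - th)%:E + c%:E *
    ((2 * (1 - expR (- Num.sqrt (t' - (t - th)))))%:E + (2 * (1 - expR (- Num.sqrt (t - (t - th)))))%:E))%E).
    by apply: leeD => //; rewrite lee_wpmul2l ?lee_fin ?(ltW c0)//; exact: leeD.
  rewrite -[leLHS]/((c1 * (t - th) + c * (2 * (1 - expR (- Num.sqrt (t' - (t - th)))) +
    2 * (1 - expR (- Num.sqrt (t - (t - th))))))%:E) lee_fin.
  have k1 : 1 - expR (- Num.sqrt (t' - (t - th))) <= 2 * Num.sqrt th.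
    apply: (le_trans (one_sub_expR _)).
    have q0 : 0 <= 2 * Num.sqrt th by rewrite mulr_ge0 ?sqrtr_ge0.
    rewrite -(ger0_norm q0) -sqrtr_sqr ler_sqrt ?exprn_ge0// exprMn sqr_sqrtr ?(ltW th0)//.
    rewrite (_ : 2 ^+ 2 = 4); [lra|by rewrite -natrX].
  have k2 : 1 - expR (- Num.sqrt (t - (t - th))) <= Num.sqrt th.
    by apply: (le_trans (one_sub_expR _)); rewrite subKr.
  have k3 : c * Num.sqrt th <= e / 12.
    apply: (le_trans (ler_wpM2l (ltW c0) sth)); rewrite le_eqVlt; apply/orP; left; apply/eqP.
    by field; rewrite gt_eqF.
  have k4 : c1 * (t - th) <= e / 2.
    apply: (@le_trans _ _ (C' * (e / 2 * th ^+ n.+1 / (C' * B * (`|T| + 1))) / th ^+ n.+1 * B * (`|T| + 1))).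
      apply: ler_pM => //; [exact: ltW| |].
        rewrite /c1 ler_wpM2r ?(ltW B0)// ler_wpM2r ?invr_ge0 ?(ltW thn)// ler_wpM2l ?(ltW C'0)//.
        by rewrite ge_min lexx orbT.
      by have := ler_norm T; lra.
    rewrite le_eqVlt; apply/orP; left; apply/eqP.
    by move: (th ^+ n.+1) thn (`|T| + 1) T1 => Q Q0 T' T'0; field; rewrite !gt_eqF.
  have := sqrtr_ge0 th; move: (Num.sqrt th) k1 k2 k3 => q; move: (expR _) (expR _) => e1 e2 k1 k2 k3 q0.
  have := ler_wpM2l (ltW c0) k1; have := ler_wpM2l (ltW c0) k2; lra.
have [iH] := bnd_integralT mH mb hb bA.
congr (bnd _ _); apply/funext => x; rewrite !duhamel_indicE.
have mD (u : R) : measurable ([set s : R | 0 < s < u] : set (measurableTypeR R)) by exact: measurable_interval.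
have ii u : 0 < u -> leb.-integrable setT (EFin \o (fun s => \1_[set s : R | 0 < s < u] s * heat (u - s) (F s) x)).
  move=> u0; have [+ _] := duhamel_bnd B0 FB u0.
  move=> /(_ x)/(integrable_mkcond _ (mD u)); congr (leb.-integrable _ _).
  by apply/funext => s /=; rewrite patchE indicE; case: (_ \in _); rewrite ?mul1r ?mul0r.
by rewrite -RintegralB//; exact: ii.
Qed.

End smoothing.
End duhamel.

Lemma geometric_lt {R : realType} (c e : R) : 0 < c -> 0 < e -> exists n, c / 2 ^+ n < e.
Proof.
move=> c0 e0; exists (Num.truncn (c / e)); set n := Num.truncn _.
have : c / e < 2 ^+ n.
  apply: (@lt_le_trans _ _ n.+1%:R).
    by have /andP[] := truncn_itv (ltW (divr_gt0 c0 e0)).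
  by rewrite -natrX ler_nat ltn_expl.
by rewrite ltr_pdivrMr// [X in _ < X -> _]mulrC => h; rewrite ltr_pdivrMr// exprn_gt0.
Qed.

(** * The Picard iteration for the perturbation *)

Section picard.
Context {R : realType} {d : nat}.
Hypothesis hd : (0 < d)%N.
Variables (beta p m : R) (f : R -> R).
Hypothesis b01 : 0 < beta <= 1.
Hypothesis p1 : 1 < p.
Hypothesis pm : p <= m.
Local Notation mu := (@lebesgue_Rn R d).
Local Notation leb := (@lebesgue_measure R).
Local Notation heat := (@hermite_heat R d beta).
Local Notation duh := (@duhamel R d beta).
Implicit Types (x : Rn R d) (s t : R) (u w g : Rn R d -> R) (v : R -> Rn R d -> R).

Variables (C C1 C2 kap M : R) (r : nat).
Hypothesis C_gt0 : 0 < C.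
Hypothesis C1_gt0 : 0 < C1.
Hypothesis C2_gt0 : 0 < C2.
Hypothesis M_gt0 : 0 < M.
Hypothesis smooth : forall t g (B : R), 0 < t -> 0 < B -> L1r r.+1 g B ->
  bnd (heat t g) (C * B * expR (- (t / 4)) * Wk t).
Hypothesis NL1 : forall k u, 0 < k -> k <= kap ->
  measurable_fun setT u -> (expL_modular p k u <= 2)%E -> L1r r.+1 (f \o u) (C1 * k `^ m).
Hypothesis NL2 : forall k u w (A : R), 0 < k -> k <= kap -> measurable_fun setT u -> measurable_fun setT w ->
  (expL_modular p k u <= 2)%E -> (expL_modular p k w <= 2)%E -> bnd (fun x => u x - w x) A ->
  L1r r.+1 (fun x => f (u x) - f (w x)) (C2 * A * k `^ (m - 1)).
Hypothesis decay : forall t k u, 0 < t -> 0 < k -> measurable_fun setT u ->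
  (expL_modular p k u <= 1)%E -> (expL_modular p (M * expR (- (t / 2)) * k) (heat t u) <= 1)%E.

Variables (k0 : R) (u0 : Rn R d -> R).
Hypothesis k0_gt0 : 0 < k0.
Hypothesis mu0 : measurable_fun setT u0.
Hypothesis u0k : (expL_modular p k0 u0 <= 1)%E.

(** The scale of the solution: M k0 from the linear evolution, e k0 from a perturbation of size k0,
    because psi(s) <= e s on [0, 1]. *)
Let K := M * k0 + expR 1 * k0.
Hypothesis Kkap : K <= kap.
(** S1 keeps the perturbations of size k0 invariant; S2 makes the Picard map halve distances. *)
Hypothesis S1 : 2 * C * C1 * K `^ m <= k0.
Hypothesis S2 : 4 * C * C2 * K `^ (m - 1) <= 1.

Let e4 s := expR (- (s / 4)).
Let K0 : 0 < K. Proof. by rewrite addr_gt0 ?mulr_gt0 ?expR_gt0. Qed.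
Let e40 s : 0 < e4 s. Proof. exact: expR_gt0. Qed.
Let e41 s : 0 < s -> e4 s <= 1.
Proof. by move=> s0; rewrite expR_le1 oppr_le0 divr_ge0// ltW. Qed.
Let m1 : 1 <= m. Proof. by rewrite (le_trans (ltW p1)). Qed.
Let u0W : wL1 u0. Proof. by have [] := expL_modular_wL1 p1 k0_gt0 mu0 u0k. Qed.

Definition perturbation v := (forall s, 0 < s -> bnd (v s) (k0 * expR (- (s / 4)))) /\
  (forall eta T : R, 0 < eta -> ucon eta T v).

(* The unknown is the perturbation v of the linear evolution: the latter need
   not be continuous at s = 0 in the norm of exp L^p. *)
Definition full v s x := heat s u0 x + v s x.

Lemma full_modular v s : perturbation v -> 0 < s ->
  measurable_fun setT (full v s) /\ (expL_modular p (K * expR (- (s / 4))) (full v s) <= 2)%E.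
Proof.
move=> [vb _] s0; have mU : measurable_fun setT (heat s u0) by exact: measurable_hermite_heat.
have vs := vb s s0; have [mv _ _] := vs.
have mf : measurable_fun setT (full v s) by exact: measurable_funD.
split => //; pose k1 := M * expR (- (s / 2)) * k0; pose k2 := expR 1 * (k0 * e4 s).
have k10 : 0 < k1 by rewrite !mulr_gt0// expR_gt0.
have k20 : 0 < k2 by rewrite !mulr_gt0// expR_gt0.
apply: (@le_trans _ _ (expL_modular p (k1 + k2) (full v s))).
  apply: expL_modular_mono => //; first exact: addr_gt0.
  have ee : expR (- (s / 2)) <= e4 s by rewrite ler_expR; lra.
  have h1 : M * k0 * expR (- (s / 2)) <= M * k0 * e4 s by rewrite ler_pM2l// mulr_gt0.
  rewrite /k1 /k2 /K mulrDl -/(e4 s) mulrA lerD2r.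
  by rewrite mulrAC.
apply: (expL_modular_add2 p1 k10 k20 mU mv); first exact: decay.
exact: (bnd_modular p1 vs k20 (lexx _)).
Qed.

Lemma full_modularK v s : perturbation v -> 0 < s -> (expL_modular p K (full v s) <= 2)%E.
Proof.
move=> vP s0; have [mf h] := full_modular vP s0; apply: le_trans h.
apply: expL_modular_mono => //; first by rewrite mulr_gt0// expR_gt0.
by rewrite ler_piMr// ?(ltW K0)//; exact: e41.
Qed.

Lemma heat_ucon (eta T : R) : 0 < eta -> ucon eta T (fun s => heat s u0).
Proof.
move=> eta0 e e0; have [C' C'0 [n h]] := heat_time_bnd hd b01.
have W1 : 0 < wn u0 + 1 by rewrite ltr_wpDl// wn_ge0.
have en : 0 < eta ^+ n.+1 by rewrite exprn_gt0.
exists (e * eta ^+ n.+1 / (C' * (wn u0 + 1))); first by rewrite divr_gt0 ?mulr_gt0.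
move=> s s' es ss' s'T sh; have s0 := lt_le_trans eta0 es.
apply: (bnd_le (h s s' u0 s0 ss' u0W)).
have sn : eta ^+ n.+1 <= s ^+ n.+1 by rewrite lerXn2r ?nnegrE// ltW.
have d0 : 0 <= s' - s by rewrite subr_ge0.
apply: (@le_trans _ _ (C' * (e * eta ^+ n.+1 / (C' * (wn u0 + 1))) / eta ^+ n.+1 * (wn u0 + 1))).
  apply: ler_pM; [|exact: wn_ge0| |by rewrite lerDl].
    by apply: divr_ge0; [apply: mulr_ge0 => //; exact: ltW|rewrite exprn_ge0// ltW].
  apply: ler_pM; [by apply: mulr_ge0 => //; exact: ltW|by rewrite invr_ge0 exprn_ge0// ltW| |].
    by rewrite ler_pM2l.
  by rewrite lef_pV2 ?posrE ?exprn_gt0.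
rewrite le_eqVlt; apply/orP; left; apply/eqP.
by move: (eta ^+ n.+1) en (wn u0 + 1) W1 => Q Q0 W W0; field; rewrite !gt_eqF.
Qed.

Lemma full_ucon v (eta T : R) : perturbation v -> 0 < eta -> ucon eta T (full v).
Proof. by move=> [_ vu] eta0; apply: ucon_add; [exact: heat_ucon|exact: vu]. Qed.

Let B := C1 * K `^ m.
Let B0 : 0 < B. Proof. by rewrite mulr_gt0// powR_gt0. Qed.

Lemma L1r_le q g (A A' : R) : 0 <= A -> A <= A' -> L1r q g A -> L1r q g A'.
Proof.
move=> A0 AA [mg h1 h2]; split => //.
  by apply: (le_trans h1); rewrite lee_fin.
by apply: (le_trans h2); rewrite lee_fin lerXn2r ?nnegrE// (le_trans A0).
Qed.

Let powR_decay (a : R) s : 1 <= a -> 0 < s -> (K * e4 s) `^ a <= K `^ a * e4 s.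
Proof.
move=> a1 s0; rewrite powRM ?(ltW K0) ?(ltW (e40 s))// ler_wpM2l ?powR_ge0//.
by apply: ge1r_powR => //; rewrite e40 e41.
Qed.

(** As m >= 1, (K e^{-s/4})^m <= K^m e^{-s/4}: the decay of u passes to f(u). Regularity in time
    comes from the difference estimate at the fixed scale K. *)
Lemma forcing_full v : perturbation v -> forcing r (fun s => f \o full v s) B.
Proof.
move=> vP; split.
  move=> s s0; have [mf h] := full_modular vP s0.
  have Ke0 : 0 < K * expR (- (s / 4)) by rewrite mulr_gt0// expR_gt0.
  have Kek : K * expR (- (s / 4)) <= kap.
    by apply: le_trans Kkap; rewrite ler_piMr// ?(ltW K0)//; exact: e41.
  apply: L1r_le (NL1 Ke0 Kek mf h); first by rewrite mulr_ge0 ?powR_ge0// ltW.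
  rewrite /B -mulrA ler_wpM2l ?(ltW C1_gt0)//; exact: powR_decay.
move=> eta T e eta0 e0.
have D0 : 0 < C2 * K `^ (m - 1) by rewrite mulr_gt0// powR_gt0.
have [h h0 hu] := full_ucon T vP eta0 (divr_gt0 e0 D0).
exists h => // s s' es ss' s'T sh.
have s0 := lt_le_trans eta0 es; have s'0 := lt_le_trans s0 ss'.
have [mf _] := full_modular vP s0; have [mf' _] := full_modular vP s'0.
have := NL2 K0 Kkap mf' mf (full_modularK vP s'0) (full_modularK vP s0) (hu s s' es ss' s'T sh).
congr (L1r _ _ _); rewrite mulrAC mulrCA -[RHS]mulr1; move: D0.
by move: (C2 * _) => D D0; rewrite mulfV ?gt_eqF.
Qed.

Lemma picard_perturbation v : perturbation v -> perturbation (duh (fun s => f \o full v s)).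
Proof.
move=> vP; have FB := forcing_full vP; split => [s s0|eta T eta0].
  have [_ h] := duhamel_bnd hd b01 p1 C_gt0 smooth B0 FB s0.
  apply: (bnd_le h); have e1 := expR_ge0 (- Num.sqrt s); have ee := ltW (e40 s); rewrite -/(e4 s).
  have -> : C * B * e4 s * (2 * (1 - expR (- Num.sqrt s))) = (2 * C * C1 * K `^ m) * (e4 s * (1 - expR (- Num.sqrt s))).
    by rewrite /B; ring.
  apply: (@le_trans _ _ (k0 * (e4 s * (1 - expR (- Num.sqrt s))))).
    rewrite ler_wpM2r// mulr_ge0// subr_ge0 expR_le1 oppr_le0 sqrtr_ge0//.
  by rewrite ler_pM2l// ler_piMr// gerBl.
exact: (duhamel_path_ucon hd b01 p1 C_gt0 smooth T B0 FB eta0).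
Qed.

(** The bound on Duhamel differences carries the factor 2 C C2 K^{m-1}, at most 1/2 by S2, and
    preserves the weight e^{-s/4}. *)
Lemma picard_contraction v (w' : R -> Rn R d -> R) (A : R) : 0 < A -> perturbation v -> perturbation w' ->
  (forall s, 0 < s -> bnd (fun x => v s x - w' s x) (A * expR (- (s / 4)))) ->
  forall s, 0 < s -> bnd (fun x => duh (fun s => f \o full v s) s x - duh (fun s => f \o full w' s) s x)
     (A / 2 * expR (- (s / 4))).
Proof.
move=> A0 vP wP vw s s0.
have A'0 : 0 < C2 * A * K `^ (m - 1) by rewrite !mulr_gt0// powR_gt0.
have H : forall s, 0 < s -> L1r r.+1 (fun x => f (full v s x) - f (full w' s x)) (C2 * A * K `^ (m - 1) * expR (- (s / 4))).
  move=> t t0; have [mf _] := full_modular vP t0; have [mf' _] := full_modular wP t0.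
  have fv : bnd (fun x => full v t x - full w' t x) (A * expR (- (t / 4))).
    by have := vw t t0; congr (bnd _ _); apply/funext => x; rewrite /full; ring.
  have := NL2 K0 Kkap mf mf' (full_modularK vP t0) (full_modularK wP t0) fv.
  by congr (L1r _ _ _); ring.
have := duhamel_diff hd b01 p1 C_gt0 smooth B0 B0 A'0 (forcing_full vP) (forcing_full wP) H s0.
move=> h; apply: (bnd_le h); rewrite ler_wpM2r ?expR_ge0//.
move: (K `^ _) S2 => q S2'; have := ler_wpM2l (ltW A0) S2'; lra.
Qed.

Fixpoint picard n : R -> Rn R d -> R :=
  if n is n'.+1 then duh (fun s => f \o full (picard n') s) else fun _ _ => 0.

Lemma picardP n : perturbation (picard n).
Proof.
elim: n => [|n IH]; last exact: picard_perturbation.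
split=> [s s0|eta T _ e e0].
  by apply: (bnd_le (@bnd0 R d)); rewrite mulr_ge0 ?expR_ge0// ltW.
exists 1 => // s s' _ _ _ _ /=; under eq_fun do rewrite subrr.
exact: bnd_le (@bnd0 R d) (ltW e0).
Qed.

Lemma picard_step n s : 0 < s ->
  bnd (fun x => picard n.+1 s x - picard n s x) (k0 / 2 ^+ n * expR (- (s / 4))).
Proof.
elim: n s => [|n IH] s s0.
  have [h _] := picardP 1; have := h s s0; rewrite expr0 divr1.
  by congr (bnd _ _); apply/funext => x; rewrite subr0.
have := picard_contraction (A := k0 / 2 ^+ n) _ (picardP n.+1) (picardP n) IH s0.
rewrite exprSr invfM mulrA; apply; first by rewrite divr_gt0// exprn_gt0.
Qed.

Lemma picard_cauchy n j s : 0 < s ->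
  bnd (fun x => picard (n + j) s x - picard n s x) (2 * k0 / 2 ^+ n * expR (- (s / 4))).
Proof.
(* The exact partial sum of the geometric series is what the induction on j propagates. *)
move=> s0; suff : bnd (fun x => picard (n + j) s x - picard n s x)
    (2 * k0 / 2 ^+ n * (1 - (2 ^+ j)^-1) * expR (- (s / 4))).
  move/bnd_le; apply; rewrite ler_wpM2r ?expR_ge0//; apply: ler_piMr.
    by rewrite divr_ge0 ?exprn_ge0// mulr_ge0// ltW.
  by rewrite gerBl invr_ge0 exprn_ge0.
elim: j => [|j IH].
  rewrite addn0 expr0 invr1 subrr mulr0 mul0r; under eq_fun do rewrite subrr; exact: bnd0.
rewrite addnS.
rewrite (_ : (fun x => _) = (fun x => (picard (n + j).+1 s x - picard (n + j) s x) + (picard (n + j) s x - picard n s x))).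
  apply: bnd_le (bndD (picard_step (n + j) s0) IH) _.
  rewrite -mulrDl ler_wpM2r ?expR_ge0// exprD exprSr.
  have a0 : 0 < 2 ^+ n :> R by rewrite exprn_gt0.
  have b0 : 0 < 2 ^+ j :> R by rewrite exprn_gt0.
  move: (2 ^+ n) (2 ^+ j) a0 b0 => a b a0 b0.
  by rewrite le_eqVlt; apply/orP; left; apply/eqP; field; rewrite !gt_eqF.
by apply/funext => x; ring.
Qed.

Definition picard_lim s x := limn (fun n => picard n s x).

Lemma picard_cvg s x : 0 < s -> picard n s x @[n --> \oo] --> picard_lim s x.
Proof.
move=> s0; apply: cauchy_cvg; apply: cauchy_exP => e e0.
have [n n2] := geometric_lt (mulr_gt0 (ltr0n _ 2) k0_gt0) e0.
exists (picard n s x); exists n => // j /= nj.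
rewrite -(subnKC nj) -ball_normE/= distrC.
have [_ h _] := picard_cauchy n (j - n) s0; apply: (le_lt_trans (h x)).
apply: (le_lt_trans _ n2).
by rewrite ler_piMr ?e41// divr_ge0 ?exprn_ge0// mulr_ge0// ltW.
Qed.

Lemma picard_lim_bnd n s : 0 < s ->
  bnd (fun x => picard_lim s x - picard n s x) (2 * k0 / 2 ^+ n * expR (- (s / 4))).
Proof.
move=> s0; apply: (@bnd_lim _ _ (fun j x => picard (n + j) s x - picard n s x)).
  by move=> j; exact: picard_cauchy.
move=> x; apply: cvgB; last exact: cvg_cst.
have h := @picard_cvg s x s0; move: h.
rewrite -(cvg_shiftn n) (_ : [sequence _]_j = (fun j => picard (n + j) s x))//.
by apply/funext => j /=; rewrite addnC.
Qed.

Lemma picard_limP : perturbation picard_lim.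
Proof.
split=> [s s0|eta T eta0 e e0].
  apply: (@bnd_lim _ _ (fun n => picard n s)) => [n|x]; last exact: picard_cvg.
  by have [h _] := picardP n; exact: h.
have e3 : 0 < e / 3 by rewrite divr_gt0.
have [n /ltW n2] := geometric_lt (mulr_gt0 (ltr0n _ 2) k0_gt0) e3.
have lb s : 0 < s -> bnd (fun x => picard_lim s x - picard n s x) (e / 3).
  move=> s0; apply: bnd_le (picard_lim_bnd n s0) _; apply: le_trans n2.
  by rewrite ler_piMr ?e41// divr_ge0 ?exprn_ge0// mulr_ge0// ltW.
have [_ /(_ eta T eta0 _ e3)[h h0 hu]] := picardP n.
exists h => // s s' es ss' s'T sh; have s0 := lt_le_trans eta0 es; have s'0 := lt_le_trans s0 ss'.
have := bndD (bndB (lb s' s'0) (lb s s0)) (hu s s' es ss' s'T sh).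
rewrite (_ : e / 3 + e / 3 + e / 3 = e); last by field.
by congr (bnd _ _); apply/funext => x; ring.
Qed.

(** The contraction, applied to the limit and the n-th iterate, turns the passage to the limit under
    the Duhamel integral into a norm estimate. *)
Lemma picard_fixpoint s x : 0 < s -> picard_lim s x = duh (fun s => f \o full picard_lim s) s x.
Proof.
move=> s0; have h1 : picard n.+1 s x @[n --> \oo] --> picard_lim s x.
  by have := @picard_cvg s x s0; rewrite -cvg_shiftS.
suff h2 : picard n.+1 s x @[n --> \oo] --> duh (fun s => f \o full picard_lim s) s x.
  by rewrite -(cvg_lim (@Rhausdorff R) h1) -(cvg_lim (@Rhausdorff R) h2).
apply/cvgrPdist_le => e e0; near=> n.
have A0 : 0 < 2 * k0 / 2 ^+ n by rewrite divr_gt0 ?exprn_gt0// mulr_gt0.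
have [_ h _] := picard_contraction A0 picard_limP (picardP n) (@picard_lim_bnd n) s0.
apply: (le_trans (h x)); apply: (@le_trans _ _ (k0 / 2 ^+ n)).
  rewrite (_ : 2 * k0 / 2 ^+ n / 2 = k0 / 2 ^+ n); last by field; rewrite gt_eqF ?exprn_gt0.
  by rewrite ler_piMr ?e41// divr_ge0 ?exprn_ge0// ltW.
rewrite ler_pdivrMr ?exprn_gt0// mulrC -ler_pdivrMr//.
apply: (@le_trans _ _ n%:R); first by near: n; exact: nbhs_infty_ger.
by rewrite -natrX ler_nat ltnW// ltn_expl.
Unshelve. all: end_near.
Qed.

End picard.

(** * From the fixed point to a global solution *)

Section existence.
Context {R : realType} {d : nat}.
Hypothesis hd : (0 < d)%N.
Variables (beta p m C0 lambda : R) (f : R -> R).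
Hypothesis b01 : 0 < beta <= 1.
Hypothesis p1 : 1 < p.
Hypothesis pm : p <= m.
Hypothesis f0 : f 0 = 0.
Hypothesis C00 : 0 < C0.
Hypothesis lambda0 : 0 < lambda.
Hypothesis hf : forall u v : R, `|f u - f v| <= C0 * `|u - v| *
  (`|u| `^ (m - 1) * expR (lambda * `|u| `^ p) + `|v| `^ (m - 1) * expR (lambda * `|v| `^ p)).
Local Notation mu := (@lebesgue_Rn R d).
Local Notation leb := (@lebesgue_measure R).
Local Notation heat := (@hermite_heat R d beta).
Local Notation duh := (@duhamel R d beta).
Implicit Types (x : Rn R d) (s t : R).

Definition smoothing (C : R) r := forall t (g : Rn R d -> R) (B : R), 0 < t -> 0 < B -> L1r r.+1 g B ->
  bnd (heat t g) (C * B * expR (- (t / 4)) * Wk t).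

(* u = e^{-tH^beta} u0 + v solves the integral equation, with quantitative decay as t -> +oo *)
Definition mild_path (u0 : Rn R d -> R) (k0 K B : R) r (u v : R -> Rn R d -> R) :=
  [/\ measurable_fun setT u0 /\ (expL_modular p k0 u0 <= 1)%E,
      forall s x, u s x = heat s u0 x + v s x,
      forall s, 0 < s -> measurable_fun setT (u s) /\ (expL_modular p (K * expR (- (s / 4))) (u s) <= 2)%E,
      (forall eta T : R, 0 < eta -> ucon eta T u) /\ forcing r (fun s => f \o u s) B
    & forall s x, 0 < s -> v s x = duh (fun s => f \o u s) s x].

Lemma small_data_mild_path : exists2 C, 0 < C & exists r, smoothing C r /\
  exists eps k0 K B : R, [/\ 0 < eps, 0 < k0, 0 < K, 0 < B & forall u0 : Rn R d -> R, in_expL p u0 ->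
    (norm_expL p u0 <= eps%:E)%E -> exists u v, mild_path u0 k0 K B r u v].
Proof.
have [C C_gt0 [r sm]] := @heat_smoothing_Wk R d hd beta b01.
have [C1 C10 [kap1 kap10 NL1]] := nonlinear_L1r (d := d) p1 pm f0 C00 lambda0 hf r.
have [C2 C20 [kap2 kap20 NL2]] := nonlinear_L1r_diff (d := d) p1 pm C00 lambda0 hf r.
have [M M0 decay] := @heat_decay R d hd beta p b01 p1.
exists C => //; exists r; split => //.
have m1 : 0 < m - 1 by rewrite subr_gt0 (lt_le_trans p1).
have m0 : 0 < m by move: m1; lra.
pose L := M + expR 1; have L0 : 0 < L by rewrite addr_gt0 ?expR_gt0.
(* The single condition D K^{m-1} <= 1 covers both smallness hypotheses of the iteration; the factor
   L comes from k0 = K / L. *)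
pose D := 2 * C * C1 * L + 4 * C * C2; have D0 : 0 < D by rewrite addr_gt0 ?mulr_gt0.
pose kap := Num.min kap1 kap2; have kap0 : 0 < kap by rewrite lt_min kap10.
pose K := Num.min kap (D^-1 `^ (m - 1)^-1).
have K0 : 0 < K by rewrite lt_min kap0 powR_gt0 ?invr_gt0.
have Km1 : D * K `^ (m - 1) <= 1.
  rewrite -[leRHS](mulfV (lt0r_neq0 D0)) ler_pM2l//.
  apply: (@le_trans _ _ ((D^-1 `^ (m - 1)^-1) `^ (m - 1))); last first.
    by rewrite -powRrM mulVf ?gt_eqF// powRr1// invr_ge0 ltW.
  by rewrite ge0_ler_powR ?nnegrE ?powR_ge0 ?(ltW K0) ?(ltW m1)// ge_min lexx orbT.
have Kp0 : 0 <= K `^ (m - 1) by exact: powR_ge0.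
pose k0 := K / L; have k00 : 0 < k0 by rewrite divr_gt0.
have KE : M * k0 + expR 1 * k0 = K by rewrite -mulrDl -/L mulrC divfK ?gt_eqF.
(* Half of k0 leaves the strict gap that leads from the norm to the modular at scale k0. *)
exists (k0 / 2), k0, K, (C1 * K `^ m); split => //.
- by rewrite divr_gt0.
- by rewrite mulr_gt0// powR_gt0.
move=> u0 [[mu0 _] _] hu0.
have u0k : (expL_modular p k0 u0 <= 1)%E.
  by apply: (norm_expL_modular p1 _ mu0 hu0); rewrite gtr_pMr// invf_lt1// ltr1n.
have Kkap : M * k0 + expR 1 * k0 <= kap by rewrite KE ge_min lexx.
have S1 : 2 * C * C1 * (M * k0 + expR 1 * k0) `^ m <= k0.
  rewrite KE -mulr_powRB1 ?(ltW K0)//.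
  rewrite /k0 ler_pdivlMr//.
  apply: (@le_trans _ _ (K * (D * K `^ (m - 1)))); last by rewrite ler_piMr// ltW.
  have -> : 2 * C * C1 * (K * K `^ (m - 1)) * L = K * (2 * C * C1 * L * K `^ (m - 1)) by ring.
  by rewrite ler_pM2l// ler_wpM2r// lerDl !mulr_ge0// ltW.
have S2 : 4 * C * C2 * (M * k0 + expR 1 * k0) `^ (m - 1) <= 1.
  rewrite KE; apply: le_trans Km1; rewrite ler_wpM2r// lerDr !mulr_ge0// ltW//.
have NL1' : forall k (u : Rn R d -> R), 0 < k -> k <= kap -> measurable_fun setT u ->
    (expL_modular p k u <= 2)%E -> L1r r.+1 (f \o u) (C1 * k `^ m).
  by move=> k u k_gt0; rewrite le_min => /andP[h _]; exact: NL1.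
have NL2' : forall k (u w : Rn R d -> R) (A : R), 0 < k -> k <= kap -> measurable_fun setT u -> measurable_fun setT w ->
    (expL_modular p k u <= 2)%E -> (expL_modular p k w <= 2)%E -> bnd (fun x => u x - w x) A ->
    L1r r.+1 (fun x => f (u x) - f (w x)) (C2 * A * k `^ (m - 1)).
  by move=> k u w A k_gt0; rewrite le_min => /andP[_ h]; exact: NL2.
have P := picard_limP hd b01 p1 pm C_gt0 C10 C20 M0 sm NL1' NL2' decay k00 mu0 u0k Kkap S1 S2.
pose v := picard_lim beta f u0.
exists (full beta u0 v), v; split => //.
- by move=> s s0; have := full_modular hd b01 p1 M0 decay k00 mu0 u0k P s0; rewrite KE.
- split; first by move=> eta T eta0; exact: (full_ucon hd b01 p1 k00 mu0 u0k T P eta0).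
  have := forcing_full hd b01 p1 pm C10 C20 M0 NL1' NL2' decay k00 mu0 u0k Kkap P.
  by rewrite KE.
- move=> s x s0.
  exact: (picard_fixpoint hd b01 p1 pm C_gt0 C10 C20 M0 sm NL1' NL2' decay k00 mu0 u0k Kkap S1 S2).
Qed.

Lemma bnd_cvg0 (T : Type) (F : set_system T) {FF : Filter F} (g : T -> Rn R d -> R) (a : T -> R) :
  (\forall t \near F, bnd (g t) (a t)) -> a t @[t --> F] --> (0 : R) ->
  norm_expL p (g t) @[t --> F] --> 0%E.
Proof.
move=> ga a0; have h : \forall t \near F, (0 <= norm_expL p (g t) <= (expR 1 * a t)%:E)%E.
  by apply: filterS ga => t gt; rewrite norm_expL_ge0/=; exact: (bnd_norm_expL p1 gt).
apply: (squeeze_cvge (Fa := FF) h).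
- exact: cvg_cst.
- apply: cvg_EFin; first exact: nearW.
  by rewrite -[X in _ --> X](mulr0 (expR 1)); apply: cvgM => //; exact: cvg_cst.
Qed.

Section path.
Variables (C k0 K B : R) (r : nat) (u0 : Rn R d -> R) (u v : R -> Rn R d -> R).
Hypothesis C_gt0 : 0 < C.
Hypothesis sm : smoothing C r.
Hypothesis k00 : 0 < k0.
Hypothesis K0 : 0 < K.
Hypothesis B0 : 0 < B.
Hypothesis uP : mild_path u0 k0 K B r u v.

Let Ks s : 0 < s -> 0 < K * expR (- (s / 4)) /\ K * expR (- (s / 4)) <= K.
Proof.
move=> s0; rewrite mulr_gt0 ?expR_gt0//; split => //; apply: ler_piMr; first exact: ltW.
by rewrite expR_le1 oppr_le0 divr_ge0// ltW.
Qed.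

Lemma mild_path_norm s : 0 < s -> in_expL p (u s) /\ (norm_expL p (u s) <= (2 * K)%:E)%E.
Proof.
move=> s0; have [_ _ /(_ s s0)[mu' hu] _ _] := uP; have [k1 k2] := Ks s0.
have h1 := expL_modular_half p1 k1 mu' hu; have k3 : 0 < 2 * (K * expR (- (s / 4))) by rewrite mulr_gt0.
split.
  by apply: (in_expL_modular p1 k1 mu'); apply: (le_lt_trans hu); rewrite ltry.
by apply: le_trans (norm_expL_le k3 h1) _; rewrite lee_fin ler_pM2l.
Qed.

(** Strong measurability uses step functions on [1/(n + 1), n + 2[ with error 1/(n + 1); every t > 0
    lies in these intervals eventually. *)
Lemma mild_path_Linfty : in_Linfty_expL p (time_interval +oo%E) u.
Proof.
have [_ _ _ [uu _] _] := uP; split.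
- by move=> t [t0 _]; have [] := mild_path_norm t0.
- split; first by apply: aeW => t [t0 _]; have [] := mild_path_norm t0.
  have /choice[S hS] : forall n, exists S : @expL_step R d p,
      (forall s, n.+1%:R^-1 <= s < n.+2%:R -> bnd (fun x => u s x - step_eval S s x) n.+1%:R^-1).
    move=> n; have n0 : 0 < n.+1%:R^-1 :> R by rewrite invr_gt0.
    have [||S [hS _]] := @step_exists R d p n.+1%:R^-1 n.+2%:R n.+1%:R^-1 u _ n0 _ (uu _ _ n0); last by exists S.
      apply: (@le_lt_trans _ _ 1); first by rewrite invf_le1// ler1n.
      by rewrite ltr1n.
    by move=> s /andP[ns _]; have [] := mild_path_norm (lt_le_trans n0 ns).
  exists S; apply: aeW => t [t0 _]; apply: (bnd_cvg0 (a := fun n => n.+1%:R^-1)); last exact: cvg_harmonic.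
  near=> n; apply: hS; apply/andP; split.
    rewrite invf_ple ?posrE//; apply: (@le_trans _ _ n%:R); last by rewrite ler_nat.
    by near: n; exact: nbhs_infty_ger.
  apply: (@le_lt_trans _ _ n%:R); last by rewrite ltr_nat.
  by near: n; exact: nbhs_infty_ger.
- by exists (2 * K); apply: aeW => t [t0 _]; have [] := mild_path_norm t0.
Unshelve. all: end_near.
Qed.

Lemma mild_path_equation t : 0 < t -> mild_equation_at beta p f u0 u t.
Proof.
move=> t0; have [[mu0 u0k] uE _ [_ FB] vE] := uP; have [FB1 _] := FB.
have [u0W _] := expL_modular_wL1 p1 k00 mu0 u0k.
split; first exact: hermite_heat_definedW.
  apply: aeW => s /andP[s0 st]; have [W _] := L1r_wL1 (FB1 s s0).
  by apply: hermite_heat_definedW => //; rewrite subr_gt0.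
exists (duh (fun s => f \o u s) t); last by apply: aeW => x; rewrite uE vE.
apply: (@bochner_path R d p p1 t (fun s => heat (t - s) (f \o u s)) t0 _ _ (C * B * expR (- (t / 4)))).
- by move=> s st; apply: (bnd_in_expL p1 (duhamel_integrand sm B0 FB1 st)).
- by move=> eta T eta0 Tt; exact: (duhamel_ucon hd b01 C_gt0 sm B0 FB eta0 Tt).
- by rewrite !mulr_ge0 ?expR_ge0// ltW.
- by move=> s st; have h := duhamel_integrand sm B0 FB1 st; exact h.
Qed.

Lemma mild_path_perturbation t : 0 < t ->
  bnd (v t) (C * B * (2 * (1 - expR (- Num.sqrt t)))).
Proof.
move=> t0; have [_ _ _ [_ FB] vE] := uP.
have [_ h] := duhamel_bnd hd b01 p1 C_gt0 sm B0 FB t0.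
rewrite (_ : v t = duh (fun s => f \o u s) t); last by apply/funext => x; exact: vE.
apply: (bnd_le h); apply: ler_wpM2r.
  by rewrite mulr_ge0// subr_ge0 expR_le1 oppr_le0 sqrtr_ge0.
apply: ler_piMr; first by rewrite mulr_ge0// ltW.
by rewrite expR_le1 oppr_le0 divr_ge0// ltW.
Qed.

Lemma cvg_expR_sqrt0 (c : R) : c * (2 * (1 - expR (- Num.sqrt t))) @[t --> 0^'+] --> (0 : R).
Proof.
have E : 0 = c * (2 * (1 - expR (- Num.sqrt 0))) :> R by rewrite sqrtr0 oppr0 expR0 subrr !mulr0.
rewrite [X in _ --> X]E; apply: cvgM; first exact: cvg_cst.
apply: cvgM; first exact: cvg_cst.
apply: cvgB; first exact: cvg_cst.
apply: cvg_expR; apply: cvgN; apply: cvg_at_right_filter; exact: sqrt_continuous.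
Qed.

Lemma mild_path_initial :
  norm_expL p (fun x => u t x - heat t u0 x) @[t --> 0^'+] --> 0%E.
Proof.
apply: (bnd_cvg0 (a := fun t => C * B * (2 * (1 - expR (- Num.sqrt t))))); last exact: cvg_expR_sqrt0.
near=> t; have t0 : 0 < t by near: t; exact: nbhs_right_gt.
have := mild_path_perturbation t0; congr (bnd _ _); apply/funext => x.
by have [_ -> _ _ _] := uP; rewrite addrAC subrr add0r.
Unshelve. all: end_near.
Qed.

(** With N = 4 sigma, raising t <= N e^{t/N} to the power sigma gives t^sigma <= N^sigma e^{t/4}. *)
Lemma powR_expR_decay (sigma : R) : 0 < sigma -> exists2 A, 0 < A &
  forall t, 0 < t -> expR (- (t / 4)) <= A * t `^ (- sigma).
Proof.
move=> s0; pose N := 4 * sigma; have N0 : 0 < N by rewrite mulr_gt0.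
exists (N `^ sigma); first by rewrite powR_gt0.
move=> t t0; have h1 : t <= N * expR (t / N).
  by rewrite mulrC -ler_pdivrMr//; have := expR_ge1Dx (t / N); lra.
have h2 : t `^ sigma <= N `^ sigma * expR (t / 4).
  apply: (@le_trans _ _ ((N * expR (t / N)) `^ sigma)).
    by rewrite ge0_ler_powR ?nnegrE ?(ltW s0) ?(ltW t0)// mulr_ge0 ?expR_ge0// ltW.
  rewrite powRM ?expR_ge0 ?(ltW N0)// ler_wpM2l ?powR_ge0// -expRM ler_expR /N.
  rewrite le_eqVlt; apply/orP; left; apply/eqP; field; by rewrite gt_eqF.
rewrite expRN powRN ler_pdivlMr ?powR_gt0// mulrC ler_pdivrMr ?expR_gt0//.
Qed.

(** For a >= p the power s^a = (s^p)^{a/p} is O(psi(s)), also near 0 because a/p >= 1; homogeneity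
    then extracts the scale k. *)
Lemma expL_modular_Lnorm (a : R) : p <= a -> exists2 A, 0 < A & forall k (g : Rn R d -> R), 0 < k ->
  measurable_fun setT g -> (expL_modular p k g <= 2)%E ->
  ('N[mu]_(a%:E)[EFin \o g] <= (A * k)%:E)%E.
Proof.
move=> pa; have p0 : 0 < p by exact: lt_trans p1.
have a0 : 0 < a by exact: lt_le_trans pa.
have [A A0 hA] : exists2 A : R, 0 < A & forall y, 0 <= y -> y `^ (a / p) * expR (y / 2) <= A * (expR y - 1).
  by apply: powR_expR_half; rewrite ler_pdivlMr// mul1r.
exists ((A * 2) `^ a^-1); first by rewrite powR_gt0// mulr_gt0.
move=> k g k_gt0 mg hg.
have pos z : 0 <= z `^ a :> R by exact: powR_ge0.
have mga : measurable_fun setT (fun x => `|g x| `^ a).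
  apply: (measurableT_comp (@measurable_powR R a)); exact: measurableT_comp.
have H : (\int[mu]_x (`|g x| `^ a)%:E <= ((A * 2) * k `^ a)%:E)%E.
  apply: (@le_trans _ _ (\int[mu]_x ((k `^ a * A) * psi p (`|g x| / k))%:E)%E).
    apply: le_integral_EFin => //.
      by apply: measurable_cstM; exact: measurable_psi_abs.
    move=> x; rewrite pos/=; have z0 : 0 <= `|g x| / k by rewrite divr_ge0// ltW.
    have -> : `|g x| `^ a = k `^ a * (`|g x| / k) `^ a.
      by rewrite -powRM ?(ltW k_gt0)// mulrC divfK// gt_eqF.
    rewrite -mulrA ler_wpM2l//; apply: le_trans (hA _ (powR_ge0 (`|g x| / k) p)).
    rewrite -powRrM mulrCA divff ?gt_eqF// mulr1 ler_peMr//.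
    by rewrite -[leLHS]expR0 ler_expR divr_ge0// powR_ge0.
  rewrite (integralZl_EFin mu (measurable_psi_abs p k mg)); last 2 first.
  - by move=> x; exact: psi_ge0.
  - by rewrite mulr_ge0// ltW.
  rewrite -(expL_modularE p k_gt0 g); apply: le_trans (lee_wpmul2l _ hg) _.
    by rewrite lee_fin mulr_ge0// ltW.
  rewrite -[leLHS]/((k `^ a * A * 2)%:E) lee_fin le_eqVlt; apply/orP; left; apply/eqP.
  by move: (k `^ a) => q; ring.
have -> : 'N[mu]_(a%:E)[EFin \o g]%E = ((\int[mu]_x (`|g x| `^ a)%:E) `^ a^-1)%E by rewrite unlock.
apply: (@le_trans _ _ (((A * 2) * k `^ a)%:E `^ a^-1)%E).
  apply: gt0_ler_poweR => //; rewrite ?invr_ge0 ?(ltW a0)// ?in_itv/= ?leey ?andbT.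
  - by apply: integral_ge0 => x _; rewrite lee_fin.
  - by rewrite lee_fin !mulr_ge0// ltW.
rewrite poweR_EFin lee_fin powRM ?mulr_ge0 ?(ltW A0)// ler_wpM2l ?powR_ge0//.
by rewrite -powRrM mulfV ?gt_eqF// powRr1// ltW.
Qed.

(** The scale K e^{-t/4} of the modular bounds the L^a norm, and e^{-t/4} is O(t^{-sigma}) for small
    and large times alike. *)
Lemma mild_path_Lnorm (a sigma : R) : p <= a -> 0 < sigma -> exists2 A, 0 < A & forall t, 0 < t ->
  ('N[mu]_(a%:E)[EFin \o u t] <= (A * t `^ (- sigma))%:E)%E.
Proof.
move=> pa s0; have [A A0 hA] := expL_modular_Lnorm pa; have [D D0 hD] := powR_expR_decay s0.
exists (A * K * D); first by rewrite !mulr_gt0.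
move=> t t0; have [_ _ /(_ t t0)[mu' hu] _ _] := uP; have [k1 k2] := Ks t0.
apply: le_trans (hA _ _ k1 mu' hu) _; rewrite lee_fin -!mulrA.
by rewrite ler_pM2l// ler_pM2l//; exact: hD.
Qed.

End path.
End existence.

(** * Weak-star continuity *)

Section psi_conj.
Context {R : realType}.
Variable p : R.
Hypothesis p1 : 1 < p.
Implicit Types (r s y N : R).

Let q := p / (p - 1).
Let p0 : 0 < p. Proof. exact: lt_trans p1. Qed.
Let pm1 : 0 < p - 1. Proof. by rewrite subr_gt0. Qed.

Lemma psi_young r s : 0 <= s -> ((r * s)%:E <= (psi p s)%:E + psi_conj p r)%E.
Proof.
move=> s0; have h : ((r * s - psi p s)%:E <= psi_conj p r)%E by apply: ereal_sup_ubound; exists s.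
by apply: le_trans (leeD2l (psi p s)%:E h); rewrite -EFinD lee_fin addrC subrK.
Qed.

Lemma psi_conj_ge0 r : (0 <= psi_conj p r)%E.
Proof. by apply: ereal_sup_ubound; exists 0 => //=; rewrite psi0// mulr0 subr0. Qed.

Lemma le_psi_conj r r' : r <= r' -> (psi_conj p r <= psi_conj p r')%E.
Proof.
move=> rr'; apply: ge_ereal_sup => _ [s /= s0 <-].
apply: (@le_trans _ _ (r' * s - psi p s)%:E).
  by rewrite lee_fin lerD2r ler_wpM2r.
by apply: ereal_sup_ubound; exists s.
Qed.

(** The conjugate is nondecreasing, so its superlevel sets are intervals. *)
Lemma measurable_psi_conj : measurable_fun setT (psi_conj p : measurableTypeR R -> \bar R).
Proof.
apply: (measurability _ (ErealGenOInfty.measurableE R)) => // _ [_ [x ->] <-].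
rewrite setTI; apply: is_interval_measurable => a b /= ha hb c /andP[ac cb].
move: ha; rewrite /= !in_itv/= !andbT => /lt_le_trans; apply; exact: le_psi_conj.
Qed.

(** psi(s) >= s^p, and beyond s1 = r^{1/(p-1)} the product r s is at most s^p; up to s1 it is at
    most r s1 = r^q. *)
Lemma psi_conj_le_powR r : 0 <= r -> (psi_conj p r <= (r `^ q)%:E)%E.
Proof.
move=> r0; apply: ge_ereal_sup => _ [s /= s0 <-]; rewrite lee_fin.
have h : s `^ p <= psi p s by have := expR_ge1Dx (s `^ p); rewrite /psi; lra.
pose s1 := r `^ (p - 1)^-1.
have s10 : 0 <= s1 by exact: powR_ge0.
have rE : r = s1 `^ (p - 1) by rewrite /s1 -powRrM mulVf ?gt_eqF// powRr1.
have qE : r `^ q = r * s1.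
  rewrite /s1 mulrC; have [->|rn0] := eqVneq r 0.
    by rewrite mulr0 powR0// mulf_neq0 ?invr_neq0 ?gt_eqF.
  rewrite -[X in _ = _ * X]powRr1// -?powRD ?rn0 ?implybT//; congr (_ `^ _).
  by rewrite /q; field; rewrite gt_eqF.
rewrite qE; have [ss1|s1s] := leP s s1.
  apply: (@le_trans _ _ (r * s)); last by rewrite ler_wpM2l.
  by rewrite gerBl psi_ge0.
have : r * s <= s `^ p.
  rewrite -(mulr_powRB1 s0)// mulrC ler_wpM2l// rE ge0_ler_powR ?nnegrE// ltW//.
have := mulr_ge0 r0 s10; move: (psi p s) (s `^ p) (r * s) (r * s1) h => a b c e; lra.
Qed.

(** A convex function vanishing at 0 is superhomogeneous. *)
Lemma expR_sub1_scale L y : 1 <= L -> 0 <= y -> L * (expR y - 1) <= expR (L * y) - 1.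
Proof.
move=> L1 y0; have -> : L * y = y + (L - 1) * y by ring.
rewrite expRD; have h1 := expR_ge1Dx ((L - 1) * y).
have h2 : expR y * (1 - y) <= 1.
  rewrite -[leRHS](mulVf (lt0r_neq0 (expR_gt0 y))) mulrC ler_pM2r ?expR_gt0// -expRN.
  by have := expR_ge1Dx (- y).
have e0 := expR_gt0 y; move: (expR ((L - 1) * y)) h1 => e' h1; move: (expR y) e0 h2 => e e0 h2.
have h3 := ler_wpM2l (ltW e0) h1.
have h4 : 0 <= (L - 1) * (1 - e * (1 - y)) by rewrite mulr_ge0// subr_ge0.
nra.
Qed.

Lemma psi_scale N s : 1 <= N -> 0 <= s -> N `^ p * psi p s <= psi p (N * s).
Proof.
move=> N1 s0; have N0 : 0 <= N by exact: le_trans N1.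
rewrite /psi powRM//; apply: expR_sub1_scale; last exact: powR_ge0.
have : 1 `^ p <= N `^ p by rewrite ge0_ler_powR ?nnegrE// ltW.
by rewrite powR1.
Qed.

(** The Delta_2 bound, by the substitution of s / L for s with L = N^{1/(p-1)}: then L^p = N L =
    N^q, and psi(s) >= L^p psi(s / L). *)
Lemma psi_conj_scale N r : 1 <= N -> (psi_conj p (N * r) <= (N `^ q)%:E * psi_conj p r)%E.
Proof.
move=> N1; have N0 : 0 < N by exact: lt_le_trans N1.
apply: ge_ereal_sup => _ [s /= s0 <-].
pose L := N `^ (p - 1)^-1; have L0 : 0 < L by exact: powR_gt0.
have L1 : 1 <= L.
  have : 1 `^ (p - 1)^-1 <= L by rewrite ge0_ler_powR ?nnegrE ?invr_ge0 ?(ltW pm1) ?(ltW N0).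
  by rewrite powR1.
have Lp : L `^ p = N `^ q by rewrite /L -powRrM mulrC.
have NL : N `^ q = N * L.
  rewrite /L mulrC -[X in _ = _ * X]powRr1 ?(ltW N0)// -powRD ?(gt_eqF N0) ?implybT//; congr (_ `^ _).
  by rewrite /q; field; rewrite gt_eqF.
have s'0 : 0 <= s / L by rewrite divr_ge0// ltW.
apply: (@le_trans _ _ ((N `^ q)%:E * (r * (s / L) - psi p (s / L))%:E)%E); last first.
  apply: lee_wpmul2l; first by rewrite lee_fin powR_ge0.
  by apply: ereal_sup_ubound; exists (s / L).
rewrite -EFinM lee_fin mulrBr; have := psi_scale L1 s'0.
rewrite Lp mulrCA divff ?gt_eqF// mulr1.
have -> : N `^ q * (r * (s / L)) = N * r * s.
  by rewrite NL; field; rewrite gt_eqF.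
by move: (psi p s) => a; move: (_ * psi p _) => b; lra.
Qed.

End psi_conj.

(** * Pairing exp L^p with its predual *)

Section pairing.
Context {R : realType} {d : nat}.
Variable p : R.
Hypothesis p1 : 1 < p.
Local Notation mu := (@lebesgue_Rn R d).
Implicit Types (w phi g : Rn R d -> R) (x : Rn R d) (k l : R).

Lemma measurable_psi_conj_abs l g : measurable_fun setT g ->
  measurable_fun setT (fun x => psi_conj p (`|g x| / l)).
Proof.
move=> mg; apply: (measurableT_comp (measurable_psi_conj p)).
by apply: measurable_funM => //; exact: measurableT_comp.
Qed.

(** Young's inequality for psi and [psi_conj], at scale k for one factor and l for the other. *)
Lemma pairing_le k l w phi : 0 < k -> 0 < l -> measurable_fun setT w -> measurable_fun setT phi ->
  (\int[mu]_x (`|w x * phi x|)%:E <=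
   (k * l)%:E * (expL_modular p k w + \int[mu]_x psi_conj p (`|phi x| / l)))%E.
Proof.
move=> k0 l0 mw mphi; have kl : 0 <= k * l by rewrite mulr_ge0// ltW.
have mp := measurable_psi_abs p k mw; have mc := measurable_psi_conj_abs l mphi.
rewrite (expL_modularE p k0 w) -ge0_integralD//; last 3 first.
- by move=> x _; rewrite lee_fin psi_ge0.
- exact/measurable_EFinP.
- by move=> x _; exact: psi_conj_ge0.
rewrite -ge0_integralZl_EFin//; last 2 first.
- by move=> x _; rewrite adde_ge0 ?lee_fin ?psi_ge0 ?psi_conj_ge0.
- by apply: emeasurable_funD => //; exact/measurable_EFinP.
apply: ge0_le_integral => //.
- by apply/measurable_EFinP; apply: measurableT_comp => //; exact: measurable_funM.
- apply: emeasurable_funM; first exact: measurable_cst.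
  by apply: emeasurable_funD => //; exact/measurable_EFinP.
move=> x _; have -> : `|w x * phi x| = (k * l) * ((`|phi x| / l) * (`|w x| / k)).
  by rewrite normrM; field; rewrite !gt_eqF.
rewrite EFinM; apply: lee_wpmul2l => //.
by apply: psi_young; rewrite divr_ge0// ltW.
Qed.

End pairing.

(** * The class of test functions with convergent pairings *)

Section weak_star_density.
Context {R : realType} {d : nat}.
Variables (p k0 : R).
Hypothesis p1 : 1 < p.
Hypothesis k0_gt0 : 0 < k0.
Local Notation mu := (@lebesgue_Rn R d).
Implicit Types (w phi g : Rn R d -> R) (x : Rn R d) (k l : R).

(** One modular bound at a fixed scale for all times: the uniformity on which the density argument
    rests. *)
Definition expL_ball w := measurable_fun setT w /\ (expL_modular p k0 w <= 1)%E.

(* psi_conj satisfies the Delta_2 condition (psi_conj_scale), so that some l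
   could equivalently replace all l. *)
Definition conj_finite g := measurable_fun setT g /\
  forall l, 0 < l -> (\int[mu]_x psi_conj p (`|g x| / l) < +oo)%E.

(** \int being total, linearity of [pairing] in the test function requires integrability. *)
Definition pairable phi := measurable_fun setT phi /\
  forall w, expL_ball w -> mu.-integrable setT (EFin \o (fun x => w x * phi x)).

Lemma in_predual_conj_finite phi : in_predual p phi -> conj_finite phi.
Proof.
move=> [[mphi _] [k k_gt0 hk]]; split => // l l0.
pose N := Num.max 1 (k / l); have N1 : 1 <= N by rewrite le_max lexx.
apply: (@le_lt_trans _ _ ((N `^ (p / (p - 1)))%:E * \int[mu]_x psi_conj p (`|phi x| / k))%E); last first.
  by apply: lte_mul_pinfty => //; rewrite lee_fin powR_ge0.
rewrite -ge0_integralZl_EFin//; last 3 first.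
- by move=> x _; exact: psi_conj_ge0.
- exact: measurable_psi_conj_abs.
- exact: powR_ge0.
apply: ge0_le_integral => //.
- by move=> x _; exact: psi_conj_ge0.
- exact: measurable_psi_conj_abs.
- by apply: emeasurable_funM; [exact: measurable_cst|exact: measurable_psi_conj_abs].
move=> x _; apply: le_trans (psi_conj_scale p1 _ N1); apply: le_psi_conj.
have -> : `|phi x| / l = k / l * (`|phi x| / k) by field; rewrite !gt_eqF.
by rewrite ler_wpM2r ?divr_ge0 ?(ltW k_gt0)// le_max lexx orbT.
Qed.

Lemma conj_finite_le g phi : measurable_fun setT phi -> (forall x, `|phi x| <= `|g x|) ->
  conj_finite g -> conj_finite phi.
Proof.
move=> mphi h [mg hg]; split => // l l0; apply: le_lt_trans (hg l l0).
apply: ge0_le_integral => //.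
- by move=> x _; exact: psi_conj_ge0.
- exact: measurable_psi_conj_abs.
- exact: measurable_psi_conj_abs.
by move=> x _; apply: le_psi_conj; rewrite ler_wpM2r// invr_ge0 ltW.
Qed.

Lemma conj_finite_pairable phi : conj_finite phi -> pairable phi.
Proof.
move=> [mphi h]; split => // w [mw hw]; apply/integrableP; split.
  by apply/measurable_EFinP; exact: measurable_funM.
apply: le_lt_trans (pairing_le p1 k0_gt0 ltr01 mw mphi) _.
apply: lte_mul_pinfty => //; first by rewrite lee_fin mulr1 ltW.
by apply: lte_add_pinfty; [apply: le_lt_trans hw _; exact: ltry|exact: h].
Qed.

Lemma conj_finite_indic (B : set (Rn R d)) : measurable B -> (mu B < +oo)%E ->
  conj_finite (\1_B : Rn R d -> R).
Proof.
move=> mB Bfin; split => [|l l0]; first exact: measurable_indic.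
apply: (@le_lt_trans _ _ (\int[mu]_x ((l^-1 `^ (p / (p - 1))) * \1_B x)%:E)%E).
  apply: ge0_le_integral => //.
  - by move=> x _; exact: psi_conj_ge0.
  - by apply: measurable_psi_conj_abs; exact: measurable_indic.
  - by apply/measurable_EFinP; apply: measurable_cstM; exact: measurable_indic.
  move=> x _; rewrite indicE; case: (_ \in _).
    by rewrite normr1 mul1r mulr1; apply: psi_conj_le_powR => //; rewrite invr_ge0 ltW.
  rewrite normr0 mul0r mulr0; apply: le_trans (psi_conj_le_powR p1 (lexx 0)) _.
  by rewrite powR0// mulf_neq0 ?invr_neq0// gt_eqF ?subr_gt0// (lt_trans ltr01).
rewrite integralZl_EFin; [|exact: measurable_indic|by move=> x; rewrite indicE|exact: powR_ge0].
by rewrite integral_indic// setIT; apply: lte_mul_pinfty => //; rewrite lee_fin powR_ge0.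
Qed.

Lemma pairableD phi g : pairable phi -> pairable g -> pairable (fun x => phi x + g x).
Proof.
move=> [m1 h1] [m2 h2]; split; first exact: measurable_funD.
move=> w wB; have := integrableD measurableT (h1 w wB) (h2 w wB).
by congr (mu.-integrable _ _); apply/funext => x /=; rewrite mulrDr.
Qed.

Lemma pairableZ (c : R) phi : pairable phi -> pairable (fun x => c * phi x).
Proof.
move=> [m1 h1]; split; first exact: measurable_cstM.
move=> w wB; under [X in _ \o X]eq_fun do rewrite mulrCA.
by apply: integrableMl_EFin; exact: h1.
Qed.

Definition pairing w phi := \int[mu]_x (w x * phi x).

Lemma pairingD w phi g : expL_ball w -> pairable phi -> pairable g ->
  pairing w (fun x => phi x + g x) = pairing w phi + pairing w g.
Proof.
move=> h [_ i1] [_ i2]; rewrite /pairing.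
by under eq_Rintegral do rewrite mulrDr; rewrite RintegralD//; [exact: i1|exact: i2].
Qed.

Lemma pairingZ w phi (c : R) : expL_ball w -> pairable phi ->
  pairing w (fun x => c * phi x) = c * pairing w phi.
Proof.
move=> h [_ i1]; rewrite /pairing.
by under eq_Rintegral do rewrite mulrCA; rewrite RintegralZl//; exact: i1.
Qed.

Lemma pairing_close l w phi g : 0 < l -> expL_ball w -> pairable phi -> pairable g ->
  (\int[mu]_x psi_conj p (`|(phi x - g x)%R| / l) <= 1)%E ->
  `|pairing w phi - pairing w g| <= 2 * k0 * l.
Proof.
move=> l0 wB aphi ag h; have [m1 h1] := aphi; have [m2 h2] := ag; have [mw hw] := wB.
rewrite /pairing -RintegralB//; [|exact: h1|exact: h2].
have i12 : mu.-integrable setT (EFin \o (fun x => w x * (phi x - g x))).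
  have [_ /(_ w wB)] := pairableD aphi (pairableZ (-1) ag).
  congr (mu.-integrable _ (EFin \o _)); by apply/funext => x; rewrite mulN1r.
under eq_Rintegral do rewrite -mulrBr.
rewrite -lee_fin; apply: le_trans (normr_Rintegral_leE i12) _.
apply: le_trans (pairing_le p1 k0_gt0 l0 mw (measurable_funB m1 m2)) _.
have kl : (0 <= (k0 * l)%:E)%E by rewrite lee_fin mulr_ge0// ltW.
apply: le_trans (lee_wpmul2l kl (leeD hw h)) _.
by rewrite -[leLHS]/((k0 * l * (1 + 1))%:E) lee_fin; lra.
Qed.

Lemma psi_conj_le_id r : 0 <= r <= 1 -> (psi_conj p r <= r%:E)%E.
Proof.
move=> /andP[r0 r1]; apply: le_trans (psi_conj_le_powR p1 r0) _; rewrite lee_fin.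
have pm1 : 0 < p - 1 by rewrite subr_gt0.
have [->|rn0] := eqVneq r 0.
  by rewrite powR0// mulf_neq0 ?invr_neq0 ?gt_eqF// (lt_trans ltr01).
apply: ge1r_powR; first by rewrite lt_neqAle eq_sym rn0 r0.
by rewrite ler_pdivlMr// mul1r gerBl.
Qed.

Section against.
Variables (w_ : R -> Rn R d -> R) (u0 : Rn R d -> R).
Hypothesis wB : forall t, 0 < t -> expL_ball (w_ t).
Hypothesis u0B : expL_ball u0.

Definition converges_against phi := pairable phi /\
  pairing (w_ t) phi @[t --> 0^'+] --> pairing u0 phi.

Lemma converges_againstD phi g : converges_against phi -> converges_against g ->
  converges_against (fun x => phi x + g x).
Proof.
move=> [a1 c1] [a2 c2]; split; first exact: pairableD.
rewrite (pairingD u0B a1 a2).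
have h : \forall t \near (0 : R)^'+, pairing (w_ t) phi + pairing (w_ t) g = pairing (w_ t) (fun x => phi x + g x).
  apply: filterS (nbhs_right_gt (0 : R)) => t t0; exact: esym (pairingD (wB t0) a1 a2).
exact: cvg_trans (near_eq_cvg h) (cvgD c1 c2).
Qed.

Lemma converges_againstZ (c : R) phi : converges_against phi -> converges_against (fun x => c * phi x).
Proof.
move=> [a1 c1]; split; first exact: pairableZ.
rewrite (pairingZ c u0B a1).
have h : \forall t \near (0 : R)^'+, c * pairing (w_ t) phi = pairing (w_ t) (fun x => c * phi x).
  apply: filterS (nbhs_right_gt (0 : R)) => t t0; exact: esym (pairingZ c (wB t0) a1).
apply: cvg_trans (near_eq_cvg h) _; apply: cvgM => //; exact: cvg_cst.
Qed.

Lemma converges_against_ext phi g : (forall x, phi x = g x) -> converges_against phi -> converges_against g.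
Proof. by move=> h; rewrite (_ : phi = g)//; exact/funext. Qed.

Lemma converges_againstB phi g : converges_against phi -> converges_against g ->
  converges_against (fun x => phi x - g x).
Proof.
move=> h1 /(converges_againstZ (-1)) h2.
by apply: converges_against_ext (converges_againstD h1 h2) => x; rewrite mulN1r.
Qed.

Lemma converges_against0 : converges_against (fun=> 0).
Proof.
split.
  split => // w _; rewrite (_ : _ \o _ = cst 0%E); first exact: integrable0.
  by apply/funext => x /=; rewrite mulr0.
have E w : pairing w (fun=> 0) = 0.
  by rewrite /pairing; under eq_Rintegral do rewrite mulr0; rewrite /Rintegral integral0.
rewrite E (_ : (fun t => _) = fun=> 0); first exact: cvg_cst.
by apply/funext => t; rewrite E.
Qed.

Lemma converges_against_sum n (phi : 'I_n -> Rn R d -> R) :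
  (forall i, converges_against (phi i)) -> converges_against (fun x => \sum_(i < n) phi i x).
Proof.
move=> h; elim: n phi h => [|n IH] phi h.
  by apply: converges_against_ext converges_against0 => x; rewrite big_ord0.
apply: converges_against_ext (converges_againstD (IH _ (fun i => h (widen_ord (leqnSn n) i))) (h ord_max)) => x.
by rewrite big_ord_recr.
Qed.

(** Dominated convergence sends the [psi_conj] modular of phi - phi_n at scale l to 0, which bounds
    the error of the pairings uniformly over the ball; three terms of size e/3 remain. *)
Lemma converges_against_lim phi g (phi_ : nat -> Rn R d -> R) :
  conj_finite g -> measurable_fun setT phi -> (forall x, `|phi x| <= `|g x|) ->
  (forall n x, `|phi x - phi_ n x| <= `|g x|) -> (forall x, phi_ n x @[n --> \oo] --> phi x) ->
  (forall n, converges_against (phi_ n)) -> converges_against phi.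
Proof.
move=> gF mphi phig dom cv H; have [mg hg] := gF.
have aphi : pairable phi by apply: conj_finite_pairable; exact: conj_finite_le gF.
split => //; apply/cvgrPdist_le => e e0.
pose l := e / (6 * k0); have l0 : 0 < l by rewrite divr_gt0// mulr_gt0.
have lE : 2 * k0 * l = e / 3 by rewrite /l; field; rewrite gt_eqF.
have md n : measurable_fun setT (fun x => phi x - phi_ n x).
  by have [[mn _] _] := H n; exact: measurable_funB.
have : (\int[mu]_x psi_conj p (`|(phi x - phi_ n x)%R| / l))%E @[n --> \oo] --> 0%E.
  have [||||| _ _] := @dominated_convergence _ _ _ mu setT measurableT
    (fun n x => psi_conj p (`|phi x - phi_ n x| / l)) (cst 0%E) (fun x => psi_conj p (`|g x| / l)).
  - by move=> n; exact: measurable_psi_conj_abs.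
  - exact: measurable_cst.
  - apply: aeW => x _.
    have c0 : `|phi x - phi_ n x| / l @[n --> \oo] --> (0 : R).
      rewrite -(mul0r l^-1); apply: cvgM; last exact: cvg_cst.
      by apply/norm_cvg0P; rewrite -(subrr (phi x)); apply: cvgB => //; exact: cvg_cst.
    apply: (@squeeze_cvge _ _ _ _ (fun=> 0%E) _ (fun n => (`|phi x - phi_ n x| / l)%:E)).
    + near=> n; rewrite psi_conj_ge0//=; apply: psi_conj_le_id.
      rewrite divr_ge0 ?(ltW l0)//=.
      have : `|0 - `|phi x - phi_ n x| / l| <= 1 by near: n; move/cvgrPdist_le : c0; apply.
      by rewrite sub0r normrN ger0_norm// divr_ge0// ltW.
    + exact: cvg_cst.
    + by apply: cvg_EFin => //; exact: nearW.
  - apply/integrableP; split; first exact: measurable_psi_conj_abs.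
    rewrite (eq_integral (fun x => psi_conj p (`|g x| / l)))//; first exact: hg.
    by move=> x _; rewrite gee0_abs// psi_conj_ge0.
  - apply: aeW => x n _; rewrite gee0_abs ?psi_conj_ge0//; apply: le_psi_conj.
    by rewrite ler_wpM2r// invr_ge0 ltW.
  by rewrite integral0.
move=> /fine_cvgP[nf /cvgrPdist_le/(_ 1 ltr01) nc].
have [n hn] : exists n, (\int[mu]_x psi_conj p (`|(phi x - phi_ n x)%R| / l) <= 1)%E.
  have [n [fn cn]] := filter_ex (filterI nf nc); exists n.
  rewrite -(fineK fn) lee_fin; apply: le_trans cn; rewrite sub0r normrN.
  exact: ler_norm.
have [an cvn] := H n.
have close w : expL_ball w -> `|pairing w phi - pairing w (phi_ n)| <= e / 3.
  by move=> h; rewrite -lE; exact: pairing_close.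
near=> t; have t0 : 0 < t by near: t; exact: nbhs_right_gt.
have h1 := close u0 u0B; have h2 := close (w_ t) (wB t0).
have h3 : `|pairing u0 (phi_ n) - pairing (w_ t) (phi_ n)| <= e / 3.
  by near: t; move/cvgrPdist_le : cvn; apply; rewrite divr_gt0.
rewrite distrC in h2.
have -> : pairing u0 phi - pairing (w_ t) phi = (pairing u0 phi - pairing u0 (phi_ n)) +
  (pairing u0 (phi_ n) - pairing (w_ t) (phi_ n)) + (pairing (w_ t) (phi_ n) - pairing (w_ t) phi).
  by move: (pairing _ _) (pairing _ _) (pairing _ _) (pairing _ _) => a b c e'; ring.
apply: le_trans (ler_normD _ _) _; apply: le_trans (lerD (ler_normD _ _) (lexx _)) _.
move: h1 h2 h3; move: (`| _ |) (`| _ |) (`| _ |) => a b c h1 h2 h3.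
have -> : e = e / 3 + e / 3 + e / 3 by field.
by rewrite !lerD.
Unshelve. all: end_near.
Qed.

End against.
End weak_star_density.

(** * A pi-system generating the Borel sets *)

Section upper_boxes.
Context {R : realType} {d : nat}.
Implicit Types (x : Rn R d) (A : 'I_d -> set (measurableTypeR R)).

Definition upper_ray (A : set (measurableTypeR R)) := A = setT \/ exists b : R, A = `]b, +oo[%classic.

Definition box A : set (Rn R d) := [set x | forall j, A j (tnth x j)].

Definition upper_box : set (set (Rn R d)) :=
  [set E | exists2 A, (forall j, upper_ray (A j)) & E = box A].

Definition cube (M : R) : set (Rn R d) := [set x | forall j, `|tnth x j| <= M].

Lemma measurable_upper_ray (A : set (measurableTypeR R)) : upper_ray A -> measurable A.
Proof. by move=> [->|[b ->]]; [exact: measurableT|exact: measurable_itv]. Qed.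

Lemma measurable_box A : (forall j, measurable (A j)) -> measurable (box A).
Proof.
move=> mA; rewrite (_ : box A = \big[setI/setT]_(j < d) ((fun x : Rn R d => tnth x j) @^-1` A j)).
  apply: bigsetI_measurable => j _; rewrite -[X in measurable X]setTI.
  exact: measurable_tnth.
apply/seteqP; split => x.
  by move=> h; elim/big_rec: _ => // j B _ Bx; split => //; exact: h.
by move=> h j; move: h; rewrite (bigD1 j)//= => -[].
Qed.

Lemma upper_ray_setI (A B : set (measurableTypeR R)) : upper_ray A -> upper_ray B -> upper_ray (A `&` B).
Proof.
move=> [->|[b ->]]; first by rewrite setTI.
move=> [->|[c ->]]; first by rewrite setIT; right; exists b.
right; exists (Num.max b c); apply/seteqP; split => z /=; rewrite !in_itv/= !andbT gt_max.
  by move=> [-> ->].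
by move=> /andP[].
Qed.

Lemma upper_box_setI : setI_closed upper_box.
Proof.
move=> _ _ [A hA ->] [B hB ->]; exists (fun j => A j `&` B j).
  by move=> j; exact: upper_ray_setI.
by apply/seteqP; split => x; [move=> [h1 h2] j; split|move=> h; split => j; have [] := h j].
Qed.

Lemma measurable_upper_boxE : @measurable _ (Rn R d) = <<s upper_box >>.
Proof.
apply/seteqP; split => [E|].
  have mt j : measurable_fun setT (fun x : g_sigma_algebraType upper_box => (tnth x j : measurableTypeR R)).
    apply: (measurability _ (RGenOInfty.measurableE R)) => // _ [_ [b ->] <-].
    rewrite setTI; apply: sub_sigma_algebra.
    exists (fun i => if i == j then `]b, +oo[%classic else setT).
      by move=> i; case: eqP => _; [right; exists b|left].
    apply/seteqP; split => x /= h; first by move=> i; case: eqP => [->|].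
    by have := h j; rewrite eqxx.
  have mi : measurable_fun setT (fun x : g_sigma_algebraType upper_box => x : Rn R d).
    exact/measurable_fun_tnthP.
  by move=> mE; have := mi measurableT E mE; rewrite setTI.
apply: smallest_sub; first exact: sigma_algebra_measurable.
by move=> _ [A hA ->]; apply: measurable_box => j; exact: measurable_upper_ray.
Qed.

End upper_boxes.

(** * From boxes to all of the predual *)

Section weak_star_boxes.
Import HBNNSimple.
Context {R : realType} {d : nat}.
Variables (p k0 : R).
Hypothesis p1 : 1 < p.
Hypothesis k0_gt0 : 0 < k0.
Local Notation mu := (@lebesgue_Rn R d).
Implicit Types (phi g : Rn R d -> R) (x : Rn R d).
Variables (w_ : R -> Rn R d -> R) (u0 : Rn R d -> R).
Hypothesis wB : forall t, 0 < t -> expL_ball p k0 (w_ t).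
Hypothesis u0B : expL_ball p k0 u0.
Local Notation converges := (converges_against p k0 w_ u0).
Hypothesis converges_box : forall (M : R) A, (forall j, upper_ray (A j)) ->
  converges (\1_(box A `&` cube M) : Rn R d -> R).

Let mC M : measurable (@cube R d M) := (@lebesgue_cube_lty R d M).1.

Let cube_finite M (E : set (Rn R d)) : measurable E -> conj_finite p (\1_(E `&` cube M) : Rn R d -> R).
Proof.
move=> mE; have mEC : measurable (E `&` cube M) by exact: measurableI.
apply: conj_finite_indic => //; apply: le_lt_trans (@lebesgue_cube_lty R d M).2.
by apply: le_measure; rewrite ?inE//; exact: mC.
Qed.

(* Dynkin's lemma: pairing against the members of expL_ball is uniformly
   absolutely continuous on sets of small measure. *)
Lemma converges_indic (M : R) (E : set (Rn R d)) : measurable E ->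
  converges (\1_(E `&` cube M) : Rn R d -> R).
Proof.
have := @measurable_upper_boxE R d => mE.
suff h : forall S, <<s upper_box >> S -> converges (\1_(S `&` cube M) : Rn R d -> R).
  by move=> mE'; apply: h; rewrite -mE.
apply: (dynkin_induction mE).
- exact: upper_box_setI.
- rewrite (_ : setT = box (fun=> setT)); first by apply: converges_box => j; left.
  by apply/seteqP; split.
- by move=> _ [A hA ->]; exact: converges_box.
- move=> S mS hS.
  have hT : converges (\1_(setT `&` cube M) : Rn R d -> R).
    rewrite (_ : setT = box (fun=> setT)); first by apply: converges_box => j; left.
    by apply/seteqP; split.
  apply: converges_against_ext (converges_againstB wB u0B hT hS) => x.
  by rewrite !indicE !in_setI in_setT in_setC; case: (_ \in S); case: (_ \in cube M); rewrite ?subrr ?subr0.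
(* Finite disjoint unions follow by additivity; the countable union is their pointwise limit,
   dominated by the indicator of the cube. *)
- move=> F mF tF hF; pose F_ n := \big[setU/set0]_(i < n) F i.
  have mF_ n : measurable (F_ n) by apply: bigsetU_measurable => i _; exact: mF.
  have hF_ n : converges (\1_(F_ n `&` cube M) : Rn R d -> R).
    elim: n => [|n IH].
      apply: converges_against_ext (converges_against0 p k0 w_ u0) => x.
      by rewrite /F_ big_ord0 set0I indic0.
    apply: converges_against_ext (converges_againstD wB u0B IH (hF n)) => x.
    rewrite /F_ big_ord_recr/= -/(F_ n) !indicE !in_setI in_setU.
    have d0 : F_ n `&` F n = set0.
      by have := @trivIset_bigsetUI _ predT F _ n n isT (leqnn n); apply; exact: sub_trivIset tF.
    have := in_setI x (F_ n) (F n); rewrite d0 in_set0.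
    by case: (x \in F_ n); case: (x \in F n); case: (x \in cube M) => //= _; rewrite ?addr0 ?add0r.
  have mU : measurable (\bigcup_k F k) by exact: bigcup_measurable.
  apply: (@converges_against_lim _ _ p k0 p1 k0_gt0 w_ u0 wB u0B _ (\1_(setT `&` cube M)) (fun n => \1_(F_ n `&` cube M))) => //.
  + exact: cube_finite.
  + by apply: measurable_indic; exact: measurableI.
  + move=> x; rewrite !indicE !in_setI in_setT; case: (_ \in cube M); case: (_ \in \bigcup_k F k) => //=;
    by rewrite ?normr0 ?normr1.
  + move=> n x; rewrite !indicE !in_setI in_setT; case: (x \in cube M); rewrite ?andbF ?subrr//= !andbT.
    by case: (_ \in _); case: (_ \in _); rewrite ?subrr ?subr0 ?sub0r ?normrN ?normr0 ?normr1.
  + move=> x; have [[k _ Fk]|nF] := pselect ((\bigcup_k F k) x).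
      apply: cvg_near_cst; exists k.+1 => // n /= kn; rewrite !indicE !in_setI.
      congr ((_ && _)%:R); rewrite !mem_set//; first by exists k.
      by apply: (bigsetU_sup kn).
    rewrite (_ : (fun n => _) = (fun=> \1_(\bigcup_k F k `&` cube M) x)); first exact: cvg_cst.
    apply/funext => n; rewrite !indicE !in_setI; congr ((_ && _)%:R).
    by rewrite !memNset// => h; apply: nF; exact: bigsetU_bigcup h.
Qed.

(** Simple functions increase to phi; the indicator of a growing cube reduces them to the bounded
    sets covered by [converges_indic], and phi itself is the majorant. *)
Lemma converges_ge0 phi : conj_finite p phi -> (forall x, 0 <= phi x) -> converges phi.
Proof.
move=> phiF phi0; have [mphi _] := phiF.
have mE : measurable_fun setT (EFin \o phi) by exact/measurable_EFinP.
have [s [nds cs]] := @approximation _ (Rn R d) R setT measurableT (EFin \o phi) mE (fun x _ => phi0 x).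
pose phi_ n x := s n x * \1_(cube n%:R) x.
have cs' x : s n x @[n --> \oo] --> phi x.
  by have := cs x I => /fine_cvgP[].
have les n x : s n x <= phi x.
  rewrite -(cvg_lim (@Rhausdorff R) (cs' x)).
  apply: (@nondecreasing_cvgn_le _ (fun n => s n x)); last exact: cvgP (cs' x).
  by move=> i j ij; have /lefP := nds _ _ ij; exact.
have l1 n x : 0 <= phi_ n x <= phi x.
  rewrite /phi_ indicE mulr_ge0//=; case: (_ \in _); by rewrite ?mulr1 ?mulr0.
have cvc x : \1_(cube n%:R) x @[n --> \oo] --> (1 : R).
  apply: cvg_near_cst; pose m := (\sum_(j < d) Num.truncn `|tnth x j|).+1%N; exists m => // n /= mn.
  rewrite indicE mem_set// => j; apply: (@le_trans _ _ m%:R); last by rewrite ler_nat.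
  apply: (@le_trans _ _ (Num.truncn `|tnth x j|).+1%:R).
    by apply: ltW; have /andP[] := truncn_itv (normr_ge0 (tnth x j)).
  by rewrite ler_nat ltnS (bigD1 j)//= leq_addr.
apply: (@converges_against_lim _ _ p k0 p1 k0_gt0 w_ u0 wB u0B _ phi phi_) => //.
- move=> n x; have /andP[a b] := l1 n x; rewrite ger0_norm ?subr_ge0// ger0_norm//; by rewrite gerBl.
- move=> x; rewrite -[X in _ --> X]mulr1; apply: cvgM; [exact: cs'|exact: cvc].
- move=> n.
  have [N [c [B [mB sE]]]] : exists N (c : 'I_N -> R) (B : 'I_N -> set (Rn R d)),
      (forall i, measurable (B i)) /\ forall x, s n x = \sum_(i < N) c i * \1_(B i) x.
    refine (ex_intro _ _ (ex_intro _ _ (ex_intro _ _ (conj _ (fimfunEord (s n)))))).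
    by move=> i; exact: measurable_funPTI.
  apply: converges_against_ext (converges_against_sum wB u0B
    (phi := fun i x => c i * \1_(B i `&` cube n%:R) x) _).
    move=> x; rewrite /phi_ sE mulr_suml; apply: eq_bigr => i _.
    by rewrite -mulrA; congr (_ * _); rewrite !indicE in_setI -natrM mulnb.
  by move=> i; apply: (converges_againstZ wB u0B); exact: converges_indic.
Qed.

Lemma converges_in_predual phi : in_predual p phi -> converges phi.
Proof.
move=> /(in_predual_conj_finite p1) phiF; have [mphi _] := phiF.
have P g : (forall x, 0 <= g x <= `|phi x|) -> measurable_fun setT g -> converges g.
  move=> h mg; apply: converges_ge0 => [|x]; last by have /andP[] := h x.
  by apply: conj_finite_le phiF => // x; have /andP[a b] := h x; rewrite ger0_norm.
have h1 : converges (fun x => Num.max (phi x) 0).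
  apply: P => [x|]; last by apply: measurable_maxr => //; exact: measurable_cst.
  by rewrite le_max lexx orbT ge_max ler_norm normr_ge0.
have h2 : converges (fun x => Num.max (- phi x) 0).
  apply: P => [x|]; last by apply: measurable_maxr => //; exact: measurableT_comp.
  by rewrite le_max lexx orbT ge_max -normrN ler_norm normr_ge0.
apply: converges_against_ext (converges_againstB wB u0B h1 h2) => x.
have [h|h] := leP 0 (phi x).
  by rewrite [X in _ - X]max_r ?subr0// oppr_le0.
by rewrite max_l ?sub0r ?opprK// oppr_ge0 ltW.
Qed.

End weak_star_boxes.

Lemma norm_le_cvg0 (R : realType) (T : Type) (F : set_system T) {FF : Filter F} (f h : T -> R) :
  (\forall t \near F, `|f t| <= h t) -> h t @[t --> F] --> (0 : R) -> f t @[t --> F] --> (0 : R).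
Proof.
move=> fh /cvgr0Pnorm_le h0; apply/cvgr0Pnorm_le => e e0.
apply: filterS2 fh (h0 e e0) => t h1 h2.
exact: le_trans h1 (le_trans (ler_norm _) h2).
Qed.

(** * Weak-star continuity of the linear evolution *)

Section heat_weak_star.
Context {R : realType} {d : nat}.
Hypothesis hd : (0 < d)%N.
Variables beta p : R.
Hypothesis b01 : 0 < beta <= 1.
Hypothesis p1 : 1 < p.
Local Notation mu := (@lebesgue_Rn R d).
Local Notation heat := (@hermite_heat R d beta).
Implicit Types (u g phi : Rn R d -> R) (x y : Rn R d) (t : R).

(** Fubini's theorem for a symmetric kernel; absolute integrability rests on the bound C wt for the
    evolution of g, paired with |u| in the weighted space. *)
Lemma heat_symmetric t u g (C : R) : 0 < t -> wL1 u -> wL1 g -> (forall x, 0 <= g x) ->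
  (forall x, heat t g x <= C * wt x) -> pairing (heat t u) g = pairing u (heat t g).
Proof.
move=> t0 uW gW g0 gC; have [mu' _] := uW; have [mg _] := gW.
have K0 x y : 0 <= heatK beta t x y by exact: heatK_ge0.
pose F (z : Rn R d * Rn R d) := (heatK beta t z.1 z.2 * u z.2 * g z.1)%:E.
have mF : measurable_fun setT F.
  apply/measurable_EFinP; apply: measurable_funM.
    apply: measurable_funM; first exact: measurable_heatK2.
    exact: (measurableT_comp mu' measurable_snd).
  exact: (measurableT_comp mg measurable_fst).
have gE y : (\int[mu]_x (g x * heatK beta t x y)%:E)%E = (heat t g y)%:E.
  by rewrite (hermite_heat_EFin hd y b01 t0 gW); apply: eq_integral => x _; rewrite heatK_sym.
have gi y : mu.-integrable setT (EFin \o (fun x => g x * heatK beta t x y)).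
  have := heat_pairing hd b01 y gW t0; congr (mu.-integrable _ (_ \o _)).
  by apply/funext => x; rewrite heatK_sym.
have iF : (mu \x mu)%E.-integrable setT F.
  apply/(integrable21ltyP mu mu mF).
  apply: (@le_lt_trans _ _ (\int[mu]_y (C * (`|u y| * wt y))%:E)%E).
    apply: ge0_le_integral => //.
    - by move=> y _; apply: integral_ge0 => x _; exact: abse_ge0.
    - apply: (@measurable_fun_fubini_tonelli_G _ _ _ _ R mu (fun z => `|F z|)%E) => //.
      exact: measurableT_comp.
    - apply/measurable_EFinP; apply: measurable_cstM; apply: measurable_funM; last exact: measurable_wt.
      exact: measurableT_comp.
    move=> y _; apply: (@le_trans _ _ (\int[mu]_x (`|u y| * (g x * heatK beta t x y))%:E)%E).
      rewrite le_eqVlt; apply/orP; left; apply/eqP; apply: eq_integral => x _.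
      rewrite /F/= !normrM (ger0_norm (K0 x y)) (ger0_norm (g0 x)); congr (_%:E).
      by move: (heatK _ _ _ _) (`|u y|) (g x) => a b c; ring.
    rewrite integralZl_EFin//.
    - rewrite gE -EFinM lee_fin mulrCA ler_wpM2l//; exact: gC.
    - by apply: measurable_funM => //; under eq_fun do rewrite heatK_sym; exact: measurable_heatK.
    - by move=> x; rewrite mulr_ge0.
  have /integrableP[_] := integrableMl_EFin C (wL1_norm uW).
  apply: le_lt_trans; apply: ge0_le_integral => //.
  - move=> y _; rewrite lee_fin; apply: le_trans (_ : 0 <= `|u y| * heat t g y) _.
      rewrite mulr_ge0// -lee_fin -gE; apply: integral_ge0 => x _; rewrite lee_fin mulr_ge0//.
    by rewrite mulrCA ler_wpM2l//; exact: gC.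
  - apply/measurable_EFinP; apply: measurable_cstM; apply: measurable_funM; last exact: measurable_wt.
    exact: measurableT_comp.
  - apply: measurableT_comp => //; apply/measurable_EFinP; apply: measurable_cstM; apply: measurable_funM; last exact: measurable_wt.
    exact: measurableT_comp.
  - by move=> y _; rewrite /= lee_fin ler_norm.
have := Fubini iF; rewrite /F/= => H.
rewrite /pairing /Rintegral; congr fine.
transitivity (\int[mu]_x \int[mu]_y (heatK beta t x y * u y * g x)%:E)%E.
  apply: eq_integral => x _.
  rewrite mulrC EFinM (hermite_heat_EFin hd x b01 t0 uW) -integralZl//; last exact: heat_pairing.
  by apply: eq_integral => y _; rewrite -EFinM; congr (_%:E); ring.
rewrite H; apply: eq_integral => y _.
rewrite EFinM -gE -integralZl//; last exact: gi.
by apply: eq_integral => x _; rewrite -EFinM; congr (_%:E); ring.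
Qed.

Lemma hyperplane_null (j : 'I_d) (c : R) : {ae mu, forall x, tnth x j != c}.
Proof.
pose B i := if i == j then [set c : measurableTypeR R] else setT.
have mB i : measurable (B i) by rewrite /B; case: eqP.
exists (box B); split.
- exact: measurable_box.
- have -> : mu (box B) = (\prod_(i < d) @lebesgue_measure R (B i))%E by exact: lebesgue_Rn_box.
  by rewrite (bigD1 j)//= /B eqxx lebesgue_measure_set1 mul0e.
- by move=> x /= /negP; rewrite negbK /B => /eqP xc i; case: eqP => [->|].
Qed.

Lemma upper_ray_near (A : set (measurableTypeR R)) : upper_ray A -> exists b : R, forall z : R, z != b ->
  exists2 eta : R, 0 < eta & forall y : R, `|y - z| < eta -> A y = A z.
Proof.
move=> [->|[b ->]]; first by exists 0 => z _; exists 1.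
exists b => z zb; exists `|z - b|; first by rewrite normr_gt0 subr_eq0.
move=> y yz; apply/propext; rewrite /= !in_itv/= !andbT.
have [bz|bz|bz] := ltgtP b z; last by move: zb; rewrite bz eqxx.
  have h : b < y.
    move: yz; rewrite (gtr0_norm (_ : 0 < z - b)) ?subr_gt0// ltr_norml => /andP[]; lra.
  by rewrite h.
have h : y <= b.
  move: yz; rewrite (ltr0_norm (_ : z - b < 0)) ?subr_lt0// ltr_norml => /andP[]; lra.
by rewrite ltNge h.
Qed.

Lemma ball_near (M z : R) : z != M -> z != - M ->
  exists2 eta : R, 0 < eta & forall y : R, `|y - z| < eta -> (`|y| <= M) = (`|z| <= M).
Proof.
move=> zM zM'; have nz : `| `|z| - M| > 0.
  rewrite normr_gt0 subr_eq0; have [z0|z0] := leP 0 z; first by rewrite ger0_norm.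
  by rewrite ltr0_norm// eqr_oppLR.
exists `| `|z| - M| => // y yz.
have := ler_dist_dist y z => yz'.
have {}yz := le_lt_trans yz' yz.
have [bz|bz|bz] := ltgtP `|z| M; last by move: nz; rewrite bz subrr normr0 ltxx.
  move: yz; rewrite (ltr0_norm (_ : `|z| - M < 0)) ?subr_lt0// ltr_norml => /andP[]; lra.
move: yz; rewrite (gtr0_norm (_ : 0 < `|z| - M)) ?subr_gt0// ltr_norml => /andP[h1 h2].
by apply/negbTE; rewrite -ltNge; lra.
Qed.

(** Only points of the finitely many hyperplanes where some coordinate equals [b j], M or - M can
    fail, and these are null sets. *)
Lemma box_cube_near (M : R) A : (forall j, upper_ray (A j)) ->
  {ae mu, forall x, exists2 eta : R, 0 < eta & forall y, (forall j, `|tnth y j - tnth x j| < eta) ->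
    (box A `&` cube M) y = (box A `&` cube M) x}.
Proof.
move=> hA; have /choice[b hb] : forall j, exists b : R, forall z : R, z != b ->
    exists2 eta : R, 0 < eta & forall y : R, `|y - z| < eta -> A j y = A j z.
  by move=> j; exact: upper_ray_near.
have : {ae mu, forall x, forall j : 'I_d, [/\ tnth x j != b j, tnth x j != M & tnth x j != - M]}.
  apply: filter_forall => j.
  apply: filterS (filterI (hyperplane_null j (b j)) (filterI (hyperplane_null j M) (hyperplane_null j (- M)))).
  by move=> x [h1 [h2 h3]]; split.
apply: filterS => x hx.
have /choice[e he] : forall j, exists e : R, 0 < e /\ forall y : R, `|y - tnth x j| < e ->
    A j y = A j (tnth x j) /\ (`|y| <= M) = (`|tnth x j| <= M).
  move=> j; have [h1 h2 h3] := hx j.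
  have [e e0 eA] := hb j _ h1; have [e' e'0 eM] := ball_near h2 h3.
  exists (Num.min e e'); split; first by rewrite lt_min e0.
  by move=> y; rewrite lt_min => /andP[y1 y2]; split; [exact: eA|exact: eM].
(* The inverse of a sum of inverses replaces the minimum of the [e j]; the summand 1 makes its
   positivity immediate. *)
pose S := \sum_(j < d) (e j)^-1 + 1.
have S0 : 0 < S by rewrite ltr_wpDl// sumr_ge0// => j _; rewrite invr_ge0 ltW//; have [] := he j.
exists S^-1; first by rewrite invr_gt0.
have Se j : S^-1 <= e j.
  have [ej _] := he j; rewrite -[leRHS]invrK lef_pV2 ?posrE ?invr_gt0//.
  rewrite /S (bigD1 j)//= -addrA lerDl addr_ge0// sumr_ge0// => i _.
  by rewrite invr_ge0 ltW//; have [] := he i.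
move=> y hy; have H j : A j (tnth y j) = A j (tnth x j) /\ (`|tnth y j| <= M) = (`|tnth x j| <= M).
  by have [_] := he j; apply; exact: lt_le_trans (hy j) (Se j).
apply/propext; split => -[h1 h2]; split => j.
- by have [<- _] := H j; exact: h1.
- by have [_ <-] := H j; exact: h2.
- by have [-> _] := H j; exact: h1.
- by have [_ ->] := H j; exact: h2.
Qed.

(** Symmetry moves the evolution onto the indicator, which converges off the faces at the rate 1 -
    e^{-t} and is dominated by C wt. As |u| wt is integrable, dominated convergence applies along
    sequences. *)
Lemma heat_pairing_box (M : R) A u : (forall j, upper_ray (A j)) -> wL1 u ->
  pairing (heat t u) (\1_(box A `&` cube M) : Rn R d -> R) @[t --> 0^'+] -->
  pairing u (\1_(box A `&` cube M) : Rn R d -> R).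
Proof.
move=> hA uW; pose E := box A `&` @cube R d M; have [mu' _] := uW.
have mE : measurable E.
  apply: measurableI; last exact: (@lebesgue_cube_lty R d M).1.
  by apply: measurable_box => j; exact: measurable_upper_ray.
have mi : measurable_fun setT (\1_E : Rn R d -> R) by exact: measurable_indic.
pose L := Num.max 1 M; have L1 : 1 <= L by rewrite le_max lexx.
have [C C0 hC] := heat_box_decay hd L1.
have i0 y : 0 <= \1_E y :> R by rewrite indicE.
have EW : wL1 (\1_E : Rn R d -> R).
  by apply: (@wL1_bounded _ _ _ 1) => // y; rewrite indicE; case: (_ \in _); rewrite ?normr1 ?normr0.
have TE t x : 0 < t -> 0 <= heat t (\1_E : Rn R d -> R) x <= C * wt x.
  move=> t0; apply: hC => // y; rewrite i0/=.
  have [yE|yE] := pselect (E y); last by rewrite indicE memNset// prodr_ge0.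
  rewrite indicE mem_set// big1// => j _; rewrite indicE mem_set//= in_itv/= -ler_norml.
  by case: yE => _ /(_ j) h; apply: (le_trans h); rewrite le_max lexx orbT.
apply/cvg_at_rightP => s [s0 cs].
have sE n : pairing (heat (s n) u) (\1_E : Rn R d -> R) = pairing u (heat (s n) (\1_E : Rn R d -> R)).
  by apply: (heat_symmetric (C := C)) => // x; have /andP[] := TE (s n) x (s0 n).
rewrite (_ : (fun n => _) = (fun n => pairing u (heat (s n) (\1_E : Rn R d -> R)))); last exact/funext.
have [||||| iE _ H] := @dominated_convergence _ _ _ mu setT measurableT
  (fun n x => (u x * heat (s n) (\1_E : Rn R d -> R) x)%:E) (fun x => (u x * \1_E x)%:E)
  (fun x => (C * (`|u x| * wt x))%:E).
- move=> n; apply/measurable_EFinP; apply: measurable_funM => //; exact: measurable_hermite_heat.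
- by apply/measurable_EFinP; exact: measurable_funM.
- apply: filterS (box_cube_near M hA) => x [eta eta0 hx] _.
  have [a ha] := heat_indic_near hd mE eta0 hx.
  apply: cvg_EFin; first exact: nearW.
  apply: cvgM; first exact: cvg_cst.
  apply/subr_cvg0; apply: (norm_le_cvg0 (h := fun n => a * (1 - expR (- s n)))).
  + by apply: nearW => n; exact: ha.
  + rewrite [X in _ --> X](_ : 0 = a * (1 - expR (- 0))); last by rewrite oppr0 expR0 subrr mulr0.
    apply: cvgM; first exact: cvg_cst.
    apply: cvgB; first exact: cvg_cst.
    by apply: cvg_expR; exact: cvgN.
- exact: integrableMl_EFin (wL1_norm uW).
- apply: aeW => x n _; rewrite /= lee_fin normrM mulrCA ler_wpM2l//.
  by have /andP[h1 h2] := TE (s n) x (s0 n); rewrite ger0_norm.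
apply: fine_cvg; rewrite fineK; first exact: H.
exact: integrable_fin_num.
Qed.

Variable k0 : R.
Hypothesis k0_gt0 : 0 < k0.

Lemma heat_weak_star u : measurable_fun setT u -> (expL_modular p k0 u <= 1)%E ->
  forall phi, in_predual p phi -> converges_against p k0 (fun t => heat t u) u phi.
Proof.
move=> mu' hu; have [uW _] := expL_modular_wL1 p1 k0_gt0 mu' hu.
have uB : expL_ball p k0 u by [].
have wB t : 0 < t -> expL_ball p k0 (heat t u).
  move=> t0; split; first exact: measurable_hermite_heat.
  by apply: le_trans hu; exact: heat_expL_modular.
move=> phi; apply: (converges_in_predual p1 k0_gt0 wB uB) => M A hA; split; last exact: heat_pairing_box.
apply: (conj_finite_pairable p1 k0_gt0).
have mE : measurable (box A `&` @cube R d M).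
  apply: measurableI; last exact: (@lebesgue_cube_lty R d M).1.
  by apply: measurable_box => j; exact: measurable_upper_ray.
apply: conj_finite_indic => //; apply: le_lt_trans (@lebesgue_cube_lty R d M).2.
by apply: le_measure; rewrite ?inE//; exact: (@lebesgue_cube_lty R d M).1.
Qed.

(** The part v tends to 0 in norm, hence against each test function, by Young's inequality at a
    scale that tends to 0. *)
Lemma weak_star_perturbation (u v : R -> Rn R d -> R) u0 (c : R -> R) :
  measurable_fun setT u0 -> (expL_modular p k0 u0 <= 1)%E ->
  (forall t x, u t x = heat t u0 x + v t x) -> (forall t, 0 < t -> bnd (v t) (c t)) ->
  c t @[t --> 0^'+] --> (0 : R) -> weak_star_cvg0 p u u0.
Proof.
move=> mu0 hu0 uE vc c0 phi hphi; have [aphi cphi] := heat_weak_star mu0 hu0 hphi.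
have [[mphi _] [l l0 hl]] := hphi.
have [u0W _] := expL_modular_wL1 p1 k0_gt0 mu0 hu0.
pose J := fine (\int[mu]_x psi_conj p (`|phi x| / l))%E.
have J0 : (0 <= \int[mu]_x psi_conj p (`|phi x| / l))%E by apply: integral_ge0 => x _; exact: psi_conj_ge0.
have JE : (\int[mu]_x psi_conj p (`|phi x| / l) = J%:E)%E by rewrite fineK// ge0_fin_numE.
have H t : 0 < t -> mu.-integrable setT (EFin \o (fun x => v t x * phi x)) /\
    `|pairing (v t) phi| <= (expR 1 * c t + t) * (l * (1 + J)).
  move=> t0; have vt := vc t t0; have [mv _ _] := vt; have ct0 := bnd_ge0 vt.
  (* The summand t keeps the scale positive when [c t] vanishes. *)
  pose k := expR 1 * c t + t; have k_gt0 : 0 < k by rewrite ltr_wpDl// mulr_ge0 ?expR_ge0.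
  have vk : (expL_modular p k (v t) <= 1)%E by apply: (bnd_modular p1 vt k_gt0); rewrite lerDl ltW.
  have [_ hi] := conj_finite_pairable p1 k_gt0 (in_predual_conj_finite p1 hphi).
  have vi : mu.-integrable setT (EFin \o (fun x => v t x * phi x)) by apply: hi; split.
  split => //; rewrite -lee_fin; apply: le_trans (normr_Rintegral_leE vi) _.
  apply: le_trans (pairing_le p1 k_gt0 l0 mv mphi) _; rewrite JE.
  apply: (@le_trans _ _ ((k * l)%:E * (1 + J%:E))%E).
    by apply: lee_wpmul2l; [rewrite lee_fin mulr_ge0// ltW|exact: leeD].
  by rewrite -[leLHS]/((k * l * (1 + J))%:E) lee_fin mulrA.
rewrite -[X in _ --> X]addr0.
suff hv : pairing (v t) phi @[t --> 0^'+] --> (0 : R).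
  have E : \forall t \near (0 : R)^'+, pairing (heat t u0) phi + pairing (v t) phi = \int[mu]_x (u t x * phi x).
    apply: filterS (nbhs_right_gt (0 : R)) => t t0; rewrite /pairing -RintegralD//.
    - by apply: eq_Rintegral => x _; rewrite uE mulrDl.
    - have [_ h] := aphi; apply: h; split; first exact: measurable_hermite_heat.
      by apply: le_trans hu0; exact: heat_expL_modular.
    - by have [] := H t t0.
  exact: cvg_trans (near_eq_cvg E) (cvgD cphi hv).
apply: (norm_le_cvg0 (h := fun t => (expR 1 * c t + t) * (l * (1 + J)))).
  by apply: filterS (nbhs_right_gt (0 : R)) => t t0; have [] := H t t0.
rewrite [X in _ --> X](_ : 0 = (expR 1 * 0 + 0) * (l * (1 + J))); last by rewrite mulr0 addr0 mul0r.
apply: cvgM; last exact: cvg_cst.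
apply: cvgD; first by apply: cvgM => //; exact: cvg_cst.
by apply: cvg_at_right_filter; exact: cvg_id.
Qed.

End heat_weak_star.

(** Each of the three ranges gives a > d(m - 1)/(2 beta). Hence a >= p, so that the modular controls
    the L^a norm, and the exponent 1/(m - 1) - d/(2 beta a) is positive, so that the exponential
    decay yields the power. *)
Theorem theorem1p2 (R : realType) (d : nat) (beta p m : R) (f : R -> R)
    (C0 lambda : R)
    (hd : (1 <= d)%N)
    (hbeta : 0 < beta <= 1)
    (hp : 1 < p <= d%:R * (m - 1) / (2 * beta))
    (hm : p <= m)
    (hf0 : f 0 = 0)
    (hC0 : 0 < C0) (hlambda : 0 < lambda)
    (hf : forall u v : R,
      `|f u - f v| <= C0 * `|u - v| *
        (`|u| `^ (m - 1) * expR (lambda * `|u| `^ p) +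
         `|v| `^ (m - 1) * expR (lambda * `|v| `^ p))) :
  exists2 eps : R, 0 < eps &
  forall u0 : Rn R d -> R, in_expL p u0 -> (norm_expL p u0 <= eps%:E)%E ->
  exists u : R -> Rn R d -> R,
    [/\ global_weak_mild_solution beta p f u0 u,
        norm_expL p (fun x => u t x - hermite_heat beta t u0 x)
          @[t --> 0^'+] --> 0%E
      & forall a : R,
        [\/ [/\ d%:R / (2 * beta) > p / (p - 1),
                d%:R / (2 * beta) * (m - 1) < a
              & (a%:E < (d%:R / (2 * beta) * (m - 1))%:E *
                        ((pos_part (2 - m))%:E)^-1)%E],
            [/\ d%:R / (2 * beta) = p / (p - 1),
                d%:R / (2 * beta) * (m - 1) < a
              & (a%:E < (d%:R / (2 * beta) * (m - 1))%:E *
                        ((pos_part (2 - m))%:E)^-1)%E]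
          | [/\ d%:R / (2 * beta) < p / (p - 1),
                pos_part (2 - m) < d%:R * (p - 1) / (2 * beta * p),
                p / (p - 1) * (m - 1) < a
              & (a%:E < (d%:R / (2 * beta) * (m - 1))%:E *
                        ((pos_part (2 - m))%:E)^-1)%E]] ->
        exists2 C : R, 0 < C &
        forall t : R, 0 < t ->
          ('N[lebesgue_Rn d]_(a%:E)[EFin \o u t] <=
            (C * t `^ (- ((m - 1)^-1 - d%:R / (2 * beta * a))))%:E)%E].
Proof.
have /andP[p1 pq] := hp; have /andP[beta0 _] := hbeta.
have [C C_gt0 [r [sm [eps [k0 [K [B [eps0 k00 K0 B0 H]]]]]]]] :=
  small_data_mild_path hd hbeta p1 hm hf0 hC0 hlambda hf.
exists eps => // u0 u0L u0e; have [u [v uP]] := H u0 u0L u0e.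
have [[mu0 u0k] uE _ _ _] := uP.
have m1 : 0 < m - 1 by rewrite subr_gt0 (lt_le_trans p1).
exists u; split.
- split.
  + exact: mild_path_Linfty uP.
  + apply: aeW => t [t0 _]; exact: (mild_path_equation hd hbeta p1 C_gt0 sm k00 B0 uP t0).
  + apply: (weak_star_perturbation hd hbeta p1 k00 mu0 u0k uE
      (fun t t0 => mild_path_perturbation hd hbeta p1 C_gt0 sm B0 uP t0)).
    exact: cvg_expR_sqrt0.
- exact: (mild_path_initial hd hbeta p1 C_gt0 sm B0 uP).
move=> a ha; have aq : d%:R / (2 * beta) * (m - 1) < a.
  (* In the third range p/(p - 1) exceeds d/(2 beta), so its lower bound on a is the stronger
     one. *)
  case: ha => [[_ h _]|[_ h _]|[h _ h' _]] //.
  by apply: lt_trans h'; rewrite ltr_pM2r.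
have qE : d%:R / (2 * beta) * (m - 1) = d%:R * (m - 1) / (2 * beta) by rewrite mulrAC.
have pa : p <= a by rewrite (le_trans pq)// -qE ltW.
have a0 : 0 < a by rewrite (lt_le_trans _ pa)// (lt_trans ltr01).
apply: (mild_path_Lnorm p1 K0 uP pa); rewrite subr_gt0.
rewrite -[ltRHS]mul1r ltr_pdivlMr// invfM mulrA mulrAC ltr_pdivrMr// mul1r.
exact: aq.
Qed.
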